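(* Let $\beta>1$ and $\{X_t\}_{t\in[0,1]}\in S_G^\beta(0,1)$. Let $\mathcal T^\infty_{0,1}$ be the collection of all $G$-stopping times $\tau$ with $0\le\tau\le1$ and $$V_0=\sup_{\tau\in\mathcal T^\infty_{0,1}}\hat{\mathbb E}[X_\tau].$$ For $n\in\mathbb N$ let $t^n_k=k/2^n$ and define backwardly $V^n_1=X_1$, $V^n_{t^n_k}=\max(X_{t^n_k},\hat{\mathbb E}_{t_k^n}[V^n_{t^n_{k+1}}])$ for $k=0,1,\dots,2^n-1$; the sequence $V_0^n$ is increasing in $n$, and set $V_0^\infty=\lim_{n\to\infty}V^n_0$. Then $$V_0=V_0^\infty .$$
   Context: Framework. Fix $0\le\underline\sigma\le\bar\sigma<\infty$ and $G(a)=\frac12(\bar\sigma^2a^+-\underline\sigma^2a^-)$. $\Omega=C_0([0,\infty);\mathbb R)$ is the space of continuous paths starting at $0$ (locally uniform topology, Borel $\sigma$-field $\mathcal B(\Omega)$), $B$ the canonical process, $\Omega_t=\{\omega_{\cdot\wedge t}:\omega\in\Omega\}$. $L_{ip}(\Omega_t)=\{\varphi(B_{t_1},\dots,B_{t_m}): m\ge1,\ t_i\in[0,t],\ \varphi \text{ bounded Lipschitz}\}$, $L_{ip}(\Omega)=\bigcup_tL_{ip}(\Omega_t)$. $\hat{\mathbb E}$ is the $G$-expectation, with conditional $G$-expectations $\hat{\mathbb E}_t$: for $X=\varphi(B_{t_1},B_{t_2}-B_{t_1},\dots,B_{t_m}-B_{t_{m-1}})$ one sets $\hat{\mathbb E}_{t_j}[X]=\varphi_j(B_{t_1},\dots,B_{t_j}-B_{t_{j-1}})$,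 where $\varphi_m=\varphi$ and $\varphi_{i-1}(x_1,\dots,x_{i-1})=u(t_i-t_{i-1},0)$ with $u$ the viscosity solution of $\partial_tu=G(\partial^2_{yy}u)$, $u(0,y)=\varphi_i(x_1,\dots,x_{i-1},y)$; $\hat{\mathbb E}=\hat{\mathbb E}_0$. $L_G^p(\Omega_t)$ is the completion of $L_{ip}(\Omega_t)$ under $\hat{\mathbb E}[|\cdot|^p]^{1/p}$, and $\hat{\mathbb E}_t$ is extended continuously to $L_G^1(\Omega)$. $\mathcal P$ is the weakly compact set of all probability measures $P$ on $\Omega$ with $E^P[X]\le\hat{\mathbb E}[X]$ for all $X\in L_{ip}(\Omega)$; it represents $\hat{\mathbb E}$, and for Borel $X$ such that $E^P[X]$ exists for all $P\in\mathcal P$ one sets $\hat{\mathbb E}[X]=\sup_{P\in\mathcal P}E^P[X]$. $c(A)=\sup_{P\in\mathcal P}P(A)$; ''q.s.'' means outside a set of capacity $c$ zero. Relations between random variables are q.s. $S_G^p(0,T)$ is the completion of $S_G^0(0,T)=\{h(t,B_{t_1\wedge t},\dots,B_{t_n\wedge t}):t_1,\dots,t_n\in[0,T],\ h\ \text{bounded Lipschitz on }\mathbb R^{n+1}\}$ under $\|\eta\|_{S_G^p}=\{\hat{\mathbb E}[\sup_{t\in[0,T]}|\eta_t|^p]\}^{1/p}$. $L_G^{1^*}(\Omega_t)$ is the set of $\mathcal B(\Omega_t)$-measurable $X$ with $\hat{\mathbb E}[|X|]<\infty$ for which there is $\{X_n\}\subset L_G^1(\Omega_t)$ with $X_n\downarrow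 X$ q.s. A random time $\tau:\Omega\to[0,\infty)$ is a $G$-stopping time if $I_{\{\tau\le t\}}\in L_G^{1^*}(\Omega_t)$ for each $t\ge0$. $X_\tau$ denotes $\omega\mapsto X_{\tau(\omega)}(\omega)$. *)

(* Defs.v *)
From HB Require Import structures.
From mathcomp Require Import all_boot all_order all_algebra.
From mathcomp Require Import all_classical all_reals all_analysis.

Set Implicit Arguments.
Unset Strict Implicit.
Unset Printing Implicit Defensive.

Import Order.TTheory GRing.Theory Num.Theory.
Import numFieldTopology.Exports numFieldNormedType.Exports.

Local Open Scope classical_set_scope.
Local Open Scope ring_scope.

(** A continuous path on [0, oo) started at 0 is represented by its unique
    extension to the real line that vanishes on (-oo, 0]; convergence uniform
    on the compact sets of the line is then convergence uniform on the compact
    sets of [0, oo). *)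
Definition cpaths (R : realType) : set {family compact, R -> R} :=
  [set w : R -> R | continuous w /\ forall t, t <= 0 -> w t = 0].

Definition cpath (R : realType) : Type := set_type (@cpaths R).

HB.instance Definition _ (R : realType) := Topological.on (cpath R).

Section path_space.
Context {R : realType}.

Lemma cpaths0 : cpaths (fun _ : R => 0 : R).
Proof. by split => // t; exact: cvg_cst. Qed.

Definition cpath0 : cpath R := SigSub (mem_set cpaths0).

HB.instance Definition _ := isPointed.Build (cpath R) cpath0.

Definition Omega : Type := g_sigma_algebraType (@open (cpath R)).

Definition B (t : R) (w : Omega) : R := (set_val (w : cpath R) : R -> R) t.

Lemma cpaths_stop (t : R) (w : Omega) : cpaths (fun s => B (Num.min s t) w).
Proof.
have [cw w0] := set_valP (w : cpath R).
split => [s|s s0]; last by apply: w0; rewrite ge_min s0.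
apply: (@continuous_comp _ _ _ (fun s : R => Num.min s t) (fun s => B s w)).
  by apply: continuous_min; [exact: cvg_id | exact: cvg_cst].
exact: cw.
Qed.

Definition stop (t : R) (w : Omega) : Omega := SigSub (mem_set (cpaths_stop t w)).

(** The Borel sigma-field of [Omega_t], pulled back along [w |-> w_{. /\ t}]. *)
Definition Borel_upto (t : R) : set (set Omega) :=
  [set stop t @^-1` A | A in measurable].

End path_space.
Arguments Omega : clear implicits.

Section G_heat.
Context {R : realType}.
Variables (slo shi : R).

Definition Gfun (a : R) : R :=
  2^-1 * (shi ^+ 2 * Num.max a 0 - slo ^+ 2 * Num.max (- a) 0).

Definition dt (psi : R -> R -> R) (t y : R) : R := derive1 (psi^~ y) t.
Definition dy (psi : R -> R -> R) (t y : R) : R := derive1 (psi t) y.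
Definition dyy (psi : R -> R -> R) (t y : R) : R := derive1 (dy psi t) y.

Definition C12 (psi : R -> R -> R) : Prop :=
  forall t y : R, 0 < t ->
  [/\ derivable (psi^~ y) t 1,
      derivable (psi t) y 1 & derivable (dy psi t) y 1] /\
  [/\ {for (t, y), continuous (fun q : R * R => dt psi q.1 q.2)},
      {for (t, y), continuous (fun q : R * R => dy psi q.1 q.2)}
    & {for (t, y), continuous (fun q : R * R => dyy psi q.1 q.2)}].

Definition viscosity_sub (u : R -> R -> R) : Prop :=
  forall (psi : R -> R -> R) (t y : R), C12 psi -> 0 < t ->
  (\forall q \near ((t, y) : R * R),
     u q.1 q.2 - psi q.1 q.2 <= u t y - psi t y) ->
  dt psi t y <= Gfun (dyy psi t y).

Definition viscosity_super (u : R -> R -> R) : Prop :=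
  forall (psi : R -> R -> R) (t y : R), C12 psi -> 0 < t ->
  (\forall q \near ((t, y) : R * R),
     u t y - psi t y <= u q.1 q.2 - psi q.1 q.2) ->
  Gfun (dyy psi t y) <= dt psi t y.

(** Boundedness is the growth condition that makes the solution with bounded
    initial datum unique. *)
Definition viscosity_solution (phi : R -> R) (u : R -> R -> R) : Prop :=
  let D := [set q : R * R | 0 <= q.1] in
  [/\ {within D, continuous (fun q : R * R => u q.1 q.2)},
      [bounded u q.1 q.2 | q in D],
      forall y, u 0 y = phi y,
      viscosity_sub u & viscosity_super u].

Definition Gheat (phi : R -> R) : R -> R -> R :=
  xget (fun _ _ => 0) [set u | viscosity_solution phi u].

Definition bounded_lipschitz n (phi : 'rV[R]_n -> R) : Prop :=
  [bounded phi x | x in [set: 'rV[R]_n]] /\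
  [lipschitz phi x | x in [set: 'rV[R]_n]].

Definition Lip_upto (t : R) : set (Omega R -> R) :=
  [set X : Omega R -> R | exists m (s : 'I_m -> R) (phi : 'rV[R]_m -> R),
    [/\ (0 < m)%N, forall i, 0 <= s i <= t, bounded_lipschitz phi
      & X = fun w => phi (\row_i B (s i) w)]].

Definition Lip : set (Omega R -> R) :=
  [set X : Omega R -> R | exists2 t, 0 <= t & Lip_upto t X].

(** Grids are 0 = ts 0 <= ts 1 <= ... <= ts m; coordinate i : 'I_m (counted
    from 0) of the increment vector is [B_{ts i.+1} - B_{ts i}]. *)
Definition increments m (ts : nat -> R) (w : Omega R) : 'rV[R]_m :=
  \row_i (B (ts i.+1) w - B (ts i) w).

Definition integrate_out m (ts : nat -> R) (i : 'I_m) (phi : 'rV[R]_m -> R)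
    (x : 'rV[R]_m) : R :=
  Gheat (fun y => phi (\row_k if k == i then y else x 0 k))
        (ts i.+1 - ts i) 0.

(** The function phi_j obtained from phi by integrating out the coordinates
    m-1, ..., j, the largest one first. It is kept as a function on R^m that
    does not depend on its coordinates of index >= j. *)
Definition backward m (ts : nat -> R) (phi : 'rV[R]_m -> R) (j : nat) :
    'rV[R]_m -> R :=
  foldr (integrate_out ts) phi [seq i : 'I_m <- enum 'I_m | (j <= i)%N].

Definition is_cond_Lip (t : R) (X Y : Omega R -> R) : Prop :=
  exists m (ts : nat -> R) (phi : 'rV[R]_m -> R) (j : nat),
  [/\ (0 < m)%N, ts 0%N = 0, nondecreasing_seq ts & bounded_lipschitz phi] /\
  [/\ (j <= m)%N, t = ts j, X = (fun w => phi (increments m ts w))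
    & Y = (fun w => backward ts phi j (increments m ts w))].

Definition cond_Lip (t : R) (X : Omega R -> R) : Omega R -> R :=
  xget (fun=> 0) [set Y : Omega R -> R | is_cond_Lip t X Y].

Definition E_Lip (X : Omega R -> R) : R :=
  xget 0 [set e | cond_Lip 0 X = fun=> e].

Definition calP : set (probability (Omega R) R) :=
  [set P | forall X, Lip X -> (\int[P]_w (X w)%:E <= (E_Lip X)%:E)%E].

Definition Ehat (X : Omega R -> \bar R) : \bar R :=
  ereal_sup [set (\int[P]_w X w)%E | P in calP].

Definition capacity (A : set (Omega R)) : \bar R :=
  ereal_sup [set P A | P in calP].

Definition qs (Q : Omega R -> Prop) : Prop :=
  exists A, [/\ measurable A, capacity A = 0%E & ~` A `<=` Q].

(** Elements of the completions are represented by Borel functions (resp.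
    processes), identified when they agree q.s. *)

Definition dist1 (X Y : Omega R -> R) : \bar R :=
  Ehat (fun w => `|X w - Y w|%:E).

Definition completion1 (L : set (Omega R -> R)) : set (Omega R -> R) :=
  [set X : Omega R -> R | measurable_fun [set: Omega R] X /\
    exists Xn : nat -> Omega R -> R,
      (forall n, L (Xn n)) /\ dist1 (Xn n) X @[n --> \oo] --> 0%E].

Definition LG1_upto (t : R) : set (Omega R -> R) := completion1 (Lip_upto t).

(** The continuous extension of [cond_Lip t] to L_G^1(Omega); its values are
    determined up to q.s. equality. *)
Definition is_cond (t : R) (X Y : Omega R -> R) : Prop :=
  measurable_fun [set: Omega R] Y /\
  exists Xn : nat -> Omega R -> R,
    [/\ forall n, Lip (Xn n), dist1 (Xn n) X @[n --> \oo] --> 0%E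
      & dist1 (cond_Lip t (Xn n)) Y @[n --> \oo] --> 0%E].

Definition condE (t : R) (X : Omega R -> R) : Omega R -> R :=
  xget (fun=> 0) [set Y : Omega R -> R | is_cond t X Y].

Definition LG1star_upto (t : R) : set (Omega R -> R) :=
  [set X : Omega R -> R | [/\ forall A : set R, measurable A -> Borel_upto t (X @^-1` A),
    (Ehat (fun w => `|X w|%:E) < +oo)%E
    & exists Xn : nat -> Omega R -> R,
        (forall n, LG1_upto t (Xn n)) /\
        qs (fun w => nonincreasing_seq (Xn^~ w) /\
                     Xn n w @[n --> \oo] --> X w)]].

Definition SG0 (T : R) : set (R -> Omega R -> R) :=
  [set eta : R -> Omega R -> R | exists n (s : 'I_n -> R) (h : 'rV[R]_(1 + n) -> R),
    [/\ forall i, 0 <= s i <= T, bounded_lipschitz h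
      & eta = fun t w => h (row_mx (const_mx t : 'rV[R]_1)
                                   (\row_i B (Num.min (s i) t) w))]].

Definition SG_norm (p T : R) (eta : R -> Omega R -> R) : \bar R :=
  (Ehat (fun w => ereal_sup [set `|eta t w|%:E | t in `[0%R, T]] `^ p) `^ p^-1%R)%E.

(** Norm limits of elements of S_G^0 have q.s. continuous paths; requiring it
    of the chosen version makes the supremum over [0, T] q.s. equal to a Borel
    function. *)
Definition SG (p T : R) : set (R -> Omega R -> R) :=
  [set eta : R -> Omega R -> R | [/\
    forall t, 0 <= t <= T -> measurable_fun [set: Omega R] (eta t),
    qs (fun w => {within `[0, T], continuous (eta^~ w)})
    & exists etan : nat -> R -> Omega R -> R,
        (forall n, SG0 T (etan n)) /\
        SG_norm p T (fun t w => etan n t w - eta t w) @[n --> \oo] --> 0%E]].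

Definition G_stopping_time (tau : Omega R -> R) : Prop :=
  (forall w, 0 <= tau w) /\
  forall t, 0 <= t -> LG1star_upto t \1_[set w | tau w <= t].

Definition stopping_times01 : set (Omega R -> R) :=
  [set tau : Omega R -> R | G_stopping_time tau /\ qs (fun w => tau w <= 1)].

Definition value (X : R -> Omega R -> R) : \bar R :=
  ereal_sup [set Ehat (fun w => (X (tau w) w)%:E) | tau in stopping_times01].

Definition dyadic (n k : nat) : R := k%:R / 2 ^+ n.

(** [snell_back X n j] is V^n at the time t^n_k with k = 2^n - j. *)
Fixpoint snell_back (X : R -> Omega R -> R) (n j : nat) : Omega R -> R :=
  if j is j'.+1 then
    let t := dyadic n (2 ^ n - j) in
    fun w => Num.max (X t w) (condE t (snell_back X n j') w)
  else X 1.

Definition snell (X : R -> Omega R -> R) (n k : nat) : Omega R -> R :=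
  snell_back X n (2 ^ n - k).

(** The constant that a q.s. constant random variable is identified with. *)
Definition qs_value (Y : Omega R -> R) : R :=
  xget 0 [set v | qs (fun w => Y w = v)].

Definition discrete_value (X : R -> Omega R -> R) (n : nat) : R :=
  qs_value (snell X n 0).

End G_heat.

(* Main.v *)
Require Import Defs.
From HB Require Import structures.
From mathcomp Require Import all_boot all_order all_algebra.
From mathcomp Require Import all_classical all_reals all_analysis.
From mathcomp Require Import measurable_realfun ring lra zify.

                                                                                             
                                                                                                
                                                                                          
                                                                                                 
                                                                                                 
                                                                                                 
                                                                                                  
                                                             

                                                                                                 
                                                                                         
                                                                                                
                                                                                                   
                                                                                              
                                                                                        
                                                                                                   
                                                                                               
                                                                                                 
                                                                                                   
                                                  

Set Implicit Arguments.
Unset Strict Implicit.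
Unset Printing Implicit Defensive.

Import Order.TTheory GRing.Theory Num.Theory.
Import numFieldTopology.Exports numFieldNormedType.Exports.

Local Open Scope classical_set_scope.
Local Open Scope ring_scope.

                            

(** The process X is replaced by elements eta of S_G^0, uniformly close to it in upper expectation.
    For these the Snell envelope W_0, W_1, ... on a dyadic grid consists of bounded Lipschitz
    functions of finitely many path values (cylinder functions), with no exceptional sets. Both
    inequalities are proved for W and carried over to X.

    Upper bound. Fix P in [calP] and a G-stopping time tau. The recursion gives E_{t_j}[W_{j+1}] <=
    W_j. Nonnegative factors known at t_j come out of the conditional expectation and P is dominated
    by the sublinear expectation, so E^P[Z (W_{j+1} - W_j)] <= 0 for every cylinder Z >= 0 of time
    t_j ([snell_super]). The event {t_j < tau} is a Borel event of Omega_{t_j}, so its indicator is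
    an L^1(P)-limit of such Z, and W is a P-supermartingale along the dyadic discretisation of tau
    from above ([stopped_le_value]). Hence X at the discretised time has P-expectation at most the
    discrete value, and path continuity lets the mesh go to zero ([stopped_integral_le]).

    Lower bound. Stop at the first grid time where W - eta <= c, with c > 0 small. While the surplus
    W - eta is positive, W_j equals the conditional expectation of W_{j+1}. A sum of increments of
    W, with nonnegative cylinder weights that vanish once a surplus does, therefore has
    G-expectation exactly zero ([weight_martingale]). Some P in [calP] attains the supremum on this
    cylinder function. Under P every term is nonpositive, hence null, so W stopped at this time is a
    P-martingale ([optimal_measure]) and eta at this time has P-expectation at least the value minus
    c ([opt_time_value]). The tolerance c makes the event of continuing the positivity set of a
    cylinder function, so its indicator is an increasing limit of cylinder functions; this is why
    the time is a G-stopping time ([opt_time_LG1star]).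

    The larger part of the development supplies the facts about G-expectation used above. Solutions
    of the G-heat equation and conditional expectations are defined by choice, so uniqueness is
    needed. A candidate [gval] is built as an ultralimit of a monotone random walk scheme.
    Supersolutions stay above the scheme step by step ([super_ge_val]), and subsolutions stay below
    because mollifying [gval] gives smooth supersolutions ([sub_le_val]). Uniqueness yields the
    semigroup property, and with it a conditional expectation [cE] on path functionals that has the
    tower and locality properties.

    Attainment of the supremum ([EL_representation]) comes from a Hahn-Banach functional touching
    the sublinear expectation at the given function, turned into a probability measure by Daniell's
    outer measure. Total mass one rests on [daniell], where Kolmogorov's fourth moment estimate
    provides compactness of paths. *)

Section ultralimit.
Context {R : realType}.

(** * Ultralimits of bounded sequences *)

Definition free_ultrafilter : set_system nat :=
  projT1 (cid (ultraFilterLemma eventually_filter)).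

#[global] Instance free_ultra : UltraFilter free_ultrafilter.
Proof. by rewrite /free_ultrafilter; case: cid => F []. Qed.

#[global] Instance free_proper : ProperFilter free_ultrafilter.
Proof. exact: ultra_proper. Qed.

Lemma free_sub : \oo `<=` free_ultrafilter.
Proof. by rewrite /free_ultrafilter; case: cid => F []. Qed.

Lemma free_near (P : nat -> Prop) :
  (\forall n \near \oo, P n) -> \forall n \near free_ultrafilter, P n.
Proof. exact: free_sub. Qed.

(** Along a fixed free ultrafilter every bounded sequence has a limit, which is linear and monotone
    in the sequence. Objects defined as such limits need no convergence proof. *)
Definition ulim (x : nat -> R) : R := lim (x n @[n --> free_ultrafilter]).

Definition bdd_seq (x : nat -> R) := exists M, forall n, `|x n| <= M.

Lemma ulim_cvg (x : nat -> R) :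
  bdd_seq x -> x n @[n --> free_ultrafilter] --> ulim x.
Proof.
move=> [M xM].
(* The image of the ultrafilter under x is an ultrafilter, so compactness of [-M, M] gives it a
   limit. *)
have UF : UltraFilter (x @ free_ultrafilter).
  split; first exact: fmap_proper_filter.
  move=> G GP sG; apply/seteqP; split => // A GA.
  have [//|FA] := in_ultra_setVsetC (x @^-1` A) free_ultra.
  have : G (~` A) by apply: sG.
  by move=> /(filterI GA); rewrite setICr => /filter_not_empty.
have := @segment_compact R (- M) M.
rewrite compact_ultra => /(_ _ UF)[].
  suff : free_ultrafilter (x @^-1` `[- M, M]) by [].
  by apply: filterE => n /=; rewrite in_itv /= -ler_norml; exact: xM.
by move=> l [_ xl]; apply/cvg_ex; exists l.
Qed.

Lemma ulimE (x : nat -> R) l : x n @[n --> free_ultrafilter] --> l -> ulim x = l.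
Proof. exact: cvg_lim. Qed.

Lemma ulim_cst (c : R) : ulim (fun=> c) = c.
Proof. by apply: ulimE; exact: cvg_cst. Qed.

Lemma le_ulim_near (x y : nat -> R) : bdd_seq x -> bdd_seq y ->
  (\forall n \near free_ultrafilter, x n <= y n) -> ulim x <= ulim y.
Proof.
move=> /ulim_cvg bx /ulim_cvg by_ xy.
by apply: ler_lim => //; apply/cvg_ex; eexists; eassumption.
Qed.

Lemma le_ulim (x y : nat -> R) : bdd_seq x -> bdd_seq y ->
  (forall n, x n <= y n) -> ulim x <= ulim y.
Proof. by move=> bx by_ xy; apply: le_ulim_near => //; exact: nearW. Qed.

Lemma ulimD (x y : nat -> R) : bdd_seq x -> bdd_seq y ->
  ulim (fun n => x n + y n) = ulim x + ulim y.
Proof. by move=> /ulim_cvg bx /ulim_cvg by_; apply: ulimE; exact: cvgD. Qed.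

Lemma ulimZ (c : R) (x : nat -> R) : bdd_seq x ->
  ulim (fun n => c * x n) = c * ulim x.
Proof. by move=> /ulim_cvg bx; apply: ulimE; exact: cvgMr. Qed.

Lemma ulimN (x : nat -> R) : bdd_seq x -> ulim (fun n => - x n) = - ulim x.
Proof. by move=> /ulim_cvg bx; apply: ulimE; exact: cvgN. Qed.

Lemma bdd_seqD (x y : nat -> R) : bdd_seq x -> bdd_seq y ->
  bdd_seq (fun n => x n + y n).
Proof.
move=> [M xM] [N yN]; exists (M + N) => n.
by rewrite (le_trans (ler_normD _ _))// lerD.
Qed.

Lemma bdd_seqZ (c : R) (x : nat -> R) : bdd_seq x -> bdd_seq (fun n => c * x n).
Proof.
by move=> [M xM]; exists (`|c| * M) => n; rewrite normrM ler_wpM2l.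
Qed.

Lemma bdd_seq_cst (c : R) : bdd_seq (fun=> c).
Proof. by exists `|c|. Qed.

Lemma ulim_near_ge (x : nat -> R) c e : bdd_seq x -> 0 < e ->
  c <= ulim x -> \forall n \near free_ultrafilter, c - e <= x n.
Proof.
move=> /ulim_cvg bx e0 xc; near=> n.
have : `|ulim x - x n| < e by near: n; move/cvgrPdist_lt : bx => /(_ e e0).
by rewrite ltr_norml => /andP[]; lra.
Unshelve. all: by end_near. Qed.

Lemma ulim_near_dist (x : nat -> R) e : bdd_seq x -> 0 < e ->
  \forall n \near free_ultrafilter, `|x n - ulim x| <= e.
Proof.
move=> /ulim_cvg bx e0; near=> n; rewrite distrC ltW//.
by near: n; move/cvgrPdist_lt : bx => /(_ e e0).
Unshelve. all: by end_near. Qed.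

End ultralimit.

(** * Sublinear operators on functions of one variable *)

Section operators.
Context {R : realType}.
Implicit Types (T P : (R -> R) -> R -> R) (f g : R -> R).

(** Monotonicity with [sl_cst] gives contraction in the supremum distance ([sl_normdist]);
    [sl_shift] turns this into preservation of Lipschitz constants ([sl_lip]). *)
Record sublin T : Prop := Sublin {
  sl_mono : forall f g y, (forall z, f z <= g z) -> T f y <= T g y ;
  sl_add : forall f g y, T (fun z => f z + g z) y <= T f y + T g y ;
  sl_hom : forall c f y, 0 <= c -> T (fun z => c * f z) y = c * T f y ;
  sl_cst : forall c f y, T (fun z => f z + c) y = T f y + c ;
  sl_shift : forall a f y, T (fun z => f (z + a)) y = T f (y + a) }.

Record lin P : Prop := Lin {
  lin_sub : sublin P ;
  lin_add : forall f g y, P (fun z => f z + g z) y = P f y + P g y ;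
  lin_mul : forall c f y, P (fun z => c * f z) y = c * P f y }.

Definition lip L f := forall x y, `|f x - f y| <= L * `|x - y|.
Definition bdd M f := forall x : R, `|f x| <= M.

Lemma sl_csts T : sublin T -> forall c y, T (fun=> c) y = c.
Proof.
move=> sT c y; have T0 : T (fun=> 0) y = 0.
  rewrite -[RHS](mul0r (T (fun=> 0) y)) -(sl_hom sT)//.
  by congr (T _ y); apply/funext => z; rewrite mul0r.
rewrite -[RHS]add0r -T0 -(sl_cst sT).
by congr (T _ y); apply/funext => z; rewrite add0r.
Qed.

Lemma sl_dist T : sublin T -> forall c f g y,
  (forall z, f z <= g z + c) -> T f y <= T g y + c.
Proof. by move=> sT c f g y fg; rewrite -(sl_cst sT); exact: sl_mono. Qed.

Lemma sl_normdist T : sublin T -> forall c f g y,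
  (forall z, `|f z - g z| <= c) -> `|T f y - T g y| <= c.
Proof.
move=> sT c f g y fg; rewrite ler_norml; apply/andP; split.
  suff : T g y <= T f y + c by lra.
  by apply: (sl_dist sT) => z; have := fg z; rewrite ler_norml; lra.
suff : T f y <= T g y + c by lra.
by apply: (sl_dist sT) => z; have := fg z; rewrite ler_norml; lra.
Qed.

Lemma sl_bdd T : sublin T -> forall M f, bdd M f -> bdd M (T f).
Proof.
move=> sT M f fM y; rewrite -[T f y]subr0 -[X in _ - X](sl_csts sT 0 y).
by apply: (sl_normdist sT) => z; rewrite subr0.
Qed.

Lemma sl_lip T : sublin T -> forall L f, lip L f -> lip L (T f).
Proof.
move=> sT L f fL x y.
have -> : T f x = T (fun z => f (z + (x - y))) y by rewrite (sl_shift sT) subrKC.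
by apply: (sl_normdist sT) => z; rewrite (le_trans (fL _ _))// addrAC subrr add0r.
Qed.

Lemma sl_superadd T : sublin T -> forall f g y,
  T f y - T g y <= T (fun z => f z - g z) y.
Proof.
move=> sT f g y; have := sl_add sT (fun z => f z - g z) g y.
by under [fun z => _ + _]eq_fun do rewrite subrK; lra.
Qed.

Lemma sublin_comp T1 T2 : sublin T1 -> sublin T2 -> sublin (fun f => T1 (T2 f)).
Proof.
move=> s1 s2; split=> [f g y fg|f g y|c f y c0|c f y|a f y].
- by apply: (sl_mono s1) => z; exact: (sl_mono s2).
- apply: le_trans (sl_add s1 _ _ _); apply: (sl_mono s1) => z.
  exact: (sl_add s2).
- rewrite -(sl_hom s1)//; congr (T1 _ y); apply/funext => z.
  exact: (sl_hom s2).
- rewrite -(sl_cst s1)//; congr (T1 _ y); apply/funext => z.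
  exact: (sl_cst s2).
- rewrite -(sl_shift s1)//; congr (T1 _ y); apply/funext => z.
  exact: (sl_shift s2).
Qed.

Lemma sublin_id : sublin id.
Proof. by split. Qed.

Lemma sublin_iter T n : sublin T -> sublin (iter n T).
Proof.
by move=> sT; elim: n => [|n IH]; [exact: sublin_id|exact: sublin_comp].
Qed.

Lemma sublin_max T1 T2 : sublin T1 -> sublin T2 ->
  sublin (fun f y => Num.max (T1 f y) (T2 f y)).
Proof.
move=> s1 s2; split=> [f g y fg|f g y|c f y c0|c f y|a f y].
- by rewrite ge_max !le_max (sl_mono s1 y fg) (sl_mono s2 y fg)/= orbT.
- rewrite ge_max (le_trans (sl_add s1 f g y))/=; last first.
    by rewrite lerD// le_max lexx.
  by rewrite (le_trans (sl_add s2 f g y))// lerD// le_max lexx orbT.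
- by rewrite (sl_hom s1)// (sl_hom s2)// maxr_pMr.
- by rewrite (sl_cst s1) (sl_cst s2) addr_maxl.
- by rewrite (sl_shift s1) (sl_shift s2).
Qed.

Lemma lin_comp P1 P2 : lin P1 -> lin P2 -> lin (fun f => P1 (P2 f)).
Proof.
move=> l1 l2; split => [|f g y|c f y].
- by apply: sublin_comp; exact: lin_sub.
- rewrite -(lin_add l1); congr (P1 _ y); apply/funext => z.
  exact: (lin_add l2).
- rewrite -(lin_mul l1); congr (P1 _ y); apply/funext => z.
  exact: (lin_mul l2).
Qed.

Lemma lin_iter P n : lin P -> lin (iter n P).
Proof.
by move=> lP; elim: n => [|n IH]; [split => //; exact: sublin_id|exact: lin_comp].
Qed.

(** Expectation after one step of the symmetric random walk with jumps h and -h. *)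
Definition Qop h f y : R := 2^-1 * (f (y + h) + f (y - h)).

Lemma lin_Q h : lin (Qop h).
Proof.
split; first split.
- by move=> f g y fg; rewrite /Qop ler_wpM2l ?invr_ge0// lerD.
- by move=> f g y; rewrite /Qop; lra.
- by move=> c f y _; rewrite /Qop; lra.
- by move=> c f y; rewrite /Qop; lra.
- by move=> a f y; rewrite /Qop [y + a + h]addrAC [y + a - h]addrAC.
- by move=> f g y; rewrite /Qop; lra.
- by move=> c f y; rewrite /Qop; lra.
Qed.

(** Quartics without cubic term: a family stable under [Qop], whose quartic term can dominate a
    bounded function away from the origin. *)
Definition quad A p b C (z : R) : R := A + p * z + b * z ^+ 2 + C * z ^+ 4.

Lemma Qop_quad h A p b C y : Qop h (quad A p b C) y =
  quad (A + h ^+ 2 * b + h ^+ 4 * C) p (b + 6 * h ^+ 2 * C) C y.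
Proof. by rewrite /Qop /quad; field. Qed.

Lemma iterQ_quad h n A p b y : iter n (Qop h) (quad A p b 0) y =
  quad (A + n%:R * h ^+ 2 * b) p b 0 y.
Proof.
elim: n A b y => [|n IH] A b y /=; first by rewrite /quad; ring.
rewrite [X in Qop _ X](_ : _ = quad (A + n%:R * h ^+ 2 * b) p b 0); last first.
  by apply/funext => z; rewrite IH.
by rewrite Qop_quad /quad -natr1; ring.
Qed.

(** The fourth moment of a centred walk of variance v = n h^2 is 3 v^2 - 2 n h^4; the negative
    correction is dropped. *)
Lemma iterQ_pow4 h n y : iter n (Qop h) (fun z => z ^+ 4) y <=
  y ^+ 4 + 6 * (n%:R * h ^+ 2) * y ^+ 2 + 3 * (n%:R * h ^+ 2) ^+ 2.
Proof.
suff -> : iter n (Qop h) (fun z => z ^+ 4) y =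
  quad (3 * (n%:R * h ^+ 2) ^+ 2 - 2 * n%:R * h ^+ 4) 0 (6 * (n%:R * h ^+ 2)) 1 y.
  rewrite /quad.
  have : 0 <= n%:R * h ^+ 4 by rewrite mulr_ge0// exprn_even_ge0.
  by nra.
elim: n y => [|n IH] y /=; first by rewrite /quad; ring.
rewrite [X in Qop _ X](_ : _ = quad (3 * (n%:R * h ^+ 2) ^+ 2 -
  2 * n%:R * h ^+ 4) 0 (6 * (n%:R * h ^+ 2)) 1); last exact/funext.
by rewrite Qop_quad /quad -natr1; ring.
Qed.

End operators.

(** * Differentiation rules in relational form *)

Section derivatives.
Context {R : realType}.
Implicit Types (f g F df ddf : R -> R).

Definition has_deriv f (x a : R) : Prop := is_derive x 1 f a.

Lemma deq f (x a b : R) : has_deriv f x a -> a = b -> has_deriv f x b.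
Proof. by move=> + <-. Qed.

Lemma dcst (c x : R) : has_deriv (fun=> c : R) x (0 : R).
Proof. by rewrite /has_deriv; exact: is_derive_cst. Qed.

Lemma did (x : R) : has_deriv (fun z : R => z) x (1 : R).
Proof. by rewrite /has_deriv; exact: is_derive_id. Qed.

Lemma dadd f g (x df dg : R) : has_deriv f x df -> has_deriv g x dg ->
  has_deriv (fun z => f z + g z) x (df + dg).
Proof. by rewrite /has_deriv => *; exact: is_deriveD. Qed.

Lemma dopp f (x df : R) : has_deriv f x df ->
  has_deriv (fun z => - f z) x (- df).
Proof. by rewrite /has_deriv => *; exact: is_deriveN. Qed.

Lemma dmul f g (x df dg : R) : has_deriv f x df -> has_deriv g x dg ->
  has_deriv (fun z => f z * g z) x (f x * dg + g x * df).
Proof. by rewrite /has_deriv => *; exact: is_deriveM. Qed.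

Lemma dmulc c f (x df : R) : has_deriv f x df ->
  has_deriv (fun z => c * f z) x (c * df).
Proof. by rewrite /has_deriv => *; exact: is_deriveZ. Qed.

Lemma dexp n f (x df : R) : has_deriv f x df ->
  has_deriv (fun z => f z ^+ n) x (n%:R * f x ^+ n.-1 * df).
Proof.
move=> fd; elim: n => [|n IH].
  by apply: deq; [exact: (dcst 1)|rewrite !mul0r].
rewrite (_ : (fun z => f z ^+ n.+1) = (fun z => f z * f z ^+ n)); last first.
  by apply/funext => z; rewrite exprS.
apply: deq; first exact: (dmul fd IH).
case: n {IH} => [|n] /=; first by rewrite !mul0r mulr0 expr0; ring.
by rewrite -[in RHS]natr1 !exprS; ring.
Qed.

End derivatives.

Ltac dtac := lazymatch goal with
  | |- has_deriv (fun=> ?c) _ _ => exact: dcst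
  | |- has_deriv (fun z => z) _ _ => exact: did
  | |- has_deriv (fun z => _ + _) _ _ => apply: dadd; dtac
  | |- has_deriv (fun z => - _) _ _ => apply: dopp; dtac
  | |- has_deriv (fun z => _ ^+ _) _ _ => apply: dexp; dtac
  | |- has_deriv (fun z => ?c * _) _ _ => apply: (@dmulc _ c); dtac
  | |- has_deriv (fun z => _ * _) _ _ => apply: dmul; dtac
  | _ => by eauto
  end.
Ltac dsolve := apply: deq; [dtac|].

(** * Mean values, primitives, moving averages and Taylor bounds *)

Section calculus.
Context {R : realType}.
Implicit Types (f g F df ddf : R -> R).

Lemma is_derive_cont f (x df : R) : has_deriv f x df -> {for x, continuous f}.
Proof.
by move=> [d _]; apply: differentiable_continuous; exact/derivable1_diffP.
Qed.

Lemma mvt f (df : R -> R) (x y : R) : (forall z : R, has_deriv f z (df z)) ->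
  exists2 c, Num.min x y <= c <= Num.max x y & f y - f x = df c * (y - x).
Proof.
move=> fd.
have fc (a b : R) : {within `[a, b], continuous f}.
  by apply: continuous_subspaceT => z; exact: is_derive_cont (fd z).
have [xy|yx] := leP x y.
  have [c] := MVT_segment xy (fun z _ => fd z) (fc _ _).
  by rewrite in_itv /= => cxy E; exists c.
have [c] := MVT_segment (ltW yx) (fun z _ => fd z) (fc _ _).
rewrite in_itv /= => cxy E; exists c => //.
by rewrite -opprB E -mulrN opprB.
Qed.

Lemma mvt_dist f (df : R -> R) (x y : R) : (forall z : R, has_deriv f z (df z)) ->
  exists c, [/\ f y - f x = df c * (y - x), `|c - x| <= `|y - x|
    & 0 <= (c - x) * (y - x)].
Proof.
move=> /(mvt x y)[c cxy E]; exists c; split => //.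
- have [xy|yx] := leP x y; move: cxy.
    by rewrite (min_idPl xy) (max_idPr xy) => /andP[? ?]; rewrite !ger0_norm; lra.
  rewrite (min_idPr (ltW yx)) (max_idPl (ltW yx)) => /andP[? ?].
  by rewrite !ler0_norm; lra.
- have [xy|yx] := leP x y; move: cxy.
    rewrite (min_idPl xy) (max_idPr xy) => /andP[? ?].
    by rewrite mulr_ge0// subr_ge0.
  rewrite (min_idPr (ltW yx)) (max_idPl (ltW yx)) => /andP[? ?].
  by rewrite mulr_le0// subr_le0// ltW.
Qed.

Lemma nondecr_derive f (df : R -> R) (x y : R) : (forall z : R, has_deriv f z (df z)) ->
  x <= y -> (forall z, x <= z <= y -> 0 <= df z) -> f x <= f y.
Proof.
move=> /(mvt x y)[c + E] xy d0; rewrite (min_idPl xy) (max_idPr xy) => /d0 dc.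
by rewrite -subr_ge0 E mulr_ge0// subr_ge0.
Qed.

Lemma derive_eq0_cst f x y : (forall z : R, has_deriv f z 0) -> f x = f y.
Proof. by move=> /(mvt y x)[c _ /eqP]; rewrite mul0r subr_eq0 => /eqP. Qed.

Lemma antiderivative_half f (a : R) : continuous f ->
  exists F, forall x : R, a < x -> has_deriv F x (f x).
Proof.
move=> cf; exists (fun x => \int[lebesgue_measure]_(t in `[a, x]) f t) => x ax.
have xx1 : x < x + 1 by rewrite ltrDl.
have [|dF dFE] := continuous_FTC1_closed xx1 _ ax (cf x).
  apply: continuous_compact_integrable; first exact: segment_compact.
  exact: continuous_subspaceT.
by apply: DeriveDef; [exact: dF|rewrite -derive1E; exact: dFE].
Qed.

(** Primitives on the half-lines ]-(n+1), oo[, normalised at 0, agree where both exist by the mean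
    value theorem. They are glued by letting n follow the integer part of the absolute value of
    x. *)
Lemma antiderivative f : continuous f ->
  exists F, forall x : R, has_deriv F x (f x).
Proof.
move=> cf.
have /choice[F0 F0P] : forall n : nat, exists F, forall x : R, - n.+1%:R < x -> has_deriv F x (f x).
  by move=> n; exact: antiderivative_half.
pose F n x := F0 n x - F0 n 0.
have FP n (x : R) : - n.+1%:R < x -> has_deriv (F n) x (f x).
  by move=> nx; rewrite /F; dsolve; last exact: addr0.
have Feq n m (x : R) : - n.+1%:R < x -> - m.+1%:R < x -> F n x = F m x.
  move=> nx mx; apply/eqP; rewrite -subr_eq0.
  pose a := Num.min x 0; pose b := Num.max x 0.
  have nm (z : R) : z \in `]a, b[ -> has_deriv (fun z => F n z - F m z) z 0.
    rewrite in_itv /= => /andP[az _]; rewrite -(subrr (f z)).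
    have na : - n.+1%:R < z by apply: le_lt_trans az; rewrite /a le_min (ltW nx)/= oppr_le0.
    have ma : - m.+1%:R < z by apply: le_lt_trans az; rewrite /a le_min (ltW mx)/= oppr_le0.
    by apply: dadd; [exact: FP|apply: dopp; exact: FP].
  have ab : a <= b by rewrite /a /b le_max ge_min lexx.
  have cd : {within `[a, b], continuous (fun z => F n z - F m z)}.
    apply: continuous_in_subspaceT => z; rewrite inE /= in_itv /= => /andP[az _].
    have na : - n.+1%:R < z.
      by apply: lt_le_trans az; rewrite /a lt_min nx/= oppr_lt0.
    have ma : - m.+1%:R < z.
      by apply: lt_le_trans az; rewrite /a lt_min mx/= oppr_lt0.
    by apply: cvgB; [exact: is_derive_cont (FP _ _ na)|exact: is_derive_cont (FP _ _ ma)].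
  have [c _] := MVT_segment ab nm cd.
  by rewrite mul0r /a /b /=; case: (leP x 0) => x0; rewrite /F !subrr => /eqP; rewrite ?subr0 ?sub0r ?oppr_eq0 // => /eqP ->.
exists (fun x => F (Num.trunc `|x|) x) => x.
set n := (Num.trunc `|x|).+1.
have bnd (z : R) : `|z - x| < 1 -> - (Num.trunc `|z|).+1%:R < z /\ - n.+1%:R < z.
  move=> zx; have := truncnS_gt `|z|; have := truncnS_gt `|x|.
  move: zx; rewrite /n -!natr1 => zx h1 h2.
  have : - `|z| <= z by rewrite lerNnormlW.
  have : `|z| <= `|x| + `|z - x|.
    by rewrite -{1}(subrKC x z) ler_normD.
  lra.
have [_ nx] : - (Num.trunc `|x|).+1%:R < x /\ - n.+1%:R < x.
  by apply: bnd; rewrite subrr normr0.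
apply: (@near_eq_is_derive _ _ _ (F n)); last exact: FP.
near=> z.
have /bnd[h1 h2] : `|z - x| < 1 by near: z; exists 1 => //= z; rewrite /ball /= distrC.
by symmetry; exact: Feq.
Unshelve. all: by end_near. Qed.

Definition prim f : R -> R :=
  xget (fun=> 0) [set F | forall x : R, has_deriv F x (f x)].

Lemma primP f : continuous f -> forall x : R, has_deriv (prim f) x (f x).
Proof.
by move=> /antiderivative[F FP]; rewrite /prim; case: xgetP => [G _ //|/(_ F)].
Qed.

(** Steklov average of f over [y, y + e], written with a primitive so that its derivative is a
    difference quotient of f. *)
Definition avg (e : R) f (y : R) : R := e^-1 * (prim f (y + e) - prim f y).

Lemma avg_uniq e f F : (forall x : R, has_deriv F x (f x)) ->
  avg e f = fun y => e^-1 * (F (y + e) - F y).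
Proof.
move=> FP; apply/funext => y; rewrite /avg; congr (_ * _).
have cf : exists F, forall x : R, has_deriv F x (f x) by exists F.
have pP (x : R) : has_deriv (prim f) x (f x).
  by rewrite /prim; case: xgetP => [G _ //|/(_ F)].
have d0 (z : R) : has_deriv (fun z => prim f z - F z) z 0.
  by rewrite -(subrr (f z)); apply: dadd => //; exact: dopp.
by have /= := derive_eq0_cst (y + e) y d0; lra.
Qed.

Lemma deriv_shift f (a df x : R) : has_deriv f (x + a) df ->
  has_deriv (fun z => f (z + a)) x df.
Proof.
move=> fd; have ? : has_deriv (fun z : R => z + a) x 1.
  by dsolve; rewrite addr0.
have := @is_derive1_comp _ f (fun z => z + a) x df 1 fd _.
by rewrite mulr1; exact.
Qed.

Section avg.
Variables (e : R) (e0 : 0 < e).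

Lemma avg_le f g y : continuous f -> continuous g ->
  (forall z, y <= z <= y + e -> f z <= g z) -> avg e f y <= avg e g y.
Proof.
move=> /primP cf /primP cg fg; rewrite /avg ler_pM2l ?invr_gt0//.
have d (z : R) : has_deriv (fun z => prim g z - prim f z) z (g z - f z) by apply: dadd => //; exact: dopp.
have := nondecr_derive (x := y) (y := y + e) d.
rewrite lerDl (ltW e0) => /(_ isT) /= H.
suff : prim g y - prim f y <= prim g (y + e) - prim f (y + e) by lra.
by apply: H => z zy; rewrite subr_ge0 fg.
Qed.

Lemma avg_cst c y : avg e (fun=> c) y = c.
Proof.
have H (x : R) : has_deriv (fun z : R => c * z) x c.
  by dsolve; rewrite mulr1.
by rewrite (avg_uniq e H); field; rewrite gt_eqF.
Qed.

Lemma avgD f g y : continuous f -> continuous g ->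
  avg e (fun z => f z + g z) y = avg e f y + avg e g y.
Proof.
move=> /primP cf /primP cg; have H (x : R) : has_deriv (fun z => prim f z + prim g z) x (f x + g x).
  exact: dadd.
by rewrite (avg_uniq e H) /avg /=; ring.
Qed.

Lemma avgZ c f y : continuous f ->
  avg e (fun z => c * f z) y = c * avg e f y.
Proof.
move=> /primP cf; have H (x : R) : has_deriv (fun z => c * prim f z) x (c * f x) by exact: dmulc.
by rewrite (avg_uniq e H) /avg /= /GRing.scale /=; ring.
Qed.

Lemma avg_shift a f y : continuous f ->
  avg e (fun z => f (z + a)) y = avg e f (y + a).
Proof.
move=> /primP cf; have H (x : R) : has_deriv (fun z => prim f (z + a)) x (f (x + a)).
  exact: deriv_shift.
by rewrite (avg_uniq e H) /avg /= addrAC.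
Qed.

Lemma avg_derive f (y : R) : continuous f ->
  has_deriv (avg e f) y (e^-1 * (f (y + e) - f y)).
Proof.
move=> /primP cf; rewrite /avg.
have h := deriv_shift (cf (y + e)).
by apply: dmulc; apply: dadd; [exact: h|exact: dopp].
Qed.

Lemma avg_continuous f : continuous f -> continuous (avg e f).
Proof. by move=> cf y; apply: is_derive_cont (avg_derive y cf). Qed.

Lemma avg_dist c M f y : continuous f ->
  (forall z, y <= z <= y + e -> `|f z - c| <= M) -> `|avg e f y - c| <= M.
Proof.
move=> cf fc; rewrite ler_norml; apply/andP; split.
  rewrite lerBrDr -[X in X <= _](avg_cst _ y); apply: avg_le => // [z|z /fc].
    exact: cvg_cst.
  by rewrite ler_norml; lra.
rewrite lerBlDr -[X in _ <= X](avg_cst _ y); apply: avg_le => // [z|z /fc].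
  exact: cvg_cst.
by rewrite ler_norml; lra.
Qed.

Lemma avg_dist2 M f g y : continuous f -> continuous g ->
  (forall z, y <= z <= y + e -> `|f z - g z| <= M) ->
  `|avg e f y - avg e g y| <= M.
Proof.
move=> cf cg fg; rewrite -[_ - _]subr0.
have -> : avg e f y - avg e g y = avg e (fun z => f z + -1 * g z) y.
  rewrite avgD// ?avgZ//; first by rewrite mulN1r.
  by move=> z; apply: cvgMr; exact: cg.
apply: avg_dist => [z|z /fg]; last by rewrite subr0 mulN1r.
by apply: cvgD; [exact: cf|apply: cvgMr; exact: cg].
Qed.

End avg.

Lemma lip_ge0 L f : lip L f -> 0 <= L.
Proof.
move=> /(_ 1 0); rewrite subr0 normr1 mulr1; exact: le_trans (normr_ge0 _).
Qed.

Lemma lip_continuous L f : lip L f -> continuous f.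
Proof.
move=> fL x; apply/cvgrPdist_le => d d0.
have L0 := lip_ge0 fL.
near=> z; rewrite (le_trans (fL _ _))//.
have : `|x - z| <= d / (L + 1).
  near: z; exists (d / (L + 1)); first by rewrite /= divr_gt0// ltr_wpDl.
  by move=> z; exact: ltW.
rewrite ler_pdivlMr ?ltr_wpDl// => h.
have := normr_ge0 (x - z); nra.
Unshelve. all: by end_near. Qed.

Lemma taylor1 f df L x y : (forall z : R, has_deriv f z (df z)) -> lip L df ->
  `|f y - f x - df x * (y - x)| <= L * (y - x) ^+ 2.
Proof.
move=> fd dL; have [c [E cx _]] := mvt_dist x y fd.
rewrite E -mulrBl normrM (le_trans (ler_wpM2r _ (dL _ _)))//.
rewrite -[(y - x) ^+ 2]ger0_norm ?sqr_ge0// normrX expr2 -mulrA.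
have L0 := lip_ge0 dL.
by rewrite ler_wpM2l// ler_wpM2r.
Qed.

Lemma taylor2 f df ddf H x y : (forall z : R, has_deriv f z (df z)) ->
  (forall z : R, has_deriv df z (ddf z)) -> lip H ddf ->
  `|f y - f x - df x * (y - x) - 2^-1 * ddf x * (y - x) ^+ 2|
    <= H * `|y - x| ^+ 3.
Proof.
move=> fd dfd ddL.
have H0 := lip_ge0 ddL.
pose g z := f z - f x - df x * (z - x) - 2^-1 * ddf x * (z - x) ^+ 2.
have gd (z : R) : has_deriv g z (df z - df x - ddf x * (z - x)).
  by rewrite /g; dsolve; rewrite /=; field.
have [c [E cx _]] := mvt_dist x y gd.
have gx : g x = 0 by rewrite /g; ring.
rewrite -/(g y) -[g y]subr0 -gx E normrM [in leRHS]exprSr mulrA ler_wpM2r//.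
have := taylor1 x c dfd ddL; move=> /le_trans; apply; rewrite ler_wpM2l//.
by rewrite -[(c - x) ^+ 2]ger0_norm ?sqr_ge0// normrX lerXn2r ?nnegrE.
Qed.

(** The remainder g has g' = k, and k(c) has the sign opposite to c - x since k' = ddf - b <= 0; so
    g decreases when moving away from x. *)
Lemma taylor2_le f df ddf (b x y r : R) :
  (forall z : R, has_deriv f z (df z)) ->
  (forall z : R, has_deriv df z (ddf z)) ->
  (forall z, `|z - x| < r -> ddf z <= b) -> `|y - x| < r ->
  f y <= f x + df x * (y - x) + 2^-1 * b * (y - x) ^+ 2.
Proof.
move=> fd dfd ddb yr.
pose g z := f z - f x - df x * (z - x) - 2^-1 * b * (z - x) ^+ 2.
have gd (z : R) : has_deriv g z (df z - df x - b * (z - x)).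
  by rewrite /g; dsolve; rewrite /=; field.
pose k z := df z - df x - b * (z - x).
have kd (z : R) : has_deriv k z (ddf z - b).
  by rewrite /k; dsolve; rewrite /=; field.
have [c [E cx cxy]] := mvt_dist x y gd.
have [d [E' dx _]] := mvt_dist x c kd.
have gx : g x = 0 by rewrite /g; ring.
have kx : k x = 0 by rewrite /k; ring.
suff : g y <= 0 by rewrite /g; lra.
move: E; rewrite gx subr0 => ->; rewrite -/(k c).
move: E'; rewrite kx subr0 => ->; rewrite -mulrA mulr_le0_ge0//.
by rewrite subr_le0 ddb// (le_lt_trans dx)// (le_lt_trans cx).
Qed.

End calculus.

(** * A monotone random walk scheme for the G-heat equation *)

Section scheme.
Context {R : realType}.
Variables (slo shi : R).
Hypotheses (slo0 : 0 <= slo) (slohi : slo <= shi).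
Implicit Types (f g phi : R -> R).

Let shi0 : 0 <= shi. Proof. exact: le_trans slo0 slohi. Qed.

(** Time step 4^-N, divided into 2^(18 N) walk steps of spatial size 2^(-10 N), so that one time
    step has variance proportional to its length ([nstep_rstep]). The spatial size is the fifth
    power of the time step; this excess of precision pays for mollification in [super_block]. *)
Definition dl N : R := 4^-1 ^+ N.
Definition rstep N : R := 2^-1 ^+ (10 * N).
Definition nstep N : nat := 2 ^ (18 * N).

Lemma dl_gt0 N : 0 < dl N. Proof. by rewrite exprn_gt0// invr_gt0. Qed.

Lemma rstep_gt0 N : 0 < rstep N. Proof. by rewrite exprn_gt0// invr_gt0. Qed.

Lemma nstep_rstep N : (nstep N)%:R * rstep N ^+ 2 = dl N.
Proof.
rewrite /nstep /rstep /dl natrX -exprM.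
have -> : (10 * N * 2 = 18 * N + 2 * N)%N by clear; lia.
rewrite exprD mulrA -exprMn divff// expr1n mul1r exprM; congr (_ ^+ _).
by field.
Qed.

Lemma cvg_dl : dl N @[N --> \oo] --> 0.
Proof. by apply: cvg_expr; rewrite ger0_norm ?invr_ge0// invf_lt1// ltr1n. Qed.

                                                                                              
                                                                                              
                                                                                                 
(** Approximate heat flow of volatility s over one time step. [Top] keeps one volatility during each
    time step and takes the better of the two extreme ones, matching G as a maximum of two linear
    functions. *)
Definition Kop s N := iter (nstep N) (@Qop R (s * rstep N)).
Definition Top N f y := Num.max (Kop slo N f y) (Kop shi N f y).

Lemma lin_K s N : lin (Kop s N).
Proof. by apply: lin_iter; exact: lin_Q. Qed.

Lemma sublin_T N : sublin (Top N).
Proof. by apply: sublin_max; apply: lin_sub; exact: lin_K. Qed.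

Lemma iterK_quad s N k A p b y : iter k (Kop s N) (quad A p b 0) y =
  quad (A + k%:R * dl N * s ^+ 2 * b) p b 0 y.
Proof.
rewrite /Kop -iterM iterQ_quad natrM exprMn -(nstep_rstep N) /quad; ring.
Qed.

Lemma iterK_pow4 s N k y : iter k (Kop s N) (fun z => z ^+ 4) y <=
  y ^+ 4 + 6 * (k%:R * dl N * s ^+ 2) * y ^+ 2 + 3 * (k%:R * dl N * s ^+ 2) ^+ 2.
Proof.
rewrite /Kop -iterM; apply: le_trans (iterQ_pow4 _ _ _) _.
have -> : (k * nstep N)%:R * (s * rstep N) ^+ 2 = k%:R * dl N * s ^+ 2.
  by rewrite natrM exprMn -(nstep_rstep N); ring.
exact: lexx.
Qed.

Lemma GfunE b : Gfun slo shi (2 * b) = Num.max (slo ^+ 2 * b) (shi ^+ 2 * b).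
Proof.
have s2 : slo ^+ 2 <= shi ^+ 2 by rewrite lerXn2r ?nnegrE.
rewrite /Gfun; have [b0|b0] := leP 0 b.
  have h1 : Num.max (2 * b) 0 = 2 * b by apply/max_idPl; nra.
  have h2 : Num.max (- (2 * b)) 0 = 0 by apply/max_idPr; nra.
  rewrite h1 h2; have -> : Num.max (slo ^+ 2 * b) (shi ^+ 2 * b) = shi ^+ 2 * b.
    by apply/max_idPr; rewrite ler_wpM2r.
  by field.
have h1 : Num.max (2 * b) 0 = 0 by apply/max_idPr; nra.
have h2 : Num.max (- (2 * b)) 0 = - (2 * b) by apply/max_idPl; nra.
rewrite h1 h2; have -> : Num.max (slo ^+ 2 * b) (shi ^+ 2 * b) = slo ^+ 2 * b.
  by apply/max_idPl; nra.
by field.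
Qed.

Lemma iterT_quad N k A p b y : iter k (Top N) (quad A p b 0) y =
  quad (A + k%:R * dl N * Gfun slo shi (2 * b)) p b 0 y.
Proof.
elim: k y => [|k IH] y /=; first by rewrite /quad; ring.
rewrite (_ : iter k _ _ = quad (A + k%:R * dl N * Gfun slo shi (2 * b)) p b 0); last exact/funext.
rewrite /Top.
have KE s : Kop s N (quad (A + k%:R * dl N * Gfun slo shi (2 * b)) p b 0) y
    = dl N * (s ^+ 2 * b) + quad (A + k%:R * dl N * Gfun slo shi (2 * b)) p b 0 y.
  by have := iterK_quad s N 1 (A + k%:R * dl N * Gfun slo shi (2 * b)) p b y; rewrite /= => ->; rewrite /quad; ring.
by rewrite !KE -addr_maxl -maxr_pMr ?ltW ?dl_gt0// -GfunE /quad -natr1; ring.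
Qed.

Lemma GfunE1 b : Gfun slo shi b = Num.max (slo ^+ 2 * (2^-1 * b)) (shi ^+ 2 * (2^-1 * b)).
Proof. by rewrite -GfunE; congr Gfun; field. Qed.

Lemma GfunE_ge0 b : 0 <= b -> Gfun slo shi (2 * b) = shi ^+ 2 * b.
Proof.
by move=> b0; rewrite GfunE; apply/max_idPr; rewrite ler_wpM2r// lerXn2r ?nnegrE.
Qed.

Lemma Gfun2 : Gfun slo shi 2 = shi ^+ 2.
Proof.
rewrite -[X in Gfun _ _ X]mulr1 GfunE !mulr1; apply/max_idPr.
by rewrite lerXn2r ?nnegrE.
Qed.

Lemma iterT_pow2 N k y : iter k (Top N) (fun z => z ^+ 2) y =
  y ^+ 2 + k%:R * dl N * shi ^+ 2.
Proof.
have := iterT_quad N k 0 0 1 y; rewrite mulr1 Gfun2 => E.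
have -> : (fun z : R => z ^+ 2) = quad 0 0 1 0 by apply/funext => z; rewrite /quad; ring.
by rewrite E /quad; ring.
Qed.

Lemma Top_pow4 N y : Top N (fun z => z ^+ 4) y <=
  y ^+ 4 + 6 * (dl N * shi ^+ 2) * y ^+ 2 + 3 * (dl N * shi ^+ 2) ^+ 2.
Proof.
have s2 : slo ^+ 2 <= shi ^+ 2 by rewrite lerXn2r ?nnegrE.
have d0 := dl_gt0 N.
have a1 : 0 <= slo ^+ 2 by exact: sqr_ge0.
have a2 : dl N * slo ^+ 2 <= dl N * shi ^+ 2 by rewrite ler_wpM2l// ltW.
have a3 : 0 <= dl N * slo ^+ 2 by rewrite mulr_ge0// ltW.
have K s := iterK_pow4 s N 1 y; rewrite /= in K.
rewrite /Top ge_max; apply/andP; split; last first.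
  by apply: le_trans (K shi) _; rewrite mul1r.
apply: le_trans (K slo) _; rewrite mul1r; have := sqr_ge0 y; nra.
Qed.

Lemma iterT_pow4 N k y : iter k (Top N) (fun z => z ^+ 4) y <=
  y ^+ 4 + 6 * (k%:R * dl N * shi ^+ 2) * y ^+ 2 + 3 * (k%:R * dl N * shi ^+ 2) ^+ 2.
Proof.
have d0 := dl_gt0 N; have sT := sublin_T N.
elim: k y => [|k IH] y /=; first by rewrite !mul0r; lra.
set a := k%:R * dl N * shi ^+ 2 in IH *.
have a0 : 0 <= a by rewrite !mulr_ge0 ?sqr_ge0// ltW.
have -> : k.+1%:R * dl N * shi ^+ 2 = a + dl N * shi ^+ 2 by rewrite /a -natr1; ring.
apply: (le_trans (sl_mono sT y IH)).
apply: (@le_trans _ _ (Top N (fun z => z ^+ 4 + (6 * a) * z ^+ 2 ) y + 3 * a ^+ 2)).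
  by rewrite -(sl_cst sT).
have h2 : Top N (fun z => z ^+ 2) y = y ^+ 2 + dl N * shi ^+ 2.
  by have := iterT_pow2 N 1 y; rewrite /= mul1r.
have h6 : 0 <= 6 * a by lra.
have := sl_add sT (fun z => z ^+ 4) (fun z => (6 * a) * z ^+ 2) y.
rewrite (sl_hom sT) // h2.
have := Top_pow4 N y; nra.
Qed.

(** The scheme is exact on quadratics, and the quartic term evaluated at its centre costs only a
    fourth moment, which is of second order in time. *)
Lemma iterT_quad_le N k A p b C y : 0 <= C ->
  iter k (Top N) (fun z => quad A p b C (z - y)) y <=
  A + k%:R * dl N * Gfun slo shi (2 * b) + 3 * C * (k%:R * dl N * shi ^+ 2) ^+ 2.
Proof.
move=> C0; have sT := sublin_iter k (sublin_T N).
rewrite (sl_shift sT (- y) (quad A p b C)) subrr.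
rewrite (_ : quad A p b C = fun z => quad A p b 0 z + C * z ^+ 4); last first.
  by apply/funext => z; rewrite /quad; ring.
apply: (le_trans (sl_add sT _ _ _)); rewrite iterT_quad (sl_hom sT)//.
have := iterT_pow4 N k 0.
by rewrite expr0n /= expr0n /= !mulr0 !add0r /quad; nra.
Qed.

Lemma iterT_quad_ge N k A p b C y : 0 <= C ->
  A + k%:R * dl N * Gfun slo shi (2 * b) - 3 * C * (k%:R * dl N * shi ^+ 2) ^+ 2
  <= iter k (Top N) (fun z => quad A p b (- C) (z - y)) y.
Proof.
move=> C0; have sT := sublin_iter k (sublin_T N).
rewrite (sl_shift sT (- y) (quad A p b (- C))) subrr.
rewrite (_ : quad A p b (- C) = fun z => quad A p b 0 z - C * z ^+ 4); last first.
  by apply/funext => z; rewrite /quad; ring.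
apply: le_trans (sl_superadd sT _ _ _); rewrite iterT_quad (sl_hom sT)//.
have := iterT_pow4 N k 0.
by rewrite expr0n /= expr0n /= !mulr0 !add0r /quad; nra.
Qed.

Lemma iterK_quad_ge s N k A p b C y : 0 <= C ->
  A + k%:R * dl N * s ^+ 2 * b - 3 * C * (k%:R * dl N * s ^+ 2) ^+ 2
  <= iter k (Kop s N) (fun z => quad A p b (- C) (z - y)) y.
Proof.
move=> C0; have sT := lin_sub (lin_iter k (lin_K s N)).
rewrite (sl_shift sT (- y) (quad A p b (- C))) subrr.
rewrite (_ : quad A p b (- C) = fun z => quad A p b 0 z - C * z ^+ 4); last first.
  by apply/funext => z; rewrite /quad; ring.
apply: le_trans (sl_superadd sT _ _ _); rewrite iterK_quad (sl_hom sT)//.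
have := iterK_pow4 s N k 0.
by rewrite expr0n /= expr0n /= !mulr0 !add0r /quad; nra.
Qed.

Lemma iterK_le_iterT s N k f y : s = slo \/ s = shi ->
  iter k (Kop s N) f y <= iter k (Top N) f y.
Proof.
move=> ss; elim: k y => [//|k IH] y /=.
apply: (le_trans (sl_mono (lin_sub (lin_K s N)) y IH)).
by rewrite /Top le_max; case: ss => ->; rewrite lexx ?orbT.
Qed.

Lemma young (a l : R) : 0 < l -> `|a| <= a ^+ 2 / (2 * l) + l / 2.
Proof.
move=> l0; rewrite -subr_ge0.
have -> : a ^+ 2 / (2 * l) + l / 2 - `|a| = (`|a| - l) ^+ 2 / (2 * l).
  by rewrite -[a ^+ 2]ger0_norm ?sqr_ge0// normrX; field; rewrite gt_eqF.
by rewrite divr_ge0 ?sqr_ge0// mulr_ge0// ltW.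
Qed.

(** A Lipschitz function differs from its value at y by at most a quadratic with minimum at y, by
    [young], and quadratics evolve exactly. Choosing l of the order of the square root of the
    elapsed time would give the usual modulus. *)
Lemma iterT_time N k f L y (l : R) : lip L f -> 0 < l ->
  `|iter k (Top N) f y - f y| <= L * (k%:R * dl N * shi ^+ 2 / (2 * l) + l / 2).
Proof.
move=> fL l0; have sT := sublin_iter k (sublin_T N); have L0 := lip_ge0 fL.
pose q z := quad (L * l / 2) 0 (L / (2 * l)) 0 (z - y).
have qE z : `|f z - f y| <= q z.
  rewrite (le_trans (fL _ _))//; have := young (z - y) l0.
  by move=> /(ler_wpM2l L0)/le_trans; apply; rewrite /q /quad; lra.
have Tq : iter k (Top N) q y = L * (k%:R * dl N * shi ^+ 2 / (2 * l) + l / 2).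
  rewrite (sl_shift sT (- y) (quad _ _ _ _)) subrr iterT_quad.
  have -> : Gfun slo shi (2 * (L / (2 * l))) = L / (2 * l) * shi ^+ 2.
    rewrite GfunE_ge0; first exact: mulrC.
    by rewrite divr_ge0// mulr_ge0// ltW.
  by rewrite /quad; field; rewrite gt_eqF.
rewrite -Tq ler_norml; apply/andP; split.
  rewrite lerBrDr addrC -[X in X - _](sl_csts sT (f y) y).
  apply: (le_trans (sl_superadd sT _ _ _)); apply: (sl_mono sT) => z.
  by have := qE z; rewrite ler_norml => /andP[]; lra.
rewrite lerBlDr -(sl_cst sT); apply: (sl_mono sT) => z.
by have := qE z; rewrite ler_norml => /andP[]; lra.
Qed.

Definition kt N (t : R) : nat := Num.trunc (t * 4 ^+ N).

Lemma dlV N : dl N * 4 ^+ N = 1.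
Proof. by rewrite /dl -exprMn mulVf ?expr1n. Qed.

Lemma kt_le N t : 0 <= t -> (kt N t)%:R * dl N <= t.
Proof.
move=> t0; have /truncn_itv/andP[h _] : 0 <= t * 4 ^+ N by rewrite mulr_ge0// exprn_ge0.
have := ler_wpM2r (ltW (dl_gt0 N)) h.
by rewrite -mulrA [4 ^+ N * _]mulrC dlV mulr1.
Qed.

Lemma kt_gt N t : t < (kt N t)%:R * dl N + dl N.
Proof.
have := truncnS_gt (t * 4 ^+ N); rewrite -(ltr_pM2r (dl_gt0 N)).
by rewrite -mulrA [4 ^+ N * _]mulrC dlV mulr1 -natr1 mulrDl mul1r.
Qed.

Lemma kt_mono N s t : s <= t -> (kt N s <= kt N t)%N.
Proof. by move=> st; apply: le_truncn; rewrite ler_wpM2r// exprn_ge0. Qed.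

Lemma ktB N s t : 0 <= s -> s <= t ->
  `|(kt N t - kt N s)%:R * dl N - (t - s)| <= dl N.
Proof.
move=> s0 st; rewrite natrB ?kt_mono//.
have := kt_le N s0; have := kt_le N (le_trans s0 st).
have := kt_gt N s; have := kt_gt N t; rewrite ler_norml mulrBl; lra.
Qed.

Definition VN phi N t y := iter (kt N t) (Top N) phi y.
                                                                                         
                                                        
(** Candidate solution. Convergence of the scheme is not established; [solution_unique] identifies
    this ultralimit afterwards. *)
Definition gval phi t y := ulim (fun N => VN phi N t y).

Lemma VND phi N s t y : s <= t ->
  VN phi N t y = iter (kt N t - kt N s) (Top N) (VN phi N s) y.
Proof. by move=> st; rewrite /VN -iterD subnK// kt_mono. Qed.

Lemma kt0 N t : t <= 0 -> kt N t = 0%N.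
Proof.
move=> t0; apply/truncn0Pn; rewrite -ltNge (le_lt_trans _ ltr01)//.
by rewrite mulr_le0_ge0// exprn_ge0.
Qed.

Lemma ulim_le_err (x : nat -> R) c : bdd_seq x ->
  (forall e, 0 < e -> \forall n \near free_ultrafilter, x n <= c + e) -> ulim x <= c.
Proof.
move=> bx H; rewrite leNgt; apply/negP => cx.
pose e := (ulim x - c) / 3; have e0 : 0 < e by rewrite divr_gt0// subr_gt0.
have h1 := H _ e0; have h2 := ulim_near_ge bx e0 (lexx _).
have [n [/= n1 n2]] := filter_ex (filterI h1 h2).
by move: n1 n2; rewrite /e; lra.
Qed.

Lemma ulim_ge_err (x : nat -> R) c : bdd_seq x ->
  (forall e, 0 < e -> \forall n \near free_ultrafilter, c - e <= x n) -> c <= ulim x.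
Proof.
move=> bx H; rewrite -[ulim x]opprK -ulimN// lerNr.
apply: ulim_le_err => [|e /H]; first by case: bx => M xM; exists M => n; rewrite normrN.
by apply: filterS => n; lra.
Qed.

Lemma near_dl e : 0 < e -> \forall N \near (@free_ultrafilter), dl N <= e.
Proof.
move=> e0; apply: free_near; move/cvgrPdist_le : cvg_dl => /(_ _ e0).
by apply: filterS => N; rewrite sub0r normrN gtr0_norm ?dl_gt0.
Qed.

(** Equi-Lipschitz functions converge locally uniformly along the ultrafilter: each point controls a
    ball around it, and the filter form of compactness combines the balls. *)
Lemma locunif (f_ : nat -> R -> R) L M y r e : (forall n, lip L (f_ n)) ->
  (forall n, bdd M (f_ n)) -> 0 < e ->
  \forall n \near free_ultrafilter, forall z, `|z - y| <= r ->
    `|f_ n z - ulim (f_^~ z)| <= e.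
Proof.
move=> fL fM e0.
have L0 := lip_ge0 (fL 0%N).
have bz z : bdd_seq (f_^~ z) by exists M => n; exact: fM.
have ufL z z' : `|ulim (f_^~ z) - ulim (f_^~ z')| <= L * `|z - z'|.
  rewrite ler_norml; apply/andP; split.
    rewrite lerBrDr addrC -[X in _ + X](ulim_cst (- (L * `|z - z'|))) -ulimD//; last exact: bdd_seq_cst.
    apply: le_ulim => //; first by apply: bdd_seqD => //; exact: bdd_seq_cst.
    by move=> n; have := fL n z z'; rewrite ler_norml; lra.
  rewrite lerBlDr addrC -[X in _ + X](ulim_cst (L * `|z - z'|)) -ulimD//; last exact: bdd_seq_cst.
  apply: le_ulim => //; first by apply: bdd_seqD => //; exact: bdd_seq_cst.
  by move=> n; have := fL n z z'; rewrite ler_norml; lra.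
have /compact_near_coveringP cK := @segment_compact R (y - r) (y + r).
have cov : \forall n \near free_ultrafilter, `[y - r, y + r] `<=`
    (fun z => `|f_ n z - ulim (f_^~ z)| <= e).
  apply: cK => x _; pose d := e / (3 * (L + 1)).
  have L1 : 0 < L + 1 by lra.
  have d0 : 0 < d by rewrite divr_gt0// mulr_gt0.
  have Ld : L * d <= e / 3.
    by rewrite /d invfM mulrCA ler_wpM2l ?(ltW e0)// mulrCA ler_piMr// ler_pdivrMr// mul1r; lra.
  exists (ball x d, [set n | `|f_ n x - ulim (f_^~ x)| <= e / 3]) => /=.
    split; first exact: nbhsx_ballx.
    by apply: ulim_near_dist => //; rewrite divr_gt0.
  move=> [z n] /= [xz fx].
  have h : L * `|x - z| <= e / 3 by rewrite (le_trans _ Ld)// ler_wpM2l// ltW.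
  have := fL n z x; have := ufL x z; move: fx; rewrite [`|z - x|]distrC.
  rewrite !ler_norml; lra.
apply: filterS cov => n H z zy; apply: H; rewrite /= in_itv /=.
by move: zy; rewrite ler_norml; lra.
Qed.

End scheme.

(** * Dynamic programming and mollification for the limit of the scheme *)

Section value_function.
Context {R : realType}.
Variables (slo shi : R).
Hypotheses (slo0 : 0 <= slo) (slohi : slo <= shi).
Implicit Types (f g phi : R -> R).

Let shi0 : 0 <= shi. Proof. exact: le_trans slo0 slohi. Qed.

Local Notation Top := (Top slo shi).
Local Notation VN := (VN slo shi).
Local Notation gval := (gval slo shi).
Local Notation G := (Gfun slo shi).
Local Notation dl := (@dl R).

Lemma Gfun_ge s b : s = slo \/ s = shi -> s ^+ 2 * b <= G (2 * b).
Proof.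
by move=> ss; rewrite GfunE// le_max; case: ss => ->; rewrite lexx ?orbT.
Qed.

Section fixed_datum.
Variables (phi : R -> R) (M L : R).
Hypotheses (phiM : bdd M phi) (phiL : lip L phi).

Let L0 : 0 <= L. Proof. exact: lip_ge0 phiL. Qed.

Lemma VN_bdd N t : bdd M (VN phi N t).
Proof. by apply: sl_bdd => //; apply: sublin_iter; exact: sublin_T. Qed.

Lemma VN_lip N t : lip L (VN phi N t).
Proof. by apply: sl_lip => //; apply: sublin_iter; exact: sublin_T. Qed.

Lemma VN_bdd_seq t y : bdd_seq (fun N => VN phi N t y).
Proof. by exists M => N; exact: VN_bdd. Qed.

Lemma val_bdd t : bdd M (gval phi t).
Proof.
move=> y; rewrite ler_norml; apply/andP; split.
  rewrite -(ulim_cst (- M)); apply: le_ulim; [exact: bdd_seq_cst|exact: VN_bdd_seq|].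
  by move=> N; have := VN_bdd N t y; rewrite ler_norml => /andP[].
rewrite -[leRHS](ulim_cst M); apply: le_ulim; [exact: VN_bdd_seq|exact: bdd_seq_cst|].
by move=> N; have := VN_bdd N t y; rewrite ler_norml => /andP[].
Qed.

Lemma ulim_dist_le (x z : nat -> R) c : bdd_seq x -> bdd_seq z ->
  (forall e, 0 < e -> \forall n \near free_ultrafilter, `|x n - z n| <= c + e) ->
  `|ulim x - ulim z| <= c.
Proof.
move=> bx bz H; have bz' : bdd_seq (fun n => -1 * z n) by exact: bdd_seqZ.
have -> : ulim x - ulim z = ulim (fun n => x n + -1 * z n).
  by rewrite ulimD// ulimZ// mulN1r.
rewrite ler_norml; apply/andP; split.
  apply: ulim_ge_err => [|e /H]; first exact: bdd_seqD.
  by apply: filterS => n; rewrite mulN1r ler_norml; lra.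
apply: ulim_le_err => [|e /H]; first exact: bdd_seqD.
by apply: filterS => n; rewrite mulN1r ler_norml; lra.
Qed.

Lemma val_lip t : lip L (gval phi t).
Proof.
move=> x y; apply: ulim_dist_le; [exact: VN_bdd_seq..|move=> e e0].
by apply: filterE => n; rewrite (le_trans (VN_lip n t x y))// lerDl ltW.
Qed.

(** Truncation assigns no time step to t <= 0, so the value function extends by its datum to
    negative times. Moduli and averages can then be taken on the whole plane. *)
Lemma val_le0 t y : t <= 0 -> gval phi t y = phi y.
Proof.
move=> t0; rewrite /gval (_ : (fun N => _) = fun=> phi y) ?ulim_cst//.
by apply/funext => N; rewrite /VN kt0.
Qed.

Lemma val_time_le (s t y l : R) : 0 <= s -> s <= t -> 0 < l ->
  `|gval phi t y - gval phi s y| <= L * ((t - s) * shi ^+ 2 / (2 * l) + l / 2).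
Proof.
move=> s0 st l0; apply: ulim_dist_le; [exact: VN_bdd_seq..|move=> e e0].
pose c := L * (shi ^+ 2 / (2 * l)) + 1.
have c0 : 0 < c by rewrite ltr_wpDl// mulr_ge0// divr_ge0 ?sqr_ge0// mulr_ge0// ltW.
have ec0 : 0 < e / c by rewrite divr_gt0.
apply: filterS (near_dl ec0) => N dN; rewrite (VND _ _ _ _ _ st).
rewrite (le_trans (iterT_time _ _ _ _ _ (VN_lip N s) l0))//.
have k0 : 0 <= L * (shi ^+ 2 / (2 * l)).
  by rewrite mulr_ge0// divr_ge0 ?sqr_ge0// mulr_ge0// ltW.
have := ktB N s0 st; rewrite ler_norml => /andP[_ h].
have -> : L * ((kt N t - kt N s)%:R * dl N * shi ^+ 2 / (2 * l) + l / 2) =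
  L * (shi ^+ 2 / (2 * l)) * ((kt N t - kt N s)%:R * dl N) + L * (l / 2) by ring.
have -> : L * ((t - s) * shi ^+ 2 / (2 * l) + l / 2) + e =
  L * (shi ^+ 2 / (2 * l)) * (t - s) + L * (l / 2) + e by ring.
have h2 : L * (shi ^+ 2 / (2 * l)) * dl N <= e.
  have := ler_wpM2l k0 dN => /le_trans; apply.
  rewrite mulrCA ler_piMr ?(ltW e0)// ler_pdivrMr// mul1r /c lerDl ler01 //.
have := ler_wpM2l k0 h; lra.
Qed.

Lemma val_time (s t y l : R) : 0 < l ->
  `|gval phi t y - gval phi s y| <= L * (`|t - s| * shi ^+ 2 / (2 * l) + l / 2).
Proof.
move=> l0.
wlog st : s t / s <= t.
  move=> H; have [st|ts] := leP s t; first exact: H.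
  by rewrite distrC [`|t - s|]distrC; apply: H; exact: ltW.
have c0 : 0 <= shi ^+ 2 / (2 * l) by rewrite divr_ge0 ?sqr_ge0// mulr_ge0// ltW.
have [t0|t0] := leP t 0.
  rewrite !val_le0 ?(le_trans st)// subrr normr0 mulr_ge0// addr_ge0//.
    by rewrite -mulrA mulr_ge0.
  by rewrite divr_ge0// ltW.
rewrite [`|t - s|]ger0_norm ?subr_ge0//; have [s0|s0] := leP 0 s; first exact: val_time_le.
have := @val_time_le 0 t y l (lexx 0) (ltW t0) l0.
rewrite (_ : gval phi 0 y = gval phi s y); last by rewrite !val_le0 ?(ltW s0).
rewrite subr0 => /le_trans; apply.
rewrite ler_wpM2l// lerD2r; have /(ler_wpM2r c0) : t <= t - s by lra.
by rewrite !mulrA.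
Qed.

                                                                               
                                                           
(** Local uniform convergence suffices because mass escapes slowly: beyond distance r the error 2 M
    is at most 2 M (z - y)^2 / r^2, whose evolution contributes 2 M tau shi^2 / r^2. *)
Lemma iter_locunif (f_ : nat -> R -> R) (k : nat -> nat) (tau y e : R) :
  (forall n, lip L (f_ n)) -> (forall n, bdd M (f_ n)) ->
  (forall n, (k n)%:R * dl n <= tau) -> 0 < e ->
  \forall n \near free_ultrafilter,
    `|iter (k n) (Top n) (f_ n) y -
      iter (k n) (Top n) (fun z => ulim (f_^~ z)) y| <= e.
Proof.
move=> fL fM ktau e0.
have M0 : 0 <= M by apply: le_trans (fM 0%N 0); exact: normr_ge0.
have tau0 : 0 <= tau by apply: le_trans (ktau 0%N); rewrite mulr_ge0// ltW// dl_gt0.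
pose c := 2 * M * tau * shi ^+ 2 + 1.
have c0 : 0 < c by rewrite ltr_wpDl// !mulr_ge0// sqr_ge0.
(* With r >= 1 the contribution c / r^2 is at most c / r, hence at most e / 2. *)
pose r := 2 * c / e + 1.
have r1 : 1 <= r by rewrite /r lerDr divr_ge0 ?mulr_ge0 ?ltW.
have r0 : 0 < r by lra.
have rc : 2 * M / r ^+ 2 * (tau * shi ^+ 2) <= e / 2.
  rewrite mulrAC ler_pdivrMr ?exprn_gt0//.
  apply: (@le_trans _ _ c); first by rewrite /c !mulrA lerDl.
  apply: (@le_trans _ _ (e / 2 * r)).
    rewrite /r mulrDr mulr1 (_ : e / 2 * (2 * c / e) = c); last by field; rewrite gt_eqF.
    by rewrite lerDl ltW// divr_gt0.
  by rewrite ler_wpM2l ?divr_ge0 ?(ltW e0)// expr2 ler_peMl// ltW.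
have ufM z : `|ulim (f_^~ z)| <= M.
  rewrite -[ulim _]subr0 -(ulim_cst 0); apply: ulim_dist_le.
  - by exists M => n; exact: fM.
  - exact: bdd_seq_cst.
  - by move=> d d0; apply: filterE => n; rewrite subr0 (le_trans (fM _ _))// lerDl ltW.
have e20 : 0 < e / 2 by rewrite divr_gt0.
apply: filterS (locunif y r fL fM e20) => n H.
have sT := sublin_iter (k n) (sublin_T slo shi n).
pose q z := quad (e / 2) 0 (2 * M / r ^+ 2) 0 (z - y).
have qE z : `|f_ n z - ulim (f_^~ z)| <= q z.
  rewrite /q /quad mul0r addr0 mul0r addr0.
  have q0 : 0 <= 2 * M / r ^+ 2 by rewrite divr_ge0 ?sqr_ge0 ?mulr_ge0.
  have [zr|zr] := leP `|z - y| r.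
    by rewrite (le_trans (H _ zr))// lerDl mulr_ge0// sqr_ge0.
  apply: (@le_trans _ _ (2 * M)).
    by rewrite (le_trans (ler_normB _ _))//; have := fM n z; have := ufM z; lra.
  rewrite -[leLHS]add0r lerD// ?(ltW e20)//.
  rewrite mulrAC ler_pdivlMr ?exprn_gt0// ler_wpM2l ?mulr_ge0//.
  by rewrite -[leRHS]ger0_norm ?sqr_ge0// normrX lerXn2r ?nnegrE// ltW.
have Tq : iter (k n) (Top n) q y <= e.
  rewrite (sl_shift sT (- y) (quad _ _ _ _)) subrr iterT_quad//.
  rewrite GfunE_ge0 ?divr_ge0 ?sqr_ge0 ?mulr_ge0//.
  rewrite /quad !mulr0 !addr0 expr0n /= !mulr0 !addr0.
  have h : (k n)%:R * dl n * (shi ^+ 2 * (2 * M / r ^+ 2)) <=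
     tau * (shi ^+ 2 * (2 * M / r ^+ 2)).
    by rewrite ler_wpM2r// mulr_ge0 ?sqr_ge0// divr_ge0 ?sqr_ge0 ?mulr_ge0.
  lra.
rewrite (le_trans _ Tq)// ler_norml; apply/andP; split.
  have := sl_superadd sT (fun z => ulim (f_^~ z)) (f_ n) y.
  suff : iter (k n) (Top n) (fun z => ulim (f_^~ z) - f_ n z) y <=
         iter (k n) (Top n) q y by lra.
  by apply: (sl_mono sT) => z; have := qE z; rewrite ler_norml; lra.
apply: (le_trans (sl_superadd sT _ _ _)).
by apply: (sl_mono sT) => z; have := qE z; rewrite ler_norml; lra.
Qed.

(** Dynamic programming up to e: in the scheme, the result of the steps up to time s may be replaced
    by its ultralimit. *)
Lemma val_dpp s t y e : 0 <= s -> s <= t -> 0 < e ->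
  \forall n \near free_ultrafilter,
    `|VN phi n t y - iter (kt n t - kt n s) (Top n) (gval phi s) y| <= e.
Proof.
move=> s0 st e0.
have kb n : (kt n t - kt n s)%:R * dl n <= (t - s) + 1.
  have := ktB n s0 st; rewrite ler_norml => /andP[_].
  have : dl n <= 1 by rewrite exprn_ile1// ?invr_ge0// invf_le1// ler1n.
  lra.
apply: filterS (iter_locunif y (fun n => VN_lip n s) (fun n => VN_bdd n s) kb e0).
by move=> n; rewrite -VND.
Qed.

(** Testing the value function by quartics. This one-sided form of dynamic programming and
    boundedness are all that the viscosity property will use. *)
Lemma val_quad_le s t y A p b C : 0 <= s -> s <= t -> 0 <= C ->
  (forall z, gval phi s z <= quad A p b C (z - y)) ->
  gval phi t y <= A + (t - s) * G (2 * b) + 3 * C * ((t - s) * shi ^+ 2) ^+ 2.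
Proof.
move=> s0 st C0 H.
pose h x := A + x * G (2 * b) + 3 * C * (x * shi ^+ 2) ^+ 2.
have hc : {for t - s, continuous h}.
  rewrite /h; apply: cvgD; first apply: cvgD; first exact: cvg_cst.
    by apply: cvgMl; exact: cvg_id.
  apply: cvgMr; rewrite expr2; under eq_fun do rewrite expr2.
  by apply: cvgM; apply: cvgMl; exact: cvg_id.
apply: ulim_le_err => [|e e0]; first exact: VN_bdd_seq.
have e20 : 0 < e / 2 by rewrite divr_gt0.
have /cvgrPdist_le/(_ _ e20)[d /= d0 hd] := hc.
have d20 : 0 < d / 2 by rewrite divr_gt0.
near=> n.
have /= : `|VN phi n t y - iter (kt n t - kt n s) (Top n) (gval phi s) y| <= e / 2.
  by near: n; exact: val_dpp.
have : `|(kt n t - kt n s)%:R * dl n - (t - s)| <= d / 2.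
  near: n; apply: filterS (near_dl d20) => N; apply: le_trans; exact: ktB.
move=> nd; have /hd : ball (t - s) d ((kt n t - kt n s)%:R * dl n).
  by rewrite /ball /= distrC (le_lt_trans nd)//; lra.
have sT := sublin_iter (kt n t - kt n s) (sublin_T slo shi n).
have := iterT_quad_le slo0 slohi n (kt n t - kt n s) A p b y C0.
have := sl_mono sT y H.
by rewrite /h !ler_norml -/(h (t - s)) /=; lra.
Unshelve. all: by end_near. Qed.

Lemma val_quad_ge s t y A p b C : 0 <= s -> s <= t -> 0 <= C ->
  (forall z, quad A p b (- C) (z - y) <= gval phi s z) ->
  A + (t - s) * G (2 * b) - 3 * C * ((t - s) * shi ^+ 2) ^+ 2 <= gval phi t y.
Proof.
move=> s0 st C0 H.
pose h x := A + x * G (2 * b) - 3 * C * (x * shi ^+ 2) ^+ 2.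
have hc : {for t - s, continuous h}.
  rewrite /h; apply: cvgB; first apply: cvgD; first exact: cvg_cst.
    by apply: cvgMl; exact: cvg_id.
  apply: cvgMr; rewrite expr2; under eq_fun do rewrite expr2.
  by apply: cvgM; apply: cvgMl; exact: cvg_id.
apply: ulim_ge_err => [|e e0]; first exact: VN_bdd_seq.
have e20 : 0 < e / 2 by rewrite divr_gt0.
have /cvgrPdist_le/(_ _ e20)[d /= d0 hd] := hc.
have d20 : 0 < d / 2 by rewrite divr_gt0.
near=> n.
have /= : `|VN phi n t y - iter (kt n t - kt n s) (Top n) (gval phi s) y| <= e / 2.
  by near: n; exact: val_dpp.
have : `|(kt n t - kt n s)%:R * dl n - (t - s)| <= d / 2.
  near: n; apply: filterS (near_dl d20) => N; apply: le_trans; exact: ktB.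
move=> nd; have /hd : ball (t - s) d ((kt n t - kt n s)%:R * dl n).
  by rewrite /ball /= distrC (le_lt_trans nd)//; lra.
have sT := sublin_iter (kt n t - kt n s) (sublin_T slo shi n).
have := iterT_quad_ge slo0 slohi n (kt n t - kt n s) A p b y C0.
have := sl_mono sT y H.
by rewrite /h !ler_norml -/(h (t - s)) /=; lra.
Unshelve. all: by end_near. Qed.

Section mollify.
Variables (e : R) (e0 : 0 < e).

(** Averaging twice yields two derivatives of a merely continuous function; [dd] is the second
    one. *)
Definition avg2 f := avg e (avg e f).
Definition dd f y : R := e^-1 * (e^-1 * (f (y + e + e) - f (y + e)) - e^-1 * (f (y + e) - f y)).

Lemma avg2_deriv f y : continuous f ->
  has_deriv (avg2 f) y (e^-1 * (avg e f (y + e) - avg e f y)).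
Proof. by move=> cf; apply: avg_derive; exact: avg_continuous. Qed.

Lemma avg2_deriv2 f y : continuous f ->
  has_deriv (fun y => e^-1 * (avg e f (y + e) - avg e f y)) y (dd f y).
Proof.
move=> cf; apply: dmulc; apply: dadd; last by apply: dopp; exact: avg_derive.
by apply: deriv_shift; exact: avg_derive.
Qed.

Lemma dd_lip f K : lip K f -> lip (4 * K / e ^+ 2) (dd f).
Proof.
move=> fK x y; rewrite /dd.
have -> : 4 * K / e ^+ 2 * `|x - y| = e^-1 * (e^-1 * (4 * (K * `|x - y|))).
  by field; rewrite gt_eqF.
have ddE a b c a' b' c' : e^-1 * (a - b) - e^-1 * (b - c) -
  (e^-1 * (a' - b') - e^-1 * (b' - c')) =
  e^-1 * ((a - a') - 2 * (b - b') + (c - c')) :> R by ring.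
rewrite -mulrBr normrM gtr0_norm ?invr_gt0//.
rewrite ler_pM2l ?invr_gt0// ddE normrM gtr0_norm ?invr_gt0//.
rewrite ler_pM2l ?invr_gt0//.
have h a : `|f (x + a) - f (y + a)| <= K * `|x - y|.
  rewrite (le_trans (fK _ _))// (_ : x + a - (y + a) = x - y)//; ring.
have := h (e + e); have := h e; have := fK x y; rewrite !addrA !ler_norml; lra.
Qed.

Lemma avg2_le f g y : continuous f -> continuous g -> (forall z, f z <= g z) ->
  avg2 f y <= avg2 g y.
Proof.
move=> cf cg fg; apply: avg_le => //; [exact: avg_continuous..|move=> z _].
exact: avg_le.
Qed.

Lemma avg2_Q h f y : continuous f -> avg2 (Qop h f) y = Qop h (avg2 f) y.
Proof.
have Q1 g : continuous g -> avg e (Qop h g) = Qop h (avg e g).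
  move=> cg; apply/funext => z; rewrite /Qop.
  have cs a : continuous (fun x => g (x + a)).
    move=> x; apply: continuous_comp; last exact: cg.
    by apply: cvgD; [exact: cvg_id|exact: cvg_cst].
  rewrite avgZ ?avgD ?avg_shift//; last first.
    by move=> x; apply: cvgD; exact: cs.
move=> cf; rewrite /avg2 Q1// Q1//; exact: avg_continuous.
Qed.

Lemma avg2_iterK s N k f y : lip L f ->
  avg2 (iter k (Kop s N) f) y = iter k (Kop s N) (avg2 f) y.
Proof.
rewrite /Kop -!iterM => fL; move: (k * nstep N)%N => n.
elim: n y => [//|n IH] y /=.
rewrite avg2_Q.
  by congr (Qop _ _ y); apply/funext => z; exact: IH.
apply: (@lip_continuous _ L); apply: sl_lip => //.
by apply: lin_sub; apply: lin_iter; exact: lin_Q.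
Qed.

Lemma avg2_ulim (f_ : nat -> R -> R) y : (forall n, lip L (f_ n)) ->
  (forall n, bdd M (f_ n)) -> lip L (fun z => ulim (f_^~ z)) ->
  avg2 (f_ n) y @[n --> free_ultrafilter] --> avg2 (fun z => ulim (f_^~ z)) y.
Proof.
move=> fL fM uL; apply/cvgrPdist_le => d d0.
have cf n := lip_continuous (fL n); have cu := lip_continuous uL.
apply: filterS (locunif y (2 * e) fL fM d0) => n H.
apply: avg_dist2 => //; [exact: avg_continuous..|move=> z /andP[zy ze]].
apply: avg_dist2 => // x /andP[xz xe].
by rewrite distrC H// ler_norml; apply/andP; split; lra.
Qed.

(** A walk with one extreme volatility lies below [Top], commutes with the averages by translation
    invariance, and acts explicitly on a Taylor polynomial. The cubic Taylor remainder is split by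
    [young], with parameter l, into even powers. *)
Lemma val_mollify (s t y sg l : R) : 0 <= s -> s <= t -> sg = slo \/ sg = shi -> 0 < l ->
  (t - s) * sg ^+ 2 / 2 * dd (gval phi s) y -
  4 * L / e ^+ 2 * ((t - s) * sg ^+ 2 * l / 2 + 3 / (2 * l) * ((t - s) * sg ^+ 2) ^+ 2)
  <= avg2 (gval phi t) y - avg2 (gval phi s) y.
Proof.
move=> s0 st sgE l0; set H := 4 * L / e ^+ 2.
have H0 : 0 <= H by rewrite divr_ge0 ?sqr_ge0 ?mulr_ge0.
pose k n := (kt n t - kt n s)%N.
have lower n : (k n)%:R * dl n * sg ^+ 2 / 2 * dd (VN phi n s) y -
   H * ((k n)%:R * dl n * sg ^+ 2 * l / 2 + 3 / (2 * l) * ((k n)%:R * dl n * sg ^+ 2) ^+ 2)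
   <= avg2 (VN phi n t) y - avg2 (VN phi n s) y.
  set f := VN phi n s; have fL : lip L f by exact: VN_lip.
  have cf := lip_continuous fL.
  have sK := lin_sub (lin_iter (k n) (lin_K sg n)).
  apply: (@le_trans _ _ (iter (k n) (Kop sg n) (avg2 f) y - avg2 f y)); last first.
    have -> : VN phi n t = iter (k n) (Top n) f.
      by apply/funext => z; rewrite (VND _ _ _ _ _ st).
    rewrite lerD2r -avg2_iterK//; apply: avg2_le.
    - by apply: (@lip_continuous _ L); exact: sl_lip.
    - apply: (@lip_continuous _ L); apply: sl_lip => //.
      by apply: sublin_iter; exact: sublin_T.
    - by move=> z; exact: iterK_le_iterT.
  pose d1 z := e^-1 * (avg e f (z + e) - avg e f z).
  have TE z : quad (avg2 f y) (d1 y) (2^-1 * dd f y - H * l / 2)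
      (- (H / (2 * l))) (z - y) <= avg2 f z.
    have := taylor2 y z (fun z => avg2_deriv z cf) (fun z => avg2_deriv2 z cf) (dd_lip fL).
    rewrite -/H -/(d1 y) ler_norml => /andP[+ _].
    have : `|z - y| ^+ 3 <= (z - y) ^+ 2 * l / 2 + (z - y) ^+ 4 / (2 * l).
      have -> : `|z - y| ^+ 3 = `|z - y| * (z - y) ^+ 2.
        by rewrite exprS -normrX [`|(z - y) ^+ 2|]ger0_norm ?sqr_ge0.
      have := ler_wpM2r (sqr_ge0 (z - y)) (young (z - y) l0).
      move=> /le_trans; apply; rewrite [leLHS](_ : _ = (z - y) ^+ 2 * l / 2 + (z - y) ^+ 4 / (2 * l))//.
      by field; rewrite gt_eqF.
    move=> /(ler_wpM2l H0); rewrite /quad.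
    have -> : H * ((z - y) ^+ 2 * l / 2 + (z - y) ^+ 4 / (2 * l)) =
      H * l / 2 * (z - y) ^+ 2 + H / (2 * l) * (z - y) ^+ 4 by field; rewrite gt_eqF.
    lra.
  have C0 : 0 <= H / (2 * l) by rewrite divr_ge0// mulr_ge0// ltW.
  have := sl_mono sK y TE.
  have := iterK_quad_ge sg n (k n) (avg2 f y) (d1 y) (2^-1 * dd f y - H * l / 2) y C0.
  have -> : 3 * (H / (2 * l)) * ((k n)%:R * dl n * sg ^+ 2) ^+ 2 =
    H * (3 / (2 * l) * ((k n)%:R * dl n * sg ^+ 2) ^+ 2) by ring.
  lra.
have kcvg : (k n)%:R * dl n @[n --> free_ultrafilter] --> t - s.
  apply/cvgrPdist_le => d d0; apply: filterS (near_dl d0) => N; apply: le_trans.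
  by rewrite distrC; exact: ktB.
have vcvg x : VN phi n s x @[n --> free_ultrafilter] --> gval phi s x.
  by apply: ulim_cvg; exact: VN_bdd_seq.
have acvg x : avg2 (VN phi n x) y @[n --> free_ultrafilter] --> avg2 (gval phi x) y.
  apply: avg2_ulim; [by move=> n; exact: VN_lip|by move=> n; exact: VN_bdd|].
  exact: val_lip.
have ddcvg : dd (VN phi n s) y @[n --> free_ultrafilter] --> dd (gval phi s) y.
  by apply: cvgMr; apply: cvgB; apply: cvgMr; apply: cvgB.
have kc2 : (k n)%:R * dl n * sg ^+ 2 @[n --> free_ultrafilter] --> (t - s) * sg ^+ 2.
  exact: cvgMl.
apply: (ler_cvg_to _ (cvgB (acvg t) (acvg s)) (nearW _ lower)).
apply: cvgB; first by apply: cvgM => //; apply: cvgMl.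
apply: cvgMr; apply: cvgD; first by apply: cvgMl; apply: cvgMl.
by apply: cvgMr; under eq_fun do rewrite expr2; rewrite expr2; exact: cvgM.
Qed.

End mollify.
End fixed_datum.
End value_function.

(** * Continuity in time and space, and smooth test functions *)

Section continuity.
Context {R : realType}.
Implicit Types (f : R -> R) (u g : R -> R -> R).

Definition c2 g := continuous (fun q : R * R => g q.1 q.2).

Lemma c2_t f : continuous f -> c2 (fun t y => f t).
Proof.
move=> cf [t y]; apply: (@continuous_comp _ _ _ fst f); last exact: cf.
exact: cvg_fst.
Qed.

Lemma c2_y f : continuous f -> c2 (fun t y => f y).
Proof.
move=> cf [t y]; apply: (@continuous_comp _ _ _ snd f); last exact: cf.
exact: cvg_snd.
Qed.

Lemma c2_cst c : c2 (fun _ _ => c).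
Proof. by move=> q; exact: cvg_cst. Qed.

Lemma c2D g u : c2 g -> c2 u -> c2 (fun t y => g t y + u t y).
Proof. by move=> cg cu q; apply: cvgD; [exact: cg|exact: cu]. Qed.

Lemma c2M g u : c2 g -> c2 u -> c2 (fun t y => g t y * u t y).
Proof. by move=> cg cu q; apply: cvgM; [exact: cg|exact: cu]. Qed.

Lemma c2N g : c2 g -> c2 (fun t y => - g t y).
Proof. by move=> cg q; apply: cvgN; exact: cg. Qed.

Lemma near_box (t y : R) (P : R * R -> Prop) :
  (\forall q \near ((t, y) : R * R), P q) -> exists2 r : R, 0 < r &
  forall s z, `|s - t| < r -> `|z - y| < r -> P (s, z).
Proof.
move=> [[A B] /= [nA nB] AB].
have /nbhs_ballP[a /= a0 aA] := nA; have /nbhs_ballP[b /= b0 bB] := nB.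
exists (Num.min a b); first by rewrite lt_min a0.
move=> s z st zy; apply: (AB (s, z)); split => /=.
  by apply: aA; rewrite /ball /= distrC (lt_le_trans st)// ge_min lexx.
by apply: bB; rewrite /ball /= distrC (lt_le_trans zy)// ge_min lexx orbT.
Qed.

Lemma near_oo (a b x : R) : a < x < b -> nbhs x [set z | a < z < b].
Proof.
move=> /andP[ax xb]; exists (Num.min (x - a) (b - x)).
  by rewrite /= lt_min !subr_gt0 ax.
by move=> z; rewrite /ball /= lt_min !ltr_norml => /andP[/andP[? ?] /andP[? ?]]; lra.
Qed.

Lemma c2_eps g (t y e : R) : {for (t, y), continuous (fun q : R * R => g q.1 q.2)} ->
  0 < e -> exists2 r : R, 0 < r &
  forall s z, `|s - t| < r -> `|z - y| < r -> `|g s z - g t y| < e.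
Proof.
move=> /cvgrPdist_lt cg e0; have [r r0 H] := near_box (cg _ e0).
by exists r => // s z st zy; rewrite distrC; exact: H.
Qed.

Lemma has_deriv_eps f x a e : has_deriv f x a -> 0 < e -> exists2 d, 0 < d &
  forall h, `|h| < d -> `|f (x + h) - f x - a * h| <= e * `|h|.
Proof.
move=> /is_derive1_caratheodory[g [gE cg ga]] e0.
have /cvgrPdist_lt/(_ _ e0)/nbhs_ballP[d /= d0 dP] := cg.
exists d => // h hd; rewrite gE addrAC subrr add0r -mulrBl normrM ler_wpM2r//.
rewrite -ga distrC ltW//; apply: dP.
by rewrite /ball /= opprD addrA subrr sub0r normrN.
Qed.

Lemma has_derivE f x a : has_deriv f x a -> derive1 f x = a.
Proof. by case=> _ <-; rewrite derive1E. Qed.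

Lemma derivable_has_deriv f x : derivable f x 1 -> has_deriv f x (derive1 f x).
Proof. by move=> fx; apply: DeriveDef; [exact: fx|rewrite derive1E]. Qed.

Record smooth (V Vt Vy Vyy : R -> R -> R) : Prop := Smooth {
  sm_t : forall t y, has_deriv (V^~ y) t (Vt t y) ;
  sm_y : forall t y, has_deriv (V t) y (Vy t y) ;
  sm_yy : forall t y, has_deriv (Vy t) y (Vyy t y) ;
  sm_c : c2 V ;
  sm_ct : c2 Vt ; sm_cy : c2 Vy ; sm_cyy : c2 Vyy }.

Lemma smooth_C12 V Vt Vy Vyy : smooth V Vt Vy Vyy ->
  [/\ C12 V, forall t y, dt V t y = Vt t y & forall t y, dyy V t y = Vyy t y].
Proof.
move=> sV.
have Et t y : dt V t y = Vt t y by apply: has_derivE; exact: sm_t sV _ _.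
have Ey t : dy V t = Vy t by apply/funext => y; apply: has_derivE; exact: sm_y sV _ _.
have Eyy t y : dyy V t y = Vyy t y by rewrite /dyy Ey; apply: has_derivE; exact: sm_yy sV _ _.
split => // t y t0; split; split.
- by have [] := sm_t sV t y.
- by have [] := sm_y sV t y.
- by rewrite Ey; have [] := sm_yy sV t y.
- rewrite (_ : (fun q => _) = fun q => Vt q.1 q.2); first exact: sm_ct sV _.
  by apply/funext => q; rewrite Et.
- rewrite (_ : (fun q => _) = fun q => Vy q.1 q.2); first exact: sm_cy sV _.
  by apply/funext => q; rewrite Ey.
- rewrite (_ : (fun q => _) = fun q => Vyy q.1 q.2); first exact: sm_cyy sV _.
  by apply/funext => q; rewrite Eyy.
Qed.

Lemma C12N (psi : R -> R -> R) : C12 psi -> C12 (fun t y => - psi t y) /\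
  forall t y, 0 < t -> dt (fun t y => - psi t y) t y = - dt psi t y /\
    dyy (fun t y => - psi t y) t y = - dyy psi t y.
Proof.
move=> H.
have Ht t y : 0 < t -> has_deriv (psi^~ y) t (dt psi t y).
  by move=> t0; have [[h _ _] _] := H t y t0; exact: derivable_has_deriv.
have Hy t y : 0 < t -> has_deriv (psi t) y (dy psi t y).
  by move=> t0; have [[_ h _] _] := H t y t0; exact: derivable_has_deriv.
have Hyy t y : 0 < t -> has_deriv (dy psi t) y (dyy psi t y).
  by move=> t0; have [[_ _ h] _] := H t y t0; exact: derivable_has_deriv.
have Et t y : 0 < t -> dt (fun t y => - psi t y) t y = - dt psi t y.
  by move=> t0; apply: has_derivE; apply: dopp; exact: Ht.
have Ey t : 0 < t -> dy (fun t y => - psi t y) t = fun y => - dy psi t y.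
  by move=> t0; apply/funext => y; apply: has_derivE; apply: dopp; exact: Hy.
have Eyy t y : 0 < t -> dyy (fun t y => - psi t y) t y = - dyy psi t y.
  by move=> t0; rewrite /dyy Ey//; apply: has_derivE; apply: dopp; exact: Hyy.
split => [t y t0|t y t0]; last by split; [exact: Et|exact: Eyy].
have [_ [ct cy cyy]] := H t y t0.
have nt : \forall q \near ((t, y) : R * R), 0 < q.1.
  exists ([set s : R | 0 < s], setT) => /=; last by move=> q [].
  split; last exact: filterT.
  by exists t => //= s; rewrite /ball /= ltr_norml; lra.
have nearc (g g' : R * R -> R) : (forall q, 0 < q.1 -> g' q = - g q) ->
  {for (t, y), continuous g} -> {for (t, y), continuous g'}.
  move=> gg' cg; rewrite /prop_for /continuous_at gg'//.
  apply: cvg_trans (cvgN cg); apply: near_eq_cvg.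
  by apply: filterS nt => q q0; rewrite gg'.
split; split.
- by have [h _] := dopp (Ht t y t0); exact: h.
- by have [h _] := dopp (Hy t y t0); exact: h.
- by have [h _] := dopp (Hyy t y t0); rewrite Ey//; exact: h.
- by apply: nearc ct => q q0; exact: Et.
- by apply: nearc cy => q q0; rewrite Ey.
- by apply: nearc cyy => q q0; exact: Eyy.
Qed.

End continuity.

(** * Viscosity subsolutions against smooth supersolutions *)

Section maximum_principle.
Context {R : realType}.
Variables (H : R -> R) (K : R).
Hypotheses (K0 : 0 <= K) (HK : forall a h, 0 <= h -> H (a + h) <= H a + K * h).

Definition visc_sub (u : R -> R -> R) : Prop :=
  forall (psi : R -> R -> R) (t y : R), C12 psi -> 0 < t ->
  (\forall q \near ((t, y) : R * R),
     u q.1 q.2 - psi q.1 q.2 <= u t y - psi t y) ->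
  dt psi t y <= H (dyy psi t y).

Definition halfplane : set (R * R) := [set q | 0 <= q.1].

(** If u exceeded W at (t1, y1), perturb W to psi by a parabola in y, a linear term and a high power
    in time. The parabola keeps the maximum of u - psi away from the lateral boundary, the power
    keeps it away from T, and the initial comparison away from t0. At this interior maximum the
    linear term makes psi a strict supersolution, against the subsolution property. An abstract H
    with a one-sided Lipschitz bound serves for G and for its reflection alike. *)
Lemma maximum_principle (u W Wt Wy Wyy : R -> R -> R) (t0 T M MW : R) :
  visc_sub u -> {within halfplane, continuous (fun q : R * R => u q.1 q.2)} ->
  (forall t y, 0 <= t -> u t y <= M) ->
  smooth W Wt Wy Wyy -> 0 <= t0 -> t0 < T ->
  (forall t y, t0 <= t <= T -> - MW <= W t y) ->
  (forall t y, t0 < t < T -> H (Wyy t y) <= Wt t y) ->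
  (forall y, u t0 y <= W t0 y) ->
  forall t y, t0 <= t < T -> u t y <= W t y.
Proof.
move=> uH cu uM sW t00 t0T WMW WH u0 t1 y1 /andP[t01 t1T].
rewrite leNgt; apply/negP => Wu.
(* A third of the gap: at (t1, y1) the parabola with the linear term costs e, the power [kappa]
   another e, and e is left. *)
pose e := (u t1 y1 - W t1 y1) / 3.
have e0 : 0 < e by rewrite divr_gt0// subr_gt0.
have t01' : t0 < t1.
  rewrite lt_neqAle t01 andbT; apply/eqP => E.
  by move: Wu; rewrite -E ltNge u0.
pose D := t1 - t0; have D0 : 0 < D by rewrite subr_gt0.
pose c := y1 ^+ 2 + (2 * K + 1) * D.
have c0 : 0 < c.
  by rewrite ltr_wpDl ?sqr_ge0// mulr_gt0// ltr_wpDl// mulr_ge0.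
pose eta := e / c; have eta0 : 0 < eta by rewrite divr_gt0.
have etac : eta * c = e by rewrite /eta; field; rewrite gt_eqF.
pose rho := (T - t0) / D.
have rho1 : 1 < rho by rewrite ltr_pdivlMr// mul1r /D ltrD2r.
have rho0 : 0 < rho by exact: lt_trans rho1.
pose Q := `|M| + `|MW| + 1.
have Q0 : 0 < Q by rewrite ltr_wpDl// addr_ge0.
have MQ : M + MW <= Q by have := ler_norm M; have := ler_norm MW; rewrite /Q; lra.
(* [kappa] equals e at t1 and e rho^p at T, so a large exponent p lifts it above the bound Q at the
   end of the strip. *)
have [p rp] : exists p, Q <= e * rho ^+ p.
  have : rho^-1 ^+ p @[p --> \oo] --> 0.
    by apply: cvg_expr; rewrite ger0_norm ?invr_ge0 ?(ltW rho0)// invf_lt1.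
  have eQ : 0 < e / Q by rewrite divr_gt0.
  move=> /cvgrPdist_le/(_ _ eQ)[p _ /(_ p (leqnn p))].
  rewrite sub0r normrN ger0_norm ?exprn_ge0 ?invr_ge0 ?(ltW rho0)// exprVn.
  rewrite ler_pdivlMr// mulrC ler_pdivrMr ?exprn_gt0// => h; by exists p.
pose kappa t := e * (D^-1 * (t + - t0)) ^+ p.
pose kappa' t := e * (p%:R * (D^-1 * (t + - t0)) ^+ p.-1 * (D^-1 * (1 + 0))).
have kd t : has_deriv kappa t (kappa' t).
  by rewrite /kappa /kappa'; dsolve.
have kappa'0 t : t0 <= t -> 0 <= kappa' t.
  move=> tt; have Dt : 0 <= D^-1 * (t + - t0) by rewrite mulr_ge0 ?invr_ge0 ?(ltW D0)// subr_ge0.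
  rewrite /kappa' addr0 mulr1 mulr_ge0 ?(ltW e0)// mulr_ge0 ?invr_ge0 ?(ltW D0)//.
  by rewrite mulr_ge0// exprn_ge0.
pose psi t y := W t y + (eta * y ^+ 2 + (eta * (2 * K + 1) * (t + - t0) + kappa t)).
pose psit t y := Wt t y + (0 + (eta * (2 * K + 1) * (1 + 0) + kappa' t)).
pose psiy t y := Wy t y + 2 * eta * y.
pose psiyy t y := Wyy t y + 2 * eta.
have spsi : smooth psi psit psiy psiyy.
  have ck : continuous kappa by move=> t; exact: is_derive_cont (kd t).
  have clin : continuous (fun t : R => eta * (2 * K + 1) * (t + - t0)).
    by move=> t; apply: cvgMr; apply: cvgD; [exact: cvg_id|exact: cvg_cst].
  have csq : continuous (fun y : R => eta * y ^+ 2).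
    by move=> y; apply: cvgMr; exact: exprn_continuous.
  split.
  - move=> t y; apply: dadd; first exact: sm_t sW _ _.
    apply: dadd; first exact: dcst.
    apply: dadd; last exact: kd.
    by apply: deq; [dtac|].
  - move=> t y; apply: dadd; first exact: sm_y sW _ _.
    apply: (deq (a := eta * (2%:R * y ^+ 1 * 1) + 0)); last by rewrite expr1; ring.
    by apply: dadd; [dtac|exact: dcst].
  - move=> t y; apply: dadd; first exact: sm_yy sW _ _.
    apply: (deq (a := 2 * eta * 1)); last exact: mulr1.
    by apply: dmulc; exact: did.
  - apply: c2D; first exact: sm_c sW.
    apply: c2D; first exact: c2_y csq.
    by apply: c2D; [exact: c2_t clin|exact: c2_t ck].
  - apply: c2D; first exact: sm_ct sW.
    apply: c2D; first exact: c2_cst.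
    apply: c2D; first exact: c2_cst.
    apply: c2_t; rewrite (_ : kappa' = fun t => (e * (p%:R * D^-1)) * (D^-1 * (t + - t0)) ^+ p.-1); last first.
      by apply/funext => t; rewrite /kappa'; ring.
    have kd' t : exists d, has_deriv (fun t => (e * (p%:R * D^-1)) * (D^-1 * (t + - t0)) ^+ p.-1) t d.
      by eexists; dtac.
    by move=> t; have [d hd] := kd' t; exact: is_derive_cont hd.
  - apply: c2D; first exact: sm_cy sW.
    by apply: c2_y => y; apply: cvgMr; exact: cvg_id.
  - apply: c2D; first exact: sm_cyy sW.
    exact: c2_cst.
(* The first entry puts y1 inside the box; the second makes the parabola at least Q on its sides. *)
pose r := Num.max (`|y1| + 1) (Q / eta + 1).
have r1 : `|y1| < r by rewrite lt_max ltrDl ltr01.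
have r2 : Q / eta + 1 <= r by rewrite le_max lexx orbT.
have rr1 : 1 <= r by rewrite (le_trans _ r2)// lerDr divr_ge0// ltW.
have etar : Q <= eta * r ^+ 2.
  apply: (@le_trans _ _ (eta * r)).
    by rewrite -ler_pdivrMl// mulrC; lra.
  by rewrite ler_wpM2l ?(ltW eta0)// expr2 ler_peMr//; lra.
pose A := `[t0, T]%classic `*` `[- r, r]%classic.
have cA : compact A by apply: compact_setX; exact: segment_compact.
have Ay1 : A (t1, y1).
  split => /=; rewrite in_itv /=; first by rewrite t01 ltW.
  by rewrite -ler_norml ltW.
have cf : {within A, continuous (fun q : R * R => u q.1 q.2 - psi q.1 q.2)}.
  have cpsi : {within A, continuous (fun q : R * R => psi q.1 q.2)}.
    by apply: continuous_subspaceT; exact: sm_c spsi.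
  have cuA : {within A, continuous (fun q : R * R => u q.1 q.2)}.
    apply: continuous_subspaceW cu => -[t y] [/=].
    by rewrite in_itv /= => /andP[h _] _; exact: le_trans h.
  by move=> q; apply: cvgB; [exact: cuA|exact: cpsi].
have [[ts ys] /[!inE] -[/= ts_ ys_] gmax] := compact_EVT_max (ex_intro _ _ Ay1) cA cf.
move: ts_ ys_; rewrite !in_itv /= => /andP[ts0 tsT] ysr.
have kappa0 t : t0 <= t -> 0 <= kappa t.
  move=> tt; rewrite /kappa mulr_ge0 ?(ltW e0)// exprn_ge0// mulr_ge0 ?invr_ge0 ?(ltW D0)//.
  by rewrite subr_ge0.
have g1 : e <= u t1 y1 - psi t1 y1.
  rewrite /psi /kappa -/D mulVf ?gt_eqF// expr1n mulr1.
  have -> : u t1 y1 - (W t1 y1 + (eta * y1 ^+ 2 + (eta * (2 * K + 1) * D + e))) =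
     (u t1 y1 - W t1 y1) - eta * c - e by rewrite /c; ring.
  by rewrite etac /e; lra.
have gs : e <= u ts ys - psi ts ys.
  by rewrite (le_trans g1)//; have := gmax (t1, y1); rewrite inE => /(_ Ay1).
have Keta : 0 <= eta * (2 * K + 1) by rewrite mulr_ge0 ?(ltW eta0)//; have := K0; lra.
have lin0 : 0 <= eta * (2 * K + 1) * (ts + - t0) by rewrite mulr_ge0// subr_ge0.
have sq0 : 0 <= eta * ys ^+ 2 by rewrite mulr_ge0 ?sqr_ge0// ltW.
have ts0' : t0 < ts.
  rewrite lt_neqAle ts0 andbT; apply/eqP => E.
  have := kappa0 _ ts0; move: gs lin0; rewrite /psi -E; have := u0 ys; have := e0.
  lra.
have WMs : u ts ys - W ts ys <= Q.
  apply: le_trans MQ; have := uM ts ys (le_trans t00 ts0).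
  by have := WMW ts ys; rewrite ts0 tsT => /(_ isT); lra.
have tsT' : ts < T.
  rewrite lt_neqAle tsT andbT; apply/eqP => E.
  have : Q <= kappa ts by rewrite /kappa E (_ : D^-1 * (T + - t0) = rho)//; exact: mulrC.
  by move: gs e0; rewrite /psi; lra.
have ysr' : `|ys| < r.
  rewrite lt_neqAle ler_norml ysr andbT; apply/eqP => E.
  have : Q <= eta * ys ^+ 2.
    by rewrite -[ys ^+ 2]ger0_norm ?sqr_ge0// normrX E.
  by have := kappa0 _ ts0; move: gs e0 lin0; rewrite /psi; lra.
have [C12psi psitE psiyyE] := smooth_C12 spsi.
have nm : \forall q \near ((ts, ys) : R * R),
    u q.1 q.2 - psi q.1 q.2 <= u ts ys - psi ts ys.
  exists ([set s : R | t0 < s < T], [set z : R | - r < z < r]) => /=.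
    by split; apply: near_oo; rewrite ?ts0' ?tsT'// -ltr_norml.
  move=> [s z] /= [/andP[s1 s2] /andP[z1 z2]].
  by have := gmax (s, z); rewrite inE; apply; split; rewrite /= in_itv /=; apply/andP; split; exact: ltW.
have := uH _ _ _ C12psi (le_lt_trans t00 ts0') nm.
rewrite psitE psiyyE /psit /psiyy addr0 add0r mulr1.
have tseta : 0 <= 2 * eta by rewrite mulr_ge0// ltW.
have := WH ts ys; rewrite ts0' tsT' => /(_ isT).
have := HK (Wyy ts ys) tseta.
have := kappa'0 _ ts0; rewrite mulrDr mulr1.
have : K * (2 * eta) = eta * (2 * K) by ring.
by move: eta0; lra.
Qed.

End maximum_principle.

(** * From dynamic programming to the viscosity property *)

Section existence.
Context {R : realType}.

(** The three terms of C absorb, for arguments of size at least r, the constant, the linear and the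
    quadratic terms. C depends only on the bounds of A and p, so it can be fixed before the time
    step. *)
Lemma local_quad_bound (P b r M : R) : 0 < r -> exists2 C, 0 <= C &
  forall A p x, - M <= A -> `|p| <= P -> r <= `|x| -> M <= quad A p b C x.
Proof.
move=> r0; exists (2 * `|M| / r ^+ 4 + `|P| / r ^+ 3 + `|b| / r ^+ 2).
  by rewrite !addr_ge0// divr_ge0 ?exprn_ge0 ?(ltW r0)// mulr_ge0.
move=> A p x MA pP rx; rewrite /quad !mulrDl.
have x0 : 0 < `|x| by exact: lt_le_trans rx.
have x4 : x ^+ 4 = `|x| ^+ 4 by rewrite -normrX ger0_norm// exprn_even_ge0.
have x2 : x ^+ 2 = `|x| ^+ 2 by rewrite -normrX ger0_norm// exprn_even_ge0.
have q : 1 <= `|x| / r by rewrite ler_pdivlMr// mul1r.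
have h4 : 2 * `|M| <= 2 * `|M| / r ^+ 4 * x ^+ 4.
  rewrite x4 -mulrA -exprVn -exprMn [r^-1 * _]mulrC ler_peMr ?mulr_ge0//.
  exact: exprn_ege1.
have h3 : `|P| * `|x| <= `|P| / r ^+ 3 * x ^+ 4.
  rewrite x4 (_ : `|P| / r ^+ 3 * `|x| ^+ 4 = `|P| * `|x| * (`|x| / r) ^+ 3).
    by rewrite ler_peMr ?mulr_ge0// exprn_ege1.
  by field; rewrite gt_eqF.
have h2 : `|b| * x ^+ 2 <= `|b| / r ^+ 2 * x ^+ 4.
  rewrite x4 x2 (exprD _ 2 2) -mulrA ler_wpM2l// mulrA -exprVn -exprMn [r^-1 * _]mulrC.
  by rewrite ler_peMl ?exprn_ge0// exprn_ege1.
have : - (`|P| * `|x|) <= p * x.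
  rewrite lerNl (le_trans (ler_norm _))// normrN normrM ler_wpM2r//.
  by rewrite (le_trans pP)// ler_norm.
have : - (`|b| * x ^+ 2) <= b * x ^+ 2.
  by rewrite -mulNr ler_wpM2r ?sqr_ge0// lerNl -normrN ler_norm.
have := ler_norm M; lra.
Qed.

Variables (H : R -> R) (K M c : R) (v : R -> R -> R).
Hypotheses (K0 : 0 <= K) (HK : forall a h, 0 <= h -> H (a + h) <= H a + K * h).
Hypothesis (vM : forall t, bdd M (v t)).
Hypothesis (v_quad : forall s t y A p b C, 0 <= s -> s <= t -> 0 <= C ->
  (forall z, v s z <= quad A p b C (z - y)) ->
  v t y <= A + (t - s) * H (2 * b) + 3 * C * ((t - s) * c) ^+ 2).

                                                                              
                                                     
(** Suppose the inequality fails at (t, y) by g. At the earlier time s = t - tau, v lies below a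
    quartic: near y by Taylor expansion of the test function, far from y because the quartic exceeds
    M. Propagating the quartic by [v_quad] bounds v t y with an error of order tau^2, and for small
    tau this contradicts the time derivative of the test function. *)
Lemma dpp_visc_sub : visc_sub H v.
Proof.
move=> psi t y Cpsi t0 nmax.
have Hty : forall s z, 0 < s -> [/\ has_deriv (psi^~ z) s (dt psi s z),
   has_deriv (psi s) z (dy psi s z) & has_deriv (dy psi s) z (dyy psi s z)].
  move=> s z s0; have [[h1 h2 h3] _] := Cpsi s z s0.
  by split; apply: derivable_has_deriv; [exact: h1|exact: h2|exact: h3].
have [_ [_ cy cyy]] := Cpsi t y t0.
rewrite leNgt; apply/negP => Hlt.
pose a := dyy psi t y.
pose g := dt psi t y - H a; have g0 : 0 < g by rewrite subr_gt0.
pose h := g / (4 * (K + 1)).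
have K1 : 0 < K + 1 by rewrite ltr_wpDl.
have h0 : 0 < h by rewrite divr_gt0// mulr_gt0.
have Kh : K * h <= g / 4.
  have -> : K * h = g / 4 * (K / (K + 1)) by rewrite /h; field; rewrite gt_eqF.
  by rewrite ler_piMr ?divr_ge0 ?(ltW g0)// ler_pdivrMr// mul1r lerDl.
have [r1 r10 dyyP] := c2_eps cyy h0.
have [r2 r20 dyP] := c2_eps cy ltr01.
have [r3 r30 maxP] := near_box nmax.
pose r := Num.min (Num.min r1 r2) (Num.min r3 t).
have r0 : 0 < r by rewrite !lt_min r10 r20 r30.
have [rr1 rr2 rr3 rrt] : [/\ r <= r1, r <= r2, r <= r3 & r <= t].
  by rewrite /r; split; rewrite !ge_min lexx ?orbT.
have [C C0 CP] := local_quad_bound (`|dy psi t y| + 1) (2^-1 * (a + h)) M r0.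
have [ht _ _] := Hty _ y t0.
have g40 : 0 < g / 4 by rewrite divr_gt0.
have [d d0 dP] := has_deriv_eps ht g40.
pose B := 3 * C * c ^+ 2 + 1.
have B0 : 0 < B by rewrite ltr_wpDl// mulr_ge0 ?sqr_ge0// mulr_ge0.
pose tau := Num.min (Num.min (r / 2) (d / 2)) (g / 4 / B).
have tau0 : 0 < tau by rewrite !lt_min !divr_gt0.
have [t1 t2 t3] : [/\ tau < r, tau < d & tau * B <= g / 4].
  split; [rewrite !gt_min; apply/orP; left..|].
  - by apply/orP; left; rewrite ltr_pdivrMr//; lra.
  - by apply/orP; right; rewrite ltr_pdivrMr//; lra.
  - by rewrite -ler_pdivlMr// ge_min lexx orbT.
pose s := t - tau.
have s0 : 0 < s by rewrite subr_gt0 (lt_le_trans t1).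
have st : `|s - t| < r by rewrite /s addrAC subrr sub0r normrN gtr0_norm.
pose A := v t y - psi t y + psi s y.
have vA z : `|z - y| < r -> v s z <= v t y - psi t y + psi s z.
  by move=> zy; have := maxP s z (lt_le_trans st rr3) (lt_le_trans zy rr3) => /=; lra.
have MA : - M <= A.
  apply: (@le_trans _ _ (v s y)); first by have := vM s y; rewrite ler_norml => /andP[].
  by apply: vA; rewrite subrr normr0.
have pP : `|dy psi s y| <= `|dy psi t y| + 1.
  have /ltW h1 : `|dy psi s y - dy psi t y| < 1.
    by apply: dyP; [exact: lt_le_trans st rr2|rewrite subrr normr0].
  by rewrite -lerBlDl (le_trans _ h1)// lerB_dist.
have quadP z : v s z <= quad A (dy psi s y) (2^-1 * (a + h)) C (z - y).
  have [zy|zy] := ltP `|z - y| r; last first.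
    apply: le_trans (CP _ _ _ MA pP zy).
    by have := vM s z; rewrite ler_norml => /andP[].
  have dyyle x : `|x - y| < r -> dyy psi s x <= a + h.
    move=> xy; have := dyyP s x (lt_le_trans st rr1) (lt_le_trans xy rr1).
    by rewrite ltr_norml => /andP[_]; rewrite ltrBlDl => /ltW.
  have Tz := taylor2_le (fun x => let: And3 _ h _ := Hty s x s0 in h)
    (fun x => let: And3 _ _ h := Hty s x s0 in h) dyyle zy.
  have : 0 <= C * (z - y) ^+ 4 by rewrite mulr_ge0// exprn_even_ge0.
  by have := vA _ zy; rewrite /quad /A; lra.
have := v_quad (ltW s0) _ C0 quadP => /(_ t).
have -> : t - s = tau by rewrite /s; ring.
have -> : 2 * (2^-1 * (a + h)) = a + h by field.
have -> : s <= t by rewrite /s gerBl ltW.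
move=> /(_ isT) main.
have := dP (- tau); rewrite normrN gtr0_norm// => /(_ t2).
rewrite -/s ler_norml => /andP[_ der].
have Hah := HK a (ltW h0).
have tB : 3 * C * (tau * c) ^+ 2 <= tau * (g / 4).
  rewrite (_ : 3 * C * (tau * c) ^+ 2 = tau * (tau * (3 * C * c ^+ 2))); last by ring.
  rewrite ler_wpM2l ?(ltW tau0)// (le_trans _ t3)// ler_wpM2l ?(ltW tau0)//.
  by rewrite /B lerDl.
have tH : tau * H (a + h) <= tau * (H a + g / 4).
  by rewrite ler_wpM2l ?(ltW tau0)//; lra.
have : tau * (dt psi t y) <= tau * (H a + g / 4 + g / 4 + g / 4).
  by move: main der tB tH; rewrite /A; lra.
rewrite ler_pM2l//; move: g0; rewrite /g; lra.
Qed.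

End existence.

(** * Joint moduli of continuity and averages in either variable *)

Section modulus.
Context {R : realType}.
Implicit Types (g u : R -> R -> R).

(** Lipschitz in space and 1/2-Holder in time. The free parameter l replaces the square root of the
    time increment, so the bound remains linear in what the averages integrate. *)
Definition modc g := exists A B : R, [/\ 0 <= A, 0 <= B &
  forall t s y z l, 0 < l ->
    `|g t y - g s z| <= A * `|y - z| + B * (`|t - s| / l + l)].

Lemma modc_c2 g : modc g -> c2 g.
Proof.
move=> [A [B [A0 B0 H]]] [t y]; apply/cvgrPdist_le => e e0.
have A1 : 0 < A + 1 by rewrite ltr_wpDl.
have B1 : 0 < B + 1 by rewrite ltr_wpDl.
pose l := e / (4 * (B + 1)).
have l0 : 0 < l by rewrite divr_gt0// mulr_gt0.
pose r := Num.min (e / (4 * (A + 1))) (l * l).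
have r0 : 0 < r.
  by rewrite lt_min; apply/andP; split; [rewrite divr_gt0// mulr_gt0|exact: mulr_gt0].
exists (ball t r, ball y r) => /=; first by split; exact: nbhsx_ballx.
move=> [s z] /= [ts yz]; apply: (le_trans (H t s y z l l0)).
have h1 : A * `|y - z| <= e / 4.
  apply: (@le_trans _ _ ((A + 1) * (e / (4 * (A + 1))))).
    rewrite ler_pM// ?lerDl// ltW// (lt_le_trans yz)// ge_min lexx//.
  by rewrite le_eqVlt; apply/orP; left; apply/eqP; field; rewrite gt_eqF.
have h2 : B * (`|t - s| / l + l) <= e / 2.
  apply: (@le_trans _ _ ((B + 1) * (l + l))).
    have ll : `|t - s| / l + l <= l + l.
      by rewrite lerD2r ler_pdivrMr// ltW// (lt_le_trans ts)// ge_min lexx orbT.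
    apply: ler_pM => //; last by rewrite lerDl.
    have l1 := ltW l0; by apply: addr_ge0 => //; apply: divr_ge0.
  by rewrite le_eqVlt; apply/orP; left; apply/eqP; rewrite /l; field; rewrite gt_eqF.
lra.
Qed.

Lemma modcD g u : modc g -> modc u -> modc (fun t y => g t y + u t y).
Proof.
move=> [A [B [A0 B0 H]]] [A' [B' [A0' B0' H']]].
exists (A + A'), (B + B'); split; rewrite ?addr_ge0// => t s y z l l0.
rewrite opprD addrACA (le_trans (ler_normD _ _))//.
have := H t s y z l l0; have := H' t s y z l l0; rewrite !mulrDl; lra.
Qed.

Lemma modcZ c g : modc g -> modc (fun t y => c * g t y).
Proof.
move=> [A [B [A0 B0 H]]]; exists (`|c| * A), (`|c| * B).
split; rewrite ?mulr_ge0// => t s y z l l0.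
by rewrite -mulrBr normrM -!mulrA -mulrDr ler_wpM2l//; exact: H.
Qed.

Lemma modcB g u : modc g -> modc u -> modc (fun t y => g t y - u t y).
Proof.
move=> mg mu; have /= := modcD mg (modcZ (-1) mu).
by congr modc; apply/funext => t; apply/funext => y; rewrite mulN1r.
Qed.

Lemma modc_shift a b g : modc g -> modc (fun t y => g (t + a) (y + b)).
Proof.
move=> [A [B [A0 B0 H]]]; exists A, B; split => // t s y z l l0.
apply: (le_trans (H _ _ _ _ _ l0)).
have -> : y + b - (z + b) = y - z by ring.
have -> : t + a - (s + a) = t - s by ring.
exact: lexx.
Qed.

Lemma modc_y g t : modc g -> continuous (g t).
Proof.
move=> /modc_c2 cg y.
apply: (@continuous_comp _ _ _ (fun z : R => (t, z)) (fun q => g q.1 q.2)).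
  exact: cvg_pair (cvg_cst _) cvg_id.
exact: cg.
Qed.

Lemma modc_t g y : modc g -> continuous (g^~ y).
Proof.
move=> /modc_c2 cg t.
apply: (@continuous_comp _ _ _ (fun z : R => (z, y)) (fun q => g q.1 q.2)).
  exact: cvg_pair cvg_id (cvg_cst _).
exact: cg.
Qed.

Variables (e : R) (e0 : 0 < e).

Lemma modc_avg_y g : modc g -> modc (fun t y => avg e (g t) y).
Proof.
move=> mg; have [A [B [A0 B0 H]]] := mg; exists A, B; split => // t s y z l l0.
have -> : avg e (g t) y = avg e (fun x => g t (x + (y - z))) z.
  by rewrite avg_shift ?subrKC//; exact: modc_y.
apply: avg_dist2 => //.
- move=> x; apply: continuous_comp; last exact: modc_y.
  by apply: cvgD; [exact: cvg_id|exact: cvg_cst].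
- exact: modc_y.
- move=> x _; apply: (le_trans (H _ _ _ _ _ l0)).
  have -> : x + (y - z) - x = y - z by ring.
  exact: lexx.
Qed.

Lemma modc_avg_t g : modc g -> modc (fun t y => avg e (g^~ y) t).
Proof.
move=> mg; have [A [B [A0 B0 H]]] := mg; exists A, B; split => // t s y z l l0.
have -> : avg e (g^~ y) t = avg e (fun x => g (x + (t - s)) y) s.
  by rewrite (avg_shift e (t - s) s (modc_t (y := y) mg)) subrKC.
apply: avg_dist2 => //.
- move=> x; apply: (@continuous_comp _ _ _ (fun x => x + (t - s)) (g^~ y)); last exact: modc_t.
  by apply: cvgD; [exact: cvg_id|exact: cvg_cst].
- exact: modc_t.
- move=> x _; apply: (le_trans (H _ _ _ _ _ l0)).
  have -> : x + (t - s) - x = t - s by ring.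
  exact: lexx.
Qed.

(** The Taylor bound in y is uniform in time, hence survives averaging in time; dividing by z - y
    gives Caratheodory's form of the derivative. *)
Lemma deriv_avg_t g g' K t y : modc g -> modc g' ->
  (forall s z, has_deriv (g s) z (g' s z)) -> (forall s, lip K (g' s)) ->
  has_deriv (fun y => avg e (g^~ y) t) y (avg e (g'^~ y) t).
Proof.
move=> mg mg' gd gK.
have K0 := lip_ge0 (gK 0).
have bnd z : `|avg e (g^~ z) t - avg e (g^~ y) t - (z - y) * avg e (g'^~ y) t|
    <= K * (z - y) ^+ 2.
  have cg x := modc_t (y := x) mg; have cg' x := modc_t (y := x) mg'.
  have -> : avg e (g^~ z) t - avg e (g^~ y) t - (z - y) * avg e (g'^~ y) t =
     avg e (fun s => g s z + -1 * g s y + (- (z - y)) * g' s y) t.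
    rewrite avgD//; last 2 first.
      by move=> x; apply: cvgD; [exact: cg|apply: cvgMr; exact: cg].
      by move=> x; apply: cvgMr; exact: cg'.
    rewrite avgD//; last by move=> x; apply: cvgMr; exact: cg.
    by rewrite avgZ// avgZ//; ring.
  rewrite -[X in `|X|]subr0; apply: avg_dist => //.
    move=> x; apply: cvgD; last by apply: cvgMr; exact: cg'.
    by apply: cvgD; [exact: cg|apply: cvgMr; exact: cg].
  move=> s _; have := taylor1 y z (gd s) (gK s).
  by congr (_ <= _); congr `|_|; ring.
apply/is_derive1_caratheodory.
exists (fun z => if z == y then avg e (g'^~ y) t
  else (avg e (g^~ z) t - avg e (g^~ y) t) / (z - y)); split.
- move=> z; case: eqP => [->|/eqP zy]; first by rewrite !subrr mulr0.
  by rewrite divfK// subr_eq0.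
- rewrite /prop_for /continuous_at eqxx; apply/cvgrPdist_le => d d0.
  have K1 : 0 < K + 1 by rewrite ltr_wpDl.
  exists (d / (K + 1)); first by rewrite /= divr_gt0.
  move=> z /= yz; case: eqP => [_|/eqP zy]; first by rewrite subrr normr0 ltW.
  have zy0 : z - y != 0 by rewrite subr_eq0.
  have nzy : 0 < `|z - y| by rewrite normr_gt0.
  rewrite distrC -(ler_pM2r nzy) -normrM mulrBl divfK// [_ * (z - y)]mulrC.
  apply: (le_trans (bnd z)).
  rewrite -[(z - y) ^+ 2]ger0_norm ?sqr_ge0// normrX expr2 mulrA ler_pM2r//.
  move: yz; rewrite /ball /= distrC ltr_pdivlMr// => /ltW; apply: le_trans.
  by rewrite mulrC ler_wpM2l// lerDl.
- by rewrite eqxx.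
Qed.

End modulus.

(** * The limit of the scheme is a viscosity solution *)

Section viscosity.
Context {R : realType}.
Variables (slo shi : R).
Hypotheses (slo0 : 0 <= slo) (slohi : slo <= shi).
Implicit Types (f g phi : R -> R).

Let shi0 : 0 <= shi. Proof. exact: le_trans slo0 slohi. Qed.

Local Notation Top := (Top slo shi).
Local Notation VN := (VN slo shi).
Local Notation gval := (gval slo shi).
Local Notation G := (Gfun slo shi).
Local Notation dl := (@dl R).

Lemma GfunD a h : 0 <= h -> G (a + h) <= G a + shi ^+ 2 * h.
Proof.
move=> h0; rewrite !GfunE1// addr_maxl ge_max !le_max.
have s2 : slo ^+ 2 <= shi ^+ 2 by rewrite lerXn2r ?nnegrE.
have l2 : 0 <= slo ^+ 2 by exact: sqr_ge0.
apply/andP; split; apply/orP; [left|right]; nra.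
Qed.

(** Reflection of G: u is a supersolution for G exactly when -u is a subsolution for [Gneg], so the
    one-sided lemmas apply to both. *)
Definition Gneg a := - G (- a).

Lemma GnegD a h : 0 <= h -> Gneg (a + h) <= Gneg a + shi ^+ 2 * h.
Proof.
move=> h0; have := GfunD (- (a + h)) h0.
by rewrite /Gneg opprD -addrA [- h + h]addNr addr0; lra.
Qed.

Lemma viscosity_superN w : viscosity_super slo shi w ->
  visc_sub Gneg (fun t y => - w t y).
Proof.
move=> sw psi t y Cpsi t0 nm.
have [CN /(_ t y t0)[E1 E2]] := C12N Cpsi.
have := sw _ _ y CN t0.
rewrite E1 E2 /Gneg lerNr; apply; apply: filterS nm => q; lra.
Qed.

Lemma viscosity_superN' w : visc_sub Gneg (fun t y => - w t y) ->
  viscosity_super slo shi w.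
Proof.
move=> sw psi t y Cpsi t0 nm.
have [CN /(_ t y t0)[E1 E2]] := C12N Cpsi.
have H : \forall q \near ((t, y) : R * R),
  - w q.1 q.2 - - psi q.1 q.2 <= - w t y - - psi t y.
  by apply: filterS nm => q; lra.
by have := sw _ _ y CN t0 H; rewrite E1 E2 /Gneg opprK lerN2.
Qed.

Section solution.
Variables (phi : R -> R) (M L : R).
Hypotheses (phiM : bdd M phi) (phiL : lip L phi).

Let L0 : 0 <= L. Proof. exact: lip_ge0 phiL. Qed.

Lemma val_modc : modc (gval phi).
Proof.
exists L, (L * (shi ^+ 2 + 1)); split => // [|t s y z l l0].
  by rewrite mulr_ge0// addr_ge0// sqr_ge0.
have h1 := val_lip slo shi phiM phiL t y z.
have h2 := val_time slo0 slohi phiM phiL s t z l0.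
have : `|gval phi t y - gval phi s z| <= `|gval phi t y - gval phi t z| + `|gval phi t z - gval phi s z|.
  by rewrite -[X in `|X| <= _](subrKA (gval phi t z)) ler_normD.
suff : L * (`|t - s| * shi ^+ 2 / (2 * l) + l / 2) <= L * (shi ^+ 2 + 1) * (`|t - s| / l + l) by lra.
rewrite -[leRHS]mulrA ler_wpM2l//.
have -> : `|t - s| * shi ^+ 2 / (2 * l) = shi ^+ 2 * (`|t - s| / l) / 2.
  by field; rewrite gt_eqF.
have : 0 <= `|t - s| / l by rewrite divr_ge0// ltW.
have := sqr_ge0 shi; nra.
Qed.

Lemma val_visc_sub : viscosity_sub slo shi (gval phi).
Proof.
apply: (@dpp_visc_sub _ G (shi ^+ 2) M (shi ^+ 2)).
- exact: sqr_ge0.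
- exact: GfunD.
- by move=> t; exact: (val_bdd slo shi phiM).
- move=> s t y A p b C s0 st C0 H; exact: (val_quad_le slo0 slohi phiM phiL).
Qed.

Lemma val_visc_super : viscosity_super slo shi (gval phi).
Proof.
apply: viscosity_superN'.
apply: (@dpp_visc_sub _ Gneg (shi ^+ 2) M (shi ^+ 2)).
- exact: sqr_ge0.
- exact: GnegD.
- by move=> t y; rewrite normrN; exact: (val_bdd slo shi phiM).
- move=> s t y A p b C s0 st C0 H.
  have H' z : quad (- A) (- p) (- b) (- C) (z - y) <= gval phi s z.
    by have := H z; rewrite /quad; lra.
  have := val_quad_ge slo0 slohi phiM phiL s0 st C0 H'.
  by rewrite /Gneg mulrN; lra.
Qed.

Lemma val_solution : viscosity_solution slo shi phi (gval phi).
Proof.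
split; [| |by move=> y; exact: val_le0|exact: val_visc_sub|exact: val_visc_super].
  by apply: continuous_subspaceT; exact: modc_c2 val_modc.
exists M; split; first exact: num_real.
move=> M' MM' q /= _; apply: le_trans (ltW MM').
exact: (val_bdd slo shi phiM).
Qed.

End solution.
End viscosity.

(** * Supersolutions lie above the scheme *)

Section comparison.
Context {R : realType}.
Variables (slo shi : R).
Hypotheses (slo0 : 0 <= slo) (slohi : slo <= shi).
Implicit Types (f g phi : R -> R).

Let shi0 : 0 <= shi. Proof. exact: le_trans slo0 slohi. Qed.

Local Notation Top := (Top slo shi).
Local Notation VN := (VN slo shi).
Local Notation gval := (gval slo shi).
Local Notation G := (Gfun slo shi).
Local Notation Gneg := (Gneg slo shi).
Local Notation dl := (@dl R).
Local Notation halfplane := (@halfplane R).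

Lemma Gfun_lower sg a : sg = slo \/ sg = shi -> sg ^+ 2 / 2 * a <= G a.
Proof.
move=> sgE; have := Gfun_ge slo0 slohi (2^-1 * a) sgE.
by rewrite mulrA [2 * _]mulrA divff// mul1r.
Qed.

Section supersolution.
Variables (w : R -> R -> R) (M : R).
Hypotheses (w_super : viscosity_super slo shi w)
  (cw : {within halfplane, continuous (fun q : R * R => w q.1 q.2)})
  (wM : forall t y, 0 <= t -> - M <= w t y).

                                                                               
                                                                               
                                                        
(** Interpolate linearly in time between f and its walk step, subtracting c1 (t - t0). This is a
    smooth subsolution: one half of c1 pays for the difference between D f and sg^2/2 times f2, the
    other half for the change of the second derivative along the interpolation. [W] is its negative,
    compared with -w by [maximum_principle]. *)
Lemma super_step f f1 f2 Mf H sg r t0 y : sg = slo \/ sg = shi -> 0 < r ->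
  (forall z : R, has_deriv f z (f1 z)) -> (forall z : R, has_deriv f1 z (f2 z)) ->
  lip H f2 -> bdd Mf f -> 0 <= t0 -> (forall z, f z <= w t0 z) ->
  Qop (sg * r) f y - 2 * H * shi ^+ 3 * r ^+ 3 <= w (t0 + r ^+ 2) y.
Proof.
move=> sgE r0 fd f1d f2H fM t00 fw.
have H0 := lip_ge0 f2H.
have sg0 : 0 <= sg by case: sgE => ->.
have sgs : sg <= shi by case: sgE => ->.
have r20 : 0 < r ^+ 2 by rewrite exprn_gt0.
pose c1 := 2 * H * sg ^+ 3 * r.
have c10 : 0 <= c1 by rewrite !mulr_ge0 ?exprn_ge0// ltW.
pose D g z := r ^- 2 * (Qop (sg * r) g z - g z).
have Dd g g' : (forall z : R, has_deriv g z (g' z)) ->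
    forall z : R, has_deriv (D g) z (D g' z).
  move=> gd z; apply: dmulc; apply: dadd; last by apply: dopp; exact: gd.
  apply: dmulc; apply: dadd; first by apply: deriv_shift; exact: gd.
  by apply: (@deriv_shift _ g (- (sg * r))); exact: gd.
pose W t z := - (f z + (t + - t0) * D f z + - (c1 * (t + - t0))).
pose Wt (t z : R) := - (((t + - t0) * 0 + D f z * (1 + 0)) + - (c1 * (1 + 0))).
pose Wy t z := - (f1 z + (t + - t0) * D f1 z + 0).
pose Wyy t z := - (f2 z + (t + - t0) * D f2 z + 0).
have f2c : continuous f2 := lip_continuous f2H.
have f1c : continuous f1 by move=> z; exact: is_derive_cont (f1d z).
have fc : continuous f by move=> z; exact: is_derive_cont (fd z).
have Dc g : continuous g -> continuous (D g).
  move=> cg z; apply: cvgMr; apply: cvgB; last exact: cg.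
  apply: cvgMr; apply: cvgD.
    by apply: (@continuous_comp _ _ _ (fun z => z + sg * r) g); [apply: cvgD; [exact: cvg_id|exact: cvg_cst]|exact: cg].
  by apply: (@continuous_comp _ _ _ (fun z => z - sg * r) g); [apply: cvgD; [exact: cvg_id|exact: cvg_cst]|exact: cg].
have clin : continuous (fun t : R => t + - t0).
  by move=> t; apply: cvgD; [exact: cvg_id|exact: cvg_cst].
have sW : smooth W Wt Wy Wyy.
  split.
  - move=> t z; apply: dopp; apply: dadd; last by apply: dopp; dtac.
    apply: (deq (a := 0 + ((t + - t0) * 0 + D f z * (1 + 0)))); last exact: add0r.
    by apply: dadd; [exact: dcst|apply: dmul; [dtac|exact: dcst]].
  - move=> t z; apply: dopp; apply: dadd; last exact: dcst.
    by apply: dadd; [exact: fd|apply: dmulc; exact: (Dd _ _ fd)].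
  - move=> t z; apply: dopp; apply: dadd; last exact: dcst.
    by apply: dadd; [exact: f1d|apply: dmulc; exact: (Dd _ _ f1d)].
  - apply: c2N; apply: c2D; first apply: c2D.
    + exact: c2_y fc.
    + by apply: c2M; [exact: c2_t clin|apply: c2_y; exact: Dc].
    + by apply: c2N; apply: c2M; [exact: c2_cst|exact: c2_t clin].
  - apply: c2N; apply: c2D; last exact: c2_cst.
    apply: c2D; first by apply: c2M; [exact: c2_t clin|exact: c2_cst].
    by apply: c2M; [apply: c2_y; exact: Dc|exact: c2_cst].
  - apply: c2N; apply: c2D; last exact: c2_cst.
    apply: c2D; first exact: c2_y f1c.
    by apply: c2M; [exact: c2_t clin|apply: c2_y; exact: Dc].
  - apply: c2N; apply: c2D; last exact: c2_cst.
    apply: c2D; first exact: c2_y f2c.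
    by apply: c2M; [exact: c2_t clin|apply: c2_y; exact: Dc].
(* The maximum principle concludes only before T, so the strip extends past the time t0 + r^2 of
   interest. *)
pose T := t0 + 2 * r ^+ 2.
have t0T : t0 < T by rewrite ltrDl mulr_gt0.
have cNw : {within halfplane, continuous (fun q : R * R => - w q.1 q.2)}.
  by move=> q; apply: cvgN; exact: cw.
have Df2 z : `|r ^+ 2 * D f2 z| <= H * (sg * r).
  rewrite /D mulrA divff ?gt_eqF// mul1r /Qop.
  have -> : 2^-1 * (f2 (z + sg * r) + f2 (z - sg * r)) - f2 z =
    2^-1 * ((f2 (z + sg * r) - f2 z) + (f2 (z - sg * r) - f2 z)) by field.
  have := f2H (z + sg * r) z; have := f2H (z - sg * r) z.
  have -> : z + sg * r - z = sg * r by ring.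
  have -> : z - sg * r - z = - (sg * r) by ring.
  rewrite normrN (ger0_norm (mulr_ge0 sg0 (ltW r0))) !ler_norml.
  by move=> /andP[? ?] /andP[? ?]; apply/andP; split; lra.
have Df z : D f z <= sg ^+ 2 / 2 * f2 z + H * sg ^+ 3 * r.
  rewrite /D ler_pdivrMl// /Qop.
  have := taylor2 z (z + sg * r) fd f1d f2H.
  have := taylor2 z (z - sg * r) fd f1d f2H.
  have -> : z + sg * r - z = sg * r by ring.
  have -> : z - sg * r - z = - (sg * r) by ring.
  rewrite normrN (ger0_norm (mulr_ge0 sg0 (ltW r0))) !ler_norml.
  move=> /andP[_ h1] /andP[_ h2].
  have -> : r ^+ 2 * (sg ^+ 2 / 2 * f2 z + H * sg ^+ 3 * r) =
    2^-1 * f2 z * (sg * r) ^+ 2 + H * (sg * r) ^+ 3 by field.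
  move: h1 h2; rewrite sqrrN; lra.
have DfM z : `|r ^+ 2 * D f z| <= 2 * Mf.
  rewrite /D mulrA divff ?gt_eqF// mul1r.
  have := sl_bdd (lin_sub (lin_Q (sg * r))) fM z; have := fM z.
  move=> h1 h2; apply: (le_trans (ler_normB _ _)).
  by rewrite mulr2n mulrDl mul1r lerD.
have mp : - w (t0 + r ^+ 2) y <= W (t0 + r ^+ 2) y.
  apply: (@maximum_principle _ Gneg (shi ^+ 2) (sqr_ge0 _) (GnegD slo0 slohi)
    (fun t y => - w t y) W Wt Wy Wyy t0 T M (5 * Mf)) => //.
  - exact: viscosity_superN.
  - by move=> t z tge; rewrite lerNl; exact: wM.
  - move=> t z /andP[tt0 tT]; rewrite lerN2.
    have th0 : 0 <= (t - t0) / r ^+ 2 by rewrite divr_ge0 ?subr_ge0// ltW.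
    have th2 : (t - t0) / r ^+ 2 <= 2.
      by rewrite ler_pdivrMr// lerBlDl.
    have -> : (t + - t0) * D f z = (t - t0) / r ^+ 2 * (r ^+ 2 * D f z).
      by field; rewrite gt_eqF.
    have h1 : (t - t0) / r ^+ 2 * (r ^+ 2 * D f z) <= 2 * (2 * Mf).
      rewrite (le_trans (ler_norm _))// normrM ger0_norm// ler_pM//.
    have h2 : 0 <= c1 * (t + - t0) by rewrite mulr_ge0// subr_ge0.
    have h3 : f z <= Mf by rewrite (le_trans (ler_norm _)).
    clear - h1 h2 h3; lra.
  - move=> t z /andP[tt0 tT]; rewrite /Gneg /Wyy /Wt opprK mulr0 add0r !addr0 !mulr1 lerN2.
    apply: le_trans (Gfun_lower _ sgE).
    have th0 : 0 <= (t - t0) / r ^+ 2 by rewrite divr_ge0 ?subr_ge0// ltW.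
    have th2 : (t - t0) / r ^+ 2 <= 2.
      by rewrite ler_pdivrMr// lerBlDl ltW.
    have -> : (t + - t0) * D f2 z = (t - t0) / r ^+ 2 * (r ^+ 2 * D f2 z).
      by field; rewrite gt_eqF.
    have h1 : - (2 * (H * (sg * r))) <= (t - t0) / r ^+ 2 * (r ^+ 2 * D f2 z).
      rewrite lerNl -mulrN (le_trans (ler_norm _))// normrM ger0_norm// normrN ler_pM//.
    have h2 : 0 <= sg ^+ 2 / 2 by rewrite divr_ge0 ?sqr_ge0.
    have h3 := ler_wpM2l h2 h1.
    have h4 := Df z.
    have h5 : sg ^+ 2 / 2 * - (2 * (H * (sg * r))) = - (H * sg ^+ 3 * r) by field.
    have h6 : c1 = 2 * (H * sg ^+ 3 * r) by rewrite /c1; ring.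
    rewrite h6 mulrDr; clear - h3 h4 h5; lra.
  - by move=> z; rewrite /W addrN mul0r mulr0 oppr0 !addr0 lerN2.
  - by rewrite lerDl (ltW r20)/= ltrD2l ltr_pMl// ltr1n.
have Wend : W (t0 + r ^+ 2) y = - (Qop (sg * r) f y - c1 * r ^+ 2).
  by rewrite /W /D; field; rewrite gt_eqF.
have c1r : c1 * r ^+ 2 <= 2 * H * shi ^+ 3 * r ^+ 3.
  have -> : c1 * r ^+ 2 = 2 * H * sg ^+ 3 * r ^+ 3 by rewrite /c1; ring.
  rewrite ler_wpM2r ?exprn_ge0 ?(ltW r0)// ler_wpM2l ?mulr_ge0//.
  by rewrite lerXn2r ?nnegrE.
move: mp c1r; rewrite Wend; clear; lra.
Qed.

Lemma iterQ_deriv k h f f1 : (forall z : R, has_deriv f z (f1 z)) ->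
  forall z : R, has_deriv (iter k (Qop h) f) z (iter k (Qop h) f1 z).
Proof.
move=> fd; elim: k => [//|k IH] z /=.
apply: dmulc; apply: dadd; first by apply: deriv_shift; exact: IH.
by apply: (@deriv_shift _ _ (- h)); exact: IH.
Qed.

Lemma super_iter f f1 f2 Mf H sg r t0 k y : sg = slo \/ sg = shi -> 0 < r ->
  (forall z : R, has_deriv f z (f1 z)) -> (forall z : R, has_deriv f1 z (f2 z)) ->
  lip H f2 -> bdd Mf f -> 0 <= t0 -> (forall z, f z <= w t0 z) ->
  iter k (Qop (sg * r)) f y - k%:R * (2 * H * shi ^+ 3 * r ^+ 3)
  <= w (t0 + k%:R * r ^+ 2) y.
Proof.
move=> sgE r0 fd f1d f2H fM t00 fw.
set c := 2 * H * shi ^+ 3 * r ^+ 3.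
have sI j : sublin (iter j (@Qop R (sg * r))).
  by apply: lin_sub; apply: lin_iter; exact: lin_Q.
elim: k y => [|k IH] y; first by rewrite !mul0r subr0 addr0; exact: fw.
pose g z := iter k (Qop (sg * r)) f z + - (k%:R * c).
have gd z : has_deriv g z (iter k (Qop (sg * r)) f1 z + 0).
  by apply: dadd; [exact: iterQ_deriv|exact: dcst].
have g1d z : has_deriv (fun z => iter k (Qop (sg * r)) f1 z + 0) z (iter k (Qop (sg * r)) f2 z + 0).
  by apply: dadd; [exact: iterQ_deriv|exact: dcst].
have g2H : lip H (fun z => iter k (Qop (sg * r)) f2 z + 0).
  move=> x z; rewrite !addr0; exact: (sl_lip (sI k) f2H).
have gM : bdd (Mf + `|k%:R * c|) g.
  move=> z; rewrite (le_trans (ler_normB _ _))// lerD2r.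
  exact: (sl_bdd (sI k) fM).
have tk0 : 0 <= t0 + k%:R * r ^+ 2 by rewrite addr_ge0// mulr_ge0// exprn_ge0// ltW.
have := super_step y sgE r0 gd g1d g2H gM tk0 IH.
rewrite -/c (sl_cst (lin_sub (lin_Q (sg * r)))) -natr1 !mulrDl !mul1r addrA opprD addrA.
by [].
Qed.

Definition block_error L N : R := (4 * L + 8 * L * shi ^+ 3) * dl N ^+ 2.

Lemma avg2_dist e f L y : 0 < e -> lip L f -> `|avg2 e f y - f y| <= 2 * L * e.
Proof.
move=> e0 fL; have cf := lip_continuous fL; have L0 := lip_ge0 fL.
apply: avg_dist => // [|z /andP[yz zy]]; first exact: avg_continuous.
apply: avg_dist => // x /andP[zx xz]; apply: (le_trans (fL _ _)).
have xy : `|x - y| <= 2 * e by rewrite ger0_norm; lra.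
by rewrite [2 * L]mulrC -mulrA ler_wpM2l.
Qed.

Lemma avg2_bdd e f Mf : 0 < e -> continuous f -> bdd Mf f -> bdd Mf (avg2 e f).
Proof.
move=> e0 cf fM y; rewrite -[avg2 e f y]subr0; apply: avg_dist => //.
  exact: avg_continuous.
by move=> z _; apply: avg_dist => // x _; rewrite subr0.
Qed.

(** A Lipschitz f is mollified at scale e = dl^2 and lowered below itself, at cost of order L dl^2.
    The second derivative then has Lipschitz constant 4 L / e^2, and the errors of all walk steps
    add up to order (L / e^2) rstep dl, again L dl^2 because rstep = dl^5. *)
Lemma super_block f L Mf N t0 y : lip L f -> bdd Mf f -> 0 <= t0 ->
  (forall z, f z <= w t0 z) -> Top N f y - block_error L N <= w (t0 + dl N) y.
Proof.
move=> fL fM t00 fw; have L0 := lip_ge0 fL; have cf := lip_continuous fL.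
have d0 : 0 < dl N := dl_gt0 N.
pose e := dl N ^+ 2; have e0 : 0 < e by rewrite exprn_gt0.
pose g z := avg2 e f z + - (2 * L * e).
have gf z : g z <= f z.
  by have := avg2_dist z e0 fL; rewrite ler_norml /g => /andP[_]; lra.
pose g1 z := e^-1 * (avg e f (z + e) - avg e f z) + 0.
have gd z : has_deriv g z (g1 z) by apply: dadd; [exact: avg2_deriv|exact: dcst].
have g1d z : has_deriv g1 z (dd e f z + 0).
  by apply: dadd; [exact: avg2_deriv2|exact: dcst].
have g2H : lip (4 * L / e ^+ 2) (fun z => dd e f z + 0).
  by move=> x z; rewrite !addr0; exact: dd_lip.
have gM : bdd (Mf + `|2 * L * e|) g.
  by move=> z; rewrite (le_trans (ler_normB _ _))// lerD2r avg2_bdd.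
have gw z : g z <= w t0 z by exact: le_trans (fw z).
have rd : @rstep R N = dl N ^+ 5.
  rewrite /rstep /dl -exprM (_ : 10 * N = 2 * (N * 5))%N; last by lia.
  by rewrite exprM; congr (_ ^+ _); field.
have err : (nstep N)%:R * (2 * (4 * L / e ^+ 2) * shi ^+ 3 * (@rstep R N) ^+ 3) =
    8 * L * shi ^+ 3 * dl N ^+ 2.
  have -> : (nstep N)%:R * (2 * (4 * L / e ^+ 2) * shi ^+ 3 * (@rstep R N) ^+ 3) =
    (2 * (4 * L / e ^+ 2) * shi ^+ 3) * (@rstep R N) * ((nstep N)%:R * (@rstep R N) ^+ 2) by ring.
  by rewrite nstep_rstep rd /e; field; rewrite gt_eqF.
have key sg : sg = slo \/ sg = shi -> Kop sg N f y - block_error L N <= w (t0 + dl N) y.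
  move=> sgE.
  have := super_iter (nstep N) y sgE (rstep_gt0 N) gd g1d g2H gM t00 gw.
  rewrite err nstep_rstep; apply: le_trans.
  rewrite -/(Kop sg N g); have sK := lin_sub (lin_K sg N).
  have : Kop sg N f y <= Kop sg N g y + 4 * L * e.
    apply: (sl_dist sK) => z; have := avg2_dist z e0 fL.
    by rewrite ler_norml /g => /andP[+ _]; lra.
  by rewrite /block_error -/e; lra.
rewrite lerBlDr /Top ge_max -!lerBlDr; apply/andP; split; apply: key; by [left|right].
Qed.

Lemma super_iterT phi L Mf N k y : lip L phi -> bdd Mf phi ->
  (forall z, phi z <= w 0 z) ->
  iter k (Top N) phi y - k%:R * block_error L N <= w (k%:R * dl N) y.
Proof.
move=> fL fM fw; elim: k y => [|k IH] y; first by rewrite !mul0r subr0; exact: fw.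
have sT := sublin_iter k (sublin_T slo shi N).
pose g z := iter k (Top N) phi z + - (k%:R * block_error L N).
have gL : lip L g.
  move=> x z; rewrite /g opprD addrACA subrr addr0; exact: (sl_lip sT fL).
have gM : bdd (Mf + `|k%:R * block_error L N|) g.
  by move=> z; rewrite (le_trans (ler_normB _ _))// lerD2r; exact: (sl_bdd sT fM).
have kd0 : 0 <= k%:R * dl N by rewrite mulr_ge0// ltW// dl_gt0.
have := super_block N y gL gM kd0 IH.
rewrite (sl_cst (sublin_T slo shi N)) -natr1 !mulrDl !mul1r opprD addrA.
by [].
Qed.

(** About t / dl blocks, each with error of order dl^2, leave a total error of order dl; continuity
    of w absorbs the rounding of t to the time grid. *)
Lemma super_ge_val phi L Mf t y : lip L phi -> bdd Mf phi ->
  (forall z, phi z <= w 0 z) -> 0 <= t -> gval phi t y <= w t y.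
Proof.
move=> fL fM fw t0.
apply: ulim_le_err => [|e e0]; first exact: (VN_bdd_seq _ _ fM).
have L0 := lip_ge0 fL.
have e20 : 0 < e / 2 by rewrite divr_gt0.
have /subspace_continuousP/(_ (t, y) t0)/cvgrPdist_le/(_ _ e20) := cw.
move=> /near_box[r r0 H].
pose C := t * (4 * L + 8 * L * shi ^+ 3) + 1.
have C0 : 0 < C.
  by rewrite ltr_wpDl// mulr_ge0// addr_ge0 ?mulr_ge0 ?exprn_ge0.
pose d := Num.min (r / 2) (e / 2 / C).
have d0 : 0 < d by rewrite lt_min !divr_gt0.
apply: filterS (near_dl d0) => N; rewrite le_min => /andP[d1 d2].
have dN0 : 0 < dl N := dl_gt0 N.
have k1 := kt_le N t0; have k2 := kt_gt N t.
have k0 : 0 <= (kt N t)%:R * dl N by rewrite mulr_ge0// ltW.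
have hs : `|(kt N t)%:R * dl N - t| < r by rewrite ltr_norml; apply/andP; split; lra.
have hy : `|y - y| < r by rewrite subrr normr0.
have := H _ _ hs hy k0; rewrite ler_norml => /andP[h1 _].
have {}h1 : - (e / 2) <= w t y - w ((kt N t)%:R * dl N) y by exact: h1.
have h2 := super_iterT N (kt N t) y fL fM fw.
rewrite -/(VN phi N t y) in h2.
have h3 : (kt N t)%:R * block_error L N <= e / 2.
  have -> : (kt N t)%:R * block_error L N =
    (kt N t)%:R * dl N * (4 * L + 8 * L * shi ^+ 3) * dl N by rewrite /block_error; ring.
  apply: (@le_trans _ _ (C * dl N)); last by rewrite mulrC -ler_pdivlMr.
  rewrite ler_wpM2r ?(ltW dN0)// (le_trans _ (_ : t * (4 * L + 8 * L * shi ^+ 3) <= C))//; last by rewrite lerDl.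
  by rewrite ler_wpM2r// addr_ge0 ?mulr_ge0 ?exprn_ge0.
by move: h1 h2 h3; clear; lra.
Qed.

End supersolution.
End comparison.

(** * Subsolutions lie below; uniqueness and the semigroup *)

Section subsolution.
Context {R : realType}.
Variables (slo shi : R).
Hypotheses (slo0 : 0 <= slo) (slohi : slo <= shi).
Implicit Types (f g phi : R -> R).

Let shi0 : 0 <= shi. Proof. exact: le_trans slo0 slohi. Qed.

Local Notation gval := (gval slo shi).
Local Notation G := (Gfun slo shi).

Section mollified_value.
Variables (phi : R -> R) (M L e : R).
Hypotheses (phiM : bdd M phi) (phiL : lip L phi) (e0 : 0 < e).

Let L0 : 0 <= L. Proof. exact: lip_ge0 phiL. Qed.

Let F t y := avg2 e (gval phi t) y.
Let F1 t y := e^-1 * (avg e (gval phi t) (y + e) - avg e (gval phi t) y).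
Let F2 t y := dd e (gval phi t) y.

(** The value function averaged twice in space and once in time: smooth, uniformly close to the
    original, and a supersolution by [moll_super]. *)
Definition moll t y := avg e (F^~ y) t.
Definition moll_t t y := e^-1 * (F (t + e) y - F t y).
Definition moll_y t y := avg e (F1^~ y) t.
Definition moll_yy t y := avg e (F2^~ y) t.

Let mval : modc (gval phi). Proof. exact: (val_modc slo0 slohi phiM phiL). Qed.
Let cval t : continuous (gval phi t). Proof. exact: modc_y. Qed.
Let mA : modc (fun t y => avg e (gval phi t) y). Proof. exact: modc_avg_y. Qed.
Let mF : modc F. Proof. exact: (modc_avg_y e0 mA). Qed.

Let mshift_y a (g : R -> R -> R) : modc g -> modc (fun t y => g t (y + a)).
Proof.
move=> /(modc_shift 0 a); congr modc.
by apply/funext => t; apply/funext => y; rewrite addr0.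
Qed.

Let mshift_t a (g : R -> R -> R) : modc g -> modc (fun t y => g (t + a) y).
Proof.
move=> /(modc_shift a 0); congr modc.
by apply/funext => t; apply/funext => y; rewrite addr0.
Qed.

Let mF1 : modc F1.
Proof. by apply: modcZ; apply: modcB; [exact: (mshift_y e mA)|exact: mA]. Qed.

Let mF2 : modc F2.
Proof.
apply: modcZ; apply: modcB; apply: modcZ; apply: modcB.
- exact: (mshift_y e (mshift_y e mval)).
- exact: (mshift_y e mval).
- exact: (mshift_y e mval).
- exact: mval.
Qed.

Lemma moll_smooth : smooth moll moll_t moll_y moll_yy.
Proof.
have F1L s : lip (2 * L / e) (F1 s).
  move=> x z; rewrite /F1.
  have aL := avg_continuous.
  have h a : `|avg e (gval phi s) (x + a) - avg e (gval phi s) (z + a)| <= L * `|x - z|.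
    have -> : avg e (gval phi s) (x + a) = avg e (fun y => gval phi s (y + (x - z))) (z + a).
      by rewrite avg_shift//; congr (avg _ _ _); ring.
    apply: avg_dist2 => //.
      move=> y; apply: continuous_comp; last exact: cval.
      by apply: cvgD; [exact: cvg_id|exact: cvg_cst].
    move=> y _; apply: (le_trans (val_lip _ _ phiM phiL _ _ _)).
    by have -> : y + (x - z) - y = x - z by ring.
  rewrite -mulrBr normrM gtr0_norm ?invr_gt0// mulrC ler_pdivrMr//.
  have -> : 2 * L / e * `|x - z| * e = L * `|x - z| + L * `|x - z| by field; rewrite gt_eqF.
  have := h e; have := h 0; rewrite !addr0 => h1 h2.
  have -> : avg e (gval phi s) (x + e) - avg e (gval phi s) x -
    (avg e (gval phi s) (z + e) - avg e (gval phi s) z) =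
    (avg e (gval phi s) (x + e) - avg e (gval phi s) (z + e)) -
    (avg e (gval phi s) x - avg e (gval phi s) z) by ring.
  by rewrite (le_trans (ler_normB _ _))// lerD.
split.
- move=> t y; apply: avg_derive; exact: modc_t mF.
- move=> t y; apply: (@deriv_avg_t _ _ e0 F F1 (2 * L / e)) => // s z.
  by apply: avg2_deriv; exact: cval.
- move=> t y; apply: (@deriv_avg_t _ _ e0 F1 F2 (4 * L / e ^+ 2)) => //.
    by move=> s z; apply: avg2_deriv2; exact: cval.
  by move=> s; apply: dd_lip => //; exact: (val_lip _ _ phiM phiL).
- by apply: modc_c2; exact: modc_avg_t.
- by apply: modc_c2; apply: modcZ; apply: modcB => //; exact: mshift_t.
- by apply: modc_c2; exact: modc_avg_t.
- by apply: modc_c2; exact: modc_avg_t.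
Qed.

Lemma moll_bdd t : bdd M (moll t).
Proof.
move=> y; rewrite -[moll t y]subr0; apply: avg_dist => //; first exact: modc_t mF.
move=> s _; rewrite subr0; apply: avg2_bdd => //; exact: (val_bdd _ _ phiM).
Qed.

Lemma moll_dist t y l : 0 < l ->
  `|moll t y - gval phi t y| <= 2 * L * e + L * (e * shi ^+ 2 / (2 * l) + l / 2).
Proof.
move=> l0; apply: avg_dist => //; first exact: modc_t mF.
move=> s /andP[ts st].
rewrite -(subrKA (gval phi s y)) (le_trans (ler_normD _ _))// lerD//.
  by apply: avg2_dist => //; exact: (val_lip _ _ phiM phiL).
apply: (le_trans (val_time slo0 slohi phiM phiL _ _ _ l0)).
rewrite ler_wpM2l// lerD2r.
have c0 : 0 <= shi ^+ 2 / (2 * l).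
  by apply: divr_ge0; [exact: sqr_ge0|apply: mulr_ge0 => //; exact: ltW].
have /(ler_wpM2r c0) : `|s - t| <= e by rewrite ger0_norm ?subr_ge0// lerBlDl.
by rewrite !mulrA.
Qed.

Lemma moll_incr t y s l sg : 0 <= t -> 0 <= s -> sg = slo \/ sg = shi -> 0 < l ->
  s * sg ^+ 2 / 2 * moll_yy t y -
  4 * L / e ^+ 2 * (s * sg ^+ 2 * l / 2 + 3 / (2 * l) * (s * sg ^+ 2) ^+ 2)
  <= moll (t + s) y - moll t y.
Proof.
move=> t0 s0 sgE l0; set E := 4 * L / e ^+ 2 * _.
have cF x := modc_t (y := x) mF; have cF2 x := modc_t (y := x) mF2.
have cs : continuous (fun x => F (x + s) y).
  move=> x; apply: (@continuous_comp _ _ _ (fun x => x + s) (F^~ y)); last exact: cF.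
  by apply: cvgD; [exact: cvg_id|exact: cvg_cst].
have -> : moll (t + s) y - moll t y = avg e (fun x => F (x + s) y + -1 * F x y) t.
  rewrite avgD//; last by move=> x; apply: cvgMr; exact: cF.
  rewrite [avg e (fun z => -1 * F z y) t]avgZ// mulN1r; congr (_ - _).
  by symmetry; exact: (avg_shift e s t (cF y)).
have -> : s * sg ^+ 2 / 2 * moll_yy t y - E =
   avg e (fun x => s * sg ^+ 2 / 2 * F2 x y + (- E)) t.
  rewrite avgD//; [|by move=> x; apply: cvgMr; exact: cF2|by move=> x; exact: cvg_cst].
  by rewrite avgZ// avg_cst.
apply: avg_le => //.
- by move=> x; apply: cvgD; [apply: cvgMr; exact: cF2|exact: cvg_cst].
- by move=> x; apply: cvgD; [exact: cs|apply: cvgMr; exact: cF].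
- move=> x /andP[tx _]; rewrite mulN1r.
  have x0 : 0 <= x by exact: le_trans tx.
  have xs : x <= x + s by rewrite lerDl.
  have := val_mollify phiM phiL e0 y x0 xs sgE l0.
  by have -> : x + s - x = s by ring.
Qed.

Let arith (D V1 V2 a1 a2 s g k : R) : s * a2 <= s * (g / 4) ->
  s * a1 <= s * (g / 4) -> D - V1 * s <= g / 4 * s ->
  s * (k * V2) - (s * a1 + s * a2) <= D ->
  s * (k * V2) <= s * (V1 + g / 4 + g / 4 + g / 4).
Proof. lra. Qed.

(** G is the maximum of two linear functions, so one volatility sg suffices at a time. In
    [moll_incr] first l is made small to tame the remainder linear in s, then s tends to 0. *)
Lemma moll_super t y : 0 <= t -> G (moll_yy t y) <= moll_t t y.
Proof.
move=> t0.
have key sg : sg = slo \/ sg = shi -> sg ^+ 2 / 2 * moll_yy t y <= moll_t t y.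
  move=> sgE; rewrite leNgt; apply/negP => lt.
  pose g := sg ^+ 2 / 2 * moll_yy t y - moll_t t y.
  have g0 : 0 < g by rewrite subr_gt0.
  have g40 : 0 < g / 4 by rewrite divr_gt0.
  pose H := 4 * L / e ^+ 2.
  have H0 : 0 <= H by rewrite divr_ge0 ?sqr_ge0// mulr_ge0.
  pose c := H * sg ^+ 2 / 2 + 1.
  have c0 : 0 < c by rewrite ltr_wpDl// divr_ge0// mulr_ge0// sqr_ge0.
  pose l := g / 4 / c; have l0 : 0 < l by rewrite divr_gt0.
  have lc : H * sg ^+ 2 / 2 * l <= g / 4.
    apply: (@le_trans _ _ (c * l)); last by rewrite /l mulrC divfK ?gt_eqF.
    by rewrite ler_wpM2r ?(ltW l0)// lerDl.
  pose b := H * (3 / (2 * l)) * sg ^+ 4 + 1.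
  have b0 : 0 < b.
    rewrite ltr_wpDl//; apply: mulr_ge0; last exact: exprn_even_ge0.
    apply: mulr_ge0 => //; apply: divr_ge0 => //; apply: mulr_ge0 => //; exact: ltW.
  have [d d0 dP] := has_deriv_eps (sm_t moll_smooth t y) g40.
  pose s := Num.min (d / 2) (g / 4 / b).
  have s0 : 0 < s by rewrite lt_min !divr_gt0.
  have sd : s < d by rewrite gt_min ltr_pdivrMr// ltr_pMr// ltr1n.
  have sb : H * (3 / (2 * l)) * sg ^+ 4 * s <= g / 4.
    apply: (@le_trans _ _ (b * s)); first by rewrite ler_wpM2r ?(ltW s0)// lerDl.
    by rewrite mulrC -ler_pdivlMr// ge_min lexx orbT.
  have := dP s; rewrite gtr0_norm// => /(_ sd); rewrite ler_norml => /andP[_ h1].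
  have h2 := moll_incr y t0 (ltW s0) sgE l0.
  have : s * (sg ^+ 2 / 2 * moll_yy t y) <= s * (moll_t t y + g / 4 + g / 4 + g / 4).
    have e1 : H * (s * sg ^+ 2 * l / 2 + 3 / (2 * l) * (s * sg ^+ 2) ^+ 2) =
       s * (H * sg ^+ 2 / 2 * l) + s * (H * (3 / (2 * l)) * sg ^+ 4 * s) by ring.
    have e2 : s * sg ^+ 2 / 2 * moll_yy t y = s * (sg ^+ 2 / 2 * moll_yy t y) by ring.
    move: h1 h2; rewrite -/H e1 e2.
    have := ler_wpM2l (ltW s0) lc; have := ler_wpM2l (ltW s0) sb.
    exact: arith.
  by rewrite ler_pM2l// leNgt => /negP; apply; rewrite -subr_gt0 /g; lra.
rewrite GfunE1// ge_max; apply/andP; split.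
  by rewrite mulrA; apply: key; left.
by rewrite mulrA; apply: key; right.
Qed.

End mollified_value.

(** The mollified value function raised by its distance to the original is a smooth supersolution
    above phi at time 0, so the maximum principle applies. Then l and afterwards e are taken
    small. *)
Lemma sub_le_val phi L Mf (u : R -> R -> R) M t y : lip L phi -> bdd Mf phi ->
  viscosity_sub slo shi u ->
  {within @halfplane R, continuous (fun q : R * R => u q.1 q.2)} ->
  (forall t y, 0 <= t -> u t y <= M) -> (forall z, u 0 z <= phi z) ->
  0 <= t -> u t y <= gval phi t y.
Proof.
move=> phiL phiM usub cu uM u0 t0; have L0 := lip_ge0 phiL.
have key e l : 0 < e -> 0 < l ->
  u t y <= gval phi t y + 2 * (2 * L * e + L * (e * shi ^+ 2 / (2 * l) + l / 2)).
  move=> e0 l0; set om := 2 * L * e + _.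
  have sV := moll_smooth phiM phiL e0.
  have [h1 h2 h3 h4 h5 h6 h7] := sV.
  pose W t y := moll phi e t y + om.
  have sW : smooth W (fun t y => moll_t phi e t y + 0) (fun t y => moll_y phi e t y + 0) (moll_yy phi e).
    split.
    - by move=> s z; apply: dadd; [exact: h1|exact: dcst].
    - by move=> s z; apply: dadd; [exact: h2|exact: dcst].
    - move=> s z; apply: (deq (a := moll_yy phi e s z + 0)); last exact: addr0.
      by apply: dadd; [exact: h3|exact: dcst].
    - by apply: c2D => //; exact: c2_cst.
    - by apply: c2D => //; exact: c2_cst.
    - by apply: c2D => //; exact: c2_cst.
    - exact: h7.
  have t1 : 0 < t + 1 by rewrite ltr_wpDl.
  have : u t y <= W t y.
    apply: (@maximum_principle _ G (shi ^+ 2) (sqr_ge0 _) (GfunD slo0 slohi) u W _ _ _ 0 (t + 1) M (Mf - om) usub cu uM sW (lexx 0) t1).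
    - move=> s z _; have := moll_bdd phiM phiL e0 s z.
      by rewrite ler_norml /W => /andP[+ _]; clear; lra.
    - by move=> s z /andP[s0 _]; rewrite addr0; apply: moll_super => //; exact: ltW.
    - move=> z; apply: (le_trans (u0 z)).
      have := moll_dist phiM phiL e0 0 z l0.
      rewrite val_le0// ler_norml -/om => /andP[+ _]; rewrite /W; clear; lra.
    - by rewrite t0/= ltrDl.
  have := moll_dist phiM phiL e0 t y l0.
  rewrite -/om ler_norml => /andP[_]; rewrite /W; clear; lra.
rewrite leNgt; apply/negP => lt.
pose d := u t y - gval phi t y; have d0 : 0 < d by rewrite subr_gt0.
have L1 : 0 < L + 1 by rewrite ltr_wpDl.
pose l := d / (4 * (L + 1)); have l0 : 0 < l by rewrite divr_gt0// mulr_gt0.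
pose c := 2 * L + L * (shi ^+ 2 / (2 * l)) + 1.
have c0 : 0 < c.
  rewrite ltr_wpDl//; apply: addr_ge0; apply: mulr_ge0 => //.
  apply: divr_ge0; [exact: sqr_ge0|apply: mulr_ge0 => //; exact: ltW].
pose e := d / (8 * c); have e0 : 0 < e by rewrite divr_gt0// mulr_gt0.
have Ll : L * l <= d / 4.
  apply: (@le_trans _ _ ((L + 1) * l)); first by rewrite ler_wpM2r ?(ltW l0)// lerDl.
  by rewrite le_eqVlt; apply/orP; left; apply/eqP; rewrite /l; field; rewrite gt_eqF.
have ce : (2 * L + L * (shi ^+ 2 / (2 * l))) * e <= d / 8.
  apply: (@le_trans _ _ (c * e)); first by rewrite ler_wpM2r ?(ltW e0)// lerDl.
  by rewrite le_eqVlt; apply/orP; left; apply/eqP; rewrite /e; field; rewrite gt_eqF.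
have := key e l e0 l0.
have -> : 2 * (2 * L * e + L * (e * shi ^+ 2 / (2 * l) + l / 2)) =
   2 * ((2 * L + L * (shi ^+ 2 / (2 * l))) * e) + L * l by field; rewrite gt_eqF.
have : u t y = gval phi t y + d by rewrite /d; ring.
move: Ll ce d0; clear; lra.
Qed.

Lemma bounded_halfplane (u : R -> R -> R) :
  [bounded u q.1 q.2 | q in [set q : R * R | 0 <= q.1]] ->
  exists M, forall t y, 0 <= t -> `|u t y| <= M.
Proof.
move=> /pinfty_ex_gt0[M M0 H]; exists M => t y t0.
by have := H (t, y); apply.
Qed.

Lemma solution_unique phi L Mf u t y : lip L phi -> bdd Mf phi ->
  viscosity_solution slo shi phi u -> 0 <= t -> u t y = gval phi t y.
Proof.
move=> phiL phiM [cu /bounded_halfplane[M uM] u0 us uS] t0.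
apply/eqP; rewrite eq_le; apply/andP; split.
  apply: (@sub_le_val phi L Mf u M t y phiL phiM us cu _ _ t0).
    by move=> s z s0; rewrite (le_trans (ler_norm _))// uM.
  by move=> z; rewrite u0.
apply: (@super_ge_val _ slo shi slo0 slohi u M uS cu _ phi L Mf t y phiL phiM _ t0).
  by move=> s z s0; rewrite lerNl (le_trans (ler_norm _))// normrN uM.
by move=> z; rewrite u0.
Qed.

(** The solution picked by choice is the ultralimit, which inherits monotonicity, sublinearity and
    translation invariance from the scheme. *)
Lemma GheatE phi L Mf t y : lip L phi -> bdd Mf phi -> 0 <= t ->
  Gheat slo shi phi t y = gval phi t y.
Proof.
move=> phiL phiM t0; rewrite /Gheat; case: xgetP => [u _ us|/(_ (gval phi))[]].
  exact: solution_unique phiL phiM us t0.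
exact: val_solution phiM phiL.
Qed.

                                                                         
                                         
(** Rounding to whole time steps breaks exact composition in the scheme, but the time-shifted value
    function solves the equation with datum [gval phi s], so uniqueness gives the identity. *)
Lemma val_semigroup phi L M s t y : lip L phi -> bdd M phi -> 0 <= s -> 0 <= t ->
  gval phi (t + s) y = gval (gval phi s) t y.
Proof.
move=> phiL phiM s0 t0.
have vL := val_lip slo shi phiM phiL s; have vM := val_bdd slo shi phiM s.
apply: (@solution_unique _ L M (fun t y => gval phi (t + s) y) t y vL vM _ t0).
have quadD (a b : R) : a + s - (b + s) = a - b by ring.
split.
- have mc : modc (fun t y => gval phi (t + s) y).
    have := modc_shift s 0 (val_modc slo0 slohi phiM phiL); congr modc.
    by apply/funext => a; apply/funext => b; rewrite addr0.
  by apply: continuous_subspaceT; exact: (modc_c2 mc).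
- exists M; split; first exact: num_real.
  move=> M' MM' q /= _; apply: le_trans (ltW MM').
  exact: (val_bdd _ _ phiM).
- by move=> z; rewrite add0r.
- apply: (@dpp_visc_sub _ G (shi ^+ 2) M (shi ^+ 2) (fun t y => gval phi (t + s) y)).
  + exact: sqr_ge0.
  + exact: GfunD.
  + by move=> a; exact: (val_bdd _ _ phiM).
  + move=> a b z A p c C a0 ab C0 H; rewrite -(quadD b a).
    by apply: (val_quad_le slo0 slohi phiM phiL) => //; [exact: addr_ge0|rewrite lerD2r].
- apply: viscosity_superN'.
  apply: (@dpp_visc_sub _ (Gneg slo shi) (shi ^+ 2) M (shi ^+ 2) (fun t y => - gval phi (t + s) y)).
  + exact: sqr_ge0.
  + exact: GnegD.
  + by move=> a z; rewrite normrN; exact: (val_bdd _ _ phiM).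
  + move=> a b z A p c C a0 ab C0 H; rewrite -(quadD b a).
    have H' x : quad (- A) (- p) (- c) (- C) (x - z) <= gval phi (a + s) x.
      by have := H x; rewrite /quad; clear; lra.
    have abs : a + s <= b + s by rewrite lerD2r.
    have := val_quad_ge slo0 slohi phiM phiL (addr_ge0 a0 s0) abs C0 H'.
    by rewrite /Gneg mulrN; clear; lra.
Qed.

Lemma val_mono phi psi M M' t y : bdd M phi -> bdd M' psi ->
  (forall z, phi z <= psi z) -> gval phi t y <= gval psi t y.
Proof.
move=> phiM psiM pp; apply: le_ulim; [exact: VN_bdd_seq phiM _ _|exact: VN_bdd_seq psiM _ _|].
by move=> N; apply: sl_mono => //; apply: sublin_iter; exact: sublin_T.
Qed.

Lemma bddD f g M M' : bdd M f -> bdd M' g -> bdd (M + M') (fun z => f z + g z).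
Proof. by move=> fM gM z; rewrite (le_trans (ler_normD _ _))// lerD. Qed.

Lemma bddZ c f M : bdd M f -> bdd (`|c| * M) (fun z => c * f z).
Proof. by move=> fM z; rewrite normrM ler_wpM2l. Qed.

Lemma val_add phi psi M M' t y : bdd M phi -> bdd M' psi ->
  gval (fun z => phi z + psi z) t y <= gval phi t y + gval psi t y.
Proof.
move=> phiM psiM.
have bp := VN_bdd_seq slo shi phiM t y; have bq := VN_bdd_seq slo shi psiM t y.
rewrite -(ulimD bp bq); apply: le_ulim; [exact: VN_bdd_seq (bddD phiM psiM) _ _|exact: bdd_seqD|].
by move=> N; apply: sl_add; apply: sublin_iter; exact: sublin_T.
Qed.

Lemma val_hom phi M c t y : bdd M phi -> 0 <= c ->
  gval (fun z => c * phi z) t y = c * gval phi t y.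
Proof.
move=> phiM c0; rewrite -(ulimZ c (VN_bdd_seq slo shi phiM t y)).
congr ulim; apply/funext => N; apply: sl_hom => //.
by apply: sublin_iter; exact: sublin_T.
Qed.

Lemma val_cst phi M c t y : bdd M phi ->
  gval (fun z => phi z + c) t y = gval phi t y + c.
Proof.
move=> phiM; rewrite -[in RHS](ulim_cst c).
rewrite -(ulimD (VN_bdd_seq slo shi phiM t y) (bdd_seq_cst c)).
congr ulim; apply/funext => N; apply: sl_cst.
by apply: sublin_iter; exact: sublin_T.
Qed.

Lemma val_shift phi a t y : gval (fun z => phi (z + a)) t y = gval phi t (y + a).
Proof.
congr ulim; apply/funext => N; apply: sl_shift.
by apply: sublin_iter; exact: sublin_T.
Qed.

Lemma val_pow4 M t : 0 <= M -> 0 <= t ->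
  gval (fun z => Num.min (z ^+ 4) M) t 0 <= 3 * (t * shi ^+ 2) ^+ 2.
Proof.
move=> M0 t0.
have bM : bdd M (fun z => Num.min (z ^+ 4) M).
  move=> z; rewrite ger0_norm; first by rewrite ge_min lexx orbT.
  by rewrite le_min M0 exprn_even_ge0.
rewrite -(ulim_cst (3 * (t * shi ^+ 2) ^+ 2)).
apply: le_ulim; [exact: VN_bdd_seq bM _ _|exact: bdd_seq_cst|move=> N].
have sT := sublin_iter (kt N t) (sublin_T slo shi N).
apply: (@le_trans _ _ (iter (kt N t) (Top slo shi N) (fun z => z ^+ 4) 0)).
  by apply: sl_mono => // z; rewrite ge_min lexx.
apply: (le_trans (iterT_pow4 slo0 slohi _ _ _)).
rewrite !expr0n /= mulr0 !add0r ler_wpM2l// lerXn2r ?nnegrE//.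
- by rewrite mulr_ge0 ?sqr_ge0// mulr_ge0// ltW// dl_gt0.
- by rewrite mulr_ge0 ?sqr_ge0.
- by rewrite ler_wpM2r ?sqr_ge0// kt_le.
Qed.

End subsolution.

                                                          

(** * Bumped paths and cylinder functions *)

Section paths.
Context {R : realType}.
Implicit Types (w : Omega R) (t s a b : R).

Lemma B_continuous w : continuous (fun t => B t w).
Proof. by have [] := set_valP (w : cpath R). Qed.

Lemma B_le0 t w : t <= 0 -> B t w = 0.
Proof. by have [_] := set_valP (w : cpath R); apply. Qed.

Lemma Omega_eq w w' : (forall t, B t w = B t w') -> w = w'.
Proof. by move=> H; apply: val_inj; apply/funext => t; exact: H. Qed.

Definition path_of (f : R -> R) : Omega R :=
  if pselect (cpaths f) is left h then SigSub (mem_set h) else cpath0.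

Lemma path_ofE f t : cpaths f -> B t (path_of f) = f t.
Proof. by rewrite /path_of; case: pselect. Qed.

Lemma B_stop t s w : B s (stop t w) = B (Num.min s t) w.
Proof. by []. Qed.

(** For a = b the quotient is 0 by the convention on division, so the ramp vanishes identically
    ([ramp_id]); zero-length steps are treated apart below for this reason. *)
Definition ramp a b t : R := Num.max 0 (Num.min 1 ((t - a) / (b - a))).

Lemma ramp_le a b t : a <= b -> t <= a -> ramp a b t = 0.
Proof.
move=> ab ta; apply/max_idPl; rewrite ge_min; apply/orP; right.
by rewrite mulr_le0_ge0 ?subr_le0// invr_ge0 subr_ge0.
Qed.

Lemma ramp_ge a b t : a < b -> b <= t -> ramp a b t = 1.
Proof.
move=> ab bt; rewrite /ramp (min_idPl _); first by apply/max_idPr.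
by rewrite ler_pdivlMr ?subr_gt0// mul1r lerD2r.
Qed.

Lemma ramp_id a t : ramp a a t = 0.
Proof. by rewrite /ramp subrr invr0 mulr0 (min_idPr _)// maxxx. Qed.

Lemma ramp_itv a b t : 0 <= ramp a b t <= 1.
Proof. by rewrite /ramp le_max lexx/= ge_max ler01 ge_min lexx. Qed.

Lemma ramp_continuous a b : continuous (ramp a b).
Proof.
move=> t; have h : {for t, continuous (fun t => (t - a) / (b - a))}.
  by apply: cvgMl; apply: cvgB; [exact: cvg_id|exact: cvg_cst].
have h1 : {for t, continuous (fun t => Num.min 1 ((t - a) / (b - a)))}.
  by apply: (@continuous_min _ _ (fun=> 1)) => //; exact: cvg_cst.
have h2 : {for t, continuous (fun t => Num.max 0 (Num.min 1 ((t - a) / (b - a))))}.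
  by apply: (@continuous_max _ _ (fun=> 0)) => //; exact: cvg_cst.
exact: h2.
Qed.

Definition bump a b w (y : R) : Omega R :=
  path_of (fun t => B (Num.min t a) w + y * ramp a b t).

Lemma B_bump a b w y t : 0 <= a -> a <= b ->
  B t (bump a b w y) = B (Num.min t a) w + y * ramp a b t.
Proof.
move=> a0 ab; apply: path_ofE; split => [s|s s0].
  have h1 : {for s, continuous (fun s => B (Num.min s a) w)}.
    by have [cw _] := set_valP (stop a w : cpath R); exact: cw.
  have h2 : {for s, continuous (fun s => y * ramp a b s)}.
    by apply: cvgMr; exact: ramp_continuous.
  exact: (cvgD h1 h2).
rewrite B_le0 ?ramp_le ?mulr0 ?addr0//; last by rewrite ge_min s0.
exact: le_trans a0.
Qed.

Lemma bump_id a w y : 0 <= a -> bump a a w y = stop a w.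
Proof.
by move=> a0; apply: Omega_eq => t; rewrite B_bump// ramp_id mulr0 addr0.
Qed.

Lemma bump_stop a b w y : 0 <= a -> a <= b -> bump a b (stop a w) y = bump a b w y.
Proof.
by move=> a0 ab; apply: Omega_eq => t; rewrite !B_bump// B_stop -minA minxx.
Qed.

Definition gap (g : seq R) w w' : R := \sum_(s <- g) `|B s w - B s w'|.

(** Stated for functionals of the path instead of functions of vectors, so that one functional can
    be presented on different grids. *)
Definition cyl (g : seq R) (L M : R) (F : Omega R -> R) : Prop :=
  [/\ 0 <= L, forall w, `|F w| <= M &
      forall w w', `|F w - F w'| <= L * gap g w w'].

Lemma gap_ge0 g w w' : 0 <= gap g w w'.
Proof. by apply: sumr_ge0. Qed.

Lemma gap_cat g g' w w' : gap (g ++ g') w w' = gap g w w' + gap g' w w'.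
Proof. by rewrite /gap big_cat. Qed.

Lemma cyl_eq g L M F w w' : cyl g L M F -> (forall s, s \in g -> B s w = B s w') ->
  F w = F w'.
Proof.
move=> [_ _ H] E; apply/eqP; rewrite -subr_eq0 -normr_le0 (le_trans (H w w'))//.
by rewrite /gap big_seq big1 ?mulr0// => s /E ->; rewrite subrr normr0.
Qed.

Lemma cyl_stop g L M F a w : cyl g L M F -> (forall s, s \in g -> s <= a) ->
  F (stop a w) = F w.
Proof.
by move=> cF ga; apply: (cyl_eq cF) => s /ga sa; rewrite B_stop (min_idPl sa).
Qed.

Lemma cyl_bump g L M F a b w : 0 <= a -> a <= b -> cyl g L M F ->
  bdd M (fun y => F (bump a b w y)) /\
  lip (L * (size g)%:R) (fun y => F (bump a b w y)).
Proof.
move=> a0 ab [L0 FM FL]; split => [y|x y]; first exact: FM.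
rewrite (le_trans (FL _ _))// -mulrA ler_wpM2l// mulrC /gap -sum1_size natr_sum.
rewrite mulr_sumr; apply: ler_sum => s _; rewrite !B_bump// mulr1.
rewrite opprD addrACA subrr add0r -mulrBl normrM ler_piMr//.
by have /andP[r0 r1] := ramp_itv a b s; rewrite ger0_norm.
Qed.

End paths.

(** * Backward evolution of path functionals over a grid *)

Section evolution.
Context {R : realType}.
Variables (slo shi : R).
Hypotheses (slo0 : 0 <= slo) (slohi : slo <= shi).
Implicit Types (F H : Omega R -> R) (a b c : R) (g s : seq R).

Local Notation gval := (gval slo shi).

                                                                                              
                                                                                           
(** One step of the backward recursion, acting on functionals: the increment over [a, b] is
    integrated out by the G-heat flow. *)
Definition evol a b F (w : Omega R) : R :=
  gval (fun y => F (bump a b w y)) (b - a) 0.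

Lemma evol_id a F w : 0 <= a -> evol a a F w = F (stop a w).
Proof. by move=> a0; rewrite /evol subrr val_le0// bump_id. Qed.

Lemma evol_stop a b F w : 0 <= a -> a <= b -> evol a b F (stop a w) = evol a b F w.
Proof.
move=> a0 ab; rewrite /evol; congr (gval _ _ _); apply/funext => y.
by rewrite bump_stop.
Qed.

Lemma val_csts (k : R) t y : gval (fun=> k) t y = k.
Proof.
rewrite /gval (_ : (fun N => _) = fun=> k) ?ulim_cst//; apply/funext => N.
by apply: sl_csts; apply: sublin_iter; exact: sublin_T.
Qed.

Lemma val_dist (f h : R -> R) (M M' e t y : R) : bdd M f -> bdd M' h ->
  (forall z, `|f z - h z| <= e) -> `|gval f t y - gval h t y| <= e.
Proof.
move=> fM hM fh.
have bD k : bdd (M' + `|k|) (fun z => h z + k).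
  by move=> z; rewrite (le_trans (ler_normD _ _))// lerD2r.
rewrite ler_norml; apply/andP; split.
  rewrite lerBrDr addrC -(val_cst slo shi (- e) t y hM).
  apply: (val_mono slo shi t y (bD _) fM) => z.
  by have := fh z; rewrite ler_norml => /andP[]; lra.
rewrite lerBlDr addrC -(val_cst slo shi e t y hM).
apply: (val_mono slo shi t y fM (bD _)) => z.
by have := fh z; rewrite ler_norml => /andP[]; lra.
Qed.

Lemma evol_cyl a b g L M F : 0 <= a -> a <= b -> cyl g L M F ->
  cyl (map (Num.min^~ a) g) L M (evol a b F).
Proof.
move=> a0 ab cF; have [L0 FM FL] := cF; split => // [w|w w'].
  by apply: (val_bdd slo shi (M := M)) => y; exact: FM.
apply: (@val_dist _ _ M M) => [y|y|y]; [exact: FM..|].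
rewrite (le_trans (FL _ _))// ler_wpM2l// /gap big_map; apply: ler_sum => x _.
by rewrite !B_bump// opprD addrACA subrr addr0.
Qed.

(** When no time of the grid lies strictly between a and c, successive bumps y and z look like one
    bump y + z, and [val_semigroup] applies. Empty intervals are separate cases because their ramp
    is zero. *)
Lemma evol_semigroup a b c g L M F : 0 <= a -> a <= b -> b <= c -> cyl g L M F ->
  (forall x, x \in g -> (x <= a) || (c <= x)) ->
  evol a b (evol b c F) = evol a c F.
Proof.
move=> a0 ab bc cF gac; apply/funext => w.
have b0 : 0 <= b by exact: le_trans ab.
have c0 : 0 <= c by exact: le_trans bc.
have ac : a <= c by exact: le_trans bc.
have [->|nab] := eqVneq a b; first by rewrite evol_id// evol_stop.
have [E|nbc] := eqVneq b c.
  subst c; have ltab : a < b by rewrite lt_neqAle nab.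
  rewrite /evol; congr (gval _ _ _); apply/funext => y; rewrite -/(evol b b F _) evol_id//.
  apply: (cyl_eq cF) => x /gac/orP[xa|cx].
    by rewrite B_stop (min_idPl (le_trans xa ac)).
  rewrite B_stop (min_idPr cx) !B_bump// (min_idPr ac) (min_idPr (le_trans ac cx)).
  by rewrite !ramp_ge.
have ltab : a < b by rewrite lt_neqAle nab.
have ltbc : b < c by rewrite lt_neqAle nbc.
have ltac : a < c by exact: lt_trans ltbc.
have [fM fL] := cyl_bump w a0 ac cF.
pose f y := F (bump a c w y).
rewrite /evol -/f; have -> : c - a = (b - a) + (c - b) by ring.
rewrite (val_semigroup slo0 slohi _ fL fM) ?subr_ge0//.
congr (gval _ _ _); apply/funext => y.
rewrite -[y in RHS]add0r -val_shift; congr (gval _ _ _); apply/funext => z.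
apply: (cyl_eq cF) => x /gac/orP[xa|cx].
  rewrite !B_bump// (min_idPl (le_trans xa ab)) !ramp_le//; last exact: le_trans ab.
  by rewrite !mulr0 !addr0.
have ax := le_trans ac cx; have bx := le_trans bc cx.
rewrite !B_bump// (min_idPr bx) (min_idPr ab) (min_idPr ax) !ramp_ge//.
by rewrite !mulr1 -addrA [y + z]addrC.
Qed.

Fixpoint cnd a s F : Omega R -> R :=
  if s is b :: s' then evol a b (cnd b s' F) else fun w => F (stop a w).

Lemma cyl_stop_map a g L M F : cyl g L M F ->
  cyl (map (Num.min^~ a) g) L M (fun w => F (stop a w)).
Proof.
move=> [L0 FM FL]; split => // w w'; rewrite (le_trans (FL _ _))// /gap big_map.
by [].
Qed.

Lemma cnd_cyl a s g L M F : 0 <= a -> path <=%R a s -> cyl g L M F ->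
  cyl (map (Num.min^~ a) g) L M (cnd a s F).
Proof.
elim: s a => [|b s IH] a a0 /= => [_|/andP[ab bs]] cF; first exact: cyl_stop_map.
have := evol_cyl a0 ab (IH _ (le_trans a0 ab) bs cF); rewrite -map_comp.
congr cyl; apply: eq_map => x /=; by rewrite -minA (min_idPr ab).
Qed.

Lemma cnd_stop a s F w : 0 <= a -> path <=%R a s -> cnd a s F (stop a w) = cnd a s F w.
Proof.
case: s => [|b s] a0 /= => [_|/andP[ab _]]; last exact: evol_stop.
by congr F; apply: Omega_eq => t; rewrite !B_stop -minA minxx.
Qed.

Lemma cnd_indep_lt a b b' s s' g L M F : 0 <= a -> a <= b -> b < b' ->
  path <=%R b' s' -> cyl g L M F ->
  (forall x, x \in g -> (x <= a) || (x \in b' :: s')) ->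
  cnd a (b' :: s') F = evol a b (cnd b (b' :: s') F).
Proof.
move=> a0 ab bb' ps' cF gs' /=.
have ab' := le_trans ab (ltW bb').
have cH := cnd_cyl (le_trans a0 ab') ps' cF.
rewrite (evol_semigroup a0 ab (ltW bb') cH)// => x /mapP[y yg ->].
have [//|ys'] := orP (gs' _ yg); first by move=> ya; rewrite ge_min ya.
have b'y : b' <= y.
  move: ys'; rewrite inE => /predU1P[->//|ys'].
  by have /allP/(_ _ ys') := order_path_min le_trans ps'.
by rewrite le_min b'y lexx orbT.
Qed.

(** Induction on the total number of grid points: [evol_semigroup] inserts the smaller of the two
    leading points into the other grid, after which both start with the same evolution and the tails
    are compared. *)
Lemma cnd_indep a s s' g L M F : 0 <= a -> path <=%R a s -> path <=%R a s' ->
  cyl g L M F ->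
  (forall x, x \in g -> (x <= a) || (x \in s)) ->
  (forall x, x \in g -> (x <= a) || (x \in s')) ->
  cnd a s F = cnd a s' F.
Proof.
have [n] := ubnP (size s + size s'); elim: n => // n IH in a s s' *.
have nil b t c : 0 <= c -> (size t < n)%N -> c <= b -> path <=%R b t -> cyl g L M F ->
    (forall x, x \in g -> (x <= c) || (x \in b :: t)) ->
    (forall x, x \in g -> (x <= c) || (x \in [::])) ->
    cnd c (b :: t) F = cnd c [::] F.
  move=> c0 tn cb bt cF gs gn /=.
  have gc x : x \in g -> x <= c by move=> /gn; rewrite in_nil orbF.
  have b0 := le_trans c0 cb.
  rewrite (IH b t [::])//; last 2 first.
  - by move=> x /gc xc; rewrite (le_trans xc cb).
  - by move=> x /gc xc; rewrite (le_trans xc cb).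
  - apply/funext => w /=; rewrite /evol (_ : (fun y => _) = fun=> F (stop c w)).
      by rewrite val_csts.
    apply/funext => y; rewrite -[RHS](cyl_stop _ cF gc).
    have gb x : x \in g -> x <= b by move=> /gc xc; rewrite (le_trans xc).
    rewrite (cyl_stop _ cF gb) (cyl_stop _ cF gc).
    by apply: (cyl_eq cF) => x /gc xc; rewrite B_bump// B_stop !(min_idPl xc) ramp_le// mulr0 addr0.
  by rewrite addn0; exact: tn.
move=> sz a0 pa pa' cF gs gs'.
case: s => [|b t] in sz pa gs *; case: s' => [|b' t'] in sz pa' gs' *.
- by [].
- by symmetry; move: pa' => /= /andP[ab bt]; apply: nil => //; rewrite -ltnS (leq_trans _ sz).
- by move: pa => /= /andP[ab bt]; apply: nil => //; move: sz; rewrite /= addn0 ltnS.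
move: (pa) (pa') => /= /andP[ab bt] /andP[ab' bt'].
have b0 := le_trans a0 ab; have b'0 := le_trans a0 ab'.
have sub c t1 x : a <= c -> (x <= a) || (x \in c :: t1) -> (x <= c) || (x \in t1).
  move=> ac; rewrite inE => /orP[xa|/predU1P[->|->]]; last by rewrite orbT.
    by rewrite (le_trans xa).
  by rewrite lexx.
have sub2 c t1 x : a <= c -> (x <= a) || (x \in t1) -> (x <= c) || (x \in t1).
  by move=> ac /orP[xa|->]; rewrite ?orbT// (le_trans xa).
have [bb'|b'b|E] := ltgtP b b'.
- rewrite -[RHS]/(cnd a (b' :: t') F) (@cnd_indep_lt a b b' [::] t' g L M F)//=.
  congr evol; apply: (IH b t (b' :: t')) => //=; last 3 first.
  + by rewrite (ltW bb').
  + by move=> x /gs; exact: sub.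
  + by move=> x /gs'; exact: sub2.
- symmetry; rewrite -[LHS]/(cnd a (b' :: t') F) -[RHS]/(cnd a (b :: t) F) (@cnd_indep_lt a b' b [::] t g L M F)//=.
  congr evol; apply: (IH b' t' (b :: t)) => //=; last 3 first.
  + by rewrite (ltW b'b).
  + by move=> x /gs'; exact: sub.
  + by move=> x /gs; exact: sub2.
  by move: sz; clear; rewrite /=; lia.
- rewrite -E in bt' gs' *; congr evol; apply: (IH b t t') => //.
  + by move: sz; rewrite /= addSn addnS !ltnS => /ltnW; apply: leq_trans.
  + by move=> x /gs; exact: sub.
  + by move=> x /gs'; exact: sub.
Qed.

End evolution.

(** * The algebra and lattice of cylinder functions *)

Section cylinder_class.
Context {R : realType}.
Implicit Types (F H Z : Omega R -> R) (t a b c L M : R) (g : seq R).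

Definition CLt t : set (Omega R -> R) := [set F | exists g L M,
  (forall x, x \in g -> 0 <= x <= t) /\ cyl g L M F].

Definition CL : set (Omega R -> R) := [set F | exists2 t, 0 <= t & CLt t F].

Lemma cyl_catl g g' L M F : cyl g L M F -> cyl (g ++ g') L M F.
Proof.
move=> [L0 FM FL]; split=> // w w'; rewrite (le_trans (FL _ _))// ler_wpM2l//.
by rewrite gap_cat lerDl gap_ge0.
Qed.

Lemma cyl_catr g g' L M F : cyl g L M F -> cyl (g' ++ g) L M F.
Proof.
move=> [L0 FM FL]; split=> // w w'; rewrite (le_trans (FL _ _))// ler_wpM2l//.
by rewrite gap_cat lerDr gap_ge0.
Qed.

Lemma CLt_le (t t' : R) F : t <= t' -> CLt t F -> CLt t' F.
Proof.
move=> tt' [g [L [M [gt cF]]]]; exists g, L, M; split => // x /gt/andP[x0 xt].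
by rewrite x0 (le_trans xt).
Qed.

Lemma CL_common F H : CL F -> CL H -> exists2 t, 0 <= t & CLt t F /\ CLt t H.
Proof.
move=> [t t0 Ft] [t' t'0 Ht]; exists (Num.max t t'); first by rewrite le_max t0.
by split; [apply: CLt_le Ft|apply: CLt_le Ht]; rewrite le_max lexx ?orbT.
Qed.

Lemma CLt_CL t F : 0 <= t -> CLt t F -> CL F.
Proof. by move=> t0 Ft; exists t. Qed.

Lemma CLt_bdd t F : CLt t F -> exists2 M, 0 <= M & forall w, `|F w| <= M.
Proof.
move=> [g [L [M [_ [_ FM _]]]]]; exists M => //.
exact: le_trans (FM (cpath0 : Omega R)).
Qed.

Lemma CL_bdd F : CL F -> exists2 M, 0 <= M & forall w, `|F w| <= M.
Proof. by move=> [t _ /CLt_bdd]. Qed.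

Lemma CLt_stop t F w : CLt t F -> F (stop t w) = F w.
Proof.
by move=> [g [L [M [gt cF]]]]; apply: (cyl_stop _ cF) => s /gt/andP[].
Qed.

Lemma CLt_bump t b F w y : 0 <= t -> t <= b -> CLt t F -> F (bump t b w y) = F w.
Proof.
move=> t0 tb [g [L [M [gt cF]]]]; apply: (cyl_eq cF) => s /gt/andP[_ st].
by rewrite B_bump// (min_idPl st) ramp_le// mulr0 addr0.
Qed.

Lemma CLt0_cst F w w' : CLt 0 F -> F w = F w'.
Proof.
move=> [g [L [M [gt cF]]]]; apply: (cyl_eq cF) => s /gt/andP[_ st].
by rewrite !B_le0.
Qed.

Lemma CLt_cst t (k : R) : CLt t (fun=> k).
Proof.
exists [::], 0, `|k|; split => //; split => // w w'.
by rewrite subrr normr0 mul0r.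
Qed.

Lemma CLt_B2 t (r s : R) (phi : R -> R) L M : 0 <= r <= t -> 0 <= s <= t ->
  lip L phi -> bdd M phi -> CLt t (fun w => phi (B s w - B r w)).
Proof.
move=> rt st pL pM; exists [:: s; r], L, M; split.
  by move=> x; rewrite !inE => /orP[]/eqP->.
have L0 : 0 <= L by exact: lip_ge0 pL.
split=> [//|w|w w']; first exact: pM.
rewrite (le_trans (pL _ _))// ler_wpM2l// /gap !big_cons big_nil addr0.
rewrite (_ : _ - _ = (B s w - B s w') - (B r w - B r w')); last by ring.
exact: ler_normB.
Qed.

(** Cylinder functions are bounded, so phi needs to be Lipschitz on bounded squares only, which
    covers products. *)
Lemma CLt_comp2 t F H (phi : R -> R -> R) :
  (forall M, 0 <= M -> exists2 C, 0 <= C & forall x y x' y',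
    `|x| <= M -> `|y| <= M -> `|x'| <= M -> `|y'| <= M ->
    `|phi x y - phi x' y'| <= C * (`|x - x'| + `|y - y'|)) ->
  CLt t F -> CLt t H -> CLt t (fun w => phi (F w) (H w)).
Proof.
move=> hphi [g [L [M [gt cF]]]] [g' [L' [M' [gt' cH]]]].
have [L0 FM FL] := cF; have [L0' HM HL] := cH.
have M0 : 0 <= M by exact: le_trans (FM (cpath0 : Omega R)).
have M'0 : 0 <= M' by exact: le_trans (HM (cpath0 : Omega R)).
have [C C0 hC] := hphi (M + M') (addr_ge0 M0 M'0).
have FM2 w : `|F w| <= M + M' by rewrite (le_trans (FM w))// lerDl.
have HM2 w : `|H w| <= M + M' by rewrite (le_trans (HM w))// lerDr.
exists (g ++ g'), (C * (L + L')), (`|phi 0 0| + C * ((M + M') + (M + M'))); split.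
  by move=> x; rewrite mem_cat => /orP[/gt|/gt'].
split; first by rewrite mulr_ge0// addr_ge0.
  move=> w; have h0 : `|0 : R| <= M + M' by rewrite normr0 addr_ge0.
  have := hC _ _ _ _ (FM2 w) (HM2 w) h0 h0; rewrite !subr0 => h.
  rewrite -[phi (F w) _](subrK (phi 0 0)) addrC (le_trans (ler_normD _ _))// lerD2l.
  by rewrite (le_trans h)// ler_wpM2l// lerD.
move=> w w'; rewrite (le_trans (hC _ _ _ _ (FM2 w) (HM2 w) (FM2 w') (HM2 w')))//.
rewrite -mulrA ler_wpM2l// gap_cat.
have := FL w w'; have := HL w w'.
have := mulr_ge0 L0 (gap_ge0 g' w w'); have := mulr_ge0 L0' (gap_ge0 g w w').
by lra.
Qed.

Lemma CLt_add t F H : CLt t F -> CLt t H -> CLt t (fun w => F w + H w).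
Proof.
apply: (CLt_comp2 (phi := fun x y => x + y)) => M M0; exists 1 => // x y x' y' _ _ _ _.
by rewrite mul1r opprD addrACA ler_normD.
Qed.

Lemma CLt_mul t F H : CLt t F -> CLt t H -> CLt t (fun w => F w * H w).
Proof.
apply: (CLt_comp2 (phi := fun x y => x * y)) => M M0; exists M => // x y x' y' hx hy hx' hy'.
have -> : x * y - x' * y' = (x - x') * y + x' * (y - y') by ring.
rewrite (le_trans (ler_normD _ _))// !normrM mulrDr lerD//.
  by rewrite mulrC ler_wpM2r.
by rewrite ler_wpM2r.
Qed.

Lemma CLt_max t F H : CLt t F -> CLt t H -> CLt t (fun w => Num.max (F w) (H w)).
Proof.
apply: (CLt_comp2 (phi := fun x y => Num.max x y)) => M M0; exists 1 => // x y x' y' _ _ _ _.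
rewrite mul1r; have h1 := ler_norm (x - x'); have h2 := ler_norm (y - y').
have := ler_norm (- (x - x')); have := ler_norm (- (y - y')); rewrite !normrN => h3 h4.
rewrite ler_norml; case: (leP x y) => ?; case: (leP x' y') => ?; apply/andP; split;
  have := normr_ge0 (x - x'); have := normr_ge0 (y - y'); lra.
Qed.

Lemma CLt_scale t k F : CLt t F -> CLt t (fun w => k * F w).
Proof. by move=> Ft; apply: CLt_mul => //; exact: CLt_cst. Qed.

Lemma CLt_opp t F : CLt t F -> CLt t (fun w => - F w).
Proof.
move=> /(CLt_scale (-1)); rewrite (_ : (fun w => -1 * _) = (fun w => - F w))//.
by apply/funext => w; rewrite mulN1r.
Qed.

Lemma CLt_sub t F H : CLt t F -> CLt t H -> CLt t (fun w => F w - H w).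
Proof. by move=> Ft /CLt_opp; exact: CLt_add. Qed.

Lemma CLt_min t F H : CLt t F -> CLt t H -> CLt t (fun w => Num.min (F w) (H w)).
Proof.
move=> Ft Ht; have := CLt_opp (CLt_max (CLt_opp Ft) (CLt_opp Ht)).
by under eq_fun do rewrite oppr_max !opprK.
Qed.

Lemma CLt_abs t F : CLt t F -> CLt t (fun w => `|F w|).
Proof.
move=> Ft; have := CLt_max Ft (CLt_opp Ft); congr CLt; apply/funext => w.
by case: (leP 0 (F w)) => h; rewrite ?(ger0_norm h) ?(ltr0_norm h); [apply/max_idPl|apply/max_idPr]; lra.
Qed.

Lemma CLt_sum t n (F : nat -> Omega R -> R) : (forall i, (i < n)%N -> CLt t (F i)) ->
  CLt t (fun w => \sum_(i < n) F i w).
Proof.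
elim: n => [_|n IH hF].
  by under eq_fun do rewrite big_ord0; exact: CLt_cst.
under eq_fun do rewrite big_ord_recr/=.
by apply: CLt_add; [apply: IH => i /ltnW; exact: hF|exact: hF].
Qed.

Lemma CL2 (op : R -> R -> R) :
  (forall t F H, CLt t F -> CLt t H -> CLt t (fun w => op (F w) (H w))) ->
  forall F H, CL F -> CL H -> CL (fun w => op (F w) (H w)).
Proof. by move=> h F H /CL_common FC /FC[t t0 [Ft Ht]]; exists t => //; exact: h. Qed.

Lemma CL_add F H : CL F -> CL H -> CL (fun w => F w + H w).
Proof. by apply: CL2 => t *; exact: CLt_add. Qed.

Lemma CL_sub F H : CL F -> CL H -> CL (fun w => F w - H w).
Proof. by apply: (CL2 (op := fun x y => x - y)) => t *; exact: CLt_sub. Qed.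

Lemma CL_mul F H : CL F -> CL H -> CL (fun w => F w * H w).
Proof. by apply: CL2 => t *; exact: CLt_mul. Qed.

Lemma CL_max F H : CL F -> CL H -> CL (fun w => Num.max (F w) (H w)).
Proof. by apply: CL2 => t *; exact: CLt_max. Qed.

Lemma CL_min F H : CL F -> CL H -> CL (fun w => Num.min (F w) (H w)).
Proof. by apply: CL2 => t *; exact: CLt_min. Qed.

Lemma CL_cst (k : R) : CL (fun=> k).
Proof. by exists 0 => //; exact: CLt_cst. Qed.

Lemma CL_scale k F : CL F -> CL (fun w => k * F w).
Proof. by move=> [t t0 Ft]; exists t => //; exact: CLt_scale. Qed.

Lemma CL_opp F : CL F -> CL (fun w => - F w).
Proof. by move=> [t t0 Ft]; exists t => //; exact: CLt_opp. Qed.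

Lemma CL_abs F : CL F -> CL (fun w => `|F w|).
Proof. by move=> [t t0 Ft]; exists t => //; exact: CLt_abs. Qed.

Definition tail t g : seq R := sort <=%R [seq x <- g | t <= x].

Lemma tail_path t g : path <=%R t (tail t g).
Proof.
rewrite path_min_sorted ?sort_le_sorted//.
by apply/allP => x; rewrite mem_sort mem_filter => /andP[].
Qed.

Lemma mem_tail t g x : x \in g -> (x <= t) || (x \in tail t g).
Proof. by move=> xg; rewrite mem_sort mem_filter xg andbT le_total. Qed.

End cylinder_class.

(** * Conditional expectation of cylinder functions *)

Section conditional_expectation.
Context {R : realType}.
Variables (slo shi : R).
Hypotheses (slo0 : 0 <= slo) (slohi : slo <= shi).
Implicit Types (F H Z : Omega R -> R) (t a b c : R) (g : seq R).

Local Notation gval := (gval slo shi).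
Local Notation cnd := (cnd slo shi).
Local Notation evol := (evol slo shi).

Lemma cnd_indep2 a s s' g g' L L' M M' F : 0 <= a -> path <=%R a s -> path <=%R a s' ->
  cyl g L M F -> cyl g' L' M' F ->
  (forall x, x \in g -> (x <= a) || (x \in s)) ->
  (forall x, x \in g' -> (x <= a) || (x \in s')) ->
  cnd a s F = cnd a s' F.
Proof.
move=> a0 as_ as' cF cF' gs gs'.
rewrite (cnd_indep slo0 slohi a0 as_ (tail_path a (g ++ g')) cF)//; last first.
  by move=> x xg; rewrite mem_tail// mem_cat xg.
rewrite -(cnd_indep slo0 slohi a0 as' (tail_path a (g ++ g')) cF')//.
by move=> x xg; rewrite mem_tail// mem_cat xg orbT.
Qed.

Definition ugrid a F s := path <=%R a s /\ exists g L M,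
  cyl g L M F /\ forall x, x \in g -> (x <= a) || (x \in s).

                                                                                            
                                     
(** The grid is picked by choice; by [cE_cnd] any grid containing the times of F after t computes
    the same function. *)
Definition cE t F := cnd t (xget [::] [set s | ugrid t F s]) F.

Lemma cE_cnd t F s : 0 <= t -> ugrid t F s -> cE t F = cnd t s F.
Proof.
move=> t0 us; rewrite /cE; have [p [g [L [M [cF gs]]]]] := us.
have [p' [g' [L' [M' [cF' gs']]]]] : ugrid t F (xget [::] [set s | ugrid t F s]).
  exact: (xgetPex [::] (ex_intro _ s us)).
exact: cnd_indep2 t0 p' p cF' cF gs' gs.
Qed.

Lemma ugrid_tail t g L M F : cyl g L M F -> ugrid t F (tail t g).
Proof.
move=> cF; split; first exact: tail_path.
by exists g, L, M; split => // x; exact: mem_tail.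
Qed.

Lemma cE_common t F H : 0 <= t -> CL F -> CL H ->
  exists g s L L' M M', [/\ path <=%R t s, cyl g L M F, cyl g L' M' H,
    cE t F = cnd t s F /\ cE t H = cnd t s H & forall G L M, cyl g L M G -> cE t G = cnd t s G].
Proof.
move=> t0 [_ _ [g [L [M [_ cF]]]]] [_ _ [g' [L' [M' [_ cH]]]]].
have cF2 := cyl_catl g' cF; have cH2 := cyl_catr g cH.
have h G L1 M1 : cyl (g ++ g') L1 M1 G -> cE t G = cnd t (tail t (g ++ g')) G.
  by move=> cG; apply: cE_cnd => //; exact: ugrid_tail cG.
exists (g ++ g'), (tail t (g ++ g')), L, L', M, M'; split => //; first exact: tail_path.
by split; [exact: h cF2|exact: h cH2].
Qed.

Lemma evol_mono a b g L M g' L' M' F H w : cyl g L M F -> cyl g' L' M' H ->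
  (forall w, F w <= H w) -> evol a b F w <= evol a b H w.
Proof.
move=> [_ FM _] [_ HM _] FH; apply: val_mono => y; [exact: FM|exact: HM|exact: FH].
Qed.

Lemma cnd_mono a s g L M g' L' M' F H w : 0 <= a -> path <=%R a s ->
  cyl g L M F -> cyl g' L' M' H ->
  (forall w, F w <= H w) -> cnd a s F w <= cnd a s H w.
Proof.
move=> a0 ps cF cH FH; elim: s a a0 w ps => [|b s IH] a a0 w /=; first by move=> _.
move=> /andP[ab bs]; have b0 := le_trans a0 ab.
by apply: evol_mono; [exact: cnd_cyl cF|exact: cnd_cyl cH|move=> w'; exact: IH].
Qed.

Lemma cyl_add g L M L' M' F H : cyl g L M F -> cyl g L' M' H ->
  cyl g (L + L') (M + M') (fun w => F w + H w).
Proof.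
move=> [L0 FM FL] [L0' HM HL]; split; first exact: addr_ge0.
  by move=> w; rewrite (le_trans (ler_normD _ _))// lerD.
move=> w w'; rewrite opprD addrACA (le_trans (ler_normD _ _))// mulrDl.
by rewrite lerD.
Qed.

Lemma cnd_add a s g L M L' M' F H w : 0 <= a -> path <=%R a s ->
  cyl g L M F -> cyl g L' M' H ->
  cnd a s (fun w => F w + H w) w <= cnd a s F w + cnd a s H w.
Proof.
move=> a0 ps cF cH; elim: s a a0 w ps => [|b s IH] a a0 w /=; first by move=> _.
move=> /andP[ab bs]; have b0 := le_trans a0 ab.
have cF' := cnd_cyl slo shi b0 bs cF; have cH' := cnd_cyl slo shi b0 bs cH.
have cS' := cnd_cyl slo shi b0 bs (cyl_add cF cH).
apply: (le_trans (evol_mono _ _ _ cS' (cyl_add cF' cH') (fun w => IH b b0 w bs))).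
have [_ FM _] := cF'; have [_ HM _] := cH'.
by apply: val_add => y; [exact: FM|exact: HM].
Qed.

(** Functions known at time a do not see later bumps, so inside each evolution they are constants.
    The factor has to be nonnegative because the flow is only positively homogeneous. *)
Lemma cnd_loc a s g L M g' L' M' F Z H : 0 <= a -> path <=%R a s ->
  cyl g L M F -> CLt a Z -> CLt a H -> (forall w, 0 <= Z w) ->
  cyl g' L' M' (fun w => Z w * F w + H w) ->
  cnd a s (fun w => Z w * F w + H w) = (fun w => Z w * cnd a s F w + H w).
Proof.
move=> a0 ps cF Za Ha Z0 cZ; elim: s a a0 Za Ha ps => [|b s IH] a a0 Za Ha /=.
  by move=> _; apply/funext => w; rewrite (CLt_stop _ Za) (CLt_stop _ Ha).
move=> /andP[ab bs]; have b0 := le_trans a0 ab.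
rewrite (IH b b0 (CLt_le ab Za) (CLt_le ab Ha) bs).
have [_ FM _] := cnd_cyl slo shi b0 bs cF.
apply/funext => w; rewrite /evol.
under eq_fun do rewrite (CLt_bump _ _ a0 ab Za) (CLt_bump _ _ a0 ab Ha).
have FM' : bdd M (fun y => cnd b s F (bump a b w y)) by move=> y; exact: FM.
rewrite (val_cst slo shi (H w) _ _ (bddZ (Z w) FM')).
by rewrite (val_hom slo shi _ _ FM' (Z0 w)).
Qed.

Lemma cnd_cat a b l l' g L M F : 0 <= a -> path <=%R a (l ++ b :: l') -> cyl g L M F ->
  cnd a (l ++ b :: l') F = cnd a (rcons l b) (cnd b l' F).
Proof.
move=> a0 + cF; elim: l a a0 => [|c l IH] a a0 /= /andP[ab pl].
  by congr evol; apply/funext => w; rewrite cnd_stop// (le_trans a0).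
by rewrite IH// (le_trans a0).
Qed.

Lemma cE_CLt t F : 0 <= t -> CL F -> CLt t (cE t F).
Proof.
move=> t0 [T _ [g [L [M [g0 cF]]]]]; rewrite (cE_cnd t0 (ugrid_tail t cF)).
exists (map (Num.min^~ t) g), L, M; split; last first.
  exact: (cnd_cyl _ _ _ (tail_path _ _)).
move=> x /mapP[y /g0 /andP[y0 _] ->]; rewrite ge_min lexx orbT andbT.
by rewrite le_min y0.
Qed.

Lemma cE_CL t F : 0 <= t -> CL F -> CL (cE t F).
Proof. by move=> t0 FC; exists t => //; exact: cE_CLt. Qed.

Lemma cE_id t F : 0 <= t -> CLt t F -> cE t F = F.
Proof.
move=> t0 Ft; have [g [L [M [gt cF]]]] := Ft.
rewrite (@cE_cnd t F [::])//=; first by apply/funext => w; exact: CLt_stop.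
by split => //; exists g, L, M; split => // x /gt/andP[_ ->].
Qed.

Lemma cE_mono t F H w : 0 <= t -> CL F -> CL H -> (forall w, F w <= H w) ->
  cE t F w <= cE t H w.
Proof.
move=> t0 FC HC FH; have [g [s [L [L' [M [M' [ps cF cH [-> ->] _]]]]]]] := cE_common t0 FC HC.
exact: cnd_mono ps cF cH FH.
Qed.

Lemma cE_add t F H w : 0 <= t -> CL F -> CL H ->
  cE t (fun w => F w + H w) w <= cE t F w + cE t H w.
Proof.
move=> t0 FC HC; have [g [s [L [L' [M [M' [ps cF cH [-> ->] h]]]]]]] := cE_common t0 FC HC.
by rewrite (h _ _ _ (cyl_add cF cH)); exact: cnd_add ps cF cH.
Qed.

Lemma cE_loc t F Z H : 0 <= t -> CL F -> CLt t Z -> CLt t H -> (forall w, 0 <= Z w) ->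
  cE t (fun w => Z w * F w + H w) = (fun w => Z w * cE t F w + H w).
Proof.
move=> t0 FC Zt Ht Z0.
have SC : CL (fun w => Z w * F w + H w).
  by apply: CL_add; [apply: CL_mul => //|]; exact: CLt_CL t0 _.
have [g [s [L [L' [M [M' [ps cF cS [-> ->] _]]]]]]] := cE_common t0 FC SC.
exact: cnd_loc ps cF Zt Ht Z0 cS.
Qed.

Lemma cE_sub t F H w : 0 <= t -> CL F -> CL H ->
  cE t F w - cE t H w <= cE t (fun w => F w - H w) w.
Proof.
move=> t0 FC HC; rewrite lerBlDr.
have := cE_add w t0 (CL_sub FC HC) HC.
by rewrite (_ : (fun w => F w - H w + H w) = F)//; apply/funext => z; rewrite subrK.
Qed.

Lemma cE_norm t F H w : 0 <= t -> CL F -> CL H ->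
  `|cE t F w - cE t H w| <= cE t (fun w => `|F w - H w|) w.
Proof.
move=> t0 FC HC; rewrite ler_norml lerNl opprB; apply/andP; split.
  apply: (le_trans (cE_sub _ t0 HC FC)); apply: cE_mono => //; first exact: CL_sub.
    exact/CL_abs/CL_sub.
  by move=> z; rewrite distrC ler_norm.
apply: (le_trans (cE_sub _ t0 FC HC)); apply: cE_mono => //; first exact: CL_sub.
  exact/CL_abs/CL_sub.
by move=> z; exact: ler_norm.
Qed.

(** Conditioning at r is computed on a grid passing through t. Its part after t computes [cE t F],
    and its part up to t then conditions that function at r. *)
Lemma cE_tower (r t : R) F : 0 <= r -> r <= t -> CL F -> cE r (cE t F) = cE r F.
Proof.
move=> r0 rt [T _ [g [L [M [g0 cF]]]]]; have t0 := le_trans r0 rt.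
pose l := sort <=%R [seq x <- g | (r <= x) && (x <= t)].
have pl : path <=%R r (rcons l t).
  rewrite rcons_path path_min_sorted ?sort_le_sorted//=; last first.
    by apply/allP => x; rewrite mem_sort mem_filter => /andP[/andP[]].
  by have := mem_last r l; rewrite inE mem_sort mem_filter => /orP[/eqP->|/andP[/andP[]]].
have pl2 : path <=%R r (l ++ t :: tail t g).
  by rewrite -cat_rcons cat_path pl last_rcons tail_path.
have -> : cE r F = cnd r (l ++ t :: tail t g) F.
  apply: cE_cnd => //; split => //; exists g, L, M; split => // x xg.
  rewrite mem_cat inE mem_sort mem_filter xg andbT.
  have := mem_tail t xg; case: (leP x r) => //= rx; rewrite (ltW rx)/=.
  by case: (leP x t) => //= _ ->; rewrite orbT.
rewrite (cnd_cat r0 pl2 cF) (cE_cnd t0 (ugrid_tail t cF)).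
apply: cE_cnd => //; split => //.
exists (map (Num.min^~ t) g), L, M; split; first exact: (cnd_cyl _ _ _ (tail_path _ _)).
move=> x /mapP[y yg ->]; rewrite mem_rcons inE mem_sort mem_filter.
case: (leP y t) => yt; last by rewrite eqxx orbT.
by rewrite yg yt/= !andbT; case: (leP y r) => //= /ltW ->; rewrite orbT.
Qed.

Lemma cE_B2 (r s t : R) (phi : R -> R) L M w : 0 <= r -> r <= s -> s <= t ->
  lip L phi -> bdd M phi ->
  cE r (fun w => phi (B s w - B r w)) w = gval phi (s - r) 0.
Proof.
move=> r0 rs st pL pM; have s0 := le_trans r0 rs.
have [g [L' [M' [gt cF]]]] : CLt s (fun w => phi (B s w - B r w)).
  by apply: CLt_B2 pL pM; rewrite ?r0 ?s0 ?rs ?lexx.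
have cF2 : cyl [:: r; s] L M (fun w => phi (B s w - B r w)).
  split=> [|w'|w' w'']; [exact: lip_ge0 pL|exact: pM|].
  rewrite (le_trans (pL _ _))// ler_wpM2l ?(lip_ge0 pL)//.
  rewrite /gap !big_cons big_nil addr0 [leRHS]addrC.
  rewrite (_ : _ - _ = (B s w' - B s w'') - (B r w' - B r w'')); last by ring.
  exact: ler_normB.
rewrite (@cE_cnd r _ [:: s])//; last first.
  split; rewrite /= ?rs//; exists [:: r; s], L, M; split => // x; rewrite !inE.
  by case/orP => /eqP ->; rewrite ?lexx ?eqxx ?orbT.
rewrite /= /evol; have [<-|nrs] := eqVneq r s.
  by rewrite subrr !val_le0// !B_stop !minxx !subrr.
congr (gval _ _ _); apply/funext => y; rewrite !B_stop minxx (min_idPl rs) !B_bump//.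
rewrite (min_idPr rs) minxx ramp_ge ?lt_neqAle ?nrs// ramp_le//.
by congr phi; ring.
Qed.

End conditional_expectation.

(** * Lipschitz functions of row vectors *)

Section row_functions.
Context {R : realType}.
Implicit Types (L M : R).

Definition ldist m (x x' : 'rV[R]_m) : R := \sum_(k < m) `|x 0 k - x' 0 k|.

Definition rl m L M (phi : 'rV[R]_m -> R) : Prop :=
  [/\ 0 <= L, forall x, `|phi x| <= M &
      forall x x', `|phi x - phi x'| <= L * ldist x x'].

Lemma ldist_ge0 m (x x' : 'rV[R]_m) : 0 <= ldist x x'.
Proof. exact: sumr_ge0. Qed.

Lemma ldist_triangle m (x y z : 'rV[R]_m) : ldist x z <= ldist x y + ldist y z.
Proof. by rewrite -big_split; apply: ler_sum => k _; exact: ler_distD. Qed.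

Lemma ldistC m (x y : 'rV[R]_m) : ldist x y = ldist y x.
Proof. by apply: eq_bigr => k _; rewrite distrC. Qed.

Lemma normr_entry m (x : 'rV[R]_m) k : `|x 0 k| <= `|x|.
Proof.
rewrite [leRHS]/Num.norm/= mx_normrE.
exact: (le_bigmax _ (fun ij : 'I_1 * 'I_m => `|x ij.1 ij.2|) (0, k)).
Qed.

Lemma norm_ldist m (x x' : 'rV[R]_m) : `|x - x'| <= ldist x x'.
Proof.
rewrite [leLHS]/Num.norm/= mx_normrE; apply/bigmax_leP; split=> [|[i k] _ /=].
  exact: ldist_ge0.
rewrite ord1 !mxE /ldist (bigD1 k)//= lerDl; exact: sumr_ge0.
Qed.

Lemma ldist_norm m (x x' : 'rV[R]_m) : ldist x x' <= m%:R * `|x - x'|.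
Proof.
have -> : m%:R * `|x - x'| = \sum_(k < m) `|x - x'| by rewrite sumr_const card_ord mulr_natl.
apply: ler_sum => k _.
by have := normr_entry (x - x') k; rewrite !mxE.
Qed.

Lemma bounded_lipschitzP m (phi : 'rV[R]_m -> R) :
  bounded_lipschitz phi <-> exists L M, rl L M phi.
Proof.
split=> [[[M0 [_ hM]] [K0 [_ hK]]]|[L [M [L0 phiM phiL]]]].
  exists (`|K0| + 1), (M0 + 1); split; first by rewrite addr_ge0.
    by move=> x; apply: hM => //; rewrite ltrDl.
  move=> x x'; have := hK (`|K0| + 1).
  rewrite (le_lt_trans (ler_norm K0)) ?ltrDl// => /(_ isT (x, x')) /= h.
  apply: (le_trans (h _)); first by [].
  by rewrite ler_wpM2l ?norm_ldist// addr_ge0.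
split.
  exists M; split; first exact: num_real.
  by move=> y My x _; exact: le_trans (phiM x) (ltW My).
exists (L * m%:R); split; first exact: num_real.
move=> y Ly [x x'] _ /=; rewrite (le_trans (phiL _ _))//.
rewrite (le_trans (ler_wpM2l L0 (ldist_norm _ _)))// mulrA ler_wpM2r//.
exact: ltW.
Qed.

(** McShane extension: the infimum over w of F w + L times the distance to J w is L-Lipschitz and
    restores F on the range of J; cutting at M keeps it bounded. *)
Lemma factor_lipschitz m (J : Omega R -> 'rV[R]_m) (F : Omega R -> R) L M :
  0 <= L -> (forall w, `|F w| <= M) ->
  (forall w w', `|F w - F w'| <= L * ldist (J w) (J w')) ->
  exists phi, rl L M phi /\ F = fun w => phi (J w).
Proof.
move=> L0 FM FL.
pose A x := [set F w + L * ldist x (J w) | w in [set: Omega R]].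
have A0 x : A x !=set0 by exists (F cpath0 + L * ldist x (J cpath0)); exists cpath0.
have Alb x : lbound (A x) (- M).
  move=> _ [w _ <-]; have := FM w; rewrite ler_norml => /andP[h _].
  by rewrite (le_trans h)// lerDl mulr_ge0// ldist_ge0.
have hA x : has_inf (A x) by split => //; exists (- M).
have AL x x' : inf (A x) <= inf (A x') + L * ldist x x'.
  rewrite -lerBlDr; apply: lb_le_inf => // _ [w _ <-].
  rewrite lerBlDr -addrA -mulrDr; apply: (le_trans (ge_inf (proj2 (hA x)) _)).
    by exists w.
  by rewrite lerD2l ler_wpM2l// addrC ldist_triangle.
exists (fun x => Num.min M (inf (A x))); split; last first.
  apply/funext => w; have -> : inf (A (J w)) = F w.
    apply/eqP; rewrite eq_le; apply/andP; split.
      apply: (le_trans (ge_inf (proj2 (hA _)) _)); first by exists w.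
      by rewrite /ldist big1 ?mulr0 ?addr0// => k _; rewrite subrr normr0.
    apply: lb_le_inf => // _ [w' _ <-]; have := FL w w'.
    by rewrite ler_norml => /andP[_]; rewrite lerBlDl.
  by apply/esym/min_idPr; exact: le_trans (ler_norm _) (FM w).
split=> // [x|x x'].
  have h : - M <= inf (A x) by exact: lb_le_inf.
  have M0 : 0 <= M by exact: le_trans (FM (cpath0 : Omega R)).
  rewrite ler_norml le_min ge_min lexx h /= andbT.
  by rewrite (le_trans _ M0)// oppr_le0.
have h1 := AL x x'; have h2 := AL x' x; rewrite ldistC in h2.
have := ldist_ge0 x x' => /(mulr_ge0 L0) h0.
rewrite ler_norml; case: (leP M (inf (A x))) => ?; case: (leP M (inf (A x'))) => ?;
  apply/andP; split; lra.
Qed.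

End row_functions.

(** * Identification of [Lip] with the cylinder functions *)

Section link.
Context {R : realType}.
Implicit Types (t : R) (X Y : Omega R -> R).

Lemma gap_ldist m (s : 'I_m -> R) w w' :
  gap [seq s i | i <- enum 'I_m] w w' = ldist (\row_i B (s i) w) (\row_i B (s i) w').
Proof. by rewrite /gap big_map big_enum; apply: eq_bigr => i _; rewrite !mxE. Qed.

Lemma Lip_uptoE t : 0 <= t -> @Lip_upto R t = CLt t.
Proof.
move=> t0; apply/seteqP; split => X.
  move=> [m [s [phi [m0 st /bounded_lipschitzP[L [M [L0 phiM phiL]]] ->]]]].
  exists [seq s i | i <- enum 'I_m], L, M; split; first by move=> x /mapP[i _ ->].
  by split => // w w'; rewrite gap_ldist.
move=> [g [L [M [gt cX]]]].
(* The time 0 is added because [Lip_upto] demands at least one time; paths vanish there, so it costs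
   nothing. *)
have {gt} [g0 gt] : (0 < size (0%R :: g))%N /\ forall x, x \in 0%R :: g -> 0 <= x <= t.
  by split => // x; rewrite inE => /predU1P[->|/gt]//; rewrite lexx.
have [L0 XM XL] := cyl_catr [:: 0] cX.
rewrite /= -/(0 :: g) in XL; set g' := 0 :: g in g0 gt XL.
pose s (i : 'I_(size g')) := nth 0 g' i.
have gE : g' = [seq s i | i <- enum 'I_(size g')].
  apply: (@eq_from_nth _ 0) => [|i ig]; first by rewrite size_map size_enum_ord.
  by rewrite (nth_map (Ordinal ig)) ?size_enum_ord// /s nth_enum_ord.
have [w w'|phi [phiL ->]] := @factor_lipschitz _ _ (fun w => \row_i B (s i) w) X L M L0 XM.
  by rewrite -gap_ldist -gE; exact: XL.
exists (size g'), s, phi; split => //; last by apply/bounded_lipschitzP; exists L, M.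
by move=> i; apply: gt; rewrite mem_nth.
Qed.

Lemma LipE : @Lip R = CL.
Proof.
by apply/seteqP; split => X [t t0]; rewrite ?Lip_uptoE// => h; exists t; rewrite ?Lip_uptoE.
Qed.

Lemma B_increments m (ts : nat -> R) w i : ts 0%N = 0 -> (i <= m)%N ->
  B (ts i) w = \sum_(k < m | (k < i)%N) increments m ts w 0 k.
Proof.
move=> ts0 im; transitivity (\sum_(k < i) (B (ts k.+1) w - B (ts k) w)).
  rewrite -(big_mkord xpredT (fun k => B (ts k.+1) w - B (ts k) w)).
  by rewrite telescope_sumr// ts0 (B_le0 w (lexx 0)) subr0.
rewrite (big_ord_widen _ (fun k => B (ts k.+1) w - B (ts k) w) im).
by apply: eq_bigr => k _; rewrite mxE.
Qed.

Lemma B_ldist m (ts : nat -> R) w w' i : ts 0%N = 0 -> (i <= m)%N ->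
  `|B (ts i) w - B (ts i) w'| <= ldist (increments m ts w) (increments m ts w').
Proof.
move=> ts0 im; rewrite !(B_increments _ ts0 im) -sumrB (le_trans (ler_norm_sum _ _ _))//.
by rewrite /ldist [leRHS](bigID (fun k : 'I_m => (k < i)%N))/= lerDl sumr_ge0.
Qed.

Lemma increments_gap m (ts : nat -> R) n w w' : (n <= m)%N ->
  \sum_(k < m | (k < n)%N) `|increments m ts w 0 k - increments m ts w' 0 k| <=
  2 * gap [seq ts k | k <- iota 0 n.+1] w w'.
Proof.
move=> nm; pose d k := `|B (ts k) w - B (ts k) w'|.
have -> : gap [seq ts k | k <- iota 0 n.+1] w w' = \sum_(k < n.+1) d k.
  by rewrite /gap big_map -[iota 0 _]/(index_iota 0 n.+1) big_mkord.
have -> : \sum_(k < m | (k < n)%N) `|increments m ts w 0 k - increments m ts w' 0 k| =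
    \sum_(k < n) `|B (ts k.+1) w - B (ts k) w - (B (ts k.+1) w' - B (ts k) w')|.
  rewrite (big_ord_widen m (fun k => `|B (ts k.+1) w - B (ts k) w - (B (ts k.+1) w' - B (ts k) w')|) nm).
  by apply: eq_bigr => k _; rewrite !mxE.
rewrite (le_trans (_ : _ <= \sum_(k < n) (d k.+1 + d k)))//.
  apply: ler_sum => k _; rewrite /d.
  rewrite (_ : _ - _ = (B (ts k.+1) w - B (ts k.+1) w') - (B (ts k) w - B (ts k) w')); last by ring.
  exact: ler_normB.
rewrite big_split mulr_natl mulr2n lerD//.
  by rewrite big_ord_recl lerDr normr_ge0.
by rewrite big_ord_recr lerDl normr_ge0.
Qed.

End link.

(** * The backward recursion on increments computes the conditional expectation *)

Section backward_induction.
Context {R : realType}.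
Variables (slo shi : R).
Hypotheses (slo0 : 0 <= slo) (slohi : slo <= shi).
Variables (m : nat) (ts : nat -> R).
Hypotheses (ts0 : ts 0%N = 0) (tsm : nondecreasing_seq ts).
Implicit Types (phi : 'rV[R]_m -> R) (x : 'rV[R]_m).

Let ts_ge0 i : 0 <= ts i.
Proof. by rewrite -ts0; exact: tsm. Qed.

Let step_ge0 i : 0 <= ts i.+1 - ts i.
Proof. by rewrite subr_ge0; exact: tsm. Qed.

Definition setc (x : 'rV[R]_m) (i : 'I_m) (y : R) : 'rV[R]_m :=
  \row_k if k == i then y else x 0 k.

Lemma ldist_setc x i y y' : ldist (setc x i y) (setc x i y') <= `|y - y'|.
Proof.
rewrite /ldist (bigD1 i)//= !mxE eqxx big1 ?addr0// => k ki.
by rewrite !mxE (negbTE ki) subrr normr0.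
Qed.

Lemma integrate_outE i L M phi x : rl L M phi ->
  integrate_out slo shi ts i phi x = gval slo shi (fun y => phi (setc x i y)) (ts i.+1 - ts i) 0.
Proof.
move=> [L0 phiM phiL]; rewrite /integrate_out (@GheatE _ _ _ slo0 slohi _ L M)//.
move=> y y'; rewrite (le_trans (phiL _ _))// ler_wpM2l//; exact: ldist_setc.
Qed.

Lemma integrate_out_rl i L M phi : rl L M phi -> rl L M (integrate_out slo shi ts i phi).
Proof.
move=> phiLM; have [L0 phiM phiL] := phiLM; split=> // [x|x x'].
  rewrite (integrate_outE i x phiLM); apply: (val_bdd slo shi (M := M)) => y; exact: phiM.
rewrite !(integrate_outE i _ phiLM); apply: (@val_dist _ _ _ _ _ M M) => y; [exact: phiM..|].
rewrite (le_trans (phiL _ _))// ler_wpM2l//; apply: ler_sum => k _; rewrite !mxE.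
by case: eqP => // _; rewrite subrr normr0.
Qed.

Lemma backward_rl j L M phi : rl L M phi -> rl L M (backward slo shi ts phi j).
Proof.
by rewrite /backward; elim: [seq _ <- _ | _] => //= i s IH phiLM; exact/integrate_out_rl/IH.
Qed.

Lemma backward_m phi j : (m <= j)%N -> backward slo shi ts phi j = phi.
Proof.
move=> mj; rewrite /backward (_ : [seq _ <- _ | _] = [::])//.
rewrite -(filter_pred0 (enum 'I_m)); apply: eq_filter => i /=.
by rewrite leqNgt (leq_trans (ltn_ord i) mj).
Qed.

Lemma backward_rec phi (j : 'I_m) :
  backward slo shi ts phi j = integrate_out slo shi ts j (backward slo shi ts phi j.+1).
Proof.
rewrite /backward -[RHS]/(foldr _ _ (j :: _)); congr foldr.
apply: (inj_map val_inj); rewrite /= -!(filter_map _ (leq _)) val_enum_ord.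
have -> : iota 0 m = iota 0 j ++ (j : nat) :: iota j.+1 (m - j.+1).
  have E : m = (j + (m - j.+1).+1)%N by rewrite addnS -addSn subnKC.
  by rewrite {1}E iotaD.
rewrite !filter_cat.
have f0 (k : nat) : (j <= k)%N -> [seq x <- iota 0 j | (k <= x)%N] = [::].
  move=> jk; rewrite -(filter_pred0 (iota 0 j)); apply: eq_in_filter => i.
  by rewrite mem_iota/= add0n => ij; rewrite leqNgt (leq_trans ij jk).
rewrite !f0//= leqnn ltnn; congr cons; apply: eq_in_filter => i.
by rewrite mem_iota => /andP[ji _]; rewrite ji ltnW.
Qed.

Lemma integrate_out_indep i phi x x' (D : pred 'I_m) :
  (forall z z' : 'rV[R]_m, (forall k, D k -> z 0 k = z' 0 k) -> phi z = phi z') ->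
  (forall k, D k -> k != i -> x 0 k = x' 0 k) ->
  integrate_out slo shi ts i phi x = integrate_out slo shi ts i phi x'.
Proof.
move=> h hx; rewrite /integrate_out; congr (Gheat _ _ _ _ _); apply/funext => y.
by apply: h => k Dk; rewrite !mxE; case: eqVneq => // /hx ->.
Qed.

Lemma backward_indep phi n x x' : (n <= m)%N -> (forall k : 'I_m, (k < m - n)%N -> x 0 k = x' 0 k) ->
  backward slo shi ts phi (m - n) x = backward slo shi ts phi (m - n) x'.
Proof.
elim: n x x' => [|n IH] x x' nm h.
  by congr backward; apply/rowP => k; apply: h; rewrite subn0.
have jm : (m - n.+1 < m)%N by rewrite ltn_subrL (leq_trans _ nm).
rewrite (backward_rec _ (Ordinal jm)) /=.
apply: (integrate_out_indep (D := fun k => (k < m - n)%N)).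
  by rewrite subnSK//; move=> z z'; apply: IH; exact: ltnW.
move=> k kn; rewrite -val_eqE/= => kj; apply: h.
by move: kn kj; rewrite -(subnSK nm) ltnS leq_eqVlt => /predU1P[->|//]; rewrite eqxx.
Qed.

Lemma increments_bump (j k : 'I_m) w y : ts j < ts j.+1 \/ y = 0 -> (k <= j)%N ->
  increments m ts (bump (ts j) (ts j.+1) w y) 0 k = setc (increments m ts w) j y 0 k.
Proof.
move=> hy; rewrite !mxE !B_bump//; last 2 first; [exact: tsm..|].
rewrite leq_eqVlt => /predU1P[kj|kj].
  have -> : k = j by exact: val_inj.
  rewrite eqxx minxx (min_idPr (tsm (leqnSn j))) [ramp _ _ (ts j)]ramp_le ?tsm//.
  have -> : y * ramp (ts j) (ts j.+1) (ts j.+1) = y.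
    by case: hy => [h|->]; rewrite ?mul0r// ramp_ge// mulr1.
  by ring.
have -> : (k == j) = false by apply/eqP => E; rewrite E ltnn in kj.
rewrite (min_idPl (tsm kj)) (min_idPl (tsm (ltnW kj))).
rewrite (ramp_le (tsm (leqnSn j)) (tsm kj)) (ramp_le (tsm (leqnSn j)) (tsm (ltnW kj))).
by ring.
Qed.

Lemma CLt_increments L M phi : rl L M phi -> CLt (ts m) (fun w => phi (increments m ts w)).
Proof.
move=> [L0 phiM phiL]; exists [seq ts k | k <- iota 0 m.+1], (L * 2), M; split.
  by move=> x /mapP[k + ->]; rewrite mem_iota ltnS => /= km; rewrite ts_ge0 tsm.
split=> [||w w']; [by rewrite mulr_ge0|by []|].
rewrite (le_trans (phiL _ _))// -mulrA ler_wpM2l//.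
have := increments_gap ts w w' (leqnn m); congr (_ <= _).
by apply: eq_bigl => k; rewrite ltn_ord.
Qed.

(** Downward induction on the coordinate: integrating out one increment is one [evol] step over the
    corresponding interval, and [cE_tower] composes it with the steps already made. *)
Lemma backward_cE L M phi n : rl L M phi -> (n <= m)%N ->
  (fun w => backward slo shi ts phi (m - n) (increments m ts w)) =
  cE slo shi (ts (m - n)%N) (fun w => phi (increments m ts w)).
Proof.
move=> phiLM; have XC := CLt_increments phiLM.
have XCL := CLt_CL (ts_ge0 m) XC.
elim: n => [|n IH] nm.
  by rewrite subn0 backward_m// cE_id.
set j := (m - n.+1)%N; have jm : (j < m)%N by rewrite /j ltn_subrL (leq_trans _ nm).
have jS : (m - n = j.+1)%N by rewrite /j subnSK.
have tsj : ts j <= ts j.+1 by exact: tsm.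
rewrite -(cE_tower slo0 slohi (ts_ge0 j) tsj XCL) -jS -(IH (ltnW nm)).
have hrl := backward_rl (m - n) phiLM; have [L0 hM hL] := hrl.
set H := backward slo shi ts phi (m - n) in hrl hM hL *.
have Hind x x' : (forall k : 'I_m, (k < j.+1)%N -> x 0 k = x' 0 k) -> H x = H x'.
  by rewrite -jS; apply: backward_indep; exact: ltnW.
have cY : cyl [seq ts k | k <- iota 0 j.+2] (L * 2) M (fun w => H (increments m ts w)).
  split=> [||w w']; [by rewrite mulr_ge0|by []|].
  (* H ignores the coordinates beyond j. Zeroing them shows that only times up to the (j+1)-st
     matter, so the grid of this function can be shortened. *)
  pose tr x : 'rV[R]_m := \row_k if (k < j.+1)%N then x 0 k else 0.
  have Htr x : H x = H (tr x) by apply: Hind => k kj; rewrite mxE kj.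
  rewrite (Htr (increments m ts w)) (Htr (increments m ts w')) (le_trans (hL _ _))//.
  rewrite -mulrA ler_wpM2l// (le_trans _ (increments_gap ts w w' jm))//.
  rewrite /ldist big_mkcond/= [leRHS]big_mkcond/=; apply: ler_sum => k _.
  by rewrite !mxE; case: ifP; rewrite // subrr normr0.
rewrite (@cE_cnd _ slo shi slo0 slohi (ts j) _ [:: ts j.+1])//; last first.
  split; first by rewrite /= tsj.
  exists [seq ts k | k <- iota 0 j.+2], (L * 2), M; split => // x /mapP[k + ->].
  rewrite mem_iota /= add0n ltnS leq_eqVlt inE => /predU1P[->|kj].
    by rewrite eqxx orbT.
  by rewrite tsm.
apply/funext => w; rewrite -/j (backward_rec _ (Ordinal jm)) /= -jS -/H.
rewrite (integrate_outE _ _ hrl)/= /evol.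
have E (y : R) : ts j < ts j.+1 \/ y = 0 -> H (setc (increments m ts w) (Ordinal jm) y) =
    H (increments m ts (stop (ts j.+1) (bump (ts j) (ts j.+1) w y))).
  move=> hy; apply: Hind => k kj; rewrite -(@increments_bump (Ordinal jm))//.
  by rewrite !mxE !B_stop !(min_idPl _)// tsm// ltnW.
(* A repeated grid time gives a step of zero length, where only the increment y = 0 is evaluated. *)
rewrite jS; have [jj|njj] := eqVneq (ts j) (ts j.+1).
  have e0 : ts j.+1 - ts j = 0 by rewrite -jj subrr.
  by rewrite e0 !val_le0//; apply: E; right.
congr (gval _ _ _); apply/funext => y; apply: E; left.
by rewrite lt_neqAle njj.
Qed.

End backward_induction.

(** * The chosen conditional expectation agrees with [cE] *)

Section conditional_link.
Context {R : realType}.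
Variables (slo shi : R).
Hypotheses (slo0 : 0 <= slo) (slohi : slo <= shi).
Implicit Types (t : R) (X Y : Omega R -> R).

Local Notation cE := (cE slo shi).

(** All presentations of X by increments lead to the same result, so the choice made in [cond_Lip]
    is harmless. *)
Lemma is_cond_LipP t X Y : 0 <= t -> CL X -> is_cond_Lip slo shi t X Y -> Y = cE t X.
Proof.
move=> t0 XC [m [ts [phi [j [[m0 ts0 tsm /bounded_lipschitzP[L [M phiLM]]] [jm tj XE ->]]]]]].
rewrite XE tj -(subKn jm); apply: (backward_cE slo0 slohi ts0 tsm phiLM).
exact: leq_subr.
Qed.

Lemma is_cond_Lip_cE t X : 0 <= t -> CL X -> is_cond_Lip slo shi t X (cE t X).
Proof.
move=> t0 XC; have [T T0 [g [L [M [g0 [L0 XM XL]]]]]] := XC.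
(* The grid must start at 0 and contain the conditioning time together with the times of X; beyond
   its end [ts] stays constant. *)
pose l := 0 :: sort <=%R (t :: g).
have ls : sorted <=%R l.
  rewrite /= path_min_sorted ?sort_le_sorted//; apply/allP => x; rewrite mem_sort inE.
  by move=> /predU1P[->//|/g0/andP[]].
pose m := size l; pose ts i := nth 0 l (minn i m.-1).
have lm k : (k < m)%N -> ts k = nth 0 l k.
  by move=> km; rewrite /ts (minn_idPl _)// -ltnS.
have ts0 : ts 0%N = 0 by rewrite /ts min0n.
have tsm : nondecreasing_seq ts.
  move=> i j ij; apply: (sorted_leq_nth le_trans le_refl 0 ls); rewrite ?inE ?ltnS ?geq_minr//.
  by rewrite leq_min geq_minr geq_min ij.
have mem s : s \in t :: g -> exists2 i, (i < m)%N & s = ts i.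
  move=> sg; have sl : s \in l by rewrite inE mem_sort sg orbT.
  by exists (index s l); rewrite ?index_mem// lm ?index_mem// nth_index.
have [|w w'|phi [phiLM XE]] := @factor_lipschitz _ _ (increments m ts) X (L * (size g)%:R) M _ XM.
- by rewrite mulr_ge0.
- rewrite (le_trans (XL w w'))// -mulrA ler_wpM2l// mulrC /gap -sum1_size natr_sum mulr_sumr.
  rewrite big_seq [leRHS]big_seq; apply: ler_sum => s sg; rewrite mulr1.
  have [|i im ->] := mem s; first by rewrite inE sg orbT.
  by apply: B_ldist => //; exact: ltnW.
have [|j jm tj] := mem t; first by rewrite inE eqxx.
exists m, ts, phi, j; split; split => //; first by apply/bounded_lipschitzP; eexists; eexists; exact: phiLM.
  exact: ltnW.
rewrite XE tj -(subKn (ltnW jm)); apply/esym/(backward_cE slo0 slohi ts0 tsm phiLM).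
exact: leq_subr.
Qed.

Lemma cond_LipE t X : 0 <= t -> CL X -> cond_Lip slo shi t X = cE t X.
Proof.
move=> t0 XC; rewrite /cond_Lip; case: xgetP => [Y _ /is_cond_LipP ->//|].
by move=> /(_ (cE t X)); apply: contra_notP => _; exact: is_cond_Lip_cE.
Qed.

Definition EL (X : Omega R -> R) : R := cE 0 X cpath0.

Lemma cE0 X w : CL X -> cE 0 X w = EL X.
Proof. by move=> XC; apply: CLt0_cst; apply: cE_CLt. Qed.

Lemma E_LipE X : CL X -> E_Lip slo shi X = EL X.
Proof.
move=> XC; rewrite /E_Lip cond_LipE//.
have E : cE 0 X = fun=> EL X by apply/funext => w; exact: cE0.
rewrite E; case: xgetP => [e _ /= /(congr1 (@^~ (cpath0 : Omega R)))//|].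
by move=> /(_ (EL X)) [].
Qed.

End conditional_link.

                                               

(** * Hahn-Banach through minimal sublinear functionals on a subspace *)

Section hahn_banach.
Context {R : realType} {V : lmodType R}.
Variable D : set V.
Hypotheses (DD : forall x y, D x -> D y -> D (x + y)) (DZ : forall k x, D x -> D (k *: x)).
Implicit Types (p q : V -> R) (x y : V).

Definition sublinear_on q : Prop :=
  (forall x y, D x -> D y -> q (x + y) <= q x + q y) /\
  (forall k x, 0 < k -> D x -> q (k *: x) <= k * q x).

Let DN x : D x -> D (- x).
Proof. by rewrite -scaleN1r; exact: DZ. Qed.

Lemma sublinear_on0 q x : sublinear_on q -> D x -> q 0 = 0.
Proof.
move=> [qD qZ] Dx; have D0 : D 0 by rewrite -(scale0r x); exact: DZ.
have := qD 0 0 D0 D0; have := qZ 2^-1 0 _ D0; rewrite addr0 scaler0 => /(_ ltac:(lra)).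
by lra.
Qed.

Lemma sublinear_onZ q k x : sublinear_on q -> D x -> 0 <= k -> q (k *: x) = k * q x.
Proof.
move=> qs Dx; rewrite le_eqVlt => /predU1P[<-|k0].
  by rewrite scale0r mul0r (sublinear_on0 qs Dx).
have [_ qZ] := qs; apply/eqP; rewrite eq_le qZ//=.
rewrite -ler_pdivlMl// (le_trans _ (qZ k^-1 _ _ (DZ k Dx)))// ?invr_gt0//.
by rewrite scalerA mulVf ?scale1r// gt_eqF.
Qed.

Lemma sublinear_onN q x : sublinear_on q -> D x -> - q (- x) <= q x.
Proof.
move=> qs Dx; have [qD _] := qs; have := qD x (- x) Dx (DN Dx).
by rewrite subrr (sublinear_on0 qs Dx); lra.
Qed.

(** A sublinear functional below q that is at most - q x0 at - x0. A minimal q equals all its tilts,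
    and this forces additivity. *)
Definition tilt q x0 x := inf [set q (x + t *: x0) - t * q x0 | t in [set t | 0 <= t]].

Section tilt.
Variables (q : V -> R) (x0 : V).
Hypotheses (qs : sublinear_on q) (Dx0 : D x0).

Let A x := [set q (x + t *: x0) - t * q x0 | t in [set t : R | 0 <= t]].

Lemma tilt_inf x : D x -> has_inf (A x).
Proof.
move=> Dx; split; first by exists (q (x + 0 *: x0) - 0 * q x0); exists 0 => //=.
exists (- q (- x)) => _ [t t0 <-].
have [qD _] := qs; have := qD (x + t *: x0) (- x).
rewrite addrAC subrr add0r (sublinear_onZ qs Dx0 t0).
move=> /(_ (DD Dx (DZ _ Dx0)) (DN Dx)); lra.
Qed.

Lemma tilt_le x t : D x -> 0 <= t -> tilt q x0 x <= q (x + t *: x0) - t * q x0.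
Proof. by move=> Dx t0; apply: ge_inf; [exact: (tilt_inf Dx).2|exists t]. Qed.

Lemma tilt_ge x a : D x -> (forall t, 0 <= t -> a <= q (x + t *: x0) - t * q x0) ->
  a <= tilt q x0 x.
Proof.
by move=> Dx h; apply: lb_le_inf; [exact: (tilt_inf Dx).1|move=> _ [t t0 <-]; exact: h].
Qed.

Lemma tilt_sublinear : sublinear_on (tilt q x0).
Proof.
have [qD qZ] := qs; split=> [x y Dx Dy|k x k0 Dx].
  rewrite -lerBlDr; apply: tilt_ge => // t t0; rewrite lerBlDl -lerBlDr.
  apply: tilt_ge => // s s0; rewrite lerBlDl.
  have := tilt_le (DD Dx Dy) (addr_ge0 t0 s0).
  have := qD _ _ (DD Dx (DZ t Dx0)) (DD Dy (DZ s Dx0)).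
  by rewrite addrACA -scalerDl; lra.
rewrite -ler_pdivrMl//; apply: tilt_ge => // t t0; rewrite ler_pdivrMl//.
have kt : 0 <= k * t by rewrite mulr_ge0// ltW.
have := tilt_le (DZ k Dx) kt; have := qZ k _ k0 (DD Dx (DZ t Dx0)).
by rewrite scalerDr scalerA; lra.
Qed.

Lemma tilt_le0 x : D x -> tilt q x0 x <= q x.
Proof. by move=> Dx; have := tilt_le Dx (lexx 0); rewrite scale0r mul0r addr0 subr0. Qed.

End tilt.

(** Zorn's lemma, with the pointwise infimum as bound of a chain; subadditivity of the infimum uses
    that two members of a chain are comparable. *)
Lemma minimal_sublinear p : sublinear_on p ->
  exists q, [/\ sublinear_on q, forall x, D x -> q x <= p x &
    forall q', sublinear_on q' -> (forall x, D x -> q' x <= q x) ->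
      forall x, D x -> q' x = q x].
Proof.
move=> ps.
pose P q := [/\ sublinear_on q, forall x, D x -> q x <= p x & forall x, ~ D x -> q x = 0].
pose T := {q | P q}.
pose ge (q q' : T) := `[<forall x, projT1 q' x <= projT1 q x>].
(* Functionals are set to 0 outside D, so that the pointwise order is antisymmetric. *)
pose p0 x := if pselect (D x) is left _ then p x else 0.
have mod q : sublinear_on q -> sublinear_on (fun x => if pselect (D x) is left _ then q x else 0).
  move=> [qD qZ]; split=> [x y Dx Dy|k x k0 Dx].
    by case: pselect (DD Dx Dy) => // ? _; case: pselect => // ?; case: pselect => // ?; exact: qD.
  by case: pselect (DZ k Dx) => // ? _; case: pselect => // ?; exact: qZ.
have modP q : sublinear_on q -> (forall x, D x -> q x <= p x) ->
    P (fun x => if pselect (D x) is left _ then q x else 0).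
  move=> qs qp; split; [exact: mod|by move=> x Dx; case: pselect => // ?; exact: qp|].
  by move=> x; case: pselect.
have p0P : P p0 by exact: modP.
have [|q1 q2 q3 /asboolP h1 /asboolP h2|[q1 h1] [q2 h2] /asboolP /= h /asboolP /= h'|A Atot|[m [ms mp m0]] mmin] := @Zorn T ge.
- by move=> q; apply/asboolP.
- by apply/asboolP => x; exact: le_trans (h2 x) (h1 x).
- by apply: eq_exist; apply/funext => x; apply/eqP; rewrite eq_le h h'.
- have [->|/set0P[q0 Aq0]] := eqVneq A set0; first by exists (exist _ p0 p0P).
  pose I x := [set projT1 q x | q in A].
  have Ilb x : D x -> has_inf (I x).
    move=> Dx; split; first by exists (projT1 q0 x); exists q0.
    exists (- p (- x)) => _ [[q [qs qp qn]] _ <-] /=.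
    by have := sublinear_onN qs Dx; have := qp _ (DN Dx); lra.
  have Ile x (q : T) : D x -> A q -> inf (I x) <= projT1 q x.
    by move=> Dx Aq; apply: ge_inf; [exact: (Ilb _ Dx).2|exists q].
  have Is : sublinear_on (fun x => inf (I x)).
    split=> [x y Dx Dy|k x k0 Dx].
      rewrite -lerBlDr; apply: lb_le_inf; first exact: (Ilb _ Dx).1.
      move=> _ [q Aq <-]; rewrite lerBlDl -lerBlDr; apply: lb_le_inf; first exact: (Ilb _ Dy).1.
      move=> _ [q' Aq' <-]; rewrite lerBlDl.
      have [qm [Aqm hq hq']] : exists qm, [/\ A qm, forall x, projT1 qm x <= projT1 q x &
          forall x, projT1 qm x <= projT1 q' x].
        by case: (Atot _ _ Aq Aq') => /asboolP h; [exists q'|exists q].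
      have := Ile _ _ (DD Dx Dy) Aqm; have [[qD _] _ _] := projT2 qm.
      have := qD x y Dx Dy; have := hq x; have := hq' y; lra.
    rewrite -ler_pdivrMl//; apply: lb_le_inf; first exact: (Ilb _ Dx).1.
    move=> _ [q Aq <-]; rewrite ler_pdivrMl//; have [[_ qZ] _ _] := projT2 q.
    exact: le_trans (Ile _ _ (DZ k Dx) Aq) (qZ _ _ k0 Dx).
  have IP : P (fun x => if pselect (D x) is left _ then inf (I x) else 0).
    by apply: modP => // x Dx; have [_ qp _] := projT2 q0; exact: le_trans (Ile _ _ Dx Aq0) (qp _ Dx).
  exists (exist _ _ IP) => q Aq; apply/asboolP => x /=.
  by case: pselect => [Dx|nDx]; [exact: Ile|have [_ _ h] := projT2 q; rewrite [leRHS]h].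
- exists m; split => // q' q's q'm x Dx.
  have q'p y : D y -> q' y <= p y by move=> Dy; exact: le_trans (q'm _ Dy) (mp _ Dy).
  have h : ge (exist P m (And3 ms mp m0)) (exist P _ (modP _ q's q'p)).
    by apply/asboolP => y /=; case: pselect => [Dy|nDy]; [exact: q'm|rewrite m0].
  by have := congr1 (fun s : T => projT1 s x) (mmin _ h) => /=; case: pselect.
Qed.

(** A minimal functional is taken below the tilt of p at x0, so its value at - x0 is at most - p x0;
    being linear, it touches p at x0. *)
Theorem hahn_banach p x0 : sublinear_on p -> D x0 ->
  exists L : V -> R, [/\ forall x y, D x -> D y -> L (x + y) = L x + L y,
    forall k x, D x -> L (k *: x) = k * L x,
    forall x, D x -> L x <= p x & L x0 = p x0].
Proof.
move=> ps Dx0.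
have [q [qs qp qmin]] := minimal_sublinear (tilt_sublinear ps Dx0).
have qt y x : D y -> D x -> tilt q y x = q x.
  by move=> Dy; apply: qmin; [exact: tilt_sublinear|move=> z Dz; exact: tilt_le0].
have qD x y : D x -> D y -> q (x + y) = q x + q y.
  move=> Dx Dy; apply/eqP; rewrite eq_le qs.1//=.
  by have := tilt_le qs Dy Dx ler01; rewrite qt// scale1r mul1r; lra.
have qN x : D x -> q (- x) = - q x.
  move=> Dx; have := qD x (- x) Dx (DN Dx); rewrite subrr (sublinear_on0 qs Dx); lra.
exists q; split => // [k x Dx|x Dx|].
- have [k0|k0] := leP 0 k; first exact: sublinear_onZ.
  have := sublinear_onZ qs (DN Dx) (ltW _ : 0 <= - k); rewrite oppr_gt0 => /(_ k0).
  by rewrite scalerN scaleNr opprK qN// mulrNN.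
- exact: le_trans (qp _ Dx) (tilt_le0 ps Dx0 Dx).
apply/eqP; rewrite eq_le (le_trans (qp _ Dx0) (tilt_le0 ps Dx0 Dx0))//=.
have := le_trans (qp _ (DN Dx0)) (tilt_le ps Dx0 (DN Dx0) ler01).
by rewrite qN// scale1r mul1r addNr (sublinear_on0 ps Dx0); lra.
Qed.

End hahn_banach.

(** * The sublinear expectation on cylinder functions *)

Lemma lip_minpow4 {R : realType} (a : R) : 0 <= a ->
  lip (4 * a ^+ 3) (fun z : R => Num.min (z ^+ 4) (a ^+ 4)).
Proof.
move=> a0.
have E (z : R) : Num.min (z ^+ 4) (a ^+ 4) = (Num.min `|z| a) ^+ 4.
  rewrite -[z ^+ 4]ger0_norm ?exprn_even_ge0// normrX.
  have := normr_ge0 z; move: `|z| => y y0; have mono := ler_pXn2r (ltn0Sn 3) y0 a0.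
  case: (leP y a) => ya; first by apply/min_idPl; rewrite lerXn2r ?nnegrE.
  by apply/min_idPr; rewrite lerXn2r ?nnegrE// ltW.
move=> x y; rewrite !E; set c := Num.min _ _; set d := Num.min _ _.
have /andP[c0 ca] : 0 <= c <= a by rewrite /c le_min normr_ge0 a0 ge_min lexx orbT.
have /andP[d0 da] : 0 <= d <= a by rewrite /d le_min normr_ge0 a0 ge_min lexx orbT.
have cd : `|c - d| <= `|x - y|.
  have := ler_dist_dist x y; apply: le_trans; rewrite /c /d.
  have := ler_norm (`|x| - `|y|); have := ler_norm (- (`|x| - `|y|)); rewrite normrN => h1 h2.
  have := normr_ge0 (`|x| - `|y|) => h3.
  by rewrite ler_norml; case: (leP `|x| a) => ?; case: (leP `|y| a) => ?; apply/andP; split; lra.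
have -> : c ^+ 4 - d ^+ 4 = ((c + d) * (c ^+ 2 + d ^+ 2)) * (c - d) by ring.
rewrite normrM ler_pM// ger0_norm; last by rewrite mulr_ge0 ?addr_ge0 ?sqr_ge0.
have -> : 4 * a ^+ 3 = (a + a) * (a ^+ 2 + a ^+ 2) by ring.
by rewrite ler_pM ?addr_ge0 ?sqr_ge0// lerD// lerXn2r ?nnegrE.
Qed.

Section sublinear_expectation.
Context {R : realType}.
Variables (slo shi : R).
Hypotheses (slo0 : 0 <= slo) (slohi : slo <= shi).
Implicit Types (F H : Omega R -> R).

Local Notation EL := (EL slo shi).

Lemma EL_mono F H : CL F -> CL H -> (forall w, F w <= H w) -> EL F <= EL H.
Proof. by move=> FC HC; exact: cE_mono. Qed.

Lemma EL_add F H : CL F -> CL H -> EL (fun w => F w + H w) <= EL F + EL H.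
Proof. by move=> FC HC; exact: cE_add. Qed.

Lemma EL_affine (k c : R) F : 0 <= k -> CL F -> EL (fun w => k * F w + c) = k * EL F + c.
Proof.
move=> k0 FC; rewrite /EL (@cE_loc _ _ _ slo0 slohi 0 F (fun=> k) (fun=> c))//; exact: CLt_cst.
Qed.

Lemma EL_cst (k : R) : EL (fun=> k) = k.
Proof. by rewrite /EL cE_id//; exact: CLt_cst. Qed.

Lemma EL_hom (k : R) F : 0 <= k -> CL F -> EL (fun w => k * F w) = k * EL F.
Proof.
by move=> k0 FC; have := EL_affine 0 k0 FC; rewrite addr0; under eq_fun do rewrite addr0.
Qed.

(** The moment estimate behind Kolmogorov's continuity criterion; the truncation keeps the integrand
    a cylinder function. *)
Lemma EL_pow4 (r s a : R) : 0 <= r -> r <= s -> 0 <= a ->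
  EL (fun w => Num.min ((B s w - B r w) ^+ 4) (a ^+ 4)) <= 3 * ((s - r) * shi ^+ 2) ^+ 2.
Proof.
move=> r0 rs a0; have s0 := le_trans r0 rs; set M := a ^+ 4; have M0 : 0 <= M by exact: exprn_ge0.
have hb : bdd M (fun z : R => Num.min (z ^+ 4) M).
  move=> z; rewrite ger0_norm; first by rewrite ge_min lexx orbT.
  by rewrite le_min M0 exprn_even_ge0.
have hl : lip (4 * a ^+ 3) (fun z : R => Num.min (z ^+ 4) M) by exact: lip_minpow4.
pose F (w : Omega R) := Num.min ((B s w - B r w) ^+ 4) M.
have Fs : CLt s F.
  by apply: (CLt_B2 (phi := fun z => Num.min (z ^+ 4) M) _ _ hl hb); rewrite ?r0 ?s0 ?rs ?lexx.
rewrite -/F /EL -(cE_tower slo0 slohi (lexx 0) r0 (CLt_CL s0 Fs)).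
have -> : cE slo shi r F = fun=> gval slo shi (fun z => Num.min (z ^+ 4) M) (s - r) 0.
  by apply/funext => w; exact: (cE_B2 slo0 slohi w r0 rs (lexx s) hl hb).
by rewrite -/(EL _) EL_cst; apply: val_pow4 => //; rewrite subr_ge0.
Qed.

Lemma EL_hahn_banach F : CL F -> exists L : (Omega R -> R) -> R,
  [/\ forall F H, CL F -> CL H -> L (fun w => F w + H w) = L F + L H,
      forall k F, CL F -> L (fun w => k * F w) = k * L F,
      forall F, CL F -> L F <= EL F & L F = EL F].
Proof.
move=> FC.
have [||||L [LD LZ LE LF]] := @hahn_banach R (Omega R -> R) CL _ _ EL F.
- by move=> G H GC HC; exact: CL_add.
- by move=> k G GC; exact: CL_scale.
- split=> [G H GC HC|k G k0 GC]; first exact: EL_add.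
  by rewrite -(EL_hom (ltW k0) GC).
- exact: FC.
by exists L.
Qed.

End sublinear_expectation.

(** * Limits of paths with controlled dyadic increments *)

Section compactness.
Context {R : realType}.

Lemma bdd_seq_eventually (u : nat -> R) (M : R) N :
  (forall n, (N <= n)%N -> `|u n| <= M) -> bdd_seq u.
Proof.
move=> uM; exists (`|M| + \sum_(i < N) `|u i|) => n.
have [Nn|nN] := leqP N n.
  by rewrite (le_trans (uM _ Nn))// (le_trans (ler_norm _))// lerDl sumr_ge0.
rewrite (bigD1 (Ordinal nN))//= addrCA lerDl.
by rewrite addr_ge0// sumr_ge0.
Qed.

Lemma ulim_dist (x y : nat -> R) e N : bdd_seq x -> bdd_seq y ->
  (forall n, (N <= n)%N -> `|x n - y n| <= e) -> `|ulim x - ulim y| <= e.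
Proof.
move=> bx by_ h.
have near_ : \forall n \near (@free_ultrafilter), `|x n - y n| <= e.
  by apply: free_near; near=> n; apply: h; near: n; exact: nbhs_infty_ge.
rewrite ler_norml; apply/andP; split.
  rewrite lerBrDr addrC -(ulim_cst (- e)) -ulimD//; last exact: bdd_seq_cst.
  apply: le_ulim_near => //; first by apply: bdd_seqD => //; exact: bdd_seq_cst.
  by apply: filterS near_ => n; rewrite ler_norml => /andP[]; lra.
rewrite lerBlDl -(ulim_cst e) -ulimD//; last exact: bdd_seq_cst.
apply: le_ulim_near => //; first by apply: bdd_seqD => //; exact: bdd_seq_cst.
by apply: filterS near_ => n; rewrite ler_norml => /andP[]; lra.
Unshelve. all: by end_near.
Qed.

(** Geometric rate allowed for increments at dyadic level j. It is below 1, so increments sum up,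
    while 2 theta^4 > 1, so the fourth moment bounds still sum over levels. *)
Definition theta : R := 9 / 10.

Definition level j (t : R) : nat := Num.trunc (t * 2 ^+ j).

Lemma pow2_gt0 j : 0 < 2 ^+ j :> R.
Proof. exact: exprn_gt0. Qed.

Lemma dyadic_ge0 n k : 0 <= dyadic n k :> R.
Proof. by rewrite divr_ge0// ltW// pow2_gt0. Qed.

Lemma level_le j (t : R) : 0 <= t -> dyadic j (level j t) <= t.
Proof.
move=> t0; rewrite /dyadic ler_pdivrMr ?pow2_gt0//.
by have /truncn_itv/andP[] : 0 <= t * 2 ^+ j by rewrite mulr_ge0// ltW// pow2_gt0.
Qed.

Lemma level_lt j (t : R) : 0 <= t -> t < dyadic j (level j t).+1.
Proof.
move=> t0; rewrite /dyadic ltr_pdivlMr ?pow2_gt0//.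
by have /truncn_itv/andP[] : 0 <= t * 2 ^+ j by rewrite mulr_ge0// ltW// pow2_gt0.
Qed.

Lemma level_mono j (s t : R) : s <= t -> (level j s <= level j t)%N.
Proof. by move=> st; apply: le_truncn; rewrite ler_wpM2r// ltW// pow2_gt0. Qed.

Lemma level_bound j k (t : R) : t <= k%:R -> (level j t <= k * 2 ^ j)%N.
Proof.
move=> tk; have -> : (k * 2 ^ j)%N = Num.trunc ((k * 2 ^ j)%:R : R) by rewrite natrK.
apply: le_truncn.
by rewrite natrM natrX ler_wpM2r// ltW// pow2_gt0.
Qed.

Lemma dyadic_lt j k l : (dyadic j k < dyadic j l :> R) = (k < l)%N.
Proof. by rewrite /dyadic ltr_pM2r ?invr_gt0 ?pow2_gt0// ltr_nat. Qed.

Lemma dyadic_double j k : dyadic j.+1 k.*2 = dyadic j k :> R.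
Proof.
by rewrite /dyadic -mul2n natrM exprS invfM mulrACA divff// mul1r.
Qed.

Lemma level_step j (t : R) : 0 <= t ->
  level j.+1 t = (level j t).*2 \/ level j.+1 t = (level j t).*2.+1.
Proof.
move=> t0; have h1 := level_le j t0; have h2 := level_lt j t0.
have h3 := level_le j.+1 t0; have h4 := level_lt j.+1 t0.
have : (level j.+1 t < (level j t).+1.*2)%N.
  by rewrite -(dyadic_lt j.+1) dyadic_double (le_lt_trans h3).
have : ((level j t).*2 < (level j.+1 t).+1)%N.
  by rewrite -(dyadic_lt j.+1) dyadic_double (le_lt_trans h1).
by move: (level j.+1 t) (level j t) => a b; clear; lia.
Qed.

Lemma level_close j (s t : R) : 0 <= s -> s <= t -> t - s <= (2 ^+ j)^-1 ->
  level j t = level j s \/ level j t = (level j s).+1.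
Proof.
move=> s0 st ts; have t0 := le_trans s0 st.
have h1 := level_mono j st.
have : (level j t < (level j s).+2)%N.
  rewrite -(dyadic_lt j) (le_lt_trans (level_le j t0))//.
  have := level_lt j s0; rewrite /dyadic.
  have -> : (level j s).+2%:R = (level j s).+1%:R + 1 :> R by rewrite natr1.
  rewrite mulrDl mul1r.
  by move: ts; move: (2 ^+ j)^-1 => y; move: (_ * y) => x; clear; lra.
by move: h1; move: (level j s) (level j t) => a b; clear; lia.
Qed.

Section limit_path.
Variables (w : nat -> Omega R) (a : R) (s : nat -> R).
Hypotheses (a0 : 0 <= a) (s0 : forall i, 0 <= s i).
Hypothesis dyadic_incr : forall n j i, (j <= n)%N -> (i < j * 2 ^ j)%N ->
  `|B (dyadic j i.+1) (w n) - B (dyadic j i) (w n)| <= a * theta ^+ j.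
Hypothesis extra_incr : forall n j i, (j <= n)%N -> (i < j)%N ->
  `|B (s i) (w n) - B (dyadic j (level j (s i))) (w n)| <= a * theta ^+ j.

Let theta_ge0 : 0 <= theta. Proof. by rewrite /theta; lra. Qed.

Let rate_ge0 j : 0 <= a * theta ^+ j.
Proof. by rewrite mulr_ge0// exprn_ge0. Qed.

Let bdd_dyadic j k : (k <= j * 2 ^ j)%N -> bdd_seq (fun n => B (dyadic j k) (w n)).
Proof.
move=> kj; apply: (@bdd_seq_eventually _ (k%:R * (a * theta ^+ j)) j) => n jn.
elim: k kj => [|k IH] kj; first by rewrite /dyadic mul0r B_le0// normr0 mul0r.
rewrite -(subrK (B (dyadic j k) (w n)) (B _ _)) (le_trans (ler_normD _ _))//.
by rewrite -natr1 mulrDl mul1r addrC lerD ?IH 1?ltnW// dyadic_incr.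
Qed.

(** Ultralimit over the sequence of the paths at the level j dyadic point below t; [vlim] is then
    the ultralimit over levels. *)
Definition Vlev j t := ulim (fun n => B (dyadic j (level j t)) (w n)).

Let bdd_lev j (t : R) : t <= j%:R -> bdd_seq (fun n => B (dyadic j (level j t)) (w n)).
Proof. by move=> tj; apply: bdd_dyadic; exact: level_bound. Qed.

Let Vlev_step j (t : R) : 0 <= t -> t <= j%:R -> `|Vlev j.+1 t - Vlev j t| <= a * theta ^+ j.+1.
Proof.
move=> t0 tj; have tj1 : t <= j.+1%:R by rewrite (le_trans tj)// ler_nat.
apply: (ulim_dist (N := j.+1)); [exact: bdd_lev|exact: bdd_lev|move=> n jn].
rewrite -(dyadic_double j); have := level_bound j tj.
case: (level_step j t0) => -> lj; first by rewrite subrr normr0.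
apply: dyadic_incr => //; rewrite expnS mulnCA mulSn -mul2n; lia.
Qed.

(** The factor 10 is 1 / (1 - theta), from summing the geometric series. *)
Let Vlev_dist j k (t : R) : 0 <= t -> t <= j%:R -> (j <= k)%N ->
  `|Vlev k t - Vlev j t| <= 10 * a * (theta ^+ j - theta ^+ k).
Proof.
move=> t0 tj /subnKC <-; elim: (k - j)%N => [|n IH]; first by rewrite addn0 !subrr normr0 mulr0.
rewrite addnS; rewrite -[Vlev _ t](subrK (Vlev (j + n) t)) -addrA (le_trans (ler_normD _ _))//.
have tjn : t <= (j + n)%:R by rewrite (le_trans tj)// ler_nat leq_addr.
have := Vlev_step t0 tjn; rewrite exprS; move: IH (rate_ge0 (j + n)).
move: `|_| `|_| (theta ^+ (j + n)) (theta ^+ j) => x y p q; rewrite /theta; lra.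
Qed.

Let bdd_Vlev (t : R) : 0 <= t -> bdd_seq (Vlev^~ t).
Proof.
move=> t0; pose j := (Num.trunc t).+1.
have tj : t <= j%:R by rewrite ltW// truncnS_gt.
apply: (@bdd_seq_eventually _ (`|Vlev j t| + 10 * a * theta ^+ j) j) => k jk.
rewrite -[Vlev k t](subrK (Vlev j t)) addrC (le_trans (ler_normD _ _))// lerD2l.
rewrite (le_trans (Vlev_dist t0 tj jk))// ler_wpM2l ?mulr_ge0// lerBlDr lerDl.
exact: exprn_ge0.
Qed.

Definition vlim (t : R) := ulim (Vlev^~ (Num.max t 0)).

Let vlim_dist j (t : R) : 0 <= t -> t <= j%:R -> `|vlim t - Vlev j t| <= 10 * a * theta ^+ j.
Proof.
move=> t0 tj; rewrite /vlim (max_idPl t0) -(ulim_cst (Vlev j t)).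
apply: (ulim_dist (N := j)); [exact: bdd_Vlev|exact: bdd_seq_cst|move=> k jk].
rewrite (le_trans (Vlev_dist t0 tj jk))// ler_wpM2l ?mulr_ge0// lerBlDr lerDl.
exact: exprn_ge0.
Qed.

Let vlim_close j (r t : R) : 0 <= r -> r <= t -> t <= j%:R -> t - r <= (2 ^+ j)^-1 ->
  `|vlim t - vlim r| <= 21 * a * theta ^+ j.
Proof.
move=> r0 rt tj trj; have t0 := le_trans r0 rt; have rj := le_trans rt tj.
have h1 := vlim_dist t0 tj; have h2 := vlim_dist r0 rj.
have h3 : `|Vlev j t - Vlev j r| <= a * theta ^+ j.
  apply: (ulim_dist (N := j)); [exact: bdd_lev|exact: bdd_lev|move=> n jn].
  have := level_bound j tj; case: (level_close r0 rt trj) => -> lj.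
    by rewrite subrr normr0.
  exact: dyadic_incr.
have -> : vlim t - vlim r = (vlim t - Vlev j t) + (Vlev j t - Vlev j r) - (vlim r - Vlev j r).
  by ring.
rewrite (le_trans (ler_normB _ _))// (le_trans (lerD (ler_normD _ _) (lexx _)))//.
lra.
Qed.

Lemma theta_small e : 0 < e -> \forall j \near \oo, a * theta ^+ j < e.
Proof.
move=> e0; have : geometric a theta j @[j --> \oo] --> 0.
  by apply: cvg_geometric; rewrite ger0_norm// /theta; lra.
move=> /cvgrPdist_lt /(_ e e0); apply: filterS => j.
by rewrite sub0r normrN ger0_norm// /geometric/= rate_ge0.
Qed.

Lemma cpaths_vlim : cpaths vlim.
Proof.
split=> [t|t t0]; last first.
  rewrite /vlim (max_idPr t0) (_ : Vlev^~ 0 = fun=> 0) ?ulim_cst//.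
  apply/funext => j; rewrite /Vlev (_ : (fun n => _) = fun=> 0) ?ulim_cst//.
  by apply/funext => n; rewrite B_le0// /level mul0r truncn0 /dyadic mul0r.
apply/cvgrPdist_le => e e0.
have e1 : 0 < e / 21 by rewrite divr_gt0.
have [j [tj je]] : exists j, Num.max t 0 + 1 <= j%:R /\ a * theta ^+ j < e / 21.
  have : \forall j \near \oo, Num.max t 0 + 1 <= j%:R /\ a * theta ^+ j < e / 21.
    near=> j; split; last by near: j; exact: theta_small.
    by near: j; exact: nbhs_infty_ger.
  by move=> [N _ /(_ N (leqnn N))]; exists N.
have d0 : 0 < (2 ^+ j)^-1 :> R by rewrite invr_gt0 pow2_gt0.
have d1 : (2 ^+ j)^-1 <= 1 :> R.
  by rewrite invf_le1 ?pow2_gt0// exprn_ege1// ler1n.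
near=> r.
have : `|t - r| <= (2 ^+ j)^-1.
  by near: r; apply: filterS (nbhsx_ballx t _ d0) => z /ltW.
have vE x : vlim x = vlim (Num.max x 0) by rewrite /vlim -maxA maxxx.
rewrite (vE t) (vE r).
have m0 : 0 <= Num.max t 0 by rewrite le_max lexx orbT.
have n0 : 0 <= Num.max r 0 by rewrite le_max lexx orbT.
move=> tr; have mn : `|Num.max t 0 - Num.max r 0| <= (2 ^+ j)^-1.
  move: tr; rewrite !ler_norml => /andP[h1 h2].
  by apply/andP; split; case: (leP t 0) => ?; case: (leP r 0) => ?; lra.
have le_e : 21 * a * theta ^+ j <= e.
  by move: je; move: (theta ^+ j) => p; lra.
case: (leP (Num.max t 0) (Num.max r 0)) => [mr|/ltW mr].
  apply: le_trans le_e; rewrite distrC; apply: vlim_close => //.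
    by move: mn; rewrite ler_norml => /andP[]; lra.
  by move: mn; rewrite ler_norml => /andP[]; lra.
apply: le_trans le_e; apply: vlim_close => //; first by lra.
by move: mn; rewrite ler_norml => /andP[].
Unshelve. all: by end_near.
Qed.

(** Uniform geometric control of the increments makes [vlim] continuous. The hypothesis on the extra
    times s i ties them to nearby dyadic points, so the limit path is also correct there. *)
Lemma limit_path : exists w0 : Omega R,
  forall i, bdd_seq (fun n => B (s i) (w n)) /\ B (s i) w0 = ulim (fun n => B (s i) (w n)).
Proof.
exists (path_of vlim) => i; rewrite path_ofE; last exact: cpaths_vlim.
pose j0 := maxn i.+1 (Num.trunc (s i)).+1.
have j0P j : (j0 <= j)%N -> (i < j)%N /\ s i <= j%:R.
  rewrite geq_max => /andP[ij tj]; split => //.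
  by rewrite (le_trans (ltW (truncnS_gt _)))// ler_nat.
have bs : bdd_seq (fun n => B (s i) (w n)).
  have [ij sj] := j0P _ (leqnn j0).
  have [M hM] := bdd_lev sj.
  apply: (@bdd_seq_eventually _ (M + a * theta ^+ j0) j0) => n jn.
  rewrite -(subrK (B (dyadic j0 (level j0 (s i))) (w n)) (B _ _)) addrC.
  by rewrite (le_trans (ler_normD _ _))// lerD// extra_incr.
split => //; apply/eqP; rewrite -subr_eq0 -normr_le0; apply/ler_addgt0Pl => e e0.
have e1 : 0 < e / 11 by rewrite divr_gt0.
have [j [j0j je]] : exists j, (j0 <= j)%N /\ a * theta ^+ j < e / 11.
  have : \forall j \near \oo, (j0 <= j)%N /\ a * theta ^+ j < e / 11.
    near=> j; split; last by near: j; exact: theta_small.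
    by near: j; exact: nbhs_infty_ge.
  by move=> [N _ /(_ N (leqnn N))]; exists N.
have [ij sj] := j0P _ j0j.
have h1 := vlim_dist (s0 i) sj.
have h2 : `|ulim (fun n => B (s i) (w n)) - Vlev j (s i)| <= a * theta ^+ j.
  by apply: (ulim_dist (N := j)); [exact: bs|exact: bdd_lev|move=> n jn; exact: extra_incr].
rewrite addr0 -[vlim _](subrK (Vlev j (s i))) -addrA (le_trans (ler_normD _ _))//.
move: h1 h2 je.
rewrite [`|Vlev _ _ - _|]distrC.
by move: `|_| `|_| (theta ^+ j) => x y p; lra.
Unshelve. all: by end_near.
Qed.

End limit_path.

End compactness.

(** * Dominated linear functionals and Daniell's property *)

Lemma natr_le_geometric (R : realType) j : j%:R <= 10 * (11 / 10) ^+ j :> R.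
Proof.
elim: j => [|k IH]; first by rewrite expr0; lra.
have : 1 <= (11 / 10) ^+ k :> R by rewrite exprn_ege1//; lra.
rewrite exprS (_ : k.+1%:R = k%:R + 1); last by rewrite natr1.
by move: IH; move: (k%:R) (_ ^+ k) => x y; clear; lra.
Qed.

Section representing_functional.
Context {R : realType}.
Variables (slo shi : R).
Hypotheses (slo0 : 0 <= slo) (slohi : slo <= shi).
Implicit Types (F H : Omega R -> R) (L : (Omega R -> R) -> R).

Local Notation EL := (EL slo shi).

Definition dominated L : Prop :=
  [/\ forall F H, CL F -> CL H -> L (fun w => F w + H w) = L F + L H,
      forall k F, CL F -> L (fun w => k * F w) = k * L F &
      forall F, CL F -> L F <= EL F].

Variable L : (Omega R -> R) -> R.
Hypothesis domL : dominated L.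

Lemma domD F H : CL F -> CL H -> L (fun w => F w + H w) = L F + L H.
Proof. by have [h _ _] := domL; exact: h. Qed.

Lemma domZ k F : CL F -> L (fun w => k * F w) = k * L F.
Proof. by have [_ h _] := domL; exact: h. Qed.

Lemma dom_le F : CL F -> L F <= EL F.
Proof. by have [_ _ h] := domL; exact: h. Qed.

Lemma domB F H : CL F -> CL H -> L (fun w => F w - H w) = L F - L H.
Proof.
move=> FC HC; have HN := CL_opp HC.
rewrite (_ : (fun w => F w - H w) = fun w => F w + (fun w => -1 * H w) w).
  by rewrite domD//; [rewrite domZ// mulN1r|exact: CL_scale].
by apply/funext => w; rewrite mulN1r.
Qed.

Lemma dom_mono F H : CL F -> CL H -> (forall w, F w <= H w) -> L F <= L H.
Proof.
move=> FC HC FH; rewrite -subr_le0 -domB// (le_trans (dom_le (CL_sub FC HC)))//.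
rewrite -(EL_cst slo0 slohi 0); apply: EL_mono => //; [exact: CL_sub|exact: CL_cst|].
by move=> w; rewrite subr_le0.
Qed.

Lemma dom_cst k : L (fun=> k) = k.
Proof.
have h x : L (fun=> x) <= x.
  by have := dom_le (CL_cst x); rewrite EL_cst.
apply/eqP; rewrite eq_le h/=.
have := h (- k); rewrite (_ : (fun=> - k) = fun w : Omega R => -1 * k); last first.
  by apply/funext => w; rewrite mulN1r.
by rewrite (domZ (-1) (CL_cst k)); lra.
Qed.

Lemma dom_ge0 F : CL F -> (forall w, 0 <= F w) -> 0 <= L F.
Proof. by move=> FC F0; rewrite -(dom_cst 0); apply: dom_mono => //; exact: CL_cst. Qed.

Lemma dom_sum n (F : nat -> Omega R -> R) : (forall i, CL (F i)) ->
  CL (fun w => \sum_(i < n) F i w) /\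
  L (fun w => \sum_(i < n) F i w) = \sum_(i < n) L (F i).
Proof.
move=> FC; elim: n => [|n [IC IL]].
  rewrite big_ord0 (_ : (fun w => _) = fun=> 0).
    by split; [exact: CL_cst|exact: dom_cst].
  by apply/funext => w; rewrite big_ord0.
rewrite big_ord_recr/= (_ : (fun w => _) = fun w => \sum_(i < n) F i w + F n w).
  by rewrite domD// IL; split => //; exact: CL_add.
by apply/funext => w; rewrite big_ord_recr.
Qed.

(** Chebyshev majorant with values in [0, 1], equal to 1 exactly when the increment has size at
    least p. *)
Definition osc (r s p : R) (w : Omega R) : R :=
  p ^- 4 * Num.min ((B s w - B r w) ^+ 4) (p ^+ 4).

Lemma osc_ge0 r s p w : 0 <= p -> 0 <= osc r s p w.
Proof.
move=> p0; rewrite mulr_ge0 ?invr_ge0 ?exprn_ge0// le_min exprn_even_ge0//=.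
exact: exprn_ge0.
Qed.

Lemma osc_lt1 r s p w : 0 < p -> osc r s p w < 1 -> `|B s w - B r w| <= p.
Proof.
move=> p0; apply: contraTT; rewrite -ltNge -leNgt => h.
rewrite /osc (min_idPr _) ?mulVf// ?expf_neq0 ?gt_eqF//.
by rewrite -[leRHS]ger0_norm ?exprn_even_ge0// normrX lerXn2r ?nnegrE// ltW.
Qed.

Lemma osc_CL r s p : 0 <= r -> r <= s -> 0 <= p -> CL (osc r s p).
Proof.
move=> r0 rs p0; apply: CL_scale; exists s; first exact: le_trans rs.
apply: (CLt_B2 (phi := fun z => Num.min (z ^+ 4) (p ^+ 4)) (L := 4 * p ^+ 3) (M := p ^+ 4)).
- by rewrite r0.
- by rewrite (le_trans r0) ?lexx.
- exact: lip_minpow4.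
- move=> z; rewrite ger0_norm; first by rewrite ge_min lexx orbT.
  by rewrite le_min exprn_even_ge0//= exprn_ge0.
Qed.

Lemma dom_osc r s p (d : R) : 0 <= r -> r <= s -> s - r <= d -> 0 < p ->
  L (osc r s p) <= 3 * (d * shi ^+ 2) ^+ 2 / p ^+ 4.
Proof.
move=> r0 rs sd p0; have := osc_CL r0 rs (ltW p0); rewrite /osc => oC.
have d0 : 0 <= d by apply: le_trans sd; rewrite subr_ge0.
rewrite (le_trans (dom_le oC))// EL_hom//; first last.
- have := CL_scale (p ^+ 4) oC; congr CL; apply/funext => w.
  by rewrite mulrA divff ?mul1r// expf_neq0// gt_eqF.
- by rewrite invr_ge0 exprn_ge0// ltW.
rewrite mulrC ler_pM2r ?invr_gt0 ?exprn_gt0//.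
rewrite (le_trans (EL_pow4 slo0 slohi r0 rs (ltW p0)))// ler_wpM2l//.
move: (shi ^+ 2) (sqr_ge0 shi) => v v0.
by rewrite lerXn2r ?nnegrE ?mulr_ge0 ?subr_ge0// ler_wpM2r.
Qed.

Section chaining.
Variables (a : R) (s : nat -> R).
Hypotheses (a1 : 1 <= a) (s0 : forall i, 0 <= s i).

Let a_ge0 : 0 <= a. Proof. exact: le_trans a1. Qed.

Let const_ge0 (k : nat) : 0 <= k%:R * shi ^+ 4 / a ^+ 4.
Proof. by rewrite divr_ge0 ?exprn_ge0// mulr_ge0// exprn_even_ge0. Qed.

Let rate j : 0 < a * theta ^+ j.
Proof. by rewrite mulr_gt0 ?exprn_gt0// /theta; [exact: lt_le_trans a1|lra]. Qed.

(** The dyadic increments of level j on [0, j], and the distance of the first j extra times to the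
    dyadic points below them. *)
Definition osc_level j (w : Omega R) : R :=
  \sum_(i < j * 2 ^ j) osc (dyadic j i) (dyadic j i.+1) (a * theta ^+ j) w +
  \sum_(i < j) osc (dyadic j (level j (s i))) (s i) (a * theta ^+ j) w.

Let dyadicS j i : dyadic j i.+1 = dyadic j i + (2 ^+ j)^-1 :> R.
Proof. by rewrite /dyadic -natr1 mulrDl mul1r. Qed.

Let dyadic_leS j i : dyadic j i <= dyadic j i.+1 :> R.
Proof. by rewrite dyadicS lerDl invr_ge0 ltW// pow2_gt0. Qed.

Let bound j : 3 * ((2 ^+ j)^-1 * shi ^+ 2) ^+ 2 / (a * theta ^+ j) ^+ 4 =
  3 * shi ^+ 4 / a ^+ 4 * (2 ^+ j)^-1 * (1 / (2 * theta ^+ 4)) ^+ j.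
Proof.
have -> : (1 / (2 * theta ^+ 4)) ^+ j = 1 / (2 ^+ j * (theta ^+ j) ^+ 4) :> R.
  by rewrite expr_div_n expr1n exprMn exprAC.
have h1 : 2 ^+ j != 0 :> R by rewrite expf_neq0.
have h2 : theta ^+ j != 0 :> R by rewrite expf_neq0// gt_eqF// /theta; lra.
have h3 : a != 0 by rewrite gt_eqF// (lt_le_trans ltr01).
by move: (theta ^+ j) (2 ^+ j) h1 h2 => x y h1 h2; field; rewrite h1 h2 h3.
Qed.

(** There are j 2^j + j terms, each of order 4^-j / theta^(4 j). Their sum is of order j (2
    theta^4)^-j, and trading j for 10 (11/10)^j leaves the ratio 17/20. *)
Lemma osc_levelP j : CL (osc_level j) /\
  L (osc_level j) <= 60 * shi ^+ 4 / a ^+ 4 * (17 / 20) ^+ j.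
Proof.
set p := a * theta ^+ j.
have C1 i : CL (osc (dyadic j i) (dyadic j i.+1) p) by apply: osc_CL; [exact: dyadic_ge0|exact: dyadic_leS|exact: ltW (rate j)].
have C2 i : CL (osc (dyadic j (level j (s i))) (s i) p).
  by apply: osc_CL; [exact: dyadic_ge0|exact: level_le|exact: ltW (rate j)].
have [S1 E1] := dom_sum (j * 2 ^ j) C1; have [S2 E2] := dom_sum j C2.
split; first exact: CL_add.
rewrite /osc_level domD// E1 E2.
set b := 3 * ((2 ^+ j)^-1 * shi ^+ 2) ^+ 2 / p ^+ 4.
have h1 : \sum_(i < j * 2 ^ j) L (osc (dyadic j i) (dyadic j i.+1) p) <= (j * 2 ^ j)%:R * b.
  rewrite mulr_natl -[X in _ *+ X](card_ord (j * 2 ^ j)) -sumr_const; apply: ler_sum => i _.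
  apply: dom_osc; [exact: dyadic_ge0|exact: dyadic_leS| |exact: rate].
  by rewrite dyadicS addrAC subrr add0r.
have h2 : \sum_(i < j) L (osc (dyadic j (level j (s i))) (s i) p) <= j%:R * b.
  rewrite mulr_natl -[X in _ *+ X](card_ord j) -sumr_const; apply: ler_sum => i _.
  apply: dom_osc; [exact: dyadic_ge0|exact: level_le| |exact: rate].
  by have := level_lt j (s0 i); rewrite dyadicS => /ltW; rewrite lerBlDl.
have b0 : 0 <= b.
  by rewrite divr_ge0 ?exprn_ge0 ?(ltW (rate _))// mulr_ge0// sqr_ge0.
have {h1 h2} h : \sum_(i < j * 2 ^ j) L (osc (dyadic j i) (dyadic j i.+1) p) +
    \sum_(i < j) L (osc (dyadic j (level j (s i))) (s i) p) <= 2 * j%:R * 2 ^+ j * b.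
  rewrite (le_trans (lerD h1 h2))// -mulrDl ler_wpM2r// natrM natrX.
  rewrite (_ : 2 * j%:R * 2 ^+ j = j%:R * 2 ^+ j + j%:R * 2 ^+ j); last by ring.
  by rewrite lerD2l ler_peMr// exprn_ege1// ler1n.
rewrite (le_trans h)// /b bound.
have jb := natr_le_geometric R j.
have K0 : 0 <= 6 * shi ^+ 4 / a ^+ 4.
  exact: const_ge0.
have -> : 2 * j%:R * 2 ^+ j * (3 * shi ^+ 4 / a ^+ 4 * (2 ^+ j)^-1 * (1 / (2 * theta ^+ 4)) ^+ j) =
    6 * shi ^+ 4 / a ^+ 4 * (j%:R * (1 / (2 * theta ^+ 4)) ^+ j).
  have h1 : (2 ^+ j != 0 :> R) by rewrite expf_neq0.
  have h3 : a != 0 by rewrite gt_eqF// (lt_le_trans ltr01).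
  by move: ((1 / (2 * theta ^+ 4)) ^+ j) => x; field; rewrite h1 h3.
have -> : 60 * shi ^+ 4 / a ^+ 4 * (17 / 20) ^+ j = 6 * shi ^+ 4 / a ^+ 4 * (10 * (17 / 20) ^+ j).
  by ring.
rewrite ler_wpM2l//.
have q0 : 0 <= 1 / (2 * theta ^+ 4) :> R by rewrite /theta; lra.
rewrite (le_trans (ler_wpM2r (exprn_ge0 _ q0) jb))// -mulrA ler_wpM2l// -exprMn.
by rewrite lerXn2r ?nnegrE ?mulr_ge0//; rewrite /theta; lra.
Qed.

Definition osc_total n (w : Omega R) : R := \sum_(j < n) osc_level j w.

Lemma osc_totalP n : CL (osc_total n) /\ L (osc_total n) <= 400 * shi ^+ 4 / a ^+ 4.
Proof.
have [C E] := dom_sum n (fun j => (osc_levelP j).1); split => //.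
rewrite /osc_total E; set K := 400 * shi ^+ 4 / a ^+ 4.
have K0 : 0 <= K.
  exact: const_ge0.
suff : \sum_(i < n) L (osc_level i) <= K * (1 - (17 / 20) ^+ n).
  move=> h; rewrite (le_trans h)// ler_piMr// lerBlDr lerDl exprn_ge0//; lra.
elim: n {C E} => [|n IH]; first by rewrite big_ord0 expr0 subrr mulr0.
rewrite big_ord_recr/= (le_trans (lerD IH (osc_levelP n).2))//.
rewrite (_ : 60 * shi ^+ 4 / a ^+ 4 = K * (3 / 20)); last by rewrite /K; field; rewrite gt_eqF// (lt_le_trans ltr01).
by rewrite exprS; move: (_ ^+ n) => x; lra.
Qed.

Lemma osc_level_ge0 j w : 0 <= osc_level j w.
Proof.
by apply: addr_ge0; apply: sumr_ge0 => i _; apply: osc_ge0; exact: ltW.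
Qed.

Lemma osc_total_lt1 n w : osc_total n.+1 w < 1 -> forall j, (j <= n)%N ->
  (forall i, (i < j * 2 ^ j)%N -> `|B (dyadic j i.+1) w - B (dyadic j i) w| <= a * theta ^+ j) /\
  (forall i, (i < j)%N -> `|B (s i) w - B (dyadic j (level j (s i))) w| <= a * theta ^+ j).
Proof.
move=> h j jn; have jn1 : (j < n.+1)%N by [].
have hl : osc_level j w < 1.
  apply: le_lt_trans h; rewrite /osc_total (bigD1 (Ordinal jn1))//= lerDl sumr_ge0// => i _.
  exact: osc_level_ge0.
have o0 r t : 0 <= osc r t (a * theta ^+ j) w by apply: osc_ge0; exact: ltW.
split=> i ij; apply: (@osc_lt1 _ _ _ _ (rate j)); apply: le_lt_trans hl.
  by rewrite /osc_level (bigD1 (Ordinal ij))//= -addrA lerDl addr_ge0// sumr_ge0.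
rewrite /osc_level addrC (bigD1 (Ordinal ij))//= -addrA lerDl addr_ge0// sumr_ge0//.
Qed.

End chaining.

(** Pick paths w n where X n plus the total oscillation is small; they exist because L of this sum
    is. Small oscillation controls all increments, so a limit path exists. Each X m depends on
    finitely many of its values and the X n increase, so X m stays below 1 at the limit. *)
Theorem daniell (X : nat -> Omega R -> R) (c : R) : (forall n, CL (X n)) ->
  (forall n w, 0 <= X n w) -> (forall n w, X n w <= X n.+1 w) ->
  c < 1 -> (forall n, L (X n) <= c) -> exists w, forall n, X n w < 1.
Proof.
move=> XC X0 Xmono c1 Xc.
have /choice[p hp] : forall n, exists p : seq R * (R * R),
    (forall x, x \in p.1 -> 0 <= x) /\ cyl p.1 p.2.1 p.2.2 (X n).
  move=> n; have [t _ [g [K [M [gt cX]]]]] := XC n.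
  by exists (g, (K, M)); split => // x /gt/andP[].
(* An enumeration of all times occurring in the grids of all X n. *)
pose s i := if unpickle i is Some (m, k) then nth 0 (p m).1 k else 0 : R.
have s0 i : 0 <= s i.
  rewrite /s; case: unpickle => [[m k]|//].
  have [kp|kp] := ltnP k (size (p m).1); last by rewrite nth_default.
  by apply: (hp m).1; rewrite mem_nth.
have sE m x : x \in (p m).1 -> exists i, s i = x.
  move=> xp; exists (pickle (m, index x (p m).1)).
  by rewrite /s pickleK nth_index.
(* The bound a makes L of the total oscillation at most (1 - c) / 2, so that L of the sum is at most
   (1 + c) / 2, strictly below (3 + c) / 4. *)
pose A := 800 * shi ^+ 4 / (1 - c); pose a := 1 + A.
have c0 : 0 < 1 - c by rewrite subr_gt0.
have A0 : 0 <= A by apply: divr_ge0 (ltW c0); apply: mulr_ge0; [exact: ler0n|exact: exprn_even_ge0].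
have a1 : 1 <= a by rewrite lerDl.
have aK : 400 * shi ^+ 4 / a ^+ 4 <= (1 - c) / 2.
  rewrite ler_pdivrMr ?exprn_gt0 ?(lt_le_trans ltr01)//.
  have -> : 400 * shi ^+ 4 = (1 - c) / 2 * A by rewrite /A; field; rewrite gt_eqF.
  rewrite ler_wpM2l//; first by rewrite divr_ge0// ltW.
  rewrite (@le_trans _ _ a)//; first by rewrite lerDr.
  by rewrite -[leLHS]expr1 ler_weXn2l.
have /choice[w hw] : forall n, exists w, X n w + osc_total a s n.+1 w < (3 + c) / 4.
  move=> n; apply: contrapT => /forallNP h.
  have [oC oL] := osc_totalP a1 s0 n.+1.
  have : L (fun=> (3 + c) / 4) <= L (fun w => X n w + osc_total a s n.+1 w).
    apply: dom_mono; [exact: CL_cst|exact: CL_add|move=> w].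
    by rewrite leNgt; apply/negP/h.
  rewrite dom_cst domD// => h1; have := Xc n; move: h1 aK oL; move: (_ / a ^+ 4) => x; lra.
have T0 n w' : 0 <= osc_total a s n w'.
  by apply: sumr_ge0 => j _; exact: osc_level_ge0.
have Tlt n : osc_total a s n.+1 (w n) < 1 by have := hw n; have := X0 n (w n); lra.
have [w0 hw0] := @limit_path R w a s (le_trans ler01 a1) s0
  (fun n j i jn => ((osc_total_lt1 a1 (Tlt n) jn).1 i))
  (fun n j i jn => ((osc_total_lt1 a1 (Tlt n) jn).2 i)).
have Xmono2 m n w' : (m <= n)%N -> X m w' <= X n w'.
  by move=> /subnKC <-; elim: (n - m)%N => [|k IH]; rewrite ?addn0// addnS (le_trans IH).
exists w0 => m; have [K0 _ KX] := (hp m).2; set g := (p m).1 in KX; set K := (p m).2.1 in K0 KX.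
have gap_small e : 0 < e -> \forall n \near (@free_ultrafilter), gap g w0 (w n) <= e.
  move: e; have : forall x, x \in g -> exists i, s i = x by exact: sE.
  elim: g {KX} => [|x g IH] gs e e0; first by apply: nearW => n; rewrite /gap big_nil ltW.
  have [i <-] := gs x (mem_head _ _); have [bi ei] := hw0 i.
  have e2 : 0 < e / 2 by lra.
  have h1 : \forall n \near (@free_ultrafilter), gap g w0 (w n) <= e / 2.
    by apply: IH => // y yg; apply: gs; rewrite inE yg orbT.
  have h2 := ulim_near_dist bi e2.
  near=> n; have g1 : gap g w0 (w n) <= e / 2 by near: n.
  have g2 : `|B (s i) (w n) - ulim (fun n => B (s i) (w n))| <= e / 2 by near: n.
  rewrite /gap big_cons -/(gap _ _ _) ei distrC; lra.
have e0 : 0 < (1 - c) / (4 * (K + 1)) by rewrite divr_gt0// mulr_gt0// ltr_wpDl.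
have h : \forall n \near (@free_ultrafilter), (m <= n)%N.
  by apply: free_near; exact: nbhs_infty_ge.
have [n [mn gn]] : exists n, (m <= n)%N /\ gap g w0 (w n) <= (1 - c) / (4 * (K + 1)).
  exact: (filter_ex (filterI h (gap_small _ e0))).
have := KX w0 (w n); rewrite ler_norml => /andP[_ Xw].
have h2 : K * gap g w0 (w n) <= (1 - c) / 4 * (K / (K + 1)).
  rewrite (le_trans (ler_wpM2l K0 gn))// le_eqVlt; apply/orP; left; apply/eqP.
  by field; rewrite gt_eqF// ltr_wpDl.
have h3 : K / (K + 1) < 1 by rewrite ltr_pdivrMr ?mul1r ?ltrDl// ltr_wpDl.
have := hw n; have := T0 n.+1 (w n); have := Xmono2 m n (w n) mn.
have : (1 - c) / 4 * (K / (K + 1)) < (1 - c) / 4 by rewrite gtr_pMr// divr_gt0.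
lra.
Unshelve. all: by end_near.
Qed.

End representing_functional.

(** * Generating the Borel sets of path space by cylinder functions *)

Lemma clamp_dist (R : realType) (a b : R) :
  `|Num.min 1 (Num.max 0 a) - Num.min 1 (Num.max 0 b)| <= `|a - b|.
Proof.
have h1 := ler_norm (a - b); have h2 := ler_norm (b - a); rewrite distrC in h2.
have h3 := normr_ge0 (a - b).
rewrite ler_norml; case: (leP 0 a) => ?; case: (leP 0 b) => ?;
  [case: (leP 1 a) => ?; case: (leP 1 b) => ? | case: (leP 1 a) => ?; case: (leP 1 0) => ?
  | case: (leP 1 0) => ?; case: (leP 1 b) => ? | case: (leP 1 0) => ?];
  apply/andP; split; lra.
Qed.

Section borel_generation.
Context {R : realType}.
Implicit Types (w : Omega R).

(** Otherwise there are paths outside U within 1/(n+1) of w on [0, n] for every n; they converge to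
    w uniformly on compact sets. The same n is horizon and precision. *)
Lemma open_path_nbhs (U : set (cpath R)) (w : Omega R) : open U -> U w ->
  exists n : nat, forall w' : Omega R,
    (forall t, 0 <= t <= n%:R -> `|B t w - B t w'| <= n.+1%:R^-1) -> U w'.
Proof.
move=> [V oV <-] Vw; apply: contrapT => /forallNP h.
have /choice[v hv] : forall n : nat, exists w' : Omega R,
    (forall t, 0 <= t <= n%:R -> `|B t w - B t w'| <= n.+1%:R^-1) /\ ~ (set_val @^-1` V) w'.
  by move=> n; have /existsNP[w' /not_implyP[]] := h n; exists w'.
pose val w' : {family compact, R -> R} := set_val (w' : cpath R).
have cv : {family compact, (val \o v) @ \oo --> val w}.
  apply/fam_cvgP => A cA P /uniform_nbhs[E [entE EP]].
  have [e e0 eE] : exists2 e : R, 0 < e & forall x y, `|x - y| < e -> E (x, y).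
    by move: entE; rewrite -entourage_ballE => -[e e0 eE]; exists e => // x y xy; exact: eE.
  have [K [_ AK]] := compact_bounded cA.
  have AK1 t : A t -> `|t| <= K + 1 by move=> At; apply: (AK (K + 1)) => //; rewrite ltrDl.
  have : \forall n \near \oo, P (val (v n)); last exact.
  near=> n; apply: EP => t At; apply: eE.
  have [t0|t0] := leP t 0.
    have v0 (u : Omega R) : val u t = 0 by exact: (B_le0 u t0).
    by rewrite (v0 w) (v0 (v n)) subrr normr0.
  apply: (@le_lt_trans _ _ n.+1%:R^-1).
    apply: ((hv n).1 t); rewrite (ltW t0)/=; have tK := le_trans (ler_norm t) (AK1 _ At).
    by rewrite (le_trans tK)//; near: n; exact: nbhs_infty_ger.
  rewrite invf_plt ?posrE//; rewrite (@lt_le_trans _ _ n%:R)//; last by rewrite ler_nat.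
  by near: n; exact: nbhs_infty_gtr.
have [n _ /(_ n (leqnn n)) /=] : \forall n \near \oo, V (val (v n)).
  by apply: cv; rewrite nbhsE; exists V.
by have [_] := hv n.
Unshelve. all: by end_near.
Qed.

Lemma path_uniform_continuity (w : Omega R) (T e : R) : 0 < e ->
  exists k : nat, forall s t, 0 <= s <= T -> 0 <= t <= T -> `|s - t| <= (2 ^+ k)^-1 ->
    `|B s w - B t w| <= e.
Proof.
move=> e0; apply: contrapT => /forallNP h.
have /choice[p hp] : forall k : nat, exists p : R * R,
    [/\ 0 <= p.1 <= T, 0 <= p.2 <= T, `|p.1 - p.2| <= (2 ^+ k)^-1 & e < `|B p.1 w - B p.2 w|].
  move=> k; have /existsNP[s /existsNP[t]] := h k.
  move=> /not_implyP[sT /not_implyP[tT /not_implyP[st /negP]]].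
  by rewrite -ltNge; exists (s, t).
have bs : bdd_seq (fun k => (p k).1).
  by exists T => k; have [/andP[s0 sT] _ _ _] := hp k; rewrite ger0_norm.
have cs := ulim_cvg bs; set s := ulim _ in cs.
have ct : (p k).2 @[k --> free_ultrafilter] --> s.
  have -> : (fun k => (p k).2) = (fun k => (p k).1 + ((p k).2 - (p k).1)).
    by apply/funext => k; rewrite addrC subrK.
  rewrite -[s]addr0; apply: cvgD => //; apply/cvgr0Pnorm_le => d d0.
  have : \forall k \near \oo, (2 ^+ k)^-1 < d :> R.
    have : geometric 1 (2^-1 : R) k @[k --> \oo] --> 0.
      by apply: cvg_geometric; rewrite ger0_norm; lra.
    move=> /cvgrPdist_lt /(_ d d0); apply: filterS => k.
    by rewrite sub0r normrN /geometric/= mul1r exprVn ger0_norm// invr_ge0 exprn_ge0.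
  move=> /free_near; apply: filterS => k kd; have [_ _ pk _] := hp k.
  by rewrite distrC (le_trans pk)// ltW.
have d1 : B (p k).1 w @[k --> free_ultrafilter] --> B s w.
  by apply: (@cvg_comp _ _ _ _ (fun t => B t w)) cs _; exact: B_continuous.
have d2 : B (p k).2 w @[k --> free_ultrafilter] --> B s w.
  by apply: (@cvg_comp _ _ _ _ (fun t => B t w)) ct _; exact: B_continuous.
have e2 : 0 < e / 2 by rewrite divr_gt0.
move/cvgrPdist_lt : d1 => /(_ _ e2) d1; move/cvgrPdist_lt : d2 => /(_ _ e2) d2.
have [k [k1 k2]] := filter_ex (filterI d1 d2); have [_ _ _] := hp k.
rewrite (le_gtF _)// -(subrK (B s w) (B (p k).1 w)) -addrA (le_trans (ler_normD _ _))//.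
by rewrite distrC (splitr e) lerD// ltW.
Qed.

(** A code (N, k, q, p): at rational times up to N + 1 the path is within 1/(p+1) of the step
    function of dyadic level k with rational values q. Codes are countable and each cell is a
    countable intersection of one-time conditions. The extra unit of time leaves rational times to
    the right of N. *)
Definition cell (c : nat * nat * seq rat * nat) : set (Omega R) :=
  [set w | forall x : rat, 0 <= (ratr x : R) <= c.1.1.1.+1%:R ->
    `|B (ratr x) w - ratr (nth 0 c.1.2 (level c.1.1.2 (ratr x : R)))| <= c.2.+1%:R^-1].

Lemma cell_close c (w w' : Omega R) t : cell c w -> cell c w' -> 0 <= t <= c.1.1.1%:R ->
  `|B t w - B t w'| <= 4 * c.2.+1%:R^-1.
Proof.
move=> cw cw' /andP[t0 tN]; set r := _^-1.
have r0 : 0 < r by rewrite invr_gt0.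
have near_ : \forall x \near nbhs t, `|B t w - B x w| <= r /\ `|B t w' - B x w'| <= r.
  have h (v : Omega R) : \forall x \near t, `|B t v - B x v| <= r.
    by move/cvgrPdist_le : (@B_continuous R v t) => /(_ r r0).
  have h1 := h w; have h2 := h w'.
  by near=> x; split; near: x.
have [d /= d0 hd] := near_.
have td : t < Num.min (t + d) (t + 1) by rewrite lt_min !ltrDl d0 ltr01.
have [x] := rat_in_itvoo td; rewrite in_itv/= lt_min => /andP[tx /andP[xd x1]].
have [h1 h2] : `|B t w - B (ratr x) w| <= r /\ `|B t w' - B (ratr x) w'| <= r.
  by apply: hd; rewrite /ball/= distrC gtr0_norm ?subr_gt0// ltrBlDl.
have xN : 0 <= (ratr x : R) <= c.1.1.1.+1%:R.
  by rewrite (le_trans t0 (ltW tx))/= -natr1 (le_trans (ltW x1))// lerD2r.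
have := cw x xN; have := cw' x xN; rewrite -/r.
move: h1 h2; rewrite !ler_norml => /andP[? ?] /andP[? ?] /andP[? ?] /andP[? ?].
by apply/andP; split; lra.
Unshelve. all: by end_near.
Qed.

Lemma cell_cover (w : Omega R) N p : exists k q, cell (N, k, q, p) w.
Proof.
set r : R := p.+1%:R^-1; have r0 : 0 < r by rewrite invr_gt0.
have r2 : 0 < r / 2 by rewrite divr_gt0.
have [k hk] := path_uniform_continuity w N.+1%:R r2.
have qa (x : R) : {q : rat | `|x - ratr q| <= r / 2}.
  apply: cid; have xr : x < x + r / 2 by rewrite ltrDl.
  have [q] := rat_in_itvoo xr; rewrite in_itv/= => /andP[h1 h2]; exists q.
  by rewrite ler_norml; apply/andP; split; lra.
pose q := [seq projT1 (qa (B (dyadic k i) w)) | i <- iota 0 (N.+1 * 2 ^ k).+1].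
exists k, q => x /= xN; have /andP[x0 xN1] := xN.
set l := level k (ratr x).
have ln : (l < (N.+1 * 2 ^ k).+1)%N by rewrite ltnS; exact: level_bound.
rewrite /q (nth_map 0%N) ?size_iota// nth_iota// add0n.
have := projT2 (qa (B (dyadic k l) w)); move: (projT1 _) => y hy.
have h1 := level_le k x0; have h2 := level_lt k x0; rewrite -/l in h1 h2.
have : `|B (ratr x) w - B (dyadic k l) w| <= r / 2.
  apply: hk => //.
    by rewrite divr_ge0 ?(le_trans h1)//= ltW// pow2_gt0.
  rewrite ger0_norm ?subr_ge0//; move: h2; rewrite /dyadic -natr1 mulrDl mul1r.
  by move=> /ltW; rewrite lerBlDl.
move: hy; rewrite -/r !ler_norml => /andP[? ?] /andP[? ?].
by apply/andP; split; lra.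
Qed.

(** Uniform continuity puts each path into arbitrarily fine cells, and a fine enough cell stays in
    U; so U is the countable union of the cells it contains. *)
Lemma open_cells (U : set (cpath R)) : open U ->
  U = \bigcup_(n in [set n | forall c, unpickle n = Some c -> cell c `<=` U])
        (if unpickle n is Some c then cell c else set0) :> set (Omega R).
Proof.
move=> oU; apply/seteqP; split => [w Uw|w [n nU]]; last first.
  by case E : (unpickle n) => [c|//] cw; exact: nU E _ cw.
have [N hN] := open_path_nbhs oU Uw.
have [k [q cw]] := cell_cover w N (4 * N.+1)%N.
exists (pickle (N, k, q, (4 * N.+1)%N)); last by rewrite pickleK.
move=> c; rewrite pickleK => -[<-] w' cw'; apply: hN => t tN.
rewrite (le_trans (cell_close cw cw' tN))//=.
rewrite ler_pdivrMr// mulrC ler_pdivlMr// -natrM ler_nat.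
by clear; lia.
Qed.

(** Induction principle for Borel sets: only positivity sets of nonnegative cylinder functions need
    checking. *)
Lemma borel_ind (S : set (set (Omega R))) : sigma_algebra setT S ->
  (forall Y, CL Y -> (forall w, 0 <= Y w) -> S [set w | 0 < Y w]) ->
  forall A, measurable A -> S A.
Proof.
move=> sS hS; have [S0 SC SU] := sS.
have SI (F : nat -> set (Omega R)) : (forall n, S (F n)) -> S (\bigcap_n F n).
  move=> FS; rewrite -[X in S X]setCK setC_bigcap -setTD; apply: (SC _ _); apply: (SU _ _) => n.
  by rewrite -setTD; exact: (SC _ _).
have ST : S setT by rewrite -(setD0 setT); exact: SC.
have Scell c : S (cell c).
  pose F n : set (Omega R) := if unpickle n is Some x then
    (if 0 <= (ratr x : R) <= c.1.1.1.+1%:R then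
      [set w | `|B (ratr x) w - ratr (nth 0 c.1.2 (level c.1.1.2 (ratr x : R)))| <= c.2.+1%:R^-1]
     else setT) else setT.
  have -> : cell c = \bigcap_n F n.
    apply/seteqP; split=> w cw.
      by move=> n _; rewrite /F; case: unpickle => // x; case: ifP => // /cw.
    by move=> x xN; have := cw (pickle x) I; rewrite /F pickleK xN.
  apply: SI => n; rewrite /F; case: unpickle => // x; case: ifP => // /andP[x0 _].
  set q := ratr (nth _ _ _); set r := _^-1.
  have r0 : 0 <= r by rewrite invr_ge0.
  (* phi vanishes exactly within r of q, so the one-time condition is the complement of a positivity
     set. *)
  pose phi z := Num.min 1 (Num.max 0 (`|z - q| - r)).
  have phiL : lip 1 phi.
    move=> y z; rewrite mul1r /phi.
    apply: (le_trans (clamp_dist _ _)); rewrite opprB addrA subrK.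
    by rewrite (le_trans (ler_dist_dist _ _))// opprB addrA subrK.
  have phi0 z : 0 <= phi z by rewrite le_min ler01 le_max lexx.
  have phiM : bdd 1 phi by move=> z; rewrite ger0_norm// ge_min lexx.
  have YC : CL (fun w => phi (B (ratr x) w - B 0 w)).
    by exists (ratr x) => //; apply: CLt_B2 phiL phiM; rewrite ?lexx ?x0.
  have := hS _ YC (fun w => phi0 _) => /SC; congr S; apply/seteqP; split => w /=.
    move=> [_]; rewrite (B_le0 w (lexx 0)) subr0 /phi lt_min ltr01 lt_max ltxx/=.
    by rewrite subr_gt0 => /negP; rewrite -leNgt.
  move=> h; split => //; rewrite (B_le0 w (lexx 0)) subr0 /phi lt_min ltr01 lt_max ltxx/=.
  by rewrite subr_gt0; apply/negP; rewrite -leNgt.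
apply: smallest_sub => // U oU; rewrite (open_cells oU) bigcup_mkcond; apply: (SU _ _) => n.
by case: ifP => // _; case: unpickle.
Qed.

End borel_generation.

(** * Expectations of bounded measurable functions *)

Section bounded_expectation.
Context {d : measure_display} {T : measurableType d} {R : realType}.
Variable P : probability T R.
Implicit Types (f g : T -> R).

Definition bm f : Prop := measurable_fun [set: T] f /\ exists M, forall w, `|f w| <= M.

Definition Ex f : R := Rintegral P setT f.

Lemma bm_int f : bm f -> P.-integrable [set: T] (EFin \o f).
Proof.
move=> [mf [M fM]]; apply: measurable_bounded_integrable => //.
  exact: le_lt_trans (probability_le1 P measurableT) (ltry 1).
exists M; split; first exact: num_real.
by move=> y My x _; exact: le_trans (fM x) (ltW My).
Qed.

Lemma ExE f : bm f -> (\int[P]_w (f w)%:E)%E = (Ex f)%:E.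
Proof.
move=> /bm_int fi; rewrite /Ex /Rintegral fineK//.
by have := integrable_fin_num measurableT fi.
Qed.

Lemma bm_cst (k : R) : bm (fun=> k).
Proof. by split; [exact: measurable_cst|exists `|k|]. Qed.

Lemma bm_add f g : bm f -> bm g -> bm (fun w => f w + g w).
Proof.
move=> [mf [M fM]] [mg [N gN]]; split; first exact: measurable_funD.
by exists (M + N) => w; rewrite (le_trans (ler_normD _ _))// lerD.
Qed.

Lemma bm_mul f g : bm f -> bm g -> bm (fun w => f w * g w).
Proof.
move=> [mf [M fM]] [mg [N gN]]; split; first exact: measurable_funM.
by exists (M * N) => w; rewrite normrM ler_pM.
Qed.

Lemma bm_scale k f : bm f -> bm (fun w => k * f w).
Proof. by apply: bm_mul; exact: bm_cst. Qed.

Lemma bm_opp f : bm f -> bm (fun w => - f w).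
Proof.
by move=> /(bm_scale (-1)); congr bm; apply/funext => w; rewrite mulN1r.
Qed.

Lemma bm_sub f g : bm f -> bm g -> bm (fun w => f w - g w).
Proof. by move=> bf /bm_opp; exact: bm_add. Qed.

Lemma bm_abs f : bm f -> bm (fun w => `|f w|).
Proof.
move=> [mf [M fM]]; split; last by exists M => w; rewrite normr_id.
by apply: measurableT_comp => //; exact: normr_measurable.
Qed.

Lemma bm_indic A : measurable A -> bm (\1_A : T -> R).
Proof.
move=> mA; split; first exact: measurable_indic.
by exists 1 => w; rewrite indicE; case: (_ \in _); rewrite ?normr1 ?normr0.
Qed.

Lemma bm_sum n (F : nat -> T -> R) : (forall i, (i < n)%N -> bm (F i)) ->
  bm (fun w => \sum_(i < n) F i w).
Proof.
elim: n => [_|n IH hF]; first by under eq_fun do rewrite big_ord0; exact: bm_cst.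
under eq_fun do rewrite big_ord_recr/=.
by apply: bm_add; [apply: IH => i /ltnW; exact: hF|exact: hF].
Qed.

Lemma ExD f g : bm f -> bm g -> Ex (fun w => f w + g w) = Ex f + Ex g.
Proof. by move=> bf bg; rewrite /Ex RintegralD//; exact: bm_int. Qed.

Lemma ExZ k f : bm f -> Ex (fun w => k * f w) = k * Ex f.
Proof. by move=> bf; rewrite /Ex RintegralZl//; exact: bm_int. Qed.

Lemma ExN f : bm f -> Ex (fun w => - f w) = - Ex f.
Proof.
by move=> bf; rewrite -mulN1r -ExZ//; congr Ex; apply/funext => w; rewrite mulN1r.
Qed.

Lemma ExB f g : bm f -> bm g -> Ex (fun w => f w - g w) = Ex f - Ex g.
Proof. by move=> bf bg; rewrite ExD ?ExN//; exact: bm_opp. Qed.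

Lemma Ex_cst k : Ex (fun=> k) = k.
Proof. by rewrite /Ex Rintegral_cst//= [P _]probability_setT mulr1. Qed.

Lemma Ex_mono f g : bm f -> bm g -> (forall w, f w <= g w) -> Ex f <= Ex g.
Proof. by move=> bf bg fg; apply: le_Rintegral => //; exact: bm_int. Qed.

Lemma Ex_sum n (F : nat -> T -> R) : (forall i, (i < n)%N -> bm (F i)) ->
  Ex (fun w => \sum_(i < n) F i w) = \sum_(i < n) Ex (F i).
Proof.
elim: n => [_|n IH hF].
  by under eq_fun do rewrite big_ord0; rewrite Ex_cst big_ord0.
under eq_fun do rewrite big_ord_recr/=; rewrite big_ord_recr/= -IH.
  by rewrite ExD//; [apply: bm_sum => i /ltnW; exact: hF|exact: hF].
by move=> i /ltnW; exact: hF.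
Qed.

Lemma Ex_indic A : measurable A -> (Ex \1_A)%:E = P A.
Proof.
by move=> mA; rewrite -ExE ?integral_indic ?setIT//; exact: bm_indic.
Qed.

Lemma Ex_cvg (f_ : nat -> T -> R) f M : (forall n, measurable_fun [set: T] (f_ n)) ->
  (forall n w, `|f_ n w| <= M) -> (forall w, f_ n w @[n --> \oo] --> f w) ->
  bm f /\ Ex (f_ n) @[n --> \oo] --> Ex f.
Proof.
move=> mf fM cf.
have bf_ n : bm (f_ n) by split => //; exists M.
have bf : bm f.
  split; first by apply: (measurable_fun_cvg mf) => w _; exact: cf.
  exists M => w; have cn : `|f_ n w| @[n --> \oo] --> `|f w| by exact: cvg_norm.
  rewrite -(cvg_lim (@Rhausdorff R) cn); apply: limr_le; first by apply/cvg_ex; exists `|f w|.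
  exact: nearW.
split => //; have h := @dominated_cvg _ _ _ P setT measurableT (fun n w => (f_ n w)%:E)
  (fun w => (f w)%:E) (fun=> M%:E).
have : (\int[P]_w (f_ n w)%:E)%E @[n --> \oo] --> (\int[P]_w (f w)%:E)%E.
  apply: h => //.
  - by move=> n; apply/measurable_EFinP.
  - by move=> w _; apply/cvg_EFin; [exact: nearW|exact: cf].
  - exact: (bm_int (bm_cst M)).
  - by move=> n w _; rewrite lee_fin.
under eq_fun do rewrite ExE//; rewrite ExE// => /fine_cvgP[_ c]; exact: c.
Qed.

End bounded_expectation.

(** * Cylinder functions are Borel *)

Section cylinder_measurability.
Context {R : realType}.
Implicit Types (F Y : Omega R -> R).

Lemma B_time_continuous t : continuous (fun w : cpath R => B t (w : Omega R)).
Proof.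
move=> w; have h : {family compact, set_val @ (nbhs w) --> (set_val w : R -> R)}.
  exact: (@initial_continuous _ _ (@set_val _ (@cpaths R))).
by move/fam_cvgP : h => /(_ [set t] (@compact_set1 _ t)); rewrite uniform_set1.
Qed.

Lemma gap_near g (w : cpath R) (e : R) : 0 < e ->
  \forall w' \near w, gap g (w : Omega R) (w' : Omega R) <= e.
Proof.
elim: g e => [|t g IH] e e0.
  by near=> w'; rewrite /gap big_nil ltW.
have e2 : 0 < e / 2 by rewrite divr_gt0.
have h : \forall w' \near w, `|B t (w : Omega R) - B t (w' : Omega R)| <= e / 2.
  by move/cvgrPdist_le : (@B_time_continuous t w) => /(_ _ e2).
apply: filterS (filterI h (IH _ e2)) => w' [h1 h2].
by rewrite /gap big_cons (splitr e) lerD.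
Unshelve. all: by end_near.
Qed.

Lemma CL_open_gt0 Y : CL Y -> open ([set w | 0 < Y w] : set (cpath R)).
Proof.
move=> [_ _ [g [L [M [_ [L0 _ YL]]]]]]; rewrite openE => w /= Yw.
have e0 : 0 < Y w / (L + 1) / 2 by rewrite !divr_gt0// ltr_wpDl.
apply: filterS (gap_near g w e0) => w' /= h.
have := YL w w'; rewrite ler_norml => /andP[_]; rewrite lerBlDr -lerBlDl.
apply: lt_le_trans; rewrite subr_gt0 (le_lt_trans (ler_wpM2l L0 h))//.
rewrite -mulrA mulrCA mulrC -[ltRHS]mul1r ltr_pM2r//.
rewrite mulrA ltr_pdivrMr// mul1r ltr_pdivrMr ?ltr_wpDl//; lra.
Qed.

Lemma CL_measurable F : CL F -> measurable_fun [set: Omega R] F.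
Proof.
move=> FC; apply: (measurability _ (RGenOInfty.measurableE R)).
move=> _ [_ [a ->] <-]; rewrite setTI.
have Fa : CL (fun w => F w - a) by apply: CL_sub => //; exact: CL_cst.
rewrite (_ : F @^-1` _ = [set w | 0 < F w - a]).
  by apply: sub_sigma_algebra; exact: CL_open_gt0.
by apply/seteqP; split => w /=; rewrite in_itv/= andbT subr_gt0.
Qed.

Lemma CL_bm F : CL F -> bm F.
Proof.
by move=> FC; split; [exact: CL_measurable|have [M _ h] := CL_bdd FC; exists M].
Qed.

End cylinder_measurability.

(** * The probability measure of a dominated functional *)

Section outer_measure_of_functional.
Context {R : realType}.
Variables (slo shi : R).
Hypotheses (slo0 : 0 <= slo) (slohi : slo <= shi).
Variable L : (Omega R -> R) -> R.
Hypothesis domL : dominated slo shi L.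
Implicit Types (A U : set (Omega R)) (X Y : nat -> Omega R -> R).

                                                                                            
(** Admissible bounds for Daniell's outer measure: L along an increasing sequence of nonnegative
    cylinder functions that reaches 1 at every point of A. *)
Definition adm A (c : R) : Prop := exists X,
  [/\ forall n, CL (X n), forall n w, 0 <= X n w, forall n w, X n w <= X n.+1 w,
      forall w, A w -> exists n, 1 <= X n w & forall n, L (X n) <= c].

Definition omu A : \bar R := ereal_inf [set c%:E | c in adm A].

Lemma adm_ge0 A c : adm A c -> 0 <= c.
Proof.
move=> [X [XC X0 _ _ Xc]]; exact: le_trans (dom_ge0 slo0 slohi domL (XC 0%N) (X0 0%N)) (Xc _).
Qed.

Lemma adm1 A : adm A 1.
Proof.
exists (fun _ _ => 1); split => // [n|w _|n].
- exact: CL_cst.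
- by exists 0%N.
- by rewrite (dom_cst slo0 slohi domL).
Qed.

Lemma admS A U c : A `<=` U -> adm U c -> adm A c.
Proof. by move=> AU [X [XC X0 Xm XU Xc]]; exists X; split => // w /AU/XU. Qed.

Lemma omu_le A c : adm A c -> (omu A <= c%:E)%E.
Proof. by move=> Ac; apply: ereal_inf_lbound; exists c. Qed.

Lemma omu_ge0 A : (0 <= omu A)%E.
Proof. by apply: le_ereal_inf_tmp => _ [c /adm_ge0 c0 <-]; rewrite lee_fin. Qed.

Lemma omu_fin A : omu A \is a fin_num.
Proof. by rewrite ge0_fin_numE ?omu_ge0// (le_lt_trans (omu_le (adm1 A)))// ltry. Qed.

Lemma omu0 : omu set0 = 0%E.
Proof.
apply/eqP; rewrite eq_le omu_ge0 andbT; apply: omu_le.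
exists (fun _ _ => 0); split => // [n|n]; first exact: CL_cst.
by rewrite (dom_cst slo0 slohi domL).
Qed.

Lemma omuS : {homo omu : A U / A `<=` U >-> (A <= U)%E}.
Proof.
move=> A U AU; apply: le_ereal_inf_tmp => _ [c Uc <-]; apply: omu_le; exact: admS AU Uc.
Qed.

Lemma omu_adherent A (e : R) : 0 < e -> exists2 c, adm A c & c <= fine (omu A) + e.
Proof.
move=> e0; have [_ [c Ac <-] h] := lb_ereal_inf_adherent e0 (omu_fin A).
by exists c => //; move: h; rewrite -/(omu A) -(fineK (omu_fin A)) -EFinD lte_fin => /ltW.
Qed.

Lemma adm_bigcup (F : nat -> set (Omega R)) (c : nat -> R) (C : R) :
  (forall i, adm (F i) (c i)) -> (forall n, \sum_(i < n) c i <= C) ->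
  adm (\bigcup_i F i) C.
Proof.
move=> Fc cC; have /choice[X hX] := Fc.
exists (fun n w => \sum_(i < n) X i n w); split.
- move=> n; apply: (dom_sum slo0 slohi domL n (F := fun i => X i n) _).1 => i.
  by have [h _ _ _ _] := hX i.
- by move=> n w; apply: sumr_ge0 => i _; have [_ h _ _ _] := hX i.
- move=> n w; rewrite big_ord_recr/= -[leLHS]addr0; apply: lerD.
    by apply: ler_sum => i _; have [_ _ h _ _] := hX i.
  by have [_ h _ _ _] := hX n.
- move=> w [i _ Fiw]; have [_ X0 Xm XF _] := hX i; have [n hn] := XF w Fiw.
  exists (maxn n i.+1); have im : (i < maxn n i.+1)%N by rewrite leq_max ltnSn orbT.
  rewrite (bigD1 (Ordinal im))//= (le_trans hn)// ler_wpDr//.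
    by apply: sumr_ge0 => j _; have [_ h _ _ _] := hX j.
  have /subnKC <- : (n <= maxn n i.+1)%N by rewrite leq_max leqnn.
  by elim: (_ - n)%N => [|k IH]; rewrite ?addn0// addnS (le_trans IH).
- move=> n; rewrite (dom_sum slo0 slohi domL n (F := fun i => X i n) _).2; last first.
    by move=> i; have [h _ _ _ _] := hX i.
  rewrite (le_trans _ (cC n))//; apply: ler_sum => i _.
  by have [_ _ _ _ h] := hX i.
Qed.

Lemma omu_sigma_subadditive : sigma_subadditive omu.
Proof.
move=> F; apply/lee_addgt0Pr => e e0.
have S0 : (0 <= \sum_(0 <= i <oo) omu (F i))%E by apply: nneseries_ge0 => i _ _; exact: omu_ge0.
have [->|nS] := eqVneq (\sum_(0 <= i <oo) omu (F i))%E +oo%E; first by rewrite addye// leey.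
have Sfin : (\sum_(0 <= i <oo) omu (F i))%E \is a fin_num by rewrite ge0_fin_numE// ltey.
rewrite -(fineK Sfin) -EFinD; apply: omu_le.
have /choice[c hc] : forall i, exists c, adm (F i) c /\ c <= fine (omu (F i)) + e / 2 ^+ i.+1.
  move=> i; have [|c Ac ce] := @omu_adherent (F i) (e / 2 ^+ i.+1).
    by rewrite divr_gt0// exprn_gt0.
  by exists c.
apply: (adm_bigcup (fun i => (hc i).1)) => n.
rewrite (@le_trans _ _ (\sum_(i < n) (fine (omu (F i)) + e / 2 ^+ i.+1)))//.
  by apply: ler_sum => i _; exact: (hc i).2.
rewrite big_split/= lerD//.
  rewrite -lee_fin (fineK Sfin) -sumEFin.
  rewrite (eq_bigr (fun i : 'I_n => omu (F i))); last by move=> i _; rewrite fineK ?omu_fin.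
  rewrite -(big_mkord xpredT (fun i => omu (F i))).
  by apply: nneseries_lim_ge => i _ _; exact: omu_ge0.
have -> : \sum_(i < n) e / 2 ^+ i.+1 = e * (1 - (2 ^+ n)^-1).
  elim: n => [|n IH]; first by rewrite big_ord0 expr0 invr1 subrr mulr0.
  by rewrite big_ord_recr/= IH exprS; field; rewrite expf_neq0.
by rewrite ler_piMr ?(ltW e0)// lerBlDr lerDl invr_ge0 exprn_ge0.
Qed.

Definition omu_outer : {outer_measure set Omega R -> \bar R} :=
  HB.pack omu (isOuterMeasure.Build R (Omega R) omu omu0 omu_ge0 omuS omu_sigma_subadditive).

(** The functions Z k increase to the indicator of U. Multiplying a sequence admissible for A by Z n
    serves the part inside U, multiplying by 1 - Z m with m fixed serves the part outside, and
    linearity of L makes the two bounds add up. *)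
Lemma caratheodory_gt0 (Y : Omega R -> R) : CL Y -> (forall w, 0 <= Y w) ->
  omu_outer.-caratheodory [set w | 0 < Y w].
Proof.
move=> YC Y0; apply: le_caratheodory_measurable => A /=; set U := [set w | 0 < Y w].
apply: le_ereal_inf_tmp => _ [c [X [XC X0 Xm XA Xc]] <-].
pose Z k w := Num.min 1 (k%:R * Y w).
have ZC k : CL (Z k) by apply: CL_min; [exact: CL_cst|exact: CL_scale].
have Z0 k w : 0 <= Z k w by rewrite le_min ler01 mulr_ge0.
have Z1 k w : Z k w <= 1 by rewrite ge_min lexx.
have Zm k l w : (k <= l)%N -> Z k w <= Z l w.
  by move=> kl; rewrite le_min ge_min lexx/= ge_min ler_wpM2r ?orbT// ler_nat.
have Xm2 k l w : (k <= l)%N -> X k w <= X l w.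
  by move=> /subnKC <-; elim: (l - k)%N => [|n IH]; rewrite ?addn0// addnS (le_trans IH).
have XZC n m : CL (fun w => X n w * Z m w) by exact: CL_mul.
have ZcC m : CL (fun w => 1 - Z m w) by apply: CL_sub => //; exact: CL_cst.
have XZcC n m : CL (fun w => X n w * (1 - Z m w)) by exact: CL_mul.
have split_ n m : L (X n) = L (fun w => X n w * Z m w) + L (fun w => X n w * (1 - Z m w)).
  by rewrite -(domD domL)//; congr L; apply/funext => w; rewrite -mulrDr subrKC mulr1.
have Z1c m w : 0 <= 1 - Z m w by rewrite subr_ge0.
have dm := dom_mono slo0 slohi domL.
have h1 m : (omu (A `&` ~` U) <= (c - L (fun w => X m w * Z m w))%:E)%E.
  apply: omu_le; exists (fun n w => X n w * (1 - Z m w)); split => //.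
  - by move=> n w; rewrite mulr_ge0.
  - by move=> n w; rewrite ler_wpM2r.
  - move=> w [/XA[n hn] /negP]; rewrite -leNgt => Yw; exists n.
    have -> : Z m w = 0 by rewrite /Z (_ : Y w = 0) ?mulr0 ?(min_idPr ler01)//; apply/eqP; rewrite eq_le Yw Y0.
    by rewrite subr0 mulr1.
  - move=> n; pose k := maxn n m.
    have kn : (n <= k)%N by rewrite leq_max leqnn.
    have km : (m <= k)%N by rewrite leq_max leqnn orbT.
    apply: (@le_trans _ _ (L (fun w => X k w * (1 - Z m w)))).
      by apply: dm => // w; rewrite ler_wpM2r// Xm2.
    rewrite lerBrDl (le_trans _ (Xc k))// (split_ k m) lerD2r.
    by apply: dm => // w; rewrite ler_wpM2r// Xm2.
rewrite -leeBrDr ?omu_fin// -(fineK (omu_fin (A `&` ~` U))) -EFinB; apply: omu_le.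
exists (fun n w => X n w * Z n w); split => //.
- by move=> n w; rewrite mulr_ge0.
- by move=> n w; rewrite ler_pM// Zm.
- move=> w [/XA[n hn] Yw]; pose k := maxn n (Num.trunc (Y w)^-1).+1; exists k.
  have -> : Z k w = 1.
    apply/min_idPl; rewrite -ler_pdivrMr// mul1r (le_trans (ltW (truncnS_gt _)))//.
    by rewrite ler_nat leq_max leqnn orbT.
  by rewrite mulr1 (le_trans hn)// Xm2// leq_max leqnn.
- move=> n; have := h1 n; rewrite -{1}(fineK (omu_fin (A `&` ~` U))) lee_fin; lra.
Qed.

Lemma measurable_caratheodory A : measurable A -> omu_outer.-caratheodory A.
Proof.
apply: borel_ind; last exact: caratheodory_gt0.
split; [exact: caratheodory_measurable_set0| |exact: caratheodory_measurable_bigcup].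
by move=> U cU; rewrite setTD; exact: caratheodory_measurable_setC.
Qed.

Lemma omu_sigma_additive : semi_sigma_additive (omu : set (Omega R) -> \bar R).
Proof.
move=> F mF tF mU.
apply: (@caratheodory_measure_sigma_additive _ _ omu_outer F) => //.
  by move=> i; apply: measurable_caratheodory.
exact: measurable_caratheodory.
Qed.

(** A bound below 1 for the whole space would contradict [daniell], which finds a path where the
    sequence never reaches 1. *)
Lemma omuT : omu setT = 1%E.
Proof.
apply/eqP; rewrite eq_le (omu_le (adm1 _))/=.
apply: le_ereal_inf_tmp => _ [c [X [XC X0 Xm XA Xc]] <-]; rewrite lee_fin leNgt.
apply/negP => c1; have [w hw] := daniell slo0 slohi domL XC X0 Xm c1 Xc.
by have [n] := XA w I; rewrite leNgt hw.
Qed.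

Definition omu_measure : {measure set Omega R -> \bar R} :=
  HB.pack omu (isMeasure.Build _ (Omega R) R omu omu0 omu_ge0 omu_sigma_additive).

Definition omu_probability : probability (Omega R) R :=
  HB.pack (omu_measure : set (Omega R) -> \bar R) omu_measure
    (Measure_isProbability.Build _ (Omega R) R omu_measure omuT).

Lemma clamp_sum (y : R) m : \sum_(k < m) Num.min 1 (Num.max 0 (y - k%:R)) <= Num.max 0 y.
Proof.
elim: m y => [|m IH] y; first by rewrite big_ord0 le_max lexx.
rewrite big_ord_recl/= subr0; have := IH (y - 1).
rewrite (eq_bigr (fun k : 'I_m => Num.min 1 (Num.max 0 (y - (fintype.bump 0 k)%:R)))); last first.
  by move=> k _; rewrite /fintype.bump/= natrD opprD addrA.
move=> h; apply: (le_trans (lerD (lexx _) h)).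
by case: (leP 0 y) => ?; [case: (leP 1 y) => ?|rewrite (min_idPr ler01)];
  case: (leP 0 (y - 1)) => ?; lra.
Qed.

Lemma count_lt (y : R) m : Num.min y m%:R <= \sum_(k < m) ((k%:R < y)%R : nat)%:R.
Proof.
elim: m => [|m IH]; first by rewrite big_ord0 ge_min lexx orbT.
rewrite big_ord_recr/= (le_trans _ (lerD IH (lexx _)))//.
have -> : m.+1%:R = m%:R + 1 :> R by rewrite natr1.
by case: (leP y m%:R) => h; case: (leP y (m%:R + 1)) => h'; rewrite /= ?mulr0n ?mulr1n; lra.
Qed.

(** Layer cake with n layers: n F is at most the sum of the indicators of {F > k / n}. The layer k +
    1 is admissible through the clamp of n F - k, the clamps sum to at most n F, and the bottom
    layer accounts for the error 1 / n. *)
Lemma Ex_le_functional (F : Omega R -> R) : CL F -> (forall w, 0 <= F w <= 1) ->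
  Ex omu_probability F <= L F.
Proof.
move=> FC F01; apply/ler_addgt0Pr => e e0.
pose n := (Num.trunc e^-1).+1.
have ne : n%:R^-1 <= e.
  by rewrite invf_ple ?posrE// ltW// truncnS_gt.
have n0 : 0 < n%:R :> R by rewrite ltr0n.
pose A k := [set w | 0 < F w - k%:R / n%:R].
have FkC k : CL (fun w => F w - k%:R / n%:R) by apply: CL_sub => //; exact: CL_cst.
have mA k : measurable (A k) by apply: sub_sigma_algebra; exact: CL_open_gt0.
pose Z k w := Num.min 1 (Num.max 0 (n%:R * F w - k%:R)).
have ZC k : CL (Z k).
  apply: CL_min; first exact: CL_cst.
  apply: CL_max; first exact: CL_cst.
  by apply: CL_sub; [exact: CL_scale|exact: CL_cst].
have PA k : Ex omu_probability \1_(A k.+1) <= L (Z k).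
  rewrite -lee_fin Ex_indic//; apply: omu_le; exists (fun=> Z k); split => //.
    by move=> _ w; rewrite le_min ler01 le_max lexx.
  move=> w; rewrite /A /= subr_gt0 => h; exists 0%N; rewrite le_min lexx le_max; apply/orP; right.
  by rewrite lerBrDl natr1 mulrC -ler_pdivrMr// ltW.
have bI k : bm (\1_(A k) : Omega R -> R) by exact: bm_indic.
have FA w : n%:R * F w <= \sum_(k < n) \1_(A k) w.
  have /andP[_ f1] := F01 w.
  have nFn : n%:R * F w <= n%:R by rewrite ler_piMr.
  rewrite -[leLHS](min_idPl nFn) (le_trans (count_lt _ _))// le_eqVlt; apply/orP; left; apply/eqP.
  apply: eq_bigr => k _; rewrite indicE; congr (nat_of_bool _)%:R.
  have -> : (w \in A k) = (0 < F w - k%:R / n%:R) by apply/idP/idP; rewrite in_setE.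
  by rewrite subr_gt0 ltr_pdivrMr// mulrC.
have bF := CL_bm FC.
have : Ex omu_probability (fun w => n%:R * F w) <= \sum_(k < n) Ex omu_probability \1_(A k).
  rewrite -(@Ex_sum _ _ _ omu_probability n (fun k => \1_(A k)))//; apply: Ex_mono => //; first exact: bm_scale.
  by apply: (bm_sum (F := fun k => \1_(A k))).
rewrite ExZ// /n big_ord_recl/= -/n => h.
have h2 : \sum_(k < n.-1) Ex omu_probability \1_(A k.+1) <= n%:R * L F.
  apply: (@le_trans _ _ (\sum_(k < n.-1) L (Z k))); first by apply: ler_sum => k _; exact: PA.
  have [SC SE] := dom_sum slo0 slohi domL n.-1 ZC; rewrite -SE -(domZ domL)//.
  apply: (dom_mono slo0 slohi domL) => //; first exact: CL_scale.
  move=> w; rewrite (le_trans (clamp_sum _ _))// ge_max lexx andbT mulr_ge0//.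
  by have /andP[] := F01 w.
have h3 : Ex omu_probability \1_(A 0%N) <= 1.
  rewrite -(Ex_cst omu_probability 1); apply: Ex_mono => //; first exact: bm_cst.
have h4 : n%:R * Ex omu_probability F <= 1 + n%:R * L F by apply: le_trans h _; exact: lerD.
suff : n%:R * Ex omu_probability F <= n%:R * (L F + e) by rewrite ler_pM2l.
apply: (le_trans h4); rewrite mulrDr addrC lerD2l.
by move: ne; rewrite -(ler_pM2l n0) divff ?gt_eqF.
Qed.

(** After an affine rescaling into [0, 1], the inequality for H and for 1 - H gives equality. *)
Lemma Ex_functional (F : Omega R -> R) : CL F -> Ex omu_probability F = L F.
Proof.
move=> FC; have [M M0 FM] := CL_bdd FC.
pose a := (2 * (M + 1))^-1; have a0 : 0 < a by rewrite invr_gt0 mulr_gt0// ltr_wpDl.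
pose H w := a * F w + 2^-1.
have aM : a * (M + 1) = 2^-1 by rewrite /a; field; rewrite gt_eqF// ltr_wpDl.
have aF w : `|a * F w| <= 2^-1.
  rewrite normrM (gtr0_norm a0) -aM ler_wpM2l ?(ltW a0)// (le_trans (FM w))//.
  by rewrite lerDl.
have H01 w : 0 <= H w <= 1.
  by have := aF w; rewrite ler_norml /H => /andP[h1 h2]; apply/andP; split; lra.
have aFC : CL (fun w => a * F w) by exact: CL_scale.
have HC : CL H by apply: CL_add => //; exact: CL_cst.
have bF := CL_bm FC; have baF := bm_scale a bF.
have h1 := Ex_le_functional HC H01.
have h2 : Ex omu_probability (fun w => 1 - H w) <= L (fun w => 1 - H w).
  apply: Ex_le_functional; first by apply: CL_sub => //; exact: CL_cst.
  by move=> w; have := H01 w => /andP[? ?]; apply/andP; split; lra.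
move: h2; rewrite (domB domL)//; last exact: CL_cst.
rewrite ExB//; [|exact: bm_cst|exact: CL_bm].
rewrite Ex_cst (dom_cst slo0 slohi domL) => h2.
have : Ex omu_probability H = L H by apply/eqP; rewrite eq_le h1/=; lra.
rewrite /H (domD domL)//; last exact: CL_cst.
rewrite ExD//; last exact: bm_cst.
rewrite Ex_cst (dom_cst slo0 slohi domL) ExZ// (domZ domL)// => /addIr/mulfI; apply.
by rewrite gt_eqF.
Qed.

End outer_measure_of_functional.

(** The supremum over [calP] is attained on cylinder functions: a Hahn-Banach functional touching
    the sublinear expectation at F is integration against some P in [calP]. *)
Theorem EL_representation (R : realType) (slo shi : R) (slo0 : 0 <= slo) (slohi : slo <= shi)
    (F : Omega R -> R) : CL F ->
  exists2 P, calP slo shi P & Ex P F = EL slo shi F.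
Proof.
move=> FC; have [L [LD LZ LE LF]] := EL_hahn_banach slo0 slohi FC.
have domL : dominated slo shi L by split.
exists (omu_probability slo0 slohi domL); last by rewrite Ex_functional.
move=> H; rewrite LipE => HC; rewrite ExE; last exact: CL_bm.
by rewrite lee_fin E_LipE// Ex_functional// LE.
Qed.

                                                  

Import HBNNSimple.

(** * Integrals of functions not known to be measurable *)

Section integrals_of_arbitrary_functions.
Context {d : measure_display} {T : measurableType d} {R : realType}.
Variable P : probability T R.
Implicit Types (f g : T -> \bar R).
Local Open Scope ereal_scope.

Lemma ge0_le_integral_any f g : (forall x, 0 <= f x) -> (forall x, f x <= g x) ->
  \int[P]_x f x <= \int[P]_x g x.
Proof.
move=> f0 fg; have g0 x : 0 <= g x by exact: le_trans (f0 x) (fg x).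
rewrite !ge0_integralTE//; apply: le_ereal_sup => _ [h hf <-]; exists h => // x.
exact: le_trans (hf x) (fg x).
Qed.

Lemma ge0_le_integral_sup f c : (forall x, 0 <= f x) ->
  (forall h : {nnsfun T >-> R}, (forall x, (h x)%:E <= f x) -> \int[P]_x (h x)%:E <= c) ->
  \int[P]_x f x <= c.
Proof.
move=> f0 h; rewrite ge0_integralTE//; apply: ge_ereal_sup => _ [k kf <-].
by rewrite -integralT_nnsfun; exact: h.
Qed.

Lemma ge0_le_integral_null f g N : measurable N -> P N = 0 ->
  (forall x, 0 <= f x) -> (forall x, 0 <= g x) -> (forall x, ~ N x -> f x <= g x) ->
  \int[P]_x f x <= \int[P]_x g x.
Proof.
move=> mN PN f0 g0 fg; apply: ge0_le_integral_sup => // h hf.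
have mh : measurable_fun [set: T] (fun x => (h x)%:E) by apply/measurable_EFinP.
rewrite (ge0_negligible_integral mN measurableT mh)//; last by move=> x _; rewrite lee_fin.
rewrite integral_mkcond; apply: ge0_le_integral_any => x; rewrite patchE.
  by case: ifP => // _; rewrite lee_fin.
case: ifPn => [|_]; last exact: g0.
by rewrite in_setE => -[_ Nx]; exact: le_trans (hf x) (fg x Nx).
Qed.

Lemma eq_integral_null f g N : measurable N -> P N = 0 ->
  (forall x, ~ N x -> f x = g x) -> \int[P]_x f x = \int[P]_x g x.
Proof.
move=> mN PN fg; rewrite integralE [RHS]integralE.
have fgp x : ~ N x -> f^\+ x = g^\+ x by move=> /fg E; rewrite !funeposE E.
have fgn x : ~ N x -> f^\- x = g^\- x by move=> /fg E; rewrite !funenegE E.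
congr (_ - _); apply/eqP; rewrite eq_le; apply/andP; split;
  apply: (ge0_le_integral_null mN PN) => // x Nx; by rewrite ?fgp ?fgn.
Qed.

(** Pointwise x <= e + e (x / e)^b for b > 1. This bounds a first moment by a b-th moment, applied
    to simple functions below f. *)
Lemma integral_le_power f (b e : R) : (1 < b)%R -> (0 < e)%R -> (forall x, 0 <= f x) ->
  \int[P]_x f x <= e%:E + (e * (e^-1) `^ b)%:E * \int[P]_x (f x `^ b).
Proof.
move=> b1 e0 f0; have b0 : (0 <= b)%R by rewrite ltW// (lt_trans ltr01).
have K0 : (0 <= e * (e^-1) `^ b)%R by rewrite mulr_ge0 ?powR_ge0// ltW.
apply: ge0_le_integral_sup => // h hf.
have mhb : measurable_fun [set: T] (fun x => (h x `^ b)%:E).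
  apply/measurable_EFinP; apply: (measurableT_comp (measurable_powR b)) => //.
have hb0 x : 0 <= (h x `^ b)%:E by rewrite lee_fin powR_ge0.
apply: (@le_trans _ _ (\int[P]_x (e%:E + (e * (e^-1) `^ b)%:E * (h x `^ b)%:E))).
  apply: ge0_le_integral_any => x; first by rewrite lee_fin.
  rewrite -EFinM -EFinD lee_fin -mulrA -powRM ?invr_ge0 ?(ltW e0)//.
  have [he|he] := leP (h x) e; first by rewrite ler_wpDr// mulr_ge0 ?powR_ge0// ltW.
  rewrite ler_wpDl ?(ltW e0)// -ler_pdivrMl//.
  rewrite -[leLHS]powRr1 ?mulr_ge0 ?invr_ge0 ?(ltW e0)//.
  by apply: ler_powR; rewrite ?(ltW b1)// mulrC ler_pdivlMr// mul1r ltW.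
rewrite ge0_integralD//; last 2 first.
- by move=> x _; rewrite mule_ge0// lee_fin.
- by apply: measurable_funeM.
have -> : \int[P]__ e%:E = e%:E by have := ExE P (bm_cst e); rewrite Ex_cst.
rewrite ge0_integralZl_EFin// leeD2l//.
rewrite lee_wpmul2l ?lee_fin//; apply: ge0_le_integral_any => // x.
rewrite -poweR_EFin; apply: gt0_ler_poweR => //.
- by rewrite in_itv/= leey andbT lee_fin.
- by rewrite in_itv/= leey andbT.
- by move=> x _; rewrite lee_fin ltW.
Qed.

End integrals_of_arbitrary_functions.

(** * Convergence to zero and upper limits in the extended reals *)

Section limits.
Context {R : realType}.
Local Open Scope ereal_scope.

Lemma cvge0P (u : nat -> \bar R) : (forall n, 0 <= u n) ->
  u n @[n --> \oo] --> 0 <->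
  (forall e : R, (0 < e)%R -> exists N, forall n, (N <= n)%N -> u n <= e%:E).
Proof.
move=> u0; split=> [/fine_cvgP[uf uc] e e0|h].
  move/cvgrPdist_le : uc => /(_ e e0) uc; have [N _ hN] := filterI uf uc.
  exists N => n /hN [un]; rewrite /= sub0r normrN => ue.
  by rewrite -(fineK un) lee_fin (le_trans (ler_norm _)).
have [N0 h0] := h 1%R ltr01.
have uf n : (N0 <= n)%N -> u n \is a fin_num.
  by move=> /h0 un; rewrite ge0_fin_numE// (le_lt_trans un)// ltry.
apply/fine_cvgP; split; first by exists N0 => // n /uf.
apply/cvgrPdist_le => e e0; have [N hN] := h e e0; exists (maxn N0 N) => // n /=.
rewrite geq_max => /andP[/uf un /hN ue]; rewrite sub0r normrN.
by rewrite ger0_norm ?fine_ge0// -lee_fin fineK.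
Qed.

(** If the tail of increments is infinite there is nothing to prove; otherwise it confines the
    sequence from i on, hence its upper limit. No convergence is assumed, so the bound holds at
    every point. *)
Lemma limn_esup_dist (u : nat -> R) i :
  `|u i - fine (limn_esup (fun n => (u n)%:E))|%:E <=
  \sum_(j <oo) (if (i <= j)%N then `|u j.+1 - u j|%R else 0%R)%:E.
Proof.
have -> : \sum_(j <oo) (if (i <= j)%N then `|u j.+1 - u j|%R else 0%R)%:E =
    \sum_(i <= j <oo) `|u j.+1 - u j|%:E.
  rewrite [RHS]eseries_cond [RHS]eseries_mkcond; congr (limn _); apply/funext => n.
  by apply: eq_bigr => j _ /=; case: ifP.
set S := \sum_(i <= j <oo) _.
have a0 j : (i <= j)%N -> true -> 0 <= `|u j.+1 - u j|%:E by rewrite lee_fin.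
have [->|nS] := eqVneq S +oo; first exact: leey.
have Sfin : S \is a fin_num by rewrite ge0_fin_numE ?ltey// nneseries_ge0.
have close n : (i <= n)%N -> (`|u n - u i| <= fine S)%R.
  move=> ni; rewrite -lee_fin fineK// (le_trans _ (nneseries_lim_ge n a0))//.
  rewrite sumEFin lee_fin -telescope_sumr// ler_norm_sum//.
pose e := limn_esup (fun n => (u n)%:E).
have lo : (u i - fine S)%:E <= e.
  rewrite /e limn_esup_lim; apply: lime_ge; first exact: is_cvg_esups.
  near=> n; apply: (@le_trans _ _ (u n)%:E); last by apply: ereal_sup_ubound; exists n => //=.
  have : (i <= n)%N by near: n; exact: nbhs_infty_ge.
  by move=> /close; rewrite lee_fin ler_norml => /andP[]; lra.
have hi : e <= (u i + fine S)%:E.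
  rewrite /e limn_esup_lim; apply: lime_le; first exact: is_cvg_esups.
  near=> n; apply: ge_ereal_sup => _ [k /= nk <-].
  have : (i <= k)%N by rewrite (leq_trans _ nk)//; near: n; exact: nbhs_infty_ge.
  by move=> /close; rewrite lee_fin ler_norml => /andP[]; lra.
have efin : e \is a fin_num.
  by rewrite fin_numElt (lt_le_trans _ lo) ?ltNyr//= (le_lt_trans hi) ?ltry.
rewrite -/e -(fineK Sfin) lee_fin; move: lo hi; rewrite -(fineK efin) !lee_fin => lo hi.
by rewrite ler_norml; apply/andP; split; lra.
Unshelve. all: by end_near.
Qed.

End limits.

Lemma half_tail_le (R : realType) i n :
  \sum_(j < n) (if (i <= j)%N then (2 ^+ j)^-1 else 0) <= 2 * (2 ^+ i)^-1 :> R.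
Proof.
suff : \sum_(j < n) (if (i <= j)%N then (2 ^+ j)^-1 else 0) <=
    2 * (2 ^+ i)^-1 - (if (i <= n)%N then 2 * (2 ^+ n)^-1 else 0) :> R.
  move=> h; apply: (le_trans h); rewrite lerBlDr lerDl.
  by case: ifP => // _; rewrite mulr_ge0// invr_ge0 exprn_ge0.
elim: n => [|n IH].
  rewrite big_ord0 leqn0; case: eqP => [->|_]; first by rewrite subrr.
  by rewrite subr0 mulr_ge0// invr_ge0 exprn_ge0.
rewrite big_ord_recr/=; move: IH; case: (leqP i n) => ni.
  rewrite (leqW ni) exprS invfM => h; apply: (le_trans (lerD h (lexx _))).
  by rewrite le_eqVlt; apply/orP; left; apply/eqP; field; rewrite !expf_neq0.
rewrite subr0 addr0 => h; case: (leqP i n.+1) => ni1; last by rewrite subr0.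
have -> : i = n.+1 by apply/eqP; rewrite eqn_leq ni1.
rewrite subrr big1// => j _; case: ifP => // nj.
by move: (ltn_ord j); rewrite ltnNge (leq_trans _ nj)// ltnW.
Qed.

(** * The upper expectation, quasi-sure properties and completeness *)

Section upper_expectation.
Context {R : realType}.
Variables (slo shi : R).
Hypotheses (slo0 : 0 <= slo) (slohi : slo <= shi).
Implicit Types (F H X Y Z : Omega R -> R) (A : set (Omega R)).

Local Notation calP := (calP slo shi).
Local Notation Ehat := (Ehat slo shi).
Local Notation dist1 := (dist1 slo shi).
Local Notation EL := (EL slo shi).
Local Notation cE := (cE slo shi).
Local Notation qs := (qs slo shi).

Lemma Ehat_le (X : Omega R -> \bar R) (c : \bar R) :
  (forall P, calP P -> (\int[P]_w X w <= c)%E) -> (Ehat X <= c)%E.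
Proof. by move=> h; apply: ge_ereal_sup => _ [P cP <-]; exact: h. Qed.

Lemma Ehat_ge (X : Omega R -> \bar R) P : calP P -> (\int[P]_w X w <= Ehat X)%E.
Proof. by move=> cP; apply: ereal_sup_ubound; exists P. Qed.

Lemma calP_neq0 : exists P, calP P.
Proof. by have [P cP _] := EL_representation slo0 slohi (@CL_cst R 0); exists P. Qed.

Lemma Ehat_ge0 (X : Omega R -> \bar R) : (forall w, 0 <= X w)%E -> (0 <= Ehat X)%E.
Proof.
move=> X0; have [P cP] := calP_neq0; apply: le_trans (Ehat_ge X cP).
exact: integral_ge0.
Qed.

Lemma Ehat_mono (X Y : Omega R -> \bar R) : (forall w, 0 <= X w)%E ->
  (forall w, X w <= Y w)%E -> (Ehat X <= Ehat Y)%E.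
Proof.
move=> X0 XY; apply: Ehat_le => P cP; apply: le_trans (Ehat_ge Y cP).
exact: ge0_le_integral_any.
Qed.

Lemma Ex_le_EL P F : calP P -> CL F -> Ex P F <= EL F.
Proof.
move=> cP FC; rewrite -lee_fin -ExE; last exact: CL_bm.
by rewrite -(E_LipE slo0 slohi FC); apply: cP; rewrite LipE.
Qed.

Lemma Ehat_CL F : CL F -> Ehat (fun w => (F w)%:E) = (EL F)%:E.
Proof.
move=> FC; apply/eqP; rewrite eq_le; apply/andP; split.
  by apply: Ehat_le => P cP; rewrite ExE ?lee_fin ?Ex_le_EL//; exact: CL_bm.
have [P cP <-] := EL_representation slo0 slohi FC.
by rewrite -ExE; [exact: Ehat_ge|exact: CL_bm].
Qed.

Lemma capacity0 A P : capacity slo shi A = 0%E -> calP P -> P A = 0%E.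
Proof.
move=> A0 cP; apply/eqP; rewrite eq_le measure_ge0 andbT -A0.
by apply: ereal_sup_ubound; exists P.
Qed.

Lemma capacity_eq0 A : (forall P, calP P -> P A = 0%E) -> capacity slo shi A = 0%E.
Proof.
move=> h; apply/eqP; rewrite eq_le; apply/andP; split.
  by apply: ge_ereal_sup => _ [P cP <-]; rewrite h.
have [P cP] := calP_neq0; rewrite -(h P cP).
by apply: ereal_sup_ubound; exists P.
Qed.

Lemma qsT (Q : Omega R -> Prop) : (forall w, Q w) -> qs Q.
Proof.
move=> h; exists set0; split => //.
by apply: capacity_eq0 => P cP; rewrite measure0.
Qed.

Lemma qsI (Q1 Q2 : Omega R -> Prop) : qs Q1 -> qs Q2 -> qs (fun w => Q1 w /\ Q2 w).
Proof.
move=> [A1 [m1 c1 h1]] [A2 [m2 c2 h2]]; exists (A1 `|` A2); split.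
- exact: measurableU.
- apply: capacity_eq0 => P cP; apply/eqP; rewrite eq_le measure_ge0 andbT.
  have e1 := capacity0 c1 cP; have e2 := capacity0 c2 cP.
  apply: le_trans (measureU2 _ m1 m2) _.
  by rewrite [X in (X + _)%E]e1 [X in (_ + X)%E]e2 adde0.
- by move=> w; rewrite setCU => -[/h1 ? /h2 ?].
Qed.

Lemma qs_exists (Q : Omega R -> Prop) : qs Q -> exists w, Q w.
Proof.
move=> [A [mA cA h]]; apply: contrapT => /forallNP nQ.
have [P cP] := calP_neq0; have := capacity0 cA cP.
have -> : A = setT.
  by apply/seteqP; split => // w _; apply: contrapT => /h; exact: nQ.
by move/eqP; rewrite probability_setT onee_eq0.
Qed.

Lemma dist1_ge0 X Y : (0 <= dist1 X Y)%E.
Proof. by apply: Ehat_ge0 => w; rewrite lee_fin. Qed.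

Lemma dist1C X Y : dist1 X Y = dist1 Y X.
Proof. by rewrite /Defs.dist1; congr Defs.Ehat; apply/funext => w; rewrite distrC. Qed.

Lemma integral_dist_le P X Y : calP P -> (\int[P]_w `|X w - Y w|%:E <= dist1 X Y)%E.
Proof. by move=> cP; exact: Ehat_ge. Qed.

Lemma measurable_dist X Y : measurable_fun [set: Omega R] X ->
  measurable_fun [set: Omega R] Y ->
  measurable_fun [set: Omega R] (fun w => `|X w - Y w|%:E).
Proof.
move=> mX mY; apply/measurable_EFinP; apply: measurableT_comp; first exact: normr_measurable.
exact: measurable_funB.
Qed.

Lemma dist1_split X Y (X1 Y1 X2 Y2 : Omega R -> R) :
  measurable_fun [set: Omega R] X1 -> measurable_fun [set: Omega R] Y1 ->
  measurable_fun [set: Omega R] X2 -> measurable_fun [set: Omega R] Y2 ->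
  (forall w, `|X w - Y w| <= `|X1 w - Y1 w| + `|X2 w - Y2 w|) ->
  (dist1 X Y <= dist1 X1 Y1 + dist1 X2 Y2)%E.
Proof.
move=> m1 n1 m2 n2 h; apply: Ehat_le => P cP.
apply: (@le_trans _ _ (\int[P]_w (`|X1 w - Y1 w|%:E + `|X2 w - Y2 w|%:E))%E).
  by apply: ge0_le_integral_any => w; rewrite ?lee_fin.
rewrite ge0_integralD//; last 2 first; [exact: measurable_dist..|].
by apply: leeD; exact: integral_dist_le.
Qed.

Lemma dist1_triangle X Y Z : measurable_fun [set: Omega R] X ->
  measurable_fun [set: Omega R] Y -> measurable_fun [set: Omega R] Z ->
  (dist1 X Z <= dist1 X Y + dist1 Y Z)%E.
Proof. by move=> mX mY mZ; apply: dist1_split => // w; exact: ler_distD. Qed.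

Lemma dist1_CL F H : CL F -> CL H -> dist1 F H = (EL (fun w => `|F w - H w|))%:E.
Proof. by move=> FC HC; apply: Ehat_CL; apply: CL_abs; exact: CL_sub. Qed.

Definition approx (Xn : nat -> Omega R -> R) X : Prop :=
  [/\ measurable_fun [set: Omega R] X, forall n, CL (Xn n) &
      forall e : R, 0 < e -> exists N, forall n, (N <= n)%N -> (dist1 (Xn n) X <= e%:E)%E].

Lemma approxP Xn X : measurable_fun [set: Omega R] X -> (forall n, CL (Xn n)) ->
  dist1 (Xn n) X @[n --> \oo] --> 0%E <-> approx Xn X.
Proof.
move=> mX XC; rewrite cvge0P; last by move=> n; exact: dist1_ge0.
by split=> [h|[]].
Qed.

Lemma approx_cauchy Xn X e : approx Xn X -> 0 < e -> exists N, forall k l,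
  (N <= k)%N -> (N <= l)%N -> EL (fun w => `|Xn k w - Xn l w|) <= e.
Proof.
move=> [mX XC h] e0; have e2 : 0 < e / 2 by rewrite divr_gt0.
have [N hN] := h _ e2; exists N => k l Nk Nl.
rewrite -lee_fin -dist1_CL//.
apply: (le_trans (dist1_triangle (CL_measurable (XC k)) mX (CL_measurable (XC l)))).
by rewrite [e]splitr EFinD leeD ?hN// dist1C hN.
Qed.

(** The Borel limit is the upper limit of a rapidly Cauchy subsequence. Integrating the tail of
    increments bounds the distance to it under each P, uniformly in P. *)
Lemma complete Yn : (forall n, CL (Yn n)) ->
  (forall e : R, 0 < e -> exists N, forall k l, (N <= k)%N -> (N <= l)%N ->
     EL (fun w => `|Yn k w - Yn l w|) <= e) ->
  exists Z, approx Yn Z.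
Proof.
move=> YC cY.
have q0 i : 0 < (2 ^+ i)^-1 :> R by rewrite invr_gt0 exprn_gt0.
have /choice[N hN] : forall i, exists N, forall k l, (N <= k)%N -> (N <= l)%N ->
    EL (fun w => `|Yn k w - Yn l w|) <= (2 ^+ i)^-1.
  by move=> i; exact: cY.
(* The running maximum keeps the subsequence indices nondecreasing and beyond N i. *)
pose M i := (\max_(j < i.+1) N j)%N.
have NM i : (N i <= M i)%N by rewrite /M; exact: (leq_bigmax (@ord_max i)).
have MM i : (M i <= M i.+1)%N by rewrite /M [leqRHS]big_ord_recr/= leq_maxl.
pose U i := Yn (M i); pose Z w := fine (limn_esup (fun i => (U i w)%:E)).
have mU i : measurable_fun [set: Omega R] (U i).
  by apply: CL_measurable; exact: YC.
have mZ : measurable_fun [set: Omega R] Z.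
  apply: measurableT_comp; first exact: fine_measurable.
  by apply: measurable_fun_limn_esup => i; apply/measurable_EFinP.
have UZ i : (dist1 (U i) Z <= (2 * (2 ^+ i)^-1)%:E)%E.
  apply: Ehat_le => P cP.
  apply: (@le_trans _ _ (\int[P]_w \sum_(j <oo) (if (i <= j)%N then `|U j.+1 w - U j w| else 0)%:E)%E).
    by apply: ge0_le_integral_any => w; [rewrite lee_fin|exact: limn_esup_dist].
  have mf j : measurable_fun [set: Omega R] (fun w => (if (i <= j)%N then `|U j.+1 w - U j w| else 0)%:E).
    by case: (i <= j)%N; [exact: measurable_dist|exact: measurable_cst].
  have f0 j w : (0 <= (if (i <= j)%N then `|U j.+1 w - U j w| else 0)%:E)%E.
    by rewrite lee_fin; case: ifP.
  rewrite integral_nneseries//; apply: lime_le.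
    by apply: is_cvg_nneseries => n _ _; exact: integral_ge0.
  apply: nearW => n; rewrite big_mkord.
  apply: (@le_trans _ _ (\sum_(j < n) (if (i <= j)%N then (2 ^+ j)^-1 else 0)%:E)%E).
    apply: lee_sum => j _; case: ifP => ij; last by rewrite integral0.
    rewrite (le_trans (integral_dist_le _ _ cP))// dist1_CL//; [|exact: YC..].
    by rewrite lee_fin; apply: hN; [exact: leq_trans (NM j) (MM j)|exact: NM].
  by rewrite sumEFin lee_fin; exact: half_tail_le.
exists Z; split => // e e0.
have e2 : 0 < e / 2 by rewrite divr_gt0.
have [i hi] : exists i, (2 ^+ i)^-1 <= e / 4 :> R.
  exists (Num.trunc (e / 4)^-1).+1; rewrite invf_ple ?posrE ?exprn_gt0 ?divr_gt0//.
  by rewrite (le_trans (ltW (truncnS_gt _)))// -natrX ler_nat ltnW// ltn_expl.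
exists (M i) => n Mn.
apply: (le_trans (dist1_triangle (CL_measurable (YC n)) (mU i) mZ)).
rewrite [e]splitr EFinD leeD//.
  rewrite (dist1_CL (YC n) (YC (M i) : CL (U i))) lee_fin (le_trans (hN i n (M i) _ (NM i)))//.
    exact: leq_trans (NM i) Mn.
  lra.
by rewrite (le_trans (UZ i))// lee_fin; lra.
Qed.

End upper_expectation.

(** * Conditional expectations of limits and the discrete Snell envelope *)

Section conditional_limits.
Context {R : realType}.
Variables (slo shi : R).
Hypotheses (slo0 : 0 <= slo) (slohi : slo <= shi).
Implicit Types (F H X Y Z : Omega R -> R).

Local Notation dist1 := (dist1 slo shi).
Local Notation EL := (EL slo shi).
Local Notation cE := (cE slo shi).
Local Notation approx := (approx slo shi).
Local Notation qs := (qs slo shi).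

Lemma EL_cE t F : 0 <= t -> CL F -> EL (cE t F) = EL F.
Proof. by move=> t0 FC; rewrite /EL cE_tower. Qed.

Lemma cE_contract t F H : 0 <= t -> CL F -> CL H ->
  EL (fun w => `|cE t F w - cE t H w|) <= EL (fun w => `|F w - H w|).
Proof.
move=> t0 FC HC; have DC := CL_abs (CL_sub FC HC).
rewrite -(EL_cE t0 DC); apply: EL_mono => //.
- by apply/CL_abs/CL_sub; exact: cE_CL.
- exact: cE_CL.
- by move=> w; exact: cE_norm.
Qed.

(** The chosen version comes with its own approximating sequence. Contraction of [cE] compares it
    with the given sequence, so the conditional expectations of the given one converge to the chosen
    version too; existence of a version is completeness. *)
Lemma condE_approx t X (Xn : nat -> Omega R -> R) : 0 <= t -> approx Xn X ->
  approx (fun n => cE t (Xn n)) (condE slo shi t X).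
Proof.
move=> t0 aX; have [mX XC hX] := aX.
have cC n : CL (cE t (Xn n)) by exact: cE_CL.
have [Z aZ] : exists Z, approx (fun n => cE t (Xn n)) Z.
  apply: (complete slo0 slohi) => // e e0; have [N hN] := approx_cauchy slo0 slohi aX e0.
  by exists N => k l Nk Nl; rewrite (le_trans (cE_contract t0 (XC k) (XC l)))// hN.
have [mZ _ _] := aZ.
have cond_cE n : cond_Lip slo shi t (Xn n) = cE t (Xn n) by exact: cond_LipE.
have [mV [Xn' [X'C X'X VX]]] : is_cond slo shi t X (condE slo shi t X).
  apply: (xgetPex (fun=> 0 : R)); exists Z; split => //; exists Xn; split.
  - by move=> n; rewrite LipE.
  - exact/(approxP slo0 slohi mX XC).
  - rewrite (_ : (fun n => _) = fun n => dist1 (cE t (Xn n)) Z).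
      exact/(approxP slo0 slohi mZ cC).
    by apply/funext => n; rewrite cond_cE.
have X'CL n : CL (Xn' n) by have := X'C n; rewrite LipE.
have c'C n : CL (cE t (Xn' n)) by exact: cE_CL.
have /(approxP slo0 slohi mX X'CL)[_ _ hX'] := X'X.
move: VX; rewrite (_ : (fun n => _) = fun n => dist1 (cE t (Xn' n)) (condE slo shi t X)); last first.
  by apply/funext => n; rewrite cond_LipE.
move/(approxP slo0 slohi mV c'C) => [_ _ hV].
split => // e e0; have e3 : 0 < e / 3 by rewrite divr_gt0.
have [N1 h1] := hX _ e3; have [N2 h2] := hX' _ e3; have [N3 h3] := hV _ e3.
exists (maxn N1 (maxn N2 N3)) => n; rewrite !geq_max => /and3P[n1 n2 n3].
have mm F : CL F -> measurable_fun [set: Omega R] F by exact: CL_measurable.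
apply: (le_trans (dist1_triangle slo shi (mm _ (cC n)) (mm _ (c'C n)) mV)).
have -> : e%:E = ((e / 3)%:E + (e / 3)%:E + (e / 3)%:E)%E.
  by rewrite -!EFinD; congr EFin; field.
apply: leeD; last exact: h3.
rewrite (dist1_CL slo0 slohi (cC n) (c'C n)).
apply: (@le_trans _ _ (EL (fun w => `|Xn n w - Xn' n w|))%:E).
  by rewrite lee_fin; exact: cE_contract.
rewrite -(dist1_CL slo0 slohi (XC n) (X'CL n)).
apply: (le_trans (dist1_triangle slo shi (mm _ (XC n)) mX (mm _ (X'CL n)))).
by apply: leeD; [exact: h1|rewrite dist1C; exact: h2].
Qed.

Lemma max_dist (a b c d : R) : `|Num.max a b - Num.max c d| <= `|a - c| + `|b - d|.
Proof.
have h1 := ler_norm (a - c); have h2 := ler_norm (b - d).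
have h3 := ler_norm (c - a); have h4 := ler_norm (d - b).
rewrite [`|c - a|]distrC in h3; rewrite [`|d - b|]distrC in h4.
have h5 := normr_ge0 (a - c); have h6 := normr_ge0 (b - d).
rewrite ler_norml; case: (leP a b) => ?; case: (leP c d) => ?; apply/andP; split; lra.
Qed.

Lemma approx_max X Y Xn Yn : approx Xn X -> approx Yn Y ->
  approx (fun n w => Num.max (Xn n w) (Yn n w)) (fun w => Num.max (X w) (Y w)).
Proof.
move=> [mX XC hX] [mY YC hY]; split.
- exact: measurable_maxr.
- by move=> n; exact: CL_max.
- move=> e e0; have e2 : 0 < e / 2 by rewrite divr_gt0.
  have [N1 h1] := hX _ e2; have [N2 h2] := hY _ e2.
  exists (maxn N1 N2) => n; rewrite geq_max => /andP[n1 n2].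
  apply: (@le_trans _ _ (dist1 (Xn n) X + dist1 (Yn n) Y)%E).
    apply: (dist1_split slo shi) => //; [exact: CL_measurable|exact: CL_measurable|].
    by move=> w; exact: max_dist.
  by rewrite [e]splitr EFinD; apply: leeD; [exact: h1|exact: h2].
Qed.

(** A limit of constants is quasi-surely constant, which makes [qs_value] meaningful and continuous
    under such limits. *)
Lemma approx_cst (c : nat -> R) Y : approx (fun k (_ : Omega R) => c k) Y ->
  qs (fun w => Y w = qs_value slo shi Y) /\
  forall e, 0 < e -> exists N, forall k, (N <= k)%N -> `|c k - qs_value slo shi Y| <= e.
Proof.
move=> aY; have [mY _ hY] := aY.
have cdist k l : dist1 (fun=> c k) (fun=> c l) = `|c k - c l|%:E.
  by rewrite (dist1_CL slo0 slohi (@CL_cst R _) (@CL_cst R _)) (EL_cst slo0 slohi).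
have cc : cvgn c.
  apply: cauchy_cvg; apply/cauchy_exP => e e0.
  have e2 : 0 < e / 2 by rewrite divr_gt0.
  have [N hN] := approx_cauchy slo0 slohi aY e2.
  exists (c N); exists N => // k Nk; rewrite /ball/=.
  have := hN N k (leqnn N) Nk; rewrite (EL_cst slo0 slohi) => h; apply: (le_lt_trans h).
  by rewrite ltr_pdivrMr// ltr_pMr// ltr1n.
set v := limn c in cc; have cv e : 0 < e -> exists N, forall k, (N <= k)%N -> `|c k - v| <= e.
  move=> e0; move/cvgrPdist_le : (cc) => /(_ e e0)[N _ hN]; exists N => k Nk.
  by rewrite distrC; exact: hN.
have dv : dist1 Y (fun=> v) = 0%E.
  apply/eqP; rewrite eq_le dist1_ge0// andbT; apply/lee_addgt0Pr => e e0; rewrite add0e.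
  have e2 : 0 < e / 2 by rewrite divr_gt0.
  have [N1 h1] := hY _ e2; have [N2 h2] := cv _ e2; pose n := maxn N1 N2.
  have mc (k : R) : measurable_fun [set: Omega R] (fun=> k) by exact: measurable_cst.
  apply: (le_trans (dist1_triangle slo shi mY (mc (c n)) (mc v))).
  rewrite [e]splitr EFinD; apply: leeD; first by rewrite dist1C; apply: h1; exact: leq_maxl.
  rewrite (dist1_CL slo0 slohi (@CL_cst R _) (@CL_cst R _)).
  by rewrite (EL_cst slo0 slohi) lee_fin h2// leq_maxr.
have qv : qs (fun w => Y w = v).
  exists [set w | Y w != v]; split.
  - have := mY measurableT _ (measurableC (measurable_set1 v)).
    by rewrite setTI; congr measurable; apply/seteqP; split => w /= /eqP.
  - apply: (capacity_eq0 slo0 slohi) => P cP.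
    have mD : measurable_fun [set: Omega R] (fun w => (Y w - v)%:E).
      by apply/measurable_EFinP; apply: measurable_funB => //; exact: measurable_cst.
    have i0 : (\int[P]_w `|(Y w - v)%:E|)%E = 0%E.
      apply/eqP; rewrite eq_le integral_ge0 ?andbT//.
      by rewrite -dv; apply: (integral_dist_le Y (fun=> v) cP).
    move/(ae_eq_integral_abs P measurableT mD) : i0 => [N [mN PN hN]].
    apply/eqP; rewrite eq_le measure_ge0 andbT -PN; apply: le_measure; rewrite ?inE//.
      have := mY measurableT _ (measurableC (measurable_set1 v)).
      by rewrite setTI; congr measurable; apply/seteqP; split => w /= /eqP.
    move=> w /= /eqP Yw; apply: hN => /= h; apply: Yw.
    by have [/eqP] := h I; rewrite subr_eq0 => /eqP.
  - by move=> w /= /negP; rewrite negbK => /eqP.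
have Ev : qs_value slo shi Y = v.
  rewrite /qs_value; case: xgetP => [v' _ /= qv'|/(_ v)//].
  by have [w [<- <-]] := qs_exists slo0 slohi (qsI slo0 slohi qv' qv).
by rewrite Ev.
Qed.

Section snell.

Definition adapted (eta : R -> Omega R -> R) : Prop :=
  forall t, 0 <= t <= 1 -> CLt t (eta t).

(** The Snell recursion with [cE]: everywhere defined and within cylinder functions. *)
Fixpoint snellL (eta : R -> Omega R -> R) (n j : nat) : Omega R -> R :=
  if j is j'.+1 then
    let t := dyadic n (2 ^ n - j) in
    fun w => Num.max (eta t w) (cE t (snellL eta n j') w)
  else eta 1.

Lemma dyadic_le n k l : (k <= l)%N -> dyadic n k <= dyadic n l :> R.
Proof. by move=> kl; rewrite ler_pM2r ?invr_gt0 ?pow2_gt0// ler_nat. Qed.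

Lemma dyadic1 n : dyadic n (2 ^ n) = 1 :> R.
Proof. by rewrite /dyadic natrX divff// gt_eqF// pow2_gt0. Qed.

Lemma dyadic_le1 n j : dyadic n (2 ^ n - j) <= 1 :> R.
Proof. by rewrite -(dyadic1 n); apply: dyadic_le; exact: leq_subr. Qed.

Lemma dyadic_01 n j : 0 <= (dyadic n (2 ^ n - j) : R) <= 1.
Proof. by rewrite dyadic_ge0 dyadic_le1. Qed.

Lemma snellL_CLt eta n j : adapted eta -> CLt (dyadic n (2 ^ n - j)) (snellL eta n j).
Proof.
move=> ad; elim: j => [|j IH] /=; first by rewrite subn0 dyadic1; apply: ad; rewrite ler01 lexx.
apply: CLt_max; first exact/ad/dyadic_01.
by apply: cE_CLt => //; [exact: dyadic_ge0|exact: CLt_CL (dyadic_ge0 _ _) IH].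
Qed.

Lemma snellL_CL eta n j : adapted eta -> CL (snellL eta n j).
Proof. by move=> ad; exact: CLt_CL (dyadic_ge0 _ _) (snellL_CLt n j ad). Qed.

Lemma snell_approx (X : R -> Omega R -> R) (eta : nat -> R -> Omega R -> R) n j :
  (forall t, 0 <= t <= 1 -> approx (fun k => eta k t) (X t)) ->
  approx (fun k => snellL (eta k) n j) (snell_back slo shi X n j).
Proof.
move=> h; elim: j => [|j IH] /=; first by apply: h; rewrite ler01 lexx.
apply: (approx_max (h _ (dyadic_01 n j.+1))).
by apply: condE_approx => //; exact: dyadic_ge0.
Qed.

Definition valueL eta n := EL (snellL eta n (2 ^ n)).

Lemma snellL0 eta n w : adapted eta -> snellL eta n (2 ^ n) w = valueL eta n.
Proof.
move=> ad; have := snellL_CLt n (2 ^ n) ad; rewrite subnn /dyadic mul0r => h.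
by rewrite /valueL /EL cE_id//; exact: CLt0_cst.
Qed.

Lemma discrete_value_lim (X : R -> Omega R -> R) (eta : nat -> R -> Omega R -> R) n :
  (forall k, adapted (eta k)) ->
  (forall t, 0 <= t <= 1 -> approx (fun k => eta k t) (X t)) ->
  forall e, 0 < e -> exists N, forall k, (N <= k)%N ->
    `|valueL (eta k) n - discrete_value slo shi X n| <= e.
Proof.
move=> ad h; have := snell_approx n (2 ^ n) h.
rewrite (_ : (fun k => _) = (fun k _ => valueL (eta k) n)).
  by move=> /approx_cst[]; rewrite /discrete_value /snell subn0.
by apply/funext => k; apply/funext => w; exact: snellL0.
Qed.

(** By the tower property the finer recursion passes through the midpoint, where taking one more
    maximum can only increase the result. *)
Lemma snellL_refine eta n j : adapted eta -> (j <= 2 ^ n)%N ->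
  forall w, snellL eta n j w <= snellL eta n.+1 j.*2 w.
Proof.
move=> ad; elim: j => [//|j IH] jn w.
have jn' := ltnW jn.
have E : dyadic n.+1 (2 ^ n.+1 - j.+1.*2) = dyadic n (2 ^ n - j.+1) :> R.
  by rewrite -[RHS]dyadic_double expnS mul2n doubleB.
rewrite doubleS [snellL _ n.+1 _]/= -doubleS E [leLHS]/=.
set t := dyadic n _; set t' := dyadic n.+1 _.
have t0 : 0 <= t by exact: dyadic_ge0.
have tt' : t <= t' by rewrite /t /t' -E; apply: dyadic_le; clear; lia.
have W1 := snellL_CL n j ad; have W2 := snellL_CL n.+1 j.*2 ad.
have t'0 := le_trans t0 tt'.
have C1 : CL (eta t') by apply: CLt_CL t'0 _; exact/ad/dyadic_01.
rewrite ge_max le_max lexx/= le_max; apply/orP; right.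
apply: (@le_trans _ _ (cE t (snellL eta n.+1 j.*2) w)).
  by apply: cE_mono => // z; exact: IH.
rewrite -(cE_tower slo0 slohi t0 tt' W2); apply: cE_mono => //.
- exact: cE_CL.
- by apply: CL_max => //; exact: cE_CL.
- by move=> z; rewrite le_max lexx orbT.
Qed.

Lemma valueL_refine eta n : adapted eta -> valueL eta n <= valueL eta n.+1.
Proof.
move=> ad; apply: EL_mono => //; [exact: snellL_CL..|].
by move=> w; rewrite expnS mul2n; exact: snellL_refine.
Qed.

End snell.

End conditional_limits.

                         

(** * Approximation of elements of S_G by simple processes *)

Section processes.
Context {R : realType}.
Variables (slo shi : R).
Hypotheses (slo0 : 0 <= slo) (slohi : slo <= shi).
Implicit Types (eta X : R -> Omega R -> R).

Local Notation Ehat := (Ehat slo shi).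

Lemma ldist_row_mx n (t t' : R) (x x' : 'rV[R]_n) :
  ldist (row_mx (const_mx t : 'rV[R]_1) x) (row_mx (const_mx t' : 'rV[R]_1) x') =
  `|t - t'| + ldist x x'.
Proof.
rewrite /ldist big_split_ord/= big_ord1 !row_mxEl !mxE; congr (_ + _).
by apply: eq_bigr => i _; rewrite !row_mxEr.
Qed.

Lemma cvg_sum_ord n (f : 'I_n -> R -> R) (t : R) : (forall i, f i u @[u --> t] --> f i t) ->
  \sum_(i < n) f i u @[u --> t] --> \sum_(i < n) f i t.
Proof.
elim: n f => [|n IH] f hf; first by rewrite big_ord0; under eq_fun do rewrite big_ord0; exact: cvg_cst.
by rewrite big_ord_recr/=; under eq_fun do rewrite big_ord_recr/=; apply: cvgD => //; exact: IH.
Qed.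

Lemma SG0P eta : SG0 1 eta ->
  [/\ adapted eta, forall w, continuous (eta^~ w) & exists M, forall t w, `|eta t w| <= M].
Proof.
move=> [n [s [h [s01 /bounded_lipschitzP[L [M [L0 hM hL]]] ->]]]]; split.
- move=> t /andP[t0 t1]; exists [seq Num.min (s i) t | i <- enum 'I_n], L, M; split.
    by move=> x /mapP[i _ ->]; rewrite ge_min lexx orbT le_min t0; have /andP[-> _] := s01 i.
  split => // w w'; rewrite (le_trans (hL _ _))// ldist_row_mx subrr normr0 add0r.
  by rewrite (gap_ldist (fun i => Num.min (s i) t)).
- move=> w t; pose g u := L * (`|t - u| + \sum_(i < n) `|B (Num.min (s i) t) w - B (Num.min (s i) u) w|).
  have cg : g u @[u --> t] --> g t.
    apply: cvgMr; apply: cvgD.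
      by apply: cvg_norm; apply: cvgB; [exact: cvg_cst|exact: cvg_id].
    apply: (@cvg_sum_ord n (fun i u => `|B (Num.min (s i) t) w - B (Num.min (s i) u) w|)) => i.
    apply: cvg_norm; apply: cvgB; first exact: cvg_cst.
    apply: (@cvg_comp _ _ _ (fun u => Num.min (s i) u) (fun u => B u w)); last exact: B_continuous.
    have h1 : {for t, continuous (fun u : R => Num.min (s i) u)}.
      by apply: (@continuous_min _ _ (fun=> s i)) => //; exact: cvg_cst.
    exact: h1.
  have gt0 : g t = 0.
    by rewrite /g subrr normr0 add0r big1 ?mulr0// => i _; rewrite subrr normr0.
  rewrite gt0 in cg; apply/cvgrPdist_le => e e0.
  move/cvgrPdist_le : cg => /(_ e e0); apply: filterS => u; rewrite sub0r normrN => gu.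
  rewrite (le_trans (hL _ _))// (le_trans _ gu)// (le_trans _ (ler_norm _))//.
  rewrite ldist_row_mx /g ler_wpM2l// lerD2l; apply: ler_sum => i _.
  by rewrite !mxE.
- by exists M => t w; exact: hM.
Qed.

Definition sup_dist (eta X : R -> Omega R -> R) (w : Omega R) : \bar R :=
  ereal_sup [set `|eta t w - X t w|%:E | t in `[0%R, 1%R]].

Lemma sup_dist_ge eta X w t : 0 <= t <= 1 -> (`|eta t w - X t w|%:E <= sup_dist eta X w)%E.
Proof. by move=> t01; apply: ereal_sup_ubound; exists t => //; rewrite /= in_itv. Qed.

Lemma sup_dist_ge0 eta X w : (0 <= sup_dist eta X w)%E.
Proof.
by apply: le_trans (@sup_dist_ge eta X w 0 _); rewrite ?lee_fin// lexx ler01.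
Qed.

(** The exponent beta > 1 enters only here, through [integral_le_power]: convergence in the norm of
    S_G implies convergence of the upper expectation of the supremum distance. *)
Lemma SG_approx (b : R) X : 1 < b -> SG slo shi b 1 X ->
  exists eta : nat -> R -> Omega R -> R, (forall k, SG0 1 (eta k)) /\
    forall e, 0 < e -> exists N, forall k, (N <= k)%N -> (Ehat (sup_dist (eta k) X) <= e%:E)%E.
Proof.
move=> b1 [mX cX [eta [eta0 cv]]]; exists eta; split => // e e0.
have b0 : 0 < b by exact: lt_trans b1.
have e2 : 0 < e / 2 by rewrite divr_gt0.
(* A norm at most c bounds the b-th moment by (e / 2) / K, and K times it is the second half of
   e. *)
pose K := e / 2 * (e / 2)^-1 `^ b.
have K0 : 0 < K by rewrite mulr_gt0// powR_gt0// invr_gt0.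
pose c := (e / 2 / K) `^ b^-1.
have c0 : 0 < c by rewrite powR_gt0// divr_gt0.
have cb : c `^ b = e / 2 / K by rewrite /c -powRrM mulVf ?gt_eqF// powRr1// ltW// divr_gt0.
have S0 k w : (0 <= sup_dist (eta k) X w `^ b)%E by exact: poweR_ge0.
have E0 k : (0 <= Ehat (fun w => sup_dist (eta k) X w `^ b))%E.
  exact: Ehat_ge0.
have [||N hN] := (cvge0P _).1 cv c => //.
  by move=> k; exact: poweR_ge0.
exists N => k Nk; have := hN k Nk; rewrite /SG_norm -/(sup_dist _ _) => h.
have {h} h : (Ehat (fun w => sup_dist (eta k) X w `^ b) <= (e / 2 / K)%:E)%E.
  have -> : Ehat (fun w => sup_dist (eta k) X w `^ b)%E =
      ((Ehat (fun w => sup_dist (eta k) X w `^ b)) `^ b^-1 `^ b)%E.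
    by rewrite -poweRrM mulVf ?gt_eqF// poweRe1.
  rewrite -cb -poweR_EFin; apply: gt0_ler_poweR => //.
  - exact: ltW.
  - by rewrite in_itv/= leey andbT poweR_ge0.
  - by rewrite in_itv/= leey andbT lee_fin ltW.
apply: Ehat_le => P cP.
apply: (le_trans (integral_le_power P b1 e2 (sup_dist_ge0 (eta k) X))).
rewrite [X in (_ <= X%:E)%E]splitr EFinD leeD2l//.
have -> : (e / 2)%:E = (K%:E * (e / 2 / K)%:E)%E.
  by rewrite -EFinM; congr EFin; field; rewrite gt_eqF.
rewrite lee_wpmul2l ?lee_fin ?(ltW K0)//.
exact: le_trans (Ehat_ge _ cP) h.
Qed.

Lemma SG_approx_at (b : R) X (eta : nat -> R -> Omega R -> R) : SG slo shi b 1 X ->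
  (forall k, SG0 1 (eta k)) ->
  (forall e, 0 < e -> exists N, forall k, (N <= k)%N -> (Ehat (sup_dist (eta k) X) <= e%:E)%E) ->
  forall t, 0 <= t <= 1 -> approx slo shi (fun k => eta k t) (X t).
Proof.
move=> [mX _ _] eta0 h t t01; split; first exact: mX.
- by move=> k; have [ad _ _] := SG0P (eta0 k); have /andP[t0 _] := t01; exact: CLt_CL t0 (ad t t01).
- move=> e e0; have [N hN] := h e e0; exists N => k Nk; apply: le_trans (hN k Nk).
  by apply: Ehat_mono => w; [rewrite lee_fin|exact: sup_dist_ge].
Qed.

End processes.

(** * Approximating Borel events by cylinder functions of the same time *)

Section approximation_of_events.
Context {R : realType}.

Lemma CLt_stop_CL t (F : Omega R -> R) : 0 <= t -> CL F -> CLt t (fun w => F (stop t w)).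
Proof.
move=> t0 [T _ [g [L [M [g0 cF]]]]]; exists (map (Num.min^~ t) g), L, M.
split; last exact: cyl_stop_map.
move=> x /mapP[y /g0 /andP[y0 _] ->]; rewrite ge_min lexx orbT andbT.
by rewrite le_min y0.
Qed.

                                                                                   
                                                                                            
(** Inequalities tested against nonnegative cylinder functions of time t extend to such events under
    P. *)
Definition approximable (P : probability (Omega R) R) t (A : set (Omega R)) : Prop :=
  measurable A /\ forall e, 0 < e -> exists Z, [/\ CLt t Z, forall w, 0 <= Z w <= 1 &
    Ex P (fun w => `|\1_A w - Z w|) <= e].

Lemma cvg_dist0 (a : R) (u : nat -> R) : u n @[n --> \oo] --> a ->
  `|a - u n| @[n --> \oo] --> (0 : R).
Proof.
move=> ua; apply/cvgrPdist_le => e e0; move/cvgrPdist_le : ua => /(_ e e0).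
by apply: filterS => n; rewrite sub0r normrN normr_id.
Qed.

Lemma prod01 n (a : nat -> R) : (forall i, 0 <= a i <= 1) -> 0 <= \prod_(i < n) a i <= 1.
Proof.
move=> h; elim: n => [|n /andP[h0 h1]]; first by rewrite big_ord0 ler01 lexx.
by rewrite big_ord_recr/=; have /andP[a0 a1] := h n; rewrite mulr_ge0//= mulr_ile1.
Qed.

Lemma prod_dist n (a b : nat -> R) : (forall i, 0 <= a i <= 1) -> (forall i, 0 <= b i <= 1) ->
  `|\prod_(i < n) a i - \prod_(i < n) b i| <= \sum_(i < n) `|a i - b i|.
Proof.
move=> ha hb; elim: n => [|n IH]; first by rewrite !big_ord0 subrr normr0.
rewrite !big_ord_recr/=; have /andP[a0 a1] := ha n.
have /andP[p0 p1] := prod01 n hb.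
set p := \prod_(i < n) a i in IH *; set q := \prod_(i < n) b i in IH p0 p1 *.
have -> : p * a n - q * b n = (p - q) * a n + q * (a n - b n) by ring.
rewrite (le_trans (ler_normD _ _))// !normrM lerD//.
  by rewrite (le_trans _ IH)// ler_piMr// ger0_norm.
by rewrite ler_piMl// ger0_norm.
Qed.

Lemma bm_prod n (F : nat -> Omega R -> R) : (forall i, (i < n)%N -> bm (F i)) ->
  bm (fun w => \prod_(i < n) F i w).
Proof.
elim: n => [_|n IH hF]; first by under eq_fun do rewrite big_ord0; exact: bm_cst.
under eq_fun do rewrite big_ord_recr/=.
by apply: bm_mul; [apply: IH => i /ltnW; exact: hF|exact: hF].
Qed.

Lemma CLt_prod t n (F : nat -> Omega R -> R) : (forall i, (i < n)%N -> CLt t (F i)) ->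
  CLt t (fun w => \prod_(i < n) F i w).
Proof.
elim: n => [_|n IH hF]; first by under eq_fun do rewrite big_ord0; exact: CLt_cst.
under eq_fun do rewrite big_ord_recr/=.
by apply: CLt_mul; [apply: IH => i /ltnW; exact: hF|exact: hF].
Qed.

(** A countable union is close to a finite one, whose indicator is 1 minus a product of complements.
    Replacing each factor by its approximation costs at most the sum of the errors. *)
Lemma approximable_bigcup (P : probability (Omega R) R) t (A : nat -> set (Omega R)) : 0 <= t ->
  (forall n, approximable P t (A n)) -> approximable P t (\bigcup_n A n).
Proof.
move=> t0 hA; have mA n : measurable (A n) by have [] := hA n.
have mU : measurable (\bigcup_n A n) by exact: bigcupT_measurable.
split => // e e0; have e2 : 0 < e / 2 by rewrite divr_gt0.
pose In n w : R := 1 - \prod_(i < n) (1 - \1_(A i) w).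
have I01 n w : 0 <= 1 - (\1_(A n) w : R) <= 1.
  by rewrite indicE; case: (_ \in _); rewrite /= ?subrr ?subr0 lexx ?ler01.
have P01 n w : 0 <= \prod_(i < n) (1 - (\1_(A i) w : R)) <= 1.
  by apply: (prod01 n (a := fun i => 1 - \1_(A i) w)) => i; exact: I01.
have In01 n w : 0 <= In n w <= 1.
  by have /andP[h0 h1] := P01 n w; rewrite /In subr_ge0 h1 lerBlDr lerDl.
have bIn n : bm (In n).
  apply: bm_sub; first exact: bm_cst.
  apply: (bm_prod (F := fun i w => 1 - \1_(A i) w)) => i _.
  by apply: bm_sub; [exact: bm_cst|exact: bm_indic].
have cIn w : In n w @[n --> \oo] --> (\1_(\bigcup_n A n) w : R).
  have [[k _ Akw]|nA] := pselect ((\bigcup_n A n) w).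
    rewrite indicE mem_set; last by exists k.
    apply: cvg_near_cst; exists k.+1 => // n /= kn.
    by rewrite /In (bigD1 (Ordinal kn))//= indicE mem_set// subrr mul0r subr0.
  rewrite indicE memNset//; apply: cvg_near_cst; apply: nearW => n.
  rewrite /In big1 ?subrr// => i _; rewrite indicE memNset ?subr0// => Aiw.
  by apply: nA; exists (i : nat).
have [n hn] : exists n, Ex P (fun w => `|\1_(\bigcup_n A n) w - In n w|) <= e / 2.
  have h1 n w : `| `|\1_(\bigcup_n A n) w - In n w| | <= 1.
    rewrite normr_id; have /andP[h0 h1] := In01 n w.
    by rewrite indicE; case: (_ \in _); rewrite ler_norml; apply/andP; split => /=; lra.
  have h2 w : `|\1_(\bigcup_n A n) w - In n w| @[n --> \oo] --> (0 : R).
    exact: cvg_dist0.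
  have [_] := @Ex_cvg _ _ _ P (fun n w => `|\1_(\bigcup_n A n) w - In n w|) (fun=> 0) 1
    (fun n => (bm_abs (bm_sub (bm_indic mU) (bIn n))).1) h1 h2.
  rewrite Ex_cst => /cvgrPdist_le /(_ _ e2)[n _ /(_ n (leqnn n))].
  by rewrite sub0r normrN => /(le_trans (ler_norm _)); exists n.
have en : 0 < e / 2 / n.+1%:R by rewrite divr_gt0.
have /choice[Z hZ] : forall i, exists Z, [/\ CLt t Z, forall w, 0 <= Z w <= 1 &
    Ex P (fun w => `|\1_(A i) w - Z w|) <= e / 2 / n.+1%:R].
  by move=> i; have [_ h] := hA i; exact: h _ en.
have ZC i : CLt t (Z i) by have [] := hZ i.
have Z01 i w : 0 <= 1 - Z i w <= 1.
  by have [_ /(_ w)/andP[h0 h1] _] := hZ i; rewrite subr_ge0 h1 lerBlDr lerDl.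
have bZ i : bm (Z i) by apply: CL_bm; exact: CLt_CL t0 (ZC i).
pose W w := 1 - \prod_(i < n) (1 - Z i w).
have WC : CLt t W.
  apply: CLt_sub; first exact: CLt_cst.
  by apply: (CLt_prod (n := n) (F := fun i w => 1 - Z i w)) => i _; apply: CLt_sub => //; exact: CLt_cst.
have bW : bm W by apply: CL_bm; exact: CLt_CL t0 WC.
exists W; split => //.
  move=> w; have /andP[h0 h1] : 0 <= \prod_(i < n) (1 - Z i w) <= 1.
    by apply: (prod01 n (a := fun i => 1 - Z i w)) => i; exact: Z01.
  by rewrite /W subr_ge0 h1 lerBlDr lerDl.
have bIZ i : bm (fun w => `|\1_(A i) w - Z i w|).
  by apply: bm_abs; apply: bm_sub => //; exact: bm_indic.
apply: (@le_trans _ _ (Ex P (fun w => `|\1_(\bigcup_n A n) w - In n w| +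
    \sum_(i < n) `|\1_(A i) w - Z i w|))).
  apply: Ex_mono => [||w].
  - by apply: bm_abs; apply: bm_sub => //; exact: bm_indic.
  - apply: bm_add; first by apply: bm_abs; apply: bm_sub => //; exact: bm_indic.
    exact: (bm_sum (F := fun i w => `|\1_(A i) w - Z i w|)).
  - rewrite (le_trans (ler_distD (In n w) _ _))// lerD2l /In /W.
    have sub1 (x y : R) : `|1 - x - (1 - y)| = `|x - y| by rewrite distrC; congr `|_|; ring.
    rewrite sub1.
    rewrite (le_trans (prod_dist n (fun i => I01 i w) (fun i => Z01 i w)))//.
    by apply: ler_sum => i _; rewrite sub1.
rewrite ExD; last 2 first.
- by apply: bm_abs; apply: bm_sub => //; exact: bm_indic.
- exact: (bm_sum (F := fun i w => `|\1_(A i) w - Z i w|)).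
rewrite (@Ex_sum _ _ _ P n (fun i w => `|\1_(A i) w - Z i w|))//.
rewrite [leRHS]splitr lerD//.
apply: (@le_trans _ _ (\sum_(i < n) e / 2 / n.+1%:R)).
  by apply: ler_sum => i _; have [] := hZ i.
rewrite sumr_const card_ord -[_ *+ n]mulr_natl mulrCA ler_piMr ?(ltW e2)//.
by rewrite ler_pdivrMr// mul1r ler_nat.
Qed.

Lemma approximableC P t A : approximable P t A -> approximable P t (~` A).
Proof.
move=> [mA hA]; split; first exact: measurableC.
move=> e e0; have [Z [ZC Z01 hZ]] := hA e e0; exists (fun w => 1 - Z w); split.
- by apply: CLt_sub => //; exact: CLt_cst.
- by move=> w; have /andP[h0 h1] := Z01 w; rewrite subr_ge0 h1 lerBlDr lerDl.
- move: hZ; congr (_ <= _); congr Ex; apply/funext => w.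
  rewrite !indicE in_setC; case: (w \in A); rewrite /= !sub0r !normrN//.
  by rewrite opprB addrCA subrr addr0.
Qed.

Lemma approximable_Borel P t A : 0 <= t -> Borel_upto t A -> approximable P t A.
Proof.
move=> t0 [U mU <-]; pose S U := approximable P t (stop t @^-1` U).
apply: (@borel_ind _ S) mU.
  split.
  - rewrite /S preimage_set0; split => // e e0; exists (fun=> 0); split.
    + exact: CLt_cst.
    + by move=> _; rewrite lexx ler01.
    + rewrite (_ : (fun w => _) = fun=> 0); first by rewrite Ex_cst ltW.
      by apply/funext => w; rewrite indicE in_set0 subrr normr0.
  - by move=> V SV; rewrite /S setTD preimage_setC; exact: approximableC.
  - by move=> V SV; rewrite /S preimage_bigcup; exact: approximable_bigcup.
move=> Y YC Y0; rewrite /S /=.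
have YtC := CLt_stop_CL t0 YC; have YtL := CLt_CL t0 YtC.
have mU : measurable (stop t @^-1` [set w | 0 < Y w]).
  by apply: sub_sigma_algebra; exact: (CL_open_gt0 YtL).
split => // e e0.
pose Z k w := Num.min 1 (k%:R * Y (stop t w)).
have ZC k : CLt t (Z k) by apply: CLt_min; [exact: CLt_cst|exact: CLt_scale].
have Z01 k w : 0 <= Z k w <= 1.
  by rewrite le_min ler01 mulr_ge0// ge_min lexx.
have bZ k : bm (Z k) by apply: CL_bm; exact: CLt_CL t0 (ZC k).
set U' := stop t @^-1` _ in mU *.
have cZ w : Z k w @[k --> \oo] --> (\1_U' w : R).
  have [Yw|Yw] := ltP 0 (Y (stop t w)).
    rewrite indicE mem_set//; apply: cvg_near_cst.
    exists (Num.trunc (Y (stop t w))^-1).+1 => // k /= hk; apply/min_idPl.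
    rewrite -ler_pdivrMr// mul1r (le_trans (ltW (truncnS_gt _)))//.
    by rewrite ler_nat.
  rewrite indicE memNset; last by move=> h; have := lt_le_trans h Yw; rewrite ltxx.
  apply: cvg_near_cst; apply: nearW => k; rewrite /Z.
  have -> : Y (stop t w) = 0 by apply/eqP; rewrite eq_le Yw Y0.
  by rewrite mulr0 (min_idPr ler01).
have h1 k w : `| `|\1_U' w - Z k w| | <= 1.
  rewrite normr_id; have /andP[h0 h1] := Z01 k w.
  by rewrite indicE; case: (_ \in _); rewrite ler_norml; apply/andP; split => /=; lra.
have h2 w : `|\1_U' w - Z k w| @[k --> \oo] --> (0 : R).
  exact: cvg_dist0.
have [_] := @Ex_cvg _ _ _ P (fun k w => `|\1_U' w - Z k w|) (fun=> 0) 1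
  (fun k => (bm_abs (bm_sub (bm_indic mU) (bZ k))).1) h1 h2.
rewrite Ex_cst => /cvgrPdist_le /(_ _ e0)[k _ /(_ k (leqnn k))].
by rewrite sub0r normrN => /(le_trans (ler_norm _)); exists (Z k).
Qed.

End approximation_of_events.

(** * Sequences stopped along decreasing events *)

Section stopped_sequences.
Context {R : realType}.
Implicit Types (A : nat -> set (Omega R)) (f : nat -> Omega R -> R).

Lemma antitone_sum N (b : nat -> bool) : (forall j, b j.+1 -> b j) ->
  exists2 k, (k <= N)%N & (forall j, (j < N)%N -> b j = (j < k)%N) /\
    forall a : nat -> R, a 0%N + \sum_(j < N) (b j)%:R * (a j.+1 - a j) = a k.
Proof.
move=> bS; elim: N => [|N [k kN [bk ak]]].
  by exists 0%N => //; split => // a; rewrite big_ord0 addr0.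
have [bN|nbN] := boolP (b N).
  have E : k = N.
    apply/eqP; rewrite eqn_leq kN leqNgt; apply/negP => kN'.
    have := bk _ kN'; rewrite ltnn => /negP; apply.
    have down d : b (k + d)%N -> b k.
      by elim: d => [|d IH]; rewrite ?addn0 ?addnS// => /bS.
    by apply: (down (N - k)%N); rewrite subnKC.
  exists N.+1 => //; split => [j|a].
    move=> jN; rewrite jN; move: jN; rewrite ltnS leq_eqVlt => /orP[/eqP->//|jN'].
    by rewrite bk// E jN'.
  by rewrite big_ord_recr/= addrA ak bN mul1r E addrC subrK.
exists k; first exact: leqW.
split => [j|a].
  rewrite ltnS leq_eqVlt => /orP[/eqP->|]; last exact: bk.
  by rewrite (negbTE nbN); apply/esym; rewrite ltnNge kN.
by rewrite big_ord_recr/= addrA ak (negbTE nbN) mul0r addr0.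
Qed.

                                                                                            
                                               
(** For decreasing A this is f at a random index, the number of j < N with w in A j ([stopsumP]).
    The telescoped form is linear in the indicators, so its expectation splits into increments. *)
Definition stopsum N A f (w : Omega R) : R :=
  f 0%N w + \sum_(j < N) \1_(A j) w * (f j.+1 w - f j w).

Definition antitone A := forall j, A j.+1 `<=` A j.

Lemma stopsumP N A w : antitone A -> exists2 k, (k <= N)%N &
  (forall j, (j < N)%N -> A j w <-> (j < k)%N) /\ forall f, stopsum N A f w = f k w.
Proof.
move=> aA; have [|k kN [bk ak]] := @antitone_sum N (fun j => w \in A j).
  by move=> j; rewrite !inE => /aA.
exists k => //; split => [j /bk <-|f]; first by rewrite inE.
rewrite -(ak (f^~ w)); congr (_ + _); exact: eq_bigr.
Qed.

Lemma stopsum_bm N A f : (forall j, measurable (A j)) ->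
  (forall j, (j <= N)%N -> bm (f j)) -> bm (stopsum N A f).
Proof.
move=> mA bf; apply: bm_add; first exact: bf.
apply: (bm_sum (F := fun j w => \1_(A j) w * (f j.+1 w - f j w))) => j jN.
by apply: bm_mul; [exact: bm_indic|apply: bm_sub; apply: bf => //; exact: ltnW].
Qed.

Lemma stopsum_measurable N A f : (forall j, measurable (A j)) ->
  (forall j, (j <= N)%N -> measurable_fun [set: Omega R] (f j)) ->
  measurable_fun [set: Omega R] (stopsum N A f).
Proof.
move=> mA mf; apply: measurable_funD; first exact: mf.
elim: N mf => [|N IH] mf; first by under eq_fun do rewrite big_ord0; exact: measurable_cst.
under eq_fun do rewrite big_ord_recr/=.
apply: measurable_funD; first by apply: IH => j /leqW; exact: mf.
by apply: measurable_funM; [exact: measurable_indic|apply: measurable_funB; apply: mf => //; exact: leqnSn].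
Qed.

Lemma Ex_stopsum (P : probability (Omega R) R) N A f : (forall j, measurable (A j)) ->
  (forall j, (j <= N)%N -> bm (f j)) ->
  Ex P (stopsum N A f) =
  Ex P (f 0%N) + \sum_(j < N) Ex P (fun w => \1_(A j) w * (f j.+1 w - f j w)).
Proof.
move=> mA bf.
have bF j : (j < N)%N -> bm (fun w => \1_(A j) w * (f j.+1 w - f j w)).
  by move=> jN; apply: bm_mul; [exact: bm_indic|apply: bm_sub; apply: bf => //; exact: ltnW].
rewrite ExD; [|exact: bf|exact: (bm_sum (F := fun j w => \1_(A j) w * (f j.+1 w - f j w)))].
by congr (_ + _); exact: (@Ex_sum _ _ _ P N (fun j w => \1_(A j) w * (f j.+1 w - f j w))).
Qed.

(** g may be unbounded: it is the bounded h plus a difference whose integrability follows from the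
    assumed bound. *)
Lemma integral_near (P : probability (Omega R) R) (g h : Omega R -> R) (c : R) :
  measurable_fun [set: Omega R] g -> bm h -> (\int[P]_w `|h w - g w|%:E <= c%:E)%E ->
  ((Ex P h - c)%:E <= \int[P]_w (g w)%:E <= (Ex P h + c)%:E)%E.
Proof.
move=> mg bh hc; have mh := bh.1.
have id : P.-integrable [set: Omega R] (EFin \o (fun w => g w - h w)).
  apply/integrableP; split; first by apply/measurable_EFinP; exact: measurable_funB.
  apply: (@le_lt_trans _ _ c%:E); last exact: ltry.
  by move: hc; congr (_ <= _)%E; apply: eq_integral => w _ /=; rewrite distrC.
have E : (\int[P]_w (g w)%:E = (Ex P h)%:E + \int[P]_w (g w - h w)%:E)%E.
  rewrite -ExE// -integralD//; last exact: bm_int.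
  by apply: eq_integral => w _ /=; rewrite -EFinD addrC subrK.
have := le_abse_integral P measurableT (measurable_int P id).
have fd := integrable_fin_num measurableT id; rewrite E.
rewrite -(fineK fd) => h1; have {h1} : (`|fine (\int[P]_w (g w - h w)%:E)| <= c)%R.
  rewrite -lee_fin; apply: (le_trans h1); move: hc; congr (_ <= _)%E.
  by apply: eq_integral => w _ /=; rewrite distrC.
by rewrite ler_norml -EFinD !lee_fin => /andP[h1 h2]; apply/andP; split; lra.
Qed.

End stopped_sequences.

(** * The Snell envelope is a supermartingale under every P *)

Section snell_supermartingale.
Context {R : realType}.
Variables (slo shi : R).
Hypotheses (slo0 : 0 <= slo) (slohi : slo <= shi).
Variables (eta : R -> Omega R -> R) (n : nat).
Hypothesis ad : adapted eta.

Local Notation EL := (EL slo shi).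
Local Notation cE := (cE slo shi).
Local Notation t_ j := (dyadic n j : R).

Definition snell_at j : Omega R -> R := snellL slo shi eta n (2 ^ n - j).

Lemma snell_atS j w : (j < 2 ^ n)%N ->
  snell_at j w = Num.max (eta (t_ j) w) (cE (t_ j) (snell_at j.+1) w).
Proof.
move=> jn; rewrite /snell_at; have -> : (2 ^ n - j = (2 ^ n - j.+1).+1)%N by lia.
by rewrite /= (_ : 2 ^ n - (2 ^ n - j.+1).+1 = j)%N//; lia.
Qed.

Lemma snell_at0 w : snell_at 0 w = valueL slo shi eta n.
Proof. by rewrite /snell_at subn0 snellL0. Qed.

Lemma snell_atN : snell_at (2 ^ n) = eta 1.
Proof. by rewrite /snell_at subnn. Qed.

Lemma snell_at_CLt j : (j <= 2 ^ n)%N -> CLt (t_ j) (snell_at j).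
Proof. by move=> jn; have := snellL_CLt slo0 slohi n (2 ^ n - j) ad; rewrite subKn. Qed.

Lemma snell_at_CL j : CL (snell_at j).
Proof. exact: snellL_CL. Qed.

Lemma dyadic_itv j : (j <= 2 ^ n)%N -> 0 <= t_ j <= 1.
Proof. by move=> jn; rewrite dyadic_ge0 -(dyadic1 n) dyadic_le. Qed.

Lemma eta_CLt j : (j <= 2 ^ n)%N -> CLt (t_ j) (eta (t_ j)).
Proof. by move=> jn; apply: ad; exact: dyadic_itv. Qed.

Lemma eta_CL j : (j <= 2 ^ n)%N -> CL (eta (t_ j)).
Proof. by move=> jn; apply: CLt_CL (dyadic_ge0 _ _) (eta_CLt jn). Qed.

Lemma snell_at_ge j w : (j <= 2 ^ n)%N -> eta (t_ j) w <= snell_at j w.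
Proof.
rewrite leq_eqVlt => /orP[/eqP->|jn]; first by rewrite snell_atN dyadic1.
by rewrite snell_atS// le_max lexx.
Qed.

(** P is dominated by the sublinear expectation. There conditioning at t_j pulls Z out and leaves Z
    times E_{t_j}[W_{j+1}] - W_j, which is nonpositive by the recursion. *)
Lemma snell_super P j Z : calP slo shi P -> (j < 2 ^ n)%N -> CLt (t_ j) Z ->
  (forall w, 0 <= Z w) -> Ex P (fun w => Z w * (snell_at j.+1 w - snell_at j w)) <= 0.
Proof.
move=> cP jn ZC Z0; have t0 : 0 <= t_ j by exact: dyadic_ge0.
have WC := snell_at_CLt (ltnW jn); have W'C := snell_at_CL j.+1.
have SC : CLt (t_ j) (fun w => - (Z w * snell_at j w)) by apply: CLt_opp; exact: CLt_mul.
have FC : CL (fun w => Z w * snell_at j.+1 w + - (Z w * snell_at j w)).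
  by apply: CL_add; [apply: CL_mul => //; exact: CLt_CL ZC|exact: CLt_CL SC].
rewrite (_ : (fun w => _) = fun w => Z w * snell_at j.+1 w + - (Z w * snell_at j w)); last first.
  by apply/funext => w; rewrite mulrBr.
apply: (le_trans (Ex_le_EL slo0 slohi cP FC)).
rewrite -(EL_cE slo0 slohi t0 FC) (cE_loc slo0 slohi t0 W'C ZC SC Z0).
rewrite -(EL_cst slo0 slohi 0); apply: EL_mono => //.
- by apply: CL_add; [apply: CL_mul; [exact: CLt_CL ZC|exact: cE_CL]|exact: CLt_CL SC].
- exact: CL_cst.
- by move=> w; rewrite -mulrBr mulr_ge0_le0// subr_le0 (snell_atS w jn) le_max lexx orbT.
Qed.

Lemma snell_super_event P j A : calP slo shi P -> (j < 2 ^ n)%N -> approximable P (t_ j) A ->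
  Ex P (fun w => \1_A w * (snell_at j.+1 w - snell_at j w)) <= 0.
Proof.
move=> cP jn [mA hA]; pose D w := snell_at j.+1 w - snell_at j w.
have DC : CL D by apply: CL_sub; exact: snell_at_CL.
have bD := CL_bm DC; have [M M0 hM] := CL_bdd DC.
apply/ler_addgt0Pr => e e0; rewrite add0r.
have eM : 0 < e / (M + 1) by rewrite divr_gt0// ltr_wpDl.
have [Z [ZC Z01 hZ]] := hA _ eM.
have bZ : bm Z by apply: CL_bm; exact: CLt_CL (dyadic_ge0 _ _) ZC.
have bA : bm (\1_A : Omega R -> R) by exact: bm_indic.
have Z0 w : 0 <= Z w by have /andP[] := Z01 w.
rewrite (_ : (fun w => _) = fun w => Z w * D w + (\1_A w - Z w) * D w); last first.
  by apply/funext => w; rewrite /D; ring.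
rewrite ExD; [|exact: bm_mul|by apply: bm_mul => //; exact: bm_sub].
rewrite -[leRHS]add0r; apply: lerD; first exact: (snell_super cP jn ZC Z0).
apply: (@le_trans _ _ (Ex P (fun w => (M + 1) * `|\1_A w - Z w|))).
  apply: Ex_mono => [||w].
  - by apply: bm_mul => //; exact: bm_sub.
  - by apply: bm_scale; apply: bm_abs; exact: bm_sub.
  - rewrite (le_trans (ler_norm _))// normrM mulrC ler_wpM2r// (le_trans (hM w))//.
    by rewrite lerDl.
rewrite ExZ; last by apply: bm_abs; exact: bm_sub.
by rewrite -ler_pdivlMl ?ltr_wpDl// mulrC.
Qed.

(** The envelope dominates eta at the random index, and each increment of the stopped envelope has
    nonpositive P-expectation by [snell_super_event]. *)
Lemma stopped_le_value P (A : nat -> set (Omega R)) : calP slo shi P -> antitone A ->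
  (forall j, measurable (A j)) ->
  (forall j, (j < 2 ^ n)%N -> approximable P (t_ j) (A j)) ->
  Ex P (stopsum (2 ^ n) A (fun j => eta (t_ j))) <= valueL slo shi eta n.
Proof.
move=> cP aA mA apA.
have be j : (j <= 2 ^ n)%N -> bm (eta (t_ j)) by move=> jn; apply: CL_bm; exact: eta_CL.
have bW j : (j <= 2 ^ n)%N -> bm (snell_at j) by move=> jn; apply: CL_bm; exact: snell_at_CL.
apply: (@le_trans _ _ (Ex P (stopsum (2 ^ n) A snell_at))).
  apply: Ex_mono => [||w]; [exact: stopsum_bm..|].
  by have [k kn [_ E]] := stopsumP (2 ^ n) w aA; rewrite !E; exact: snell_at_ge.
rewrite Ex_stopsum// (_ : snell_at 0 = fun=> valueL slo shi eta n); last first.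
  by apply/funext => w; exact: snell_at0.
rewrite Ex_cst gerDl; apply: sumr_le0 => j _.
exact: (snell_super_event cP _ (apA j (ltn_ord j))).
Qed.

End snell_supermartingale.

(** * Upper bound: no stopping time beats the discrete values in the limit *)

Section stopping_times.
Context {R : realType}.
Variables (slo shi : R).
Hypotheses (slo0 : 0 <= slo) (slohi : slo <= shi).
Variables (X : R -> Omega R -> R) (eta : nat -> R -> Omega R -> R).
Hypotheses (mX : forall t, 0 <= t <= 1 -> measurable_fun [set: Omega R] (X t))
  (cX : qs slo shi (fun w => {within `[0, 1], continuous (X^~ w)}))
  (eta0 : forall k, SG0 1 (eta k))
  (etaX : forall e, 0 < e -> exists N, forall k, (N <= k)%N ->
     (Ehat slo shi (sup_dist (eta k) X) <= e%:E)%E)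
  (aX : forall t, 0 <= t <= 1 -> approx slo shi (fun k => eta k t) (X t)).

Local Notation t_ n j := (dyadic n j : R).
Local Notation V n := (discrete_value slo shi X n).

Let ad k : adapted (eta k). Proof. by have [] := SG0P (eta0 k). Qed.

(** One approximation close to X as a process and, on the given grid, in discrete value. *)
Lemma good_index n (e : R) : 0 < e -> exists k,
  (Ehat slo shi (sup_dist (eta k) X) <= e%:E)%E /\ `|valueL slo shi (eta k) n - V n| <= e.
Proof.
move=> e0; have [N1 h1] := etaX e0.
have [N2 h2] := discrete_value_lim slo0 slohi n ad aX e0.
by exists (maxn N1 N2); split; [apply: h1; exact: leq_maxl|apply: h2; exact: leq_maxr].
Qed.

Lemma discrete_value_mono : nondecreasing_seq (fun n => V n).
Proof.
apply/nondecreasing_seqP => n; apply/ler_addgt0Pr => e e0.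
have e2 : 0 < e / 2 by rewrite divr_gt0.
have [N1 h1] := discrete_value_lim slo0 slohi n ad aX e2.
have [N2 h2] := discrete_value_lim slo0 slohi n.+1 ad aX e2.
pose k := maxn N1 N2.
have := h1 k (leq_maxl _ _); have := h2 k (leq_maxr _ _).
have := valueL_refine slo0 slohi n (ad k).
by rewrite !ler_norml => ? /andP[? ?] /andP[? ?]; lra.
Qed.

Section fixed_measure.
Variables (P : probability (Omega R) R).
Hypothesis cP : calP slo shi P.

Lemma stopsum_integral n k (A : nat -> set (Omega R)) (D : R) : antitone A ->
  (forall j, measurable (A j)) -> (Ehat slo shi (sup_dist (eta k) X) <= D%:E)%E ->
  let h := Ex P (stopsum (2 ^ n) A (fun j => eta k (t_ n j))) in
  ((h - D)%:E <= \int[P]_w (stopsum (2 ^ n) A (fun j => X (t_ n j)) w)%:E <= (h + D)%:E)%E.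
Proof.
move=> aA mA hD; apply: integral_near.
- by apply: stopsum_measurable => // j jn; apply: mX; exact: dyadic_itv.
- by apply: stopsum_bm => // j jn; apply: CL_bm; exact: eta_CL.
- apply: le_trans hD; apply: le_trans (Ehat_ge _ cP); apply: ge0_le_integral_any => w.
    by rewrite lee_fin.
  have [j jn [_ E]] := stopsumP (2 ^ n) w aA; rewrite !E.
  by apply: sup_dist_ge; exact: dyadic_itv.
Qed.

Section fixed_time.
Variable tau : Omega R -> R.
Hypothesis st : stopping_times01 slo shi tau.

Let late n j : set (Omega R) := [set w | t_ n j < tau w].

Lemma late_antitone n : antitone (late n).
Proof. by move=> j w; apply: le_lt_trans; exact: dyadic_le. Qed.

Lemma late_approximable n j : approximable P (t_ n j) (late n j).
Proof.
have t0 : 0 <= t_ n j by exact: dyadic_ge0.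
have [[_ /(_ _ t0)[h _ _]] _] := st.
have -> : late n j = ~` [set w | tau w <= t_ n j].
  by apply/seteqP; split => w /=; rewrite /late/= ltNge => /negP.
apply: approximableC; apply: approximable_Borel => //.
have := h [set 1] (measurable_set1 1); congr Borel_upto.
apply/seteqP; split => w /=; rewrite indicE.
  by case: (boolP (w \in _)) => [|_ /esym/eqP]; rewrite ?inE// oner_eq0.
by move=> h1; rewrite mem_set.
Qed.

Lemma late_measurable n j : measurable (late n j).
Proof. by have [] := late_approximable n j. Qed.

(** The number of grid times before tau is the index of the first grid time at or after tau, capped
    at 1: a discretisation from above, so that its events are known at grid times. *)
Lemma late_time n w : exists k, [/\ (k <= 2 ^ n)%N,
  forall f, stopsum (2 ^ n) (late n) f w = f k w,
  `|t_ n k - Num.min (tau w) 1| <= (2 ^+ n)^-1 & 0 <= Num.min (tau w) 1 <= 1].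
Proof.
have [k kn [hk E]] := stopsumP (2 ^ n) w (@late_antitone n).
have tau0 : 0 <= tau w by have [[h _] _] := st.
have p0 := @pow2_gt0 R n; have i0 : 0 < (2 ^+ n)^-1 :> R by rewrite invr_gt0.
exists k; split => //; last by rewrite le_min tau0 ler01 ge_min lexx orbT.
have h1 : Num.min (tau w) 1 <= t_ n k.
  move: kn; rewrite leq_eqVlt => /orP[/eqP->|kn]; first by rewrite dyadic1 ge_min lexx orbT.
  rewrite ge_min; apply/orP; left; rewrite leNgt; apply/negP => /(hk k kn).1.
  by rewrite ltnn.
have h2 : t_ n k - (2 ^+ n)^-1 <= Num.min (tau w) 1.
  case: k kn hk {E h1} => [|k] kn hk.
    rewrite /dyadic mul0r sub0r; apply: (@le_trans _ _ 0); first by rewrite oppr_le0 ltW.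
    by rewrite le_min tau0 ler01.
  have -> : t_ n k.+1 - (2 ^+ n)^-1 = t_ n k.
    by rewrite /dyadic -natr1 mulrDl mul1r addrK.
  rewrite le_min (ltW ((hk k kn).2 (ltnSn k)))/=.
  by have /andP[] := @dyadic_itv R n k (ltnW kn).
by rewrite ler_norml; apply/andP; split; lra.
Qed.

Lemma late_cvg (f : R -> Omega R -> R) w : {within `[0, 1], continuous (f^~ w)} ->
  stopsum (2 ^ n) (late n) (fun j => f (t_ n j)) w @[n --> \oo] --> f (Num.min (tau w) 1) w.
Proof.
move=> cf; have /choice[k hk] : forall n, exists k, [/\ (k <= 2 ^ n)%N,
    forall f, stopsum (2 ^ n) (late n) f w = f k w,
    `|t_ n k - Num.min (tau w) 1| <= (2 ^+ n)^-1 & 0 <= Num.min (tau w) 1 <= 1].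
  by move=> n; exact: late_time.
rewrite (_ : (fun n => _) = fun n => f (t_ n (k n)) w); last first.
  by apply/funext => n; have [_ E _ _] := hk n; rewrite E.
set s := Num.min (tau w) 1; have [_ _ _ s01] := hk 0%N; rewrite -/s in s01.
have ck : t_ n (k n) @[n --> \oo] --> s.
  apply/cvgrPdist_le => e e0; have := @cvg_geometric R 1 2^-1.
  rewrite ger0_norm// invf_lt1// ltr1n => /(_ isT)/cvgrPdist_le/(_ e e0).
  apply: filterS => n; rewrite sub0r normrN /geometric/= mul1r exprVn ger0_norm; last first.
    by rewrite invr_ge0 exprn_ge0.
  by move=> h; rewrite distrC (le_trans _ h)//; have [] := hk n.
have s01' : `[(0 : R), 1]%classic s by rewrite /= in_itv.
move/subspace_continuousP : cf => /(_ s s01'); apply: cvg_comp => U /ck[m _ hm]; exists m => // n mn; apply: (hm n mn).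
by rewrite /= in_itv/=; apply: dyadic_itv; have [] := hk n.
Qed.

(** At each level X at the discretised time has P-expectation at most V n, and path continuity
    carries the bound to tau. The passage to the limit is made for a bounded approximation eta k0,
    since X carries no bound for dominated convergence. *)
Lemma stopped_integral_le (c : R) : (forall n, V n <= c) ->
  (\int[P]_w (X (tau w) w)%:E <= c%:E)%E.
Proof.
move=> Vc.
have [N [mN cN hN]] := qsI slo0 slohi cX st.2.
have PN := capacity0 cN cP.
(* X at tau need not be Borel. Off a null set it equals g, which is Borel as a pointwise limit of
   stopped sums. *)
pose g w := \1_(~` N) w * X (Num.min (tau w) 1) w.
have gE w : ~ N w -> X (tau w) w = g w.
  move=> Nw; have [_ t1] := hN w Nw.
  by rewrite /g indicE mem_set// mul1r (min_idPl t1).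
have mg : measurable_fun [set: Omega R] g.
  apply: (@measurable_fun_cvg _ _ _ setT
    (fun n w => \1_(~` N) w * stopsum (2 ^ n) (late n) (fun j => X (t_ n j)) w)) => //.
    move=> n; apply: measurable_funM; first by apply: measurable_indic; exact: measurableC.
    apply: stopsum_measurable => [j|j jn]; first exact: late_measurable.
    by apply: mX; exact: dyadic_itv.
  move=> w _; rewrite /g indicE; case: (boolP (w \in _)) => [|_].
    by rewrite inE => /hN[cw _]; under eq_fun do rewrite mul1r; rewrite mul1r; exact: late_cvg.
  by under eq_fun do rewrite mul0r; rewrite mul0r; exact: cvg_cst.
rewrite (eq_integral_null (g := fun w => (g w)%:E) mN PN); last by move=> w /gE ->.
apply/lee_addgt0Pr => e e0; have e2 : 0 < e / 2 by rewrite divr_gt0.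
have [k0 hk0] := etaX e2; have hD := hk0 k0 (leqnn _).
have [_ ck [M hM]] := SG0P (eta0 k0).
pose H w := eta k0 (Num.min (tau w) 1) w.
have mk n : bm (stopsum (2 ^ n) (late n) (fun j => eta k0 (t_ n j))).
  apply: stopsum_bm => [j|j jn]; first exact: late_measurable.
  by apply: CL_bm; exact: eta_CL.
have cH w : stopsum (2 ^ n) (late n) (fun j => eta k0 (t_ n j)) w @[n --> \oo] --> H w.
  by apply: late_cvg; exact: continuous_subspaceT.
have [||bH cEx] := @Ex_cvg _ _ _ P
  (fun n => stopsum (2 ^ n) (late n) (fun j => eta k0 (t_ n j))) H M _ _ cH.
- by move=> n; have [] := mk n.
- move=> n w; have [j jn [_ E]] := stopsumP (2 ^ n) w (@late_antitone n).
  by rewrite E.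
have /andP[_ h1] : ((Ex P H - e / 2)%:E <= \int[P]_w (g w)%:E <= (Ex P H + e / 2)%:E)%E.
  apply: integral_near => //.
  apply: le_trans hD; apply: le_trans (Ehat_ge _ cP).
  apply: (ge0_le_integral_null mN PN) => [w|w|w Nw].
  - by rewrite lee_fin.
  - exact: sup_dist_ge0.
  - rewrite -gE// /H; have [_ t1] := hN w Nw; rewrite (min_idPl t1).
    by apply: sup_dist_ge; rewrite t1 andbT; have [[h _] _] := st.
apply: (le_trans h1); rewrite -EFinD lee_fin.
suff : Ex P H <= c + e / 2 by lra.
rewrite -(cvg_lim _ cEx)//; apply: limr_le; first by apply/cvg_ex; exists (Ex P H).
apply: nearW => n.
have /andP[h2 _] := stopsum_integral n (@late_antitone n) (late_measurable n) hD.
suff /(le_trans h2) : (\int[P]_w (stopsum (2 ^ n) (late n) (fun j => X (t_ n j)) w)%:E <= c%:E)%E.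
  by rewrite lee_fin => ?; lra.
apply: le_trans (_ : ((V n)%:E <= _)%E); last by rewrite lee_fin.
(* A second approximation, depending on n, is needed here: k0 was fixed before n, and its discrete
   value at level n need not be close enough to V n. *)
apply/lee_addgt0Pr => d d0; have d2 : 0 < d / 2 by rewrite divr_gt0.
have [k [Dk vk]] := good_index n d2.
have /andP[_ h3] := stopsum_integral n (@late_antitone n) (late_measurable n) Dk.
apply: (le_trans h3); rewrite -EFinD lee_fin.
have := stopped_le_value slo0 slohi (ad k) cP (@late_antitone n) (late_measurable n)
  (fun j _ => late_approximable n j).
by move: vk; rewrite ler_norml => /andP[? ?] ?; lra.
Qed.

End fixed_time.
End fixed_measure.
End stopping_times.

(** * Lower bound: an almost optimal stopping time *)

Section almost_optimal_time.
Context {R : realType}.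
Variables (slo shi : R).
Hypotheses (slo0 : 0 <= slo) (slohi : slo <= shi).
Variables (eta : R -> Omega R -> R) (n : nat) (c : R).
Hypotheses (ad : adapted eta) (c0 : 0 < c).

Local Notation EL := (EL slo shi).
Local Notation cE := (cE slo shi).
Local Notation t_ j := (dyadic n j : R).
Local Notation W := (snell_at slo shi eta n).

Definition surplus j w := W j w - eta (t_ j) w.

(** A cylinder function in [0, 1] that is 1 on [continue j] and 0 as soon as a surplus up to j is
    nonpositive, so that it lives where the recursion is a martingale step. *)
Definition weight j (w : Omega R) : R :=
  \prod_(i < j.+1) Num.max 0 (Num.min 1 (c^-1 * surplus i w)).

(** Positive exactly when all surpluses up to j exceed c; being a cylinder function, it makes
    [continue j] open with monotone cylinder approximations of its indicator. *)
Definition excess j (w : Omega R) : R := \prod_(i < j.+1) Num.max 0 (surplus i w - c).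

Definition continue j : set (Omega R) := [set w | 0 < excess j w].

Let clamp01 (x : R) : 0 <= Num.max 0 (Num.min 1 x) <= 1.
Proof. by rewrite le_max lexx/= ge_max ler01 ge_min lexx. Qed.

Lemma surplus_CLt i j : (i <= j)%N -> (j <= 2 ^ n)%N -> CLt (t_ j) (surplus i).
Proof.
move=> ij jn; have i_n := leq_trans ij jn; apply: (@CLt_le _ (t_ i)); first exact: dyadic_le.
by apply: CLt_sub; [exact: snell_at_CLt|exact: eta_CLt].
Qed.

Lemma weight_CLt j : (j <= 2 ^ n)%N -> CLt (t_ j) (weight j).
Proof.
move=> jn; apply: (@CLt_prod _ _ j.+1 (fun i w => Num.max 0 (Num.min 1 (c^-1 * surplus i w)))) => i ij.
apply: CLt_max; first exact: CLt_cst.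
by apply: CLt_min; [exact: CLt_cst|apply: CLt_scale; exact: surplus_CLt].
Qed.

Lemma weight01 j w : 0 <= weight j w <= 1.
Proof. by apply: (prod01 _ (a := fun i => Num.max 0 (Num.min 1 (c^-1 * surplus i w)))). Qed.

Lemma excess_CLt j : (j <= 2 ^ n)%N -> CLt (t_ j) (excess j).
Proof.
move=> jn; apply: (@CLt_prod _ _ j.+1 (fun i w => Num.max 0 (surplus i w - c))) => i ij.
apply: CLt_max; first exact: CLt_cst.
by apply: CLt_sub; [exact: surplus_CLt|exact: CLt_cst].
Qed.

Lemma excess_ge0 j w : 0 <= excess j w.
Proof. by apply: prodr_ge0 => i _; rewrite le_max lexx. Qed.

Lemma excess_gt0P j w : 0 < excess j w <-> forall i, (i <= j)%N -> c < surplus i w.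
Proof.
split=> [|h]; last first.
  by apply: prodr_gt0 => i _; rewrite lt_max subr_gt0 h ?orbT// -ltnS.
rewrite lt_neqAle eq_sym excess_ge0 andbT => /prodf_neq0 h i ij.
have ij' : (i < j.+1)%N by [].
have := h (Ordinal ij') isT; rewrite /= -subr_gt0 => h'.
by rewrite ltNge; apply: contra h' => h'; rewrite (max_idPl h').
Qed.

Lemma continue_antitone : antitone continue.
Proof.
by move=> j w /excess_gt0P h; apply/excess_gt0P => i ij; exact: h (leqW ij).
Qed.

Lemma weight1 j w : continue j w -> weight j w = 1.
Proof.
move=> /excess_gt0P h; rewrite /weight big1// => i _; rewrite (min_idPl _) ?(max_idPr _)//.
by rewrite -ler_pdivrMl ?invr_gt0// invrK mulr1 ltW// h// -ltnS.
Qed.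

                                                                                         
                                                                           
(** Conditioning at the last time keeps all earlier terms. Where the last weight is nonzero the
    surplus is positive, so the maximum in the recursion is the conditional expectation and the last
    increment disappears; equality is exact despite sublinearity. *)
Lemma weight_martingale m : (m <= 2 ^ n)%N ->
  EL (fun w => \sum_(j < m) weight j w * (W j.+1 w - W j w)) = 0.
Proof.
elim: m => [|m IH] mn; first by under eq_fun do rewrite big_ord0; exact: (EL_cst slo0 slohi).
pose Q (w : Omega R) := \sum_(j < m) weight j w * (W j.+1 w - W j w).
have t0 : 0 <= t_ m by exact: dyadic_ge0.
have ZC := weight_CLt (ltnW mn); have Z0 w : 0 <= weight m w by have /andP[] := weight01 m w.
have WC : CL (W m.+1) by exact: snell_at_CL.
have HC : CLt (t_ m) (fun w => Q w - weight m w * W m w).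
  apply: CLt_sub; last by apply: CLt_mul => //; apply: snell_at_CLt => //; exact: ltnW.
  apply: (CLt_sum (F := fun j w => weight j w * (W j.+1 w - W j w))) => j jm.
  have jn := ltn_trans jm mn.
  apply: CLt_mul; first by apply: CLt_le (weight_CLt (ltnW jn)); apply: dyadic_le; exact: ltnW.
  apply: CLt_sub.
    by apply: (@CLt_le _ (t_ j.+1)); [exact: dyadic_le|exact: snell_at_CLt].
  apply: (@CLt_le _ (t_ j)); first by apply: dyadic_le; exact: ltnW.
  by apply: snell_at_CLt => //; exact: ltnW.
have FC : CL (fun w => weight m w * W m.+1 w + (Q w - weight m w * W m w)).
  by apply: CL_add; [apply: CL_mul => //; exact: CLt_CL ZC|exact: CLt_CL HC].
rewrite (_ : (fun w => _) = fun w => weight m w * W m.+1 w + (Q w - weight m w * W m w)); last first.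
  by apply/funext => w; rewrite big_ord_recr/= /Q; ring.
rewrite -(EL_cE slo0 slohi t0 FC) (cE_loc slo0 slohi t0 WC ZC HC Z0) -[RHS](IH (ltnW mn)).
congr EL; apply/funext => w.
suff -> : weight m w * cE (t_ m) (W m.+1) w = weight m w * W m w by rewrite addrC subrK.
have [sw|sw] := leP (surplus m w) 0.
  rewrite /weight big_ord_recr/= (_ : Num.max 0 _ = 0) ?mulr0 ?mul0r//.
  by apply/max_idPl; rewrite ge_min pmulr_rle0 ?invr_gt0// sw orbT.
congr (_ * _); move: sw; rewrite /surplus snell_atS// subr_gt0 lt_max ltxx/= => h.
by apply/esym/max_idPr; exact: ltW.
Qed.

Lemma truncated_excess_cvg j w :
  Num.min 1 (k%:R * excess j w) @[k --> \oo] --> (\1_(continue j) w : R).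
Proof.
have [h|h] := ltP 0 (excess j w).
  rewrite indicE mem_set//; apply: cvg_near_cst.
  exists (Num.trunc (excess j w)^-1).+1 => // k /= hk; apply/min_idPl.
  by rewrite -ler_pdivrMr// mul1r (le_trans (ltW (truncnS_gt _)))// ler_nat.
rewrite indicE memNset; last by move=> h'; have := lt_le_trans h' h; rewrite ltxx.
apply: cvg_near_cst; apply: nearW => k.
have -> : excess j w = 0 by apply/eqP; rewrite eq_le h excess_ge0.
by rewrite mulr0 (min_idPr ler01).
Qed.

Lemma truncated_excess_CLt k j : (j <= 2 ^ n)%N ->
  CLt (t_ j) (fun w => Num.min 1 (k%:R * excess j w)).
Proof.
by move=> jn; apply: CLt_min; [exact: CLt_cst|apply: CLt_scale; exact: excess_CLt].
Qed.

Lemma truncated_excess01 k j w : 0 <= Num.min 1 (k%:R * excess j w) <= 1.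
Proof. by rewrite le_min ler01 mulr_ge0 ?excess_ge0//= ge_min lexx. Qed.

Lemma truncated_excess_le k j w : Num.min 1 (k%:R * excess j w) <= weight j w.
Proof.
have /andP[w0 w1] := weight01 j w.
have [/weight1 ->|h] := ltP 0 (excess j w); first by rewrite ge_min lexx.
have -> : excess j w = 0 by apply/eqP; rewrite eq_le h excess_ge0.
by rewrite mulr0 ge_min w0 orbT.
Qed.

Lemma continue_measurable j : (j <= 2 ^ n)%N -> measurable (continue j).
Proof.
move=> jn; apply: sub_sigma_algebra; apply: CL_open_gt0.
exact: CLt_CL (dyadic_ge0 _ _) (excess_CLt jn).
Qed.

(** Take P attaining the supremum for the weighted sum, which is zero. The supermartingale property
    makes each term nonpositive, so each is null, and this passes down from the weights to the
    indicators they dominate. *)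
Lemma optimal_measure : exists2 P, calP slo shi P & forall j, (j < 2 ^ n)%N ->
  Ex P (fun w => \1_(continue j) w * (W j.+1 w - W j w)) = 0.
Proof.
pose D j w := W j.+1 w - W j w.
have DC j : CL (D j) by apply: CL_sub; exact: snell_at_CL.
have SC j : (j < 2 ^ n)%N -> CL (weight j).
  by move=> /ltnW jn; exact: CLt_CL (dyadic_ge0 _ _) (weight_CLt jn).
have QC : CL (fun w => \sum_(j < 2 ^ n) weight j w * D j w).
  exists 1 => //; apply: (CLt_sum (F := fun j w => weight j w * D j w)) => j jn.
  have /andP[_ j1] := @dyadic_itv R n j (ltnW jn).
  have /andP[_ j'1] := @dyadic_itv R n j.+1 jn.
  apply: CLt_mul; first by apply: CLt_le j1 _; apply: weight_CLt; exact: ltnW.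
  apply: CLt_sub; first by apply: CLt_le j'1 _; exact: snell_at_CLt.
  by apply: CLt_le j1 _; apply: snell_at_CLt => //; exact: ltnW.
have [P cP EP] := EL_representation slo0 slohi QC; exists P => // j jn.
have bSD i : (i < 2 ^ n)%N -> bm (fun w => weight i w * D i w).
  by move=> i_n; apply: CL_bm; apply: CL_mul => //; exact: SC.
have neg i : (i < 2 ^ n)%N -> Ex P (fun w => weight i w * D i w) <= 0.
  move=> i_n; apply: (snell_super slo0 slohi ad cP i_n) => [|w].
    by apply: weight_CLt; exact: ltnW.
  by have /andP[] := weight01 i w.
have SD0 : Ex P (fun w => weight j w * D j w) = 0.
  apply/eqP; rewrite eq_le neg//= -(weight_martingale (leqnn _)) -EP.
  rewrite (@Ex_sum _ _ _ P (2 ^ n) (fun j w => weight j w * D j w))//.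
  rewrite (bigD1 (Ordinal jn))//= gerDl; apply: sumr_le0 => i _; exact: neg.
pose Z k w := Num.min 1 (k%:R * excess j w).
have ZC k : CLt (t_ j) (Z k) by apply: truncated_excess_CLt; exact: ltnW.
have bZ k : bm (Z k) by apply: CL_bm; exact: CLt_CL (dyadic_ge0 _ _) (ZC k).
have bD := CL_bm (DC j); have [M M0 hM] := CL_bdd (DC j).
(* Both Z k and weight j - Z k are nonnegative and known at t_j, so both terms are nonpositive;
   their sum is null. *)
have ZD0 k : Ex P (fun w => Z k w * D j w) = 0.
  apply/eqP; rewrite eq_le (snell_super slo0 slohi ad cP jn (ZC k))/=; last first.
    by move=> w; have /andP[] := truncated_excess01 k j w.
  rewrite -SD0 -subr_le0 -ExB; [|exact: bSD|exact: bm_mul].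
  rewrite (_ : (fun w => _) = fun w => (weight j w - Z k w) * D j w); last first.
    by apply/funext => w; rewrite mulrBl.
  apply: (snell_super slo0 slohi ad cP jn) => [|w].
    by apply: CLt_sub => //; apply: weight_CLt; exact: ltnW.
  by rewrite subr_ge0 truncated_excess_le.
have [||w|_ cv] := @Ex_cvg _ _ _ P (fun k w => Z k w * D j w)
  (fun w => \1_(continue j) w * D j w) M.
- by move=> k; have [] := bm_mul (bZ k) bD.
- move=> k w; rewrite normrM -[leRHS]mul1r ler_pM// .
  by have /andP[z0 z1] := truncated_excess01 k j w; rewrite ger0_norm.
- by apply: cvgMl; exact: truncated_excess_cvg.
- have : Ex P (fun w => Z k w * D j w) @[k --> \oo] --> (0 : R).
    by under eq_fun do rewrite ZD0; exact: cvg_cst.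
  by move=> /(cvg_unique _ cv) ->.
Qed.

(** Emptied from the last grid time on, so that the events are decreasing and measurable for every
    index. *)
Let A j := if (j < 2 ^ n)%N then continue j else set0.

Let aA : antitone A.
Proof.
move=> j w; rewrite /A; case: ifP => // jn; rewrite (ltnW jn); exact: continue_antitone.
Qed.

Let mA j : measurable (A j).
Proof. by rewrite /A; case: ifP => // /ltnW; exact: continue_measurable. Qed.

Definition opt_time : Omega R -> R := stopsum (2 ^ n) A (fun j _ => t_ j).

Lemma opt_timeP w : exists2 k, (k <= 2 ^ n)%N & [/\ opt_time w = t_ k,
  (forall j, (j < 2 ^ n)%N -> continue j w <-> (j < k)%N) &
  forall f, stopsum (2 ^ n) A f w = f k w].
Proof.
have [k kn [hk E]] := stopsumP (2 ^ n) w aA; exists k => //; split => // [|j jn].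
  by rewrite /opt_time E.
by rewrite -hk// /A jn.
Qed.

(** Under the optimal measure the stopped envelope keeps its initial value, and at the stopping
    index it exceeds eta by at most c: either the surplus there is at most c or the terminal time is
    reached, where the two agree. *)
Lemma opt_time_value : exists2 P, calP slo shi P &
  forall (X : R -> Omega R -> R) D, (forall t, 0 <= t <= 1 -> measurable_fun [set: Omega R] (X t)) ->
  (Ehat slo shi (sup_dist eta X) <= D%:E)%E ->
  ((valueL slo shi eta n - c - D)%:E <= \int[P]_w (X (opt_time w) w)%:E)%E.
Proof.
have [P cP hP] := optimal_measure; exists P => // X D mX hD.
pose f j := eta (t_ j).
have be j : (j <= 2 ^ n)%N -> bm (f j) by move=> jn; apply: CL_bm; exact: eta_CL.
have bW j : (j <= 2 ^ n)%N -> bm (W j) by move=> jn; apply: CL_bm; exact: snell_at_CL.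
have XE : (fun w => X (opt_time w) w) = stopsum (2 ^ n) A (fun j => X (t_ j)).
  by apply/funext => w; have [k kn [-> _ E]] := opt_timeP w; rewrite E.
have h : valueL slo shi eta n - c <= Ex P (stopsum (2 ^ n) A f).
  have -> : valueL slo shi eta n = Ex P (stopsum (2 ^ n) A W).
    rewrite Ex_stopsum// (_ : W 0 = fun=> valueL slo shi eta n); last first.
      by apply/funext => w; exact: snell_at0.
    rewrite Ex_cst big1 ?addr0// => j _.
    by rewrite /A ltn_ord hP.
  rewrite lerBlDr -(Ex_cst P c) -ExD; [|exact: stopsum_bm|exact: bm_cst].
  apply: Ex_mono => [||w]; first exact: stopsum_bm.
    by apply: bm_add; [exact: stopsum_bm|exact: bm_cst].
  have [k kn [_ hk E]] := opt_timeP w; rewrite !E /f.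
  move: (kn); rewrite leq_eqVlt => /orP[/eqP Ek|kn'].
    by rewrite Ek snell_atN dyadic1 lerDl ltW.
  rewrite addrC -lerBlDr leNgt; apply/negP => sk.
  have : continue k w.
    apply/excess_gt0P => i; rewrite leq_eqVlt => /orP[/eqP ->//|ik].
    by have /excess_gt0P := (hk i (ltn_trans ik kn')).2 ik; exact.
  by move=> /(hk k kn').1; rewrite ltnn.
have /andP[h1 _] : ((Ex P (stopsum (2 ^ n) A f) - D)%:E <= \int[P]_w (X (opt_time w) w)%:E
    <= (Ex P (stopsum (2 ^ n) A f) + D)%:E)%E.
  apply: integral_near; [|exact: stopsum_bm|].
    by rewrite XE; apply: stopsum_measurable => // j jn; apply: mX; exact: dyadic_itv.
  apply: le_trans hD; apply: le_trans (Ehat_ge _ cP); apply: ge0_le_integral_any => w.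
    by rewrite lee_fin.
  have [k kn [-> _ E]] := opt_timeP w; rewrite E.
  by apply: sup_dist_ge; exact: dyadic_itv.
by apply: le_trans h1; rewrite lee_fin lerD2r.
Qed.

(** The time takes grid values only, so before 1 the event depends on t through the last grid time j
    at or before t: stopping has occurred when continuing at j fails. *)
Lemma opt_time_le t : 0 <= t -> 1 <= t \/ exists j, [/\ (j < 2 ^ n)%N, t_ j <= t &
  [set w | opt_time w <= t] = ~` continue j].
Proof.
move=> t0; have [t1|t1] := leP 1 t; [by left|right].
have p0 := @pow2_gt0 R n.
pose j := Num.trunc (t * 2 ^+ n).
have tp0 : 0 <= t * 2 ^+ n by rewrite mulr_ge0// ltW.
have /andP[j1 j2] := truncn_itv tp0.
have jn : (j < 2 ^ n)%N.
  by rewrite -(ltr_nat R) natrX (le_lt_trans j1)// gtr_pMl.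
exists j; split => //; first by rewrite /dyadic ler_pdivrMr.
apply/seteqP; split => w /=; have [k kn [-> hk _]] := opt_timeP w.
  move=> kt /(hk j jn).1 jk.
  have := lt_le_trans j2 (_ : j.+1%:R <= k%:R :> R); rewrite ler_nat => /(_ jk).
  by rewrite -ltr_pdivlMr// ltNge kt.
move=> nj; have kj : (k <= j)%N by rewrite leqNgt; apply/negP => /(hk j jn).2.
apply: (@le_trans _ _ (t_ j)); first exact: dyadic_le.
by rewrite /dyadic ler_pdivrMr.
Qed.

(** The functions 1 - min(1, k excess) are cylinder functions of a time at most t and decrease
    everywhere to the indicator, as the definition requires. *)
Lemma opt_time_LG1star t : 0 <= t -> LG1star_upto slo shi t \1_[set w | opt_time w <= t].
Proof.
move=> t0.
have [Z [Z01 ZC Zd cZ]] : exists Z : nat -> Omega R -> R, [/\ forall k w, 0 <= Z k w <= 1,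
    forall k, CLt t (Z k), forall w, nonincreasing_seq (Z^~ w) &
    forall w, Z k w @[k --> \oo] --> (\1_[set w | opt_time w <= t] w : R)].
  have [t1|[j [jn jt ->]]] := opt_time_le t0.
    exists (fun _ _ => 1); split => //; first by move=> _ _; rewrite ler01 lexx.
      by move=> _; exact: CLt_cst.
      by move=> w k l _.
    move=> w; rewrite indicE mem_set; first exact: cvg_cst.
    have [k kn [/= -> _ _]] := opt_timeP w; apply: le_trans t1.
    by have /andP[] := @dyadic_itv R n k kn.
  exists (fun k w => 1 - Num.min 1 (k%:R * excess j w)); split => //.
  - move=> k w; have /andP[h0 h1] := truncated_excess01 k j w.
    by rewrite subr_ge0 h1 lerBlDr lerDl.
  - move=> k; apply: CLt_le jt _; apply: CLt_sub; first exact: CLt_cst.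
    by apply: truncated_excess_CLt; exact: ltnW.
  - move=> w k l kl; rewrite lerD2l lerN2 le_min ge_min lexx/=.
    by rewrite ge_min; apply/orP; right; rewrite ler_wpM2r ?excess_ge0// ler_nat.
  - move=> w; rewrite indicE in_setC -[X in _ --> X](_ : 1 - (\1_(continue j) w : R) = _).
      by apply: cvgB; [exact: cvg_cst|exact: truncated_excess_cvg].
    by rewrite indicE; case: (w \in _); rewrite ?subrr ?subr0.
set I := \1_ _ in cZ *.
have bZ k : CL (Z k) by exact: CLt_CL t0 (ZC k).
have mI : measurable_fun [set: Omega R] I.
  apply: (@measurable_fun_cvg _ _ _ setT Z) => // k; exact: CL_measurable.
split.
(* The approximations do not see the path after t, so neither does their limit, and the set is its
   own preimage under [stop t]. *)
- move=> U mU; exists (I @^-1` U); first by have := mI measurableT U mU; rewrite setTI.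
  suff IE w : I (stop t w) = I w by apply/seteqP; split => w; rewrite /preimage/= IE.
  have cw : Z k w @[k --> \oo] --> (I (stop t w) : R).
    rewrite (_ : (fun k => Z k w) = fun k => Z k (stop t w)); first exact: cZ.
    by apply/funext => k; rewrite (CLt_stop w (ZC k)).
  exact: (cvg_unique _ cw (cZ w)).
- apply: (@le_lt_trans _ _ 1%:E); last exact: ltry.
  rewrite -(EL_cst slo0 slohi 1) -(Ehat_CL slo0 slohi (@CL_cst R 1)).
  apply: Ehat_mono => w; rewrite lee_fin// /I indicE.
  by case: (_ \in _); rewrite ?normr1 ?normr0.
- exists Z; split => [k|].
    split; first exact: CL_measurable.
    exists (fun=> Z k); split => [_|]; first by rewrite Lip_uptoE.
    rewrite (dist1_CL slo0 slohi (bZ k) (bZ k)).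
    have -> : (fun w => `|Z k w - Z k w|) = fun=> 0 by apply/funext => w; rewrite subrr normr0.
    by rewrite (EL_cst slo0 slohi); exact: cvg_cst.
  by apply: (qsT slo0 slohi) => w; split; [exact: Zd|exact: cZ].
Qed.

Lemma opt_time_stopping : stopping_times01 slo shi opt_time.
Proof.
split; last first.
  apply: (qsT slo0 slohi) => w; have [k kn [-> _ _]] := opt_timeP w.
  by have /andP[] := @dyadic_itv R n k kn.
split; last exact: opt_time_LG1star.
by move=> w; have [k kn [-> _ _]] := opt_timeP w; exact: dyadic_ge0.
Qed.

End almost_optimal_time.

Theorem proposition4p3 (R : realType) (slo shi : R)
  (slo_ge0 : 0 <= slo) (slo_le_shi : slo <= shi)
  (beta : R) (beta_gt1 : 1 < beta)
  (X : R -> Omega R -> R) (X_SG : SG slo shi beta 1 X) :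
  nondecreasing_seq (discrete_value slo shi X) /\
  value slo shi X = limn (fun n => (discrete_value slo shi X n)%:E).
Proof.
have [mX cX _] := X_SG.
have [eta [eta0 etaX]] := SG_approx slo_ge0 slo_le_shi beta_gt1 X_SG.
have aX := SG_approx_at X_SG eta0 etaX.
have mono := discrete_value_mono slo_ge0 slo_le_shi eta0 aX.
split; first exact: mono.
have monoE : nondecreasing_seq (fun n => (discrete_value slo shi X n)%:E).
  by move=> m n mn; rewrite lee_fin; exact: mono.
rewrite (cvg_lim _ (ereal_nondecreasing_cvgn monoE))//.
set S := ereal_sup _.
have VS n : ((discrete_value slo shi X n)%:E <= S)%E by apply: ereal_sup_ubound; exists n.
apply/eqP; rewrite eq_le; apply/andP; split.
  apply: ge_ereal_sup => _ [tau st <-]; apply: (Ehat_le (slo := slo) (shi := shi)) => P cP.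
  (* An infinite supremum leaves nothing to prove; otherwise it is a real bound for all discrete
     values. *)
  have [->|Soo] := eqVneq S +oo%E; first by rewrite leey.
  have Sfin : S \is a fin_num by rewrite fin_numE Soo andbT gt_eqF// (lt_le_trans _ (VS 0%N))// ltNyr.
  rewrite -(fineK Sfin).
  apply: (stopped_integral_le slo_ge0 slo_le_shi mX cX eta0 etaX aX cP st) => n.
  by rewrite -lee_fin fineK.
apply: ge_ereal_sup => _ [n _ <-]; apply/lee_addgt0Pr => e e0.
(* One third for the discrete value of eta k, one for the tolerance c of the stopping rule, one for
   replacing eta k by X. *)
have e3 : 0 < e / 3 by rewrite divr_gt0.
have [k [Dk vk]] := good_index slo_ge0 slo_le_shi eta0 etaX aX n e3.
have [ad _ _] := SG0P (eta0 k).
have [P cP hP] := opt_time_value slo_ge0 slo_le_shi n ad e3.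
rewrite -leeBlDr//; apply: (@le_trans _ _ (valueL slo shi (eta k) n - e / 3 - e / 3)%:E).
  by rewrite -EFinB lee_fin; move: vk; rewrite ler_norml => /andP[? ?]; lra.
apply: (le_trans (hP X _ mX Dk)); apply: (le_trans (Ehat_ge _ cP)).
by apply: ereal_sup_ubound; exists (opt_time slo shi (eta k) n (e / 3)) => //; exact: opt_time_stopping.
Qed.
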